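(* Let $Z=(Z(t))_{t\in(0,1)}$ be a real-valued zero-mean Gaussian process satisfying $(A)_\kappa$ and $(B)_\alpha$ with $m=2$, $\alpha\in(0,1)$, $\alpha>\frac1{1+2(\eta\wedge2)}$, $\kappa\ge\frac{1-\alpha}2$ and $\theta=0$. Then for any $u\in\mathbb N^*$ and any $t_1,\dots,t_u\in(0,1)$ with $t_i\ne t_j$ $(i\ne j)$, $$\sqrt{2n^{1-\alpha}}\,\big(\widehat H^{(IR)}_{n,\alpha}(t_i)-H(t_i)\big)_{1\le i\le u}\longrightarrow\big(W^{(IR)}(t_i)\big)_{1\le i\le u}$$ in distribution as $n\to\infty$, where $W^{(IR)}(t_i)$, $i=1,\dots,u$, are independent centered Gaussian random variables with $$\mathrm E[W^{(IR)}(t_i)]^2=\Big[\frac{\partial}{\partial x}(\Lambda_2)^{-1}(\Lambda_2(H(t_i)))\Big]^2\sigma^2(H(t_i)),$$ (the derivative of the function $\Lambda_2^{-1}$ evaluated at the point $\Lambda_2(H(t_i))$), and, for $H\in(0,1)$, $$\sigma^2(H):=\sum_{k\in\mathbb Z}\mathrm{Cov}\Big(\psi\big(V^{a^*}B_H(0),V^{a^*}B_H(1)\big),\psi\big(V^{a^*}B_H(k),V^{a^*}B_H(k+1)\big)\Big).$$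
   Context: $\mathbb N^*=\{1,2,\dots\}$; $[x]$ is the integer part; $x\wedge y=\min(x,y)$. $\mathcal C^\eta(0,1)$ is the space of $[\eta]$ times continuously differentiable $f:(0,1)\to\mathbb R$ for which there is $K\ge0$ with $|f^{([\eta])}(x)-f^{([\eta])}(y)|\le K|x-y|^{\eta-[\eta]}$ for all $x,y\in(0,1)$. Fractional Brownian motion (FBM) $B_H$, $H\in(0,1)$ (indexed by $\mathbb R$): zero-mean Gaussian process with stationary increments and $\mathrm E B_H^2(\tau)=|\tau|^{2H}$. Filters: for $m,q\in\mathbb N^*$, $\mathcal A(m,q)$ is the set of $a=(a_0,\dots,a_q)\in\mathbb R^{q+1}$ with $\sum_{\ell=0}^q\ell^pa_\ell=0$ for $p=0,\dots,m-1$ and $\sum_{\ell=0}^q\ell^ma_\ell\ne0$. Generalized variations of a process (or function) $Z$: $V_n^aZ(t):=\sum_{\ell=0}^qa_\ell Z(t+\ell/n)$, $V^aZ:=V_1^aZ$. The second-order filter is $a^*:=(1,-2,1)\in\mathcal A(2,2)$. Assumptions, for given $m\ge1$, $\kappa\ge0$, $\alpha\in(0,1)$ (only those $n,k$ for which all sampling points lie in $(0,1)$ are considered): $(A)_\kappa$: there exist continuous functions $0<H(t)<1$ and $c(t)>0$, $t\in(0,1)$, with $H(\cdot),c(\cdot)\in\mathcal C^\eta(0,1)$ for some $\eta>0$, such that for any $0<\varepsilon<1/2$ and any filter $a\in\mathcal A(m,q)$, $q\ge1$, $$\max_{[n\varepsilon]\le k\le[(1-\varepsilon)n]}n^\kappa\Big|\frac{\mathrm{Var}(V_n^aZ(k/n))}{\mathrm{Var}(V_n^aB_{H(k/n)}(0))}-c(k/n)\Big|\to0\quad(n\to\infty).$$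 $(B)_\alpha$: there exist $\gamma>1/2$ and $0\le\theta<\gamma/2$ such that for any $0<\varepsilon<1/2$ and any filter $a\in\mathcal A(m,q)$, $q\ge1$, there is $C>0$ such that for any $n\in\mathbb N^*$ and $[n\varepsilon]\le k<k'\le[(1-\varepsilon)n]$, $$\big|\mathrm{Cor}(V_n^aZ(k/n),V_n^aZ(k'/n))\big|\le C\,n^{(1-\alpha)\theta}\,(|k'-k|\wedge n^{1-\alpha})^{-\gamma}.$$ Estimator: $\mathcal V_{n,\alpha}(t):=\{k\in\{1,\dots,n-q-1\}:|k/n-t|\le n^{-\alpha}\}$ (with $q=2$ here), $v_{n,\alpha}(t):=\#\mathcal V_{n,\alpha}(t)$; $\psi(x,y):=\frac{|x+y|}{|x|+|y|}$ (with $\psi(0,0):=1$); $\Lambda_2(H):=\mathrm E\,\psi\big(V_n^{a^*}B_H(0),V_n^{a^*}B_H(1/n)\big)$, which does not depend on $n$ and is strictly increasing on $(0,1)$; $$\widehat H^{(IR)}_{n,\alpha}(t):=\Lambda_2^{-1}\Big(\frac1{v_{n,\alpha}(t)}\sum_{k\in\mathcal V_{n,\alpha}(t)}\psi\big(V_n^{a^*}Z(\tfrac kn),V_n^{a^*}Z(\tfrac{k+1}n)\big)\Big),$$ where $\Lambda_2^{-1}$ is the inverse function, and $\Lambda_2^{-1}(s)$ is given some fixed value in $(0,1)$, say $1/2$, if $s\notin\Lambda_2((0,1))$. $\widehat H^{(IR)}_{n,\alpha}(t)$ is considered for $n$ large enough that all sampling points lie in $(0,1)$. *)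

(* Defs.v *)
From HB Require Import structures.
From mathcomp Require Import all_boot all_order all_algebra.
From mathcomp Require Import all_classical all_reals all_analysis.

Set Implicit Arguments.
Unset Strict Implicit.
Unset Printing Implicit Defensive.

Import Order.TTheory GRing.Theory Num.Theory.
Import numFieldNormedType.Exports.

Local Open Scope classical_set_scope.
Local Open Scope ring_scope.

Section Gaussian.
Context {d : measure_display} {T : measurableType d} {R : realType}.
Variable P : probability T R.

(* The library's normal_prob m 0 is a uniform law, so the degenerate Gaussian
   law has to be supplied separately. *)
Definition gauss_law (m s : R) (A : set R) : \bar R :=
  if s == 0 then (\d_m A)%E else normal_prob m s A.

Definition is_gaussian (X : T -> R) : Prop :=
  exists m s : R, 0 <= s /\
    forall A : set R, measurable A -> P (X @^-1` A) = gauss_law m s A.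

(* The process is indexed by D; the values of Z outside D are irrelevant. *)
Definition gaussian_process (D : set R) (Z : R -> {RV P >-> R}) : Prop :=
  forall (n : nat) (c t : 'I_n -> R), (forall i, D (t i)) ->
    is_gaussian (fun w => \sum_(i < n) c i * Z (t i) w).

Definition zero_mean (D : set R) (Z : R -> {RV P >-> R}) : Prop :=
  forall t, D t -> ('E_P[Z t] = 0)%E.

Definition stationary_increments (B : R -> {RV P >-> R}) : Prop :=
  forall (n : nat) (s t : 'I_n -> R) (h : R) (A : set (n.-tuple R)),
    measurable A ->
    P [set w | A [tuple B (t i + h) w - B (s i + h) w | i < n]] =
    P [set w | A [tuple B (t i) w - B (s i) w | i < n]].

Definition is_fbm (h : R) (B : R -> {RV P >-> R}) : Prop :=
  [/\ gaussian_process setT B, zero_mean setT B, stationary_increments B &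
      forall tau : R, ('E_P[fun w => (B tau w ^+ 2)%R] = (`|tau| `^ (2 * h))%R%:E)%E].

(* Equals 0 when one of the variances vanishes. *)
Definition correlation (X Y : T -> R) : R :=
  fine (covariance P X Y) /
    (Num.sqrt (fine 'V_P[X]) * Num.sqrt (fine 'V_P[Y])).

Definition independent_rvs (u : nat) (W : 'I_u -> {RV P >-> R}) : Prop :=
  forall A : 'I_u -> set R, (forall i, measurable (A i)) ->
    P [set w | forall i, A i (W i w)] = (\prod_(i < u) P (W i @^-1` A i))%E.

End Gaussian.

Definition cvg_in_distribution {R : realType} {d d' : measure_display}
    {T : measurableType d} {T' : measurableType d'}
    (P : probability T R) (Q : probability T' R) (u : nat)
    (X : nat -> T -> 'rV[R]_u) (W : T' -> 'rV[R]_u) : Prop :=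
  forall f : 'rV[R]_u -> R, continuous f ->
    (exists M : R, forall x, `|f x| <= M) ->
    ('E_P[fun w => f (X n w)])%E @[n --> \oo] --> ('E_Q[fun w => f (W w)])%E.

Section Variations.
Context {R : realType}.

(* In the moment sums, 0 ^+ 0 = 1. *)
Definition is_filter_of_order (m q : nat) (a : q.+1.-tuple R) : Prop :=
  [/\ (0 < m)%N, (0 < q)%N,
      forall p : nat, (p < m)%N ->
        \sum_(l < q.+1) l%:R ^+ p * tnth a l = 0 :> R &
      \sum_(l < q.+1) l%:R ^+ m * tnth a l != 0 :> R].

Definition astar : 3.-tuple R := [tuple 1; - 2; 1].

Definition gvar (q : nat) (a : q.+1.-tuple R) (n : nat) (z : R -> R) (t : R) : R :=
  \sum_(l < q.+1) tnth a l * z (t + l%:R / n%:R).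

Definition gvar_rv {d : measure_display} {T : measurableType d}
    {P : probability T R} (q : nat) (a : q.+1.-tuple R) (n : nat)
    (Z : R -> {RV P >-> R}) (t : R) : T -> R :=
  fun w => gvar a n (fun s => Z s w) t.

(* All the sampling points k/n, ..., (k+q)/n lie in (0,1). *)
Definition sampled (n q k : nat) : bool := (0 < k)%N && (k + q < n)%N.

Definition holder_class (eta : R) (f : R -> R) : Prop :=
  let p := Num.truncn eta in
  [/\ forall (j : nat) (x : R), (j < p)%N -> 0 < x < 1 ->
        derivable ((derive1n j f)) x 1,
      forall x : R, 0 < x < 1 -> {for x, continuous (derive1n p f)} &
      exists2 K : R, 0 <= K &
        forall x y : R, 0 < x < 1 -> 0 < y < 1 ->
          `|(derive1n p f) x - (derive1n p f) y| <= K * `|x - y| `^ (eta - p%:R)].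

Definition psi (x y : R) : R :=
  if (x == 0) && (y == 0) then 1 else `|x + y| / (`|x| + `|y|).

End Variations.

Section Assumptions.
Context {R : realType}.
Context {d : measure_display} {T : measurableType d}.
Context {d' : measure_display} {T' : measurableType d'}.
Variable P : probability T R.
Variable PB : probability T' R.
(* B h is a fractional Brownian motion of index h, for 0 < h < 1. *)
Variable B : R -> R -> {RV PB >-> R}.

(* The maximized quantities are nonnegative, so the initial 0 only matters when
   the range of k is empty. *)
Definition assumption_A (m : nat) (kappa eta : R) (H c : R -> R)
    (Z : R -> {RV P >-> R}) : Prop :=
  [/\ 0 < eta, holder_class eta H, holder_class eta c,
      forall t : R, 0 < t < 1 ->
        [/\ {for t, continuous H}, {for t, continuous c}, 0 < H t < 1 & 0 < c t] &
      forall (eps : R) (q : nat) (a : q.+1.-tuple R), 0 < eps < 2^-1 ->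
        is_filter_of_order m a ->
        \big[Num.max/0]_(Num.truncn (n%:R * eps) <= k <
              (Num.truncn ((1 - eps) * n%:R)).+1 | sampled n q k)
          (n%:R `^ kappa *
           `| fine 'V_P[gvar_rv a n Z (k%:R / n%:R)] /
              fine 'V_PB[gvar_rv a n (B (H (k%:R / n%:R))) 0]
              - c (k%:R / n%:R) |)
        @[n --> \oo] --> (0 : R)].

Definition assumption_B (m : nat) (alpha theta : R)
    (Z : R -> {RV P >-> R}) : Prop :=
  exists gamma : R, [/\ 2^-1 < gamma, 0 <= theta, theta < gamma / 2 &
    forall (eps : R) (q : nat) (a : q.+1.-tuple R), 0 < eps < 2^-1 ->
      is_filter_of_order m a ->
      exists2 C : R, 0 < C & forall n k k' : nat, (0 < n)%N ->
        (Num.truncn (n%:R * eps) <= k)%N -> (k < k')%N ->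
        (k' <= Num.truncn ((1 - eps) * n%:R))%N ->
        sampled n q k -> sampled n q k' ->
        `| correlation P (gvar_rv a n Z (k%:R / n%:R))
                         (gvar_rv a n Z (k'%:R / n%:R)) |
        <= C * n%:R `^ ((1 - alpha) * theta) *
           (Num.min `|k'%:R - k%:R| (n%:R `^ (1 - alpha))) `^ (- gamma)].

(* E psi(V_n B_h(0), V_n B_h(1/n)) does not depend on n, by self-similarity;
   it is taken at n = 1. *)
Definition Lambda2 (h : R) : R :=
  fine ('E_PB[fun w => psi (gvar_rv astar 1 (B h) 0 w)
                          (gvar_rv astar 1 (B h) 1 w)])%E.

(* Inverse of Lambda2 : (0,1) -> R; it takes the value h0 off the range. *)
Definition Lambda2_inv (h0 : R) (s : R) : R :=
  xget h0 [set h | 0 < h < 1 /\ Lambda2 h = s].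

Definition cov_psi (h : R) (k : int) : R :=
  fine (covariance PB
    (fun w => psi (gvar_rv astar 1 (B h) 0 w) (gvar_rv astar 1 (B h) 1 w))
    (fun w => psi (gvar_rv astar 1 (B h) k%:~R w)
                  (gvar_rv astar 1 (B h) (k + 1)%:~R w))).

(* The sum over the integers, split into k >= 0 and k < 0. *)
Definition sigma2 (h : R) : R :=
  limn (series (fun k : nat => cov_psi h k%:Z)) +
  limn (series (fun k : nat => cov_psi h (- k.+1%:Z))).

Definition nbr (alpha : R) (n q : nat) (t : R) : seq nat :=
  [seq k <- iota 1 (n - q - 1) | `|k%:R / n%:R - t| <= n%:R `^ (- alpha)].

Definition IR_estimator (h0 alpha : R) (n : nat) (t : R)
    (Z : R -> {RV P >-> R}) : T -> R := fun w =>
  Lambda2_inv h0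
    ((size (nbr alpha n 2 t))%:R^-1 *
     \sum_(k <- nbr alpha n 2 t)
       psi (gvar_rv astar n Z (k%:R / n%:R) w)
           (gvar_rv astar n Z (k.+1%:R / n%:R) w)).

End Assumptions.

(* Main.v *)
(* The covariance of the second-order increments at lag j is a combination of
   variances of V^a Z for filters a obtained by shifting and adding (1,-2,1), so
   (A) makes their local correlations converge to those of a fractional Brownian
   motion of index H(t), with an error o(n^-kappa) at lag 1.  As psi is even and
   homogeneous, its mean depends on the lag-1 correlation only; it has a closed
   form Lam2, from which Lambda_2 is smooth with positive derivative.  Hence the
   bias on a window is that of Lambda_2 o H; it is o(n^(-(1-alpha)/2)), as the
   linear Taylor term cancels on a symmetric window.

   For the fluctuations, psi is approximated in mean by even trigonometric
   polynomials.  Covariances of even functions of two weakly correlated Gaussian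
   pairs are quadratic in the correlation (Gebelein), so with gamma > 1/2 they
   are summable; this bounds the variance of the approximation error and yields
   the limit variance sigma^2.  A weighted sum of cosines of a Gaussian vector is
   asymptotically normal by Stein's method: interpolating between two copies of
   the vector gives its Stein kernel, whose variance is bounded by the
   Hilbert-Schmidt and row-sum norms of the covariance.

   The characteristic functions of all linear combinations converge, and
   Weierstrass approximation by trigonometric polynomials turns this into
   convergence in distribution; the delta method passes to Lambda_2^-1. *)
Require Import Defs.
From HB Require Import structures.
From mathcomp Require Import all_boot all_order all_algebra.
From mathcomp Require Import all_classical all_reals all_analysis.
From mathcomp Require Import measurable_realfun ring lra zify.
Set Implicit Arguments.
Unset Strict Implicit.
Unset Printing Implicit Defensive.
Import Order.TTheory GRing.Theory Num.Def Num.Theory.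
Import numFieldNormedType.Exports.
Local Open Scope classical_set_scope.
Local Open Scope ring_scope.
Generalizable Variable d.

(** * Real-valued expectations, integrability and dominated convergence *)

Section Expectation.
Context `{T : measurableType d} {R : realType} (P : probability T R).

(** Gaussian vectors enter only through their characteristic function, so singular covariances get
    no separate treatment. On trigonometric polynomials every expectation is then a finite sum of
    exponentials of the covariance, and interpolation, conditioning and shifts become identities
    between such sums. The obstacle is that [psi] is not continuous at the origin while the
    covariances on a window vary with n: an approximant of [psi] must be chosen before the law, with
    an error in mean that is uniform over all pairs whose first component has unit variance and
    whose second has variance at most 2. The decorrelation bound, likewise, must not depend on the
    degree of the approximant; it uses only a sup bound and evenness. As gamma may lie below 1, only
    squares of correlations are summable: row sums of the covariance may diverge, but more slowly
    than the square root of the number q of points of a window. With weights of order q^(-1/2) the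
    variance of the Stein kernel, of order q^(-2) * (row sum)^2 * q, still tends to 0. *)

Definition Ex (X : T -> R) : R := \int[P]_w X w.

Definition itg (X : T -> R) : Prop := P.-integrable setT (EFin \o X).

Definition bddm (X : T -> R) : Prop :=
  measurable_fun setT X /\ exists M : R, forall w, `|X w| <= M.

Lemma bddm_itg (X : T -> R) : bddm X -> itg X.
Proof.
move=> [mX [M XM]]; apply: (@le_integrable _ _ _ P setT measurableT _ (EFin \o cst M)) => //.
- exact/measurable_EFinP.
- move=> w _ /=; rewrite lee_fin (le_trans (XM w))// ler_norm//.
- exact: finite_measure_integrable_cst.
Qed.

Lemma itg_measurable (X : T -> R) : itg X -> measurable_fun setT X.
Proof. by move=> /integrableP[/measurable_EFinP]. Qed.

Lemma expectationEx (X : T -> R) : itg X -> 'E_P[X]%E = (Ex X)%:E.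
Proof.
move=> iX; rewrite unlock /Ex /Rintegral fineK//.
exact: integrable_fin_num.
Qed.

Lemma fine_expectation (X : T -> R) : fine 'E_P[X]%E = Ex X.
Proof. by rewrite unlock. Qed.

Lemma itgD (X Y : T -> R) : itg X -> itg Y -> itg (fun w => X w + Y w).
Proof. by move=> iX iY; apply: (integrableD _ iX iY). Qed.

Lemma itgZ (a : R) (X : T -> R) : itg X -> itg (fun w => a * X w).
Proof. by move=> iX; apply: (@integrableZl _ _ _ P setT measurableT a (EFin \o X) iX). Qed.

Lemma itgN (X : T -> R) : itg X -> itg (fun w => - X w).
Proof.
by move=> iX; rewrite (_ : (fun w => - X w) = (fun w => (-1) * X w));
  [exact: itgZ | apply/funext => w; rewrite mulN1r].
Qed.

Lemma itgB (X Y : T -> R) : itg X -> itg Y -> itg (fun w => X w - Y w).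
Proof. by move=> iX iY; apply: itgD => //; exact: itgN. Qed.

Lemma itg_cst (a : R) : itg (fun=> a).
Proof. exact: finite_measure_integrable_cst. Qed.

Lemma itg_sum (I : Type) (r : seq I) (p : pred I) (X : I -> T -> R) :
  (forall i, itg (X i)) -> itg (fun w => \sum_(i <- r | p i) X i w).
Proof.
move=> iX; elim: r => [|i r IH].
  by rewrite (_ : (fun _ => _) = (fun=> 0)) ?funeqE => [|w]; [exact: itg_cst | rewrite big_nil].
rewrite (_ : (fun w => _) = (fun w => (if p i then X i w else 0) + \sum_(j <- r | p j) X j w)).
  by apply: itgD => //; case: (p i) => //; exact: itg_cst.
by apply/funext => w; rewrite big_cons; case: (p i); rewrite ?add0r.
Qed.

Lemma itg_le (X Y : T -> R) : measurable_fun setT X -> itg Y ->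
  (forall w, `|X w| <= Y w) -> itg X.
Proof.
move=> mX iY XY; apply: (le_integrable measurableT _ _ iY) => //; first exact/measurable_EFinP.
by move=> w _ /=; rewrite lee_fin (le_trans (XY w))// ler_norm.
Qed.

Lemma itg_norm (X : T -> R) : itg X -> itg (fun w => `|X w|).
Proof. by move=> iX; apply: (integrable_abse iX). Qed.

Lemma itgM_bdd (X Y : T -> R) : itg X -> bddm Y -> itg (fun w => X w * Y w).
Proof.
move=> iX [mY [M YM]]; apply: (@itg_le _ (fun w => M * `|X w|)).
- by apply: measurable_funM => //; exact: itg_measurable.
- by apply: itgZ; exact: itg_norm.
- by move=> w; rewrite normrM mulrC ler_wpM2r.
Qed.

Lemma ExD (X Y : T -> R) : itg X -> itg Y ->
  Ex (fun w => X w + Y w) = Ex X + Ex Y.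
Proof. by move=> iX iY; rewrite /Ex RintegralD. Qed.

Lemma ExZ (a : R) (X : T -> R) : itg X -> Ex (fun w => a * X w) = a * Ex X.
Proof. by move=> iX; rewrite /Ex RintegralZl. Qed.

Lemma ExN (X : T -> R) : itg X -> Ex (fun w => - X w) = - Ex X.
Proof.
by move=> iX; rewrite -[RHS]mulN1r -ExZ//; congr Ex; apply/funext => w; rewrite mulN1r.
Qed.

Lemma ExB (X Y : T -> R) : itg X -> itg Y ->
  Ex (fun w => X w - Y w) = Ex X - Ex Y.
Proof. by move=> iX iY; rewrite ExD ?ExN//; exact: itgN. Qed.

Lemma Ex_cst (a : R) : Ex (fun=> a) = a.
Proof. by rewrite /Ex Rintegral_cst//= probability_setT mulr1. Qed.

Lemma Ex_sum (I : Type) (r : seq I) (p : pred I) (X : I -> T -> R) :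
  (forall i, itg (X i)) ->
  Ex (fun w => \sum_(i <- r | p i) X i w) = \sum_(i <- r | p i) Ex (X i).
Proof.
move=> iX; elim: r => [|i r IH].
  rewrite big_nil -[RHS](Ex_cst 0); congr Ex; apply/funext => w; by rewrite big_nil.
rewrite big_cons -IH; case: ifPn => pi; last first.
  by congr Ex; apply/funext => w; rewrite big_cons (negbTE pi).
rewrite -ExD//; last exact: itg_sum.
by congr Ex; apply/funext => w; rewrite big_cons pi.
Qed.

Lemma Ex_le (X Y : T -> R) : itg X -> itg Y -> (forall w, X w <= Y w) ->
  Ex X <= Ex Y.
Proof. by move=> iX iY XY; apply: le_Rintegral. Qed.

Lemma Ex_ge0 (X : T -> R) : (forall w, 0 <= X w) -> 0 <= Ex X.
Proof. by move=> X0; apply: Rintegral_ge0. Qed.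

Lemma Ex_norm (X : T -> R) : itg X -> `|Ex X| <= Ex (fun w => `|X w|).
Proof. by move=> iX; apply: le_normr_Rintegral. Qed.

Lemma Ex_bdd (X : T -> R) (M : R) : measurable_fun setT X ->
  (forall w, `|X w| <= M) -> `|Ex X| <= M.
Proof.
move=> mX XM; have iX : itg X by apply: bddm_itg; split => //; exists M.
rewrite (le_trans (Ex_norm iX))// -[leRHS]Ex_cst.
by apply: Ex_le => //; [exact: itg_norm | exact: itg_cst].
Qed.

Lemma bddm_cst (a : R) : bddm (fun=> a).
Proof. by split=> //; exists `|a|. Qed.

Lemma bddmD (X Y : T -> R) : bddm X -> bddm Y -> bddm (fun w => X w + Y w).
Proof.
move=> [mX [M XM]] [mY [N YN]]; split; first exact: measurable_funD.
by exists (M + N) => w; rewrite (le_trans (ler_normD _ _))// lerD.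
Qed.

Lemma bddmM (X Y : T -> R) : bddm X -> bddm Y -> bddm (fun w => X w * Y w).
Proof.
move=> [mX [M XM]] [mY [N YN]]; split; first exact: measurable_funM.
by exists (M * N) => w; rewrite normrM ler_pM.
Qed.

Lemma bddmZ (a : R) (X : T -> R) : bddm X -> bddm (fun w => a * X w).
Proof. by move=> bX; apply: bddmM => //; exact: bddm_cst. Qed.

Lemma bddmN (X : T -> R) : bddm X -> bddm (fun w => - X w).
Proof.
by move=> [mX [M XM]]; split; [exact: measurableT_comp | exists M => w; rewrite normrN].
Qed.

Lemma bddmB (X Y : T -> R) : bddm X -> bddm Y -> bddm (fun w => X w - Y w).
Proof. by move=> bX bY; apply: bddmD => //; exact: bddmN. Qed.

Lemma bddm_sum (I : Type) (r : seq I) (p : pred I) (X : I -> T -> R) :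
  (forall i, bddm (X i)) -> bddm (fun w => \sum_(i <- r | p i) X i w).
Proof.
move=> iX; elim: r => [|i r IH].
  by rewrite (_ : (fun _ => _) = (fun=> 0)) ?funeqE => [|w]; [exact: bddm_cst | rewrite big_nil].
rewrite (_ : (fun w => _) = (fun w => (if p i then X i w else 0) + \sum_(j <- r | p j) X j w)).
  by apply: bddmD => //; case: (p i) => //; exact: bddm_cst.
by apply/funext => w; rewrite big_cons; case: (p i); rewrite ?add0r.
Qed.

Lemma Ex_cauchy_schwarz (X Y : T -> R) :
  itg (fun w => X w ^+ 2) -> itg (fun w => Y w ^+ 2) -> itg (fun w => X w * Y w) ->
  `|Ex (fun w => X w * Y w)| <=
    sqrtr (Ex (fun w => X w ^+ 2)) * sqrtr (Ex (fun w => Y w ^+ 2)).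
Proof.
move=> iX iY iXY; set a := Ex (fun w => X w ^+ 2); set b := Ex (fun w => Y w ^+ 2).
set c := Ex _.
have a0 : 0 <= a by apply: Ex_ge0 => w; exact: sqr_ge0.
have b0 : 0 <= b by apply: Ex_ge0 => w; exact: sqr_ge0.
(* Nonnegativity of E (x X + y Y)^2 for all x, y covers degenerate cases too: it is used at (b, -c)
   if b > 0, at (-c, a) if a > 0, and at (1, 1) and (1, -1) if both vanish. *)
have q (x y : R) : 0 <= x ^+ 2 * a + 2 * x * y * c + y ^+ 2 * b.
  have -> : x ^+ 2 * a + 2 * x * y * c + y ^+ 2 * b =
      Ex (fun w => x ^+ 2 * X w ^+ 2 + 2 * x * y * (X w * Y w) + y ^+ 2 * Y w ^+ 2).
    by rewrite !ExD ?ExZ//; repeat first [apply: itgD | apply: itgZ].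
  apply: Ex_ge0 => w; rewrite [leRHS](_ : _ = (x * X w + y * Y w) ^+ 2) ?sqr_ge0//.
  by ring.
rewrite -sqrtrM// -sqrtr_sqr ler_wsqrtr//.
have [b00|bn0] := eqVneq b 0; last first.
  have bp : 0 < b by rewrite lt_def bn0.
  have : 0 <= b * (a * b - c ^+ 2).
    by have := q b (- c); rewrite (_ : _ + _ = b * (a * b - c ^+ 2))//; ring.
  by rewrite pmulr_rge0// subr_ge0.
have [a00|an0] := eqVneq a 0.
  have h1 := q 1 1; have h2 := q 1 (-1).
  rewrite a00 b00 in h1 h2 *.
  have -> : c = 0 by lra.
  by rewrite expr0n mulr0.
have ap : 0 < a by rewrite lt_def an0.
have : 0 <= a * (a * b - c ^+ 2).
  by have := q (- c) a; rewrite (_ : _ + _ = a * (a * b - c ^+ 2))//; ring.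
by rewrite pmulr_rge0// subr_ge0.
Qed.

Lemma Ex_centered_sqr (X : T -> R) : itg X -> itg (fun w => X w * X w) ->
  Ex (fun w => (X w - Ex X) ^+ 2) = Ex (fun w => X w * X w) - Ex X * Ex X.
Proof.
move=> iX iXX; set e := Ex X.
rewrite (_ : (fun w => _) = (fun w => X w * X w - (2 * e * X w - e ^+ 2))); last first.
  by apply/funext => w; ring.
rewrite (ExB iXX (itgB (itgZ _ iX) (itg_cst _))) (ExB (itgZ _ iX) (itg_cst _)).
by rewrite (ExZ _ iX) Ex_cst -/e; ring.
Qed.

Lemma Ex_norm_le_sqrt (X : T -> R) : itg X -> itg (fun w => X w ^+ 2) ->
  Ex (fun w => `|X w|) <= sqrtr (Ex (fun w => X w ^+ 2)).
Proof.
move=> iX iX2.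
have h : itg (fun w => `|X w| ^+ 2).
  by apply: eq_integrable iX2 => // w _ /=; rewrite real_normK ?num_real.
have := @Ex_cauchy_schwarz (fun w => `|X w|) (fun=> 1) h.
rewrite expr1n Ex_cst sqrtr1 mulr1 => /(_ (itg_cst _)).
rewrite (_ : (fun w => `|X w| * 1) = (fun w => `|X w|)); last by apply/funext => w; rewrite mulr1.
move=> /(_ (itg_norm iX)); rewrite ger0_norm; last by apply: Ex_ge0.
move=> /le_trans; apply; rewrite ler_wsqrtr// le_eqVlt; apply/orP; left; apply/eqP.
by congr Ex; apply/funext => w; rewrite real_normK ?num_real.
Qed.

Lemma Ex_dominated (Xn : nat -> T -> R) (X Y : T -> R) :
  (forall n, measurable_fun setT (Xn n)) -> measurable_fun setT X ->
  (forall w, Xn n w @[n --> \oo] --> X w) ->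
  itg Y -> (forall n w, `|Xn n w| <= Y w) ->
  Ex (Xn n) @[n --> \oo] --> Ex X.
Proof.
move=> mXn mX XnX iY XnY.
have iX : itg X.
  apply: (itg_le mX iY) => w.
  apply: (@closed_cvg _ _ \oo _ (fun n => `|Xn n w|) (fun x => x <= Y w)).
  - exact: closed_le.
  - by apply: nearW => n; exact: XnY.
  - by apply: cvg_norm.
have mE n : measurable_fun setT (EFin \o Xn n) by exact/measurable_EFinP.
have mE' : measurable_fun setT (EFin \o X) by exact/measurable_EFinP.
have cE : {ae P, forall w, setT w -> (EFin \o Xn n) w @[n --> \oo] --> (EFin \o X) w}.
  by apply: aeW => w _ /=; apply: cvg_EFin; [exact: nearW | exact: XnX].
have dE : {ae P, forall w n, setT w -> (`|(EFin \o Xn n) w| <= (EFin \o Y) w)%E}.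
  by apply: aeW => w n _ /=; rewrite lee_fin.
have [_ _ h] := dominated_convergence measurableT mE mE' cE iY dE.
rewrite /Ex /Rintegral; apply: fine_cvg; rewrite fineK//.
exact: integrable_fin_num.
Qed.

(** Domination is asked only within distance 1 of t, so that explicit majorants such as exp (2 |x|)
    suffice for integrands that are unbounded in s. *)
Lemma is_derive_Ex (f df : R -> T -> R) (G : T -> R) (t : R) :
  (forall s w, is_derive s (1 : R) (f ^~ w) (df s w)) ->
  (forall s, itg (f s)) -> itg G ->
  (forall s w, `|s - t| < 1 -> `|df s w| <= G w) ->
  is_derive t (1 : R) (fun s => Ex (f s)) (Ex (df t)).
Proof.
move=> fdf itf iG dG.
have It : `]t - 1, t + 1[%classic t by rewrite /= in_itv/= ltrBlDr ltrDl ltr01.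
have derf1 s w : `]t - 1, t + 1[%classic s -> setT w -> derivable (f ^~ w) s 1.
  by move=> _ _; have [] := fdf s w.
have dE s w : partial1of2 f s w = df s w.
  by rewrite /partial1of2 derive1E; have [_ ->] := fdf s w.
have G0 w : 0 <= G w.
  by rewrite (le_trans _ (dG t w _))// subrr normr0.
have Gub s w : `]t - 1, t + 1[%classic s -> setT w -> `|partial1of2 f s w| <= G w.
  move=> /=; rewrite in_itv/= => /andP[h1 h2] _; rewrite dE; apply: dG.
  by rewrite ltr_norml; lra.
have intf s : `]t - 1, t + 1[%classic s -> P.-integrable setT (EFin \o f s) by move=> _; exact: itf.
have d1 := derivable_under_integral measurableT It intf derf1 G0 iG Gub.
have d2 := differentiation_under_integral measurableT It intf derf1 G0 iG Gub.
apply: DeriveDef => //.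
by rewrite -derive1E d2 /Ex; congr fine; apply: eq_integral => w _; rewrite dE.
Qed.

End Expectation.
(** * Trigonometric polynomials of Gaussian vectors *)

Section TrigPoly.
Context {R : realType} {I : finType}.
Implicit Types (l m x : I -> R) (S : I -> I -> R).

Definition dot l x : R := \sum_i l i * x i.
Definition qform S l m : R := \sum_i \sum_j l i * S i j * m j.

(* A triple (a, l, p) stands for the function x |-> a cos (l . x + p). *)
Definition tpoly := seq (R * (I -> R) * R).
Implicit Types (F G : tpoly).

Definition tev F x : R := \sum_(t <- F) t.1.1 * cos (dot t.1.2 x + t.2).
(** Differentiating a cosine adds a quarter period to its phase; with phases stored in the triples
    the class is closed under partial derivatives. *)
Definition tder (i : I) F : tpoly :=
  [seq (t.1.1 * t.1.2 i, t.1.2, t.2 + pi / 2) | t <- F].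
Definition tscale (a : R) F : tpoly := [seq (a * t.1.1, t.1.2, t.2) | t <- F].
(** Product-to-sum formula: the two triples carry the sum and the difference of the arguments. *)
Definition tmul1 (s t : R * (I -> R) * R) : tpoly :=
  [:: (s.1.1 * t.1.1 / 2, (fun i => s.1.2 i + t.1.2 i), s.2 + t.2);
      (s.1.1 * t.1.1 / 2, (fun i => s.1.2 i - t.1.2 i), s.2 - t.2)].
Definition tmul F G : tpoly := flatten [seq tmul1 s t | s <- F, t <- G].
Definition tcst (a : R) : tpoly := [:: (a, fun=> 0, 0)].

Lemma dotDl l m x : dot (fun i => l i + m i) x = dot l x + dot m x.
Proof. by rewrite /dot -big_split/=; apply: eq_bigr => i _; rewrite mulrDl. Qed.

Lemma dotBl l m x : dot (fun i => l i - m i) x = dot l x - dot m x.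
Proof. by rewrite /dot -sumrB/=; apply: eq_bigr => i _; rewrite mulrBl. Qed.

Lemma dotZl (a : R) l x : dot (fun i => a * l i) x = a * dot l x.
Proof. by rewrite /dot mulr_sumr; apply: eq_bigr => i _; rewrite mulrA. Qed.

Lemma dot0l x : dot (fun=> 0) x = 0.
Proof. by rewrite /dot big1// => i _; rewrite mul0r. Qed.

Lemma cosM (a b : R) : cos a * cos b = (cos (a + b) + cos (a - b)) / 2.
Proof. by rewrite cosD cosB; field. Qed.

Lemma tev_nil x : tev [::] x = 0. Proof. by rewrite /tev big_nil. Qed.

Lemma tev_cons t F x : tev (t :: F) x = t.1.1 * cos (dot t.1.2 x + t.2) + tev F x.
Proof. by rewrite /tev big_cons. Qed.

Lemma tev_cat F G x : tev (F ++ G) x = tev F x + tev G x.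
Proof. by rewrite /tev big_cat. Qed.

Lemma tev_scale (a : R) F x : tev (tscale a F) x = a * tev F x.
Proof.
by rewrite /tev big_map mulr_sumr; apply: eq_bigr => t _; rewrite mulrA.
Qed.

Lemma tev_cst (a : R) x : tev (tcst a) x = a.
Proof. by rewrite /tev big_seq1/= dot0l addr0 cos0 mulr1. Qed.

Lemma tev_mul1 s t x : tev (tmul1 s t) x =
  s.1.1 * cos (dot s.1.2 x + s.2) * (t.1.1 * cos (dot t.1.2 x + t.2)).
Proof.
rewrite /tmul1 !tev_cons tev_nil/= dotDl dotBl addr0 mulrACA cosM.
rewrite (_ : dot _ _ + dot _ _ + _ = dot s.1.2 x + s.2 + (dot t.1.2 x + t.2)); last by ring.
rewrite (_ : dot _ _ - dot _ _ + _ = dot s.1.2 x + s.2 - (dot t.1.2 x + t.2)); last by ring.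
by field.
Qed.

Lemma tev_flatten (Fs : seq tpoly) x : tev (flatten Fs) x = \sum_(F <- Fs) tev F x.
Proof.
elim: Fs => [|F Fs IH] /=; first by rewrite big_nil tev_nil.
by rewrite tev_cat big_cons IH.
Qed.

Lemma tev_mul F G x : tev (tmul F G) x = tev F x * tev G x.
Proof.
rewrite tev_flatten big_allpairs_dep /tev mulr_suml; apply: eq_bigr => s _.
by rewrite mulr_sumr; apply: eq_bigr => t _; rewrite -/(tev _ _) tev_mul1.
Qed.

Lemma tder_cat i F G : tder i (F ++ G) = tder i F ++ tder i G.
Proof. by rewrite /tder map_cat. Qed.

Lemma tev_tder_scale i (a : R) F x : tev (tder i (tscale a F)) x = a * tev (tder i F) x.
Proof.
rewrite /tev !big_map mulr_sumr; apply: eq_bigr => t _ /=; by rewrite !mulrA.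
Qed.

Lemma tev_tder_cst i (a : R) x : tev (tder i (tcst a)) x = 0.
Proof. by rewrite /tev big_seq1/= mulr0 mul0r. Qed.

Lemma tder_flatten i (Fs : seq tpoly) : tder i (flatten Fs) = flatten [seq tder i F | F <- Fs].
Proof. by elim: Fs => [|F Fs IH] //=; rewrite tder_cat IH. Qed.

Lemma cosDpihalf' (a : R) : cos (a + pi / 2) = - sin a.
Proof. by rewrite cosD cos_pihalf sin_pihalf; ring. Qed.

Lemma tev_tder_mul1 i s t x : tev (tder i (tmul1 s t)) x =
  tev (tder i [:: s]) x * tev [:: t] x + tev [:: s] x * tev (tder i [:: t]) x.
Proof.
rewrite /tmul1 /tder /= !tev_cons !tev_nil/= dotDl dotBl !addr0 !addrA !cosDpihalf'.
set a := dot s.1.2 x; set b := dot t.1.2 x.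
rewrite (_ : a + b + s.2 + t.2 = (a + s.2) + (b + t.2)); last by ring.
rewrite (_ : a - b + s.2 - t.2 = (a + s.2) - (b + t.2)); last by ring.
by rewrite sinD sinB; field.
Qed.

Lemma tev_tder_mul i F G x : tev (tder i (tmul F G)) x =
  tev (tder i F) x * tev G x + tev F x * tev (tder i G) x.
Proof.
rewrite tder_flatten tev_flatten big_map big_allpairs_dep.
rewrite [tev (tder i F) x]big_map [tev F x]/tev !mulr_suml -big_split/=.
apply: eq_bigr => s _.
rewrite [tev (tder i G) x]big_map [tev G x]/tev !mulr_sumr -big_split/=.
apply: eq_bigr => t _; rewrite tev_tder_mul1 /tder /=.
by rewrite !tev_cons !tev_nil/= !addr0.
Qed.

Lemma qformDl S l m n : qform S (fun i => l i + m i) n = qform S l n + qform S m n.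
Proof.
rewrite /qform -big_split/=; apply: eq_bigr => i _.
by rewrite -big_split/=; apply: eq_bigr => j _; ring.
Qed.

Lemma qformDr S l m n : qform S n (fun i => l i + m i) = qform S n l + qform S n m.
Proof.
rewrite /qform -big_split/=; apply: eq_bigr => i _.
by rewrite -big_split/=; apply: eq_bigr => j _; ring.
Qed.

Lemma qformZl S (a : R) l n : qform S (fun i => a * l i) n = a * qform S l n.
Proof.
rewrite /qform mulr_sumr; apply: eq_bigr => i _.
by rewrite mulr_sumr; apply: eq_bigr => j _; ring.
Qed.

Lemma qformZr S (a : R) l n : qform S n (fun i => a * l i) = a * qform S n l.
Proof.
rewrite /qform mulr_sumr; apply: eq_bigr => i _.
by rewrite mulr_sumr; apply: eq_bigr => j _; ring.
Qed.

Lemma qformC S l m : (forall i j, S i j = S j i) -> qform S l m = qform S m l.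
Proof.
move=> sS; rewrite /qform exchange_big/=; apply: eq_bigr => i _.
by apply: eq_bigr => j _; rewrite sS; ring.
Qed.

Lemma qform0l S l : qform S (fun=> 0) l = 0.
Proof. by rewrite /qform big1// => i _; rewrite big1// => j _; rewrite !mul0r. Qed.

End TrigPoly.
Arguments tpoly R I : clear implicits.
Arguments tev {R I} F x : simpl never.
Arguments tder {R I} i F : simpl never.
Arguments tscale {R I} a F : simpl never.
Arguments tmul {R I} F G : simpl never.
Arguments tcst {R I} a : simpl never.

(** * Gaussian vectors and expectations of trigonometric polynomials *)

Section GaussianVector.
Context `{T : measurableType d} {R : realType} (P : probability T R).

(* A centred Gaussian vector, degenerate ones included, given through its
   characteristic function. *)
Definition gvec (I : finType) (X : I -> T -> R) (S : I -> I -> R) : Prop :=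
  [/\ forall i, measurable_fun setT (X i), forall i j, S i j = S j i &
      forall l : I -> R,
        Ex P (fun w => cos (dot l (X^~ w))) = expR (- qform S l l / 2) /\
        Ex P (fun w => sin (dot l (X^~ w))) = 0].

Lemma measurable_dot (I : finType) (X : I -> T -> R) (l : I -> R) :
  (forall i, measurable_fun setT (X i)) -> measurable_fun setT (fun w => dot l (X^~ w)).
Proof.
move=> mX; apply: measurable_sum => i; exact: measurable_funM.
Qed.

Lemma bddm_cos (Y : T -> R) : measurable_fun setT Y -> bddm (fun w => cos (Y w)).
Proof.
move=> mY; split; last by exists 1 => w; rewrite ler_norml cos_geN1 cos_le1.
apply: (measurableT_comp _ mY); apply: continuous_measurable_fun; exact: continuous_cos.
Qed.

Lemma bddm_sin (Y : T -> R) : measurable_fun setT Y -> bddm (fun w => sin (Y w)).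
Proof.
move=> mY; split; last by exists 1 => w; rewrite ler_norml sin_geN1 sin_le1.
apply: (measurableT_comp _ mY); apply: continuous_measurable_fun; exact: continuous_sin.
Qed.

Lemma bddm_tev (I : finType) (X : I -> T -> R) (F : tpoly R I) :
  (forall i, measurable_fun setT (X i)) -> bddm (fun w => tev F (X^~ w)).
Proof.
move=> mX; apply: bddm_sum => t; apply: bddmZ; apply: bddm_cos.
by apply: measurable_funD => //; exact: measurable_dot.
Qed.

Lemma is_derive_Ex_cos (Y : T -> R) (p t : R) : itg P Y ->
  is_derive t (1 : R) (fun s => Ex P (fun w => cos (s * Y w + p)))
    (Ex P (fun w => - (sin (t * Y w + p) * Y w))).
Proof.
move=> iY; have mY := itg_measurable iY.
apply: (@is_derive_Ex _ _ _ _ (fun s w => cos (s * Y w + p))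
  (fun s w => - (sin (s * Y w + p) * Y w)) (fun w => `|Y w|)).
- by move=> s w; apply: is_derive_eq; rewrite /GRing.scale/=; ring.
- by move=> s; apply: bddm_itg; apply: bddm_cos; apply: measurable_funD => //; exact: measurable_funM.
- exact: itg_norm.
- move=> s w _; rewrite normrN normrM ler_piMl//.
  by rewrite ler_norml sin_geN1 sin_le1.
Qed.

Lemma Ex_cos_phase (I : finType) (X : I -> T -> R) (S : I -> I -> R) (l : I -> R) (p : R) :
  gvec X S -> Ex P (fun w => cos (dot l (X^~ w) + p)) = expR (- qform S l l / 2) * cos p.
Proof.
move=> [mX _ h]; have [hc hs] := h l.
have mD := measurable_dot l mX.
rewrite (_ : (fun w => _) = (fun w => cos p * cos (dot l (X^~ w)) - sin p * sin (dot l (X^~ w)))); last first.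
  by apply/funext => w; rewrite cosD; ring.
rewrite ExB ?ExZ ?hc ?hs; first by ring.
all: try (apply: bddm_itg; try (apply: bddmZ); by [exact: bddm_cos | exact: bddm_sin]).
Qed.

Lemma Ex_tev (I : finType) (X : I -> T -> R) (S : I -> I -> R) (F : tpoly R I) :
  gvec X S -> Ex P (fun w => tev F (X^~ w)) =
    \sum_(t <- F) t.1.1 * (expR (- qform S t.1.2 t.1.2 / 2) * cos t.2).
Proof.
move=> g; have [mX _ _] := g.
have b (l : I -> R) p : bddm (fun w => cos (dot l (X^~ w) + p)).
  by apply: bddm_cos; apply: measurable_funD => //; exact: measurable_dot.
rewrite Ex_sum; last by move=> t; apply: bddm_itg; apply: bddmZ; exact: b.
apply: eq_bigr => t _; rewrite ExZ; last by exact/bddm_itg/b.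
by rewrite (Ex_cos_phase _ _ g).
Qed.

Lemma gvec_lin (I J : finType) (X : I -> T -> R) (S : I -> I -> R) (A : J -> I -> R) :
  gvec X S ->
  gvec (fun j w => dot (A j) (X^~ w)) (fun j k => qform S (A j) (A k)).
Proof.
move=> [mX sS h]; split.
- by move=> j; exact: measurable_dot.
- by move=> j k; exact: qformC.
- move=> l; have [hc hs] := h (fun i => \sum_j l j * A j i).
  have dE w : dot l (fun j => dot (A j) (X^~ w)) = dot (fun i => \sum_j l j * A j i) (X^~ w).
    rewrite /dot; under eq_bigr do rewrite mulr_sumr.
    rewrite exchange_big/=; apply: eq_bigr => i _.
    by rewrite mulr_suml; apply: eq_bigr => j _; rewrite mulrA.
  have qE : qform (fun j k => qform S (A j) (A k)) l l =
      qform S (fun i => \sum_j l j * A j i) (fun i => \sum_j l j * A j i).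
    rewrite /qform.
    under [RHS]eq_bigr do under eq_bigr do rewrite mulr_suml mulr_suml.
    under [RHS]eq_bigr do under eq_bigr do under eq_bigr do rewrite mulr_sumr.
    under [RHS]eq_bigr do rewrite exchange_big/=.
    rewrite [RHS]exchange_big/=; apply: eq_bigr => j _.
    under [RHS]eq_bigr do rewrite exchange_big/=.
    rewrite [RHS]exchange_big/= ; apply: eq_bigr => k _.
    under eq_bigr do under eq_bigr do idtac.
    rewrite mulr_sumr mulr_suml [LHS]/=; under eq_bigr do rewrite mulr_sumr mulr_suml.
    by apply: eq_bigr => i _; apply: eq_bigr => i' _; ring.
  split.
  + by rewrite qE -hc; congr Ex; apply/funext => w; rewrite dE.
  + by rewrite -hs; congr Ex; apply/funext => w; rewrite dE.
Qed.

Lemma eq_gvec (I : finType) (X Y : I -> T -> R) (S S' : I -> I -> R) :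
  (forall i w, X i w = Y i w) -> (forall i j, S i j = S' i j) -> gvec X S -> gvec Y S'.
Proof.
move=> XY SS; suff -> : X = Y by suff -> : S = S' by [];
  apply/funext => i; apply/funext => j; exact: SS.
by apply/funext => i; apply/funext => j; exact: XY.
Qed.

End GaussianVector.

(** * Product spaces and independent Gaussian vectors *)

Section ProductExpectation.
Context {d1 d2 : measure_display} {T1 : measurableType d1} {T2 : measurableType d2}.
Context {R : realType} (P1 : probability T1 R) (P2 : probability T2 R).

Local Notation PP := (P1 \x P2)%E.

Lemma measurable_section2 (f : T1 * T2 -> R) (x : T1) :
  measurable_fun setT f -> measurable_fun setT (fun y => f (x, y)).
Proof.
move=> mf; apply: (measurableT_comp mf); exact: measurable_pair1.
Qed.

Lemma Ex_prodE (f : T1 * T2 -> R) : bddm f ->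
  Ex PP f = Ex P1 (fun x => Ex P2 (fun y => f (x, y))).
Proof.
move=> bf; have if_ := bddm_itg PP bf.
rewrite /Ex /Rintegral -(integral12_prod_meas1 if_); congr fine.
apply: eq_integral => x _; rewrite /= fineK//.
apply: integrable_fin_num => //; apply: bddm_itg.
by case: bf => mf [M fM]; split; [exact: measurable_section2 | exists M => y].
Qed.

Lemma bddm_Ex2 (f : T1 * T2 -> R) : bddm f -> bddm (fun x => Ex P2 (fun y => f (x, y))).
Proof.
move=> bf; have [mf [M fM]] := bf; split; last first.
  exists M => x; apply: Ex_bdd => //; exact: measurable_section2.
have if_ := bddm_itg PP bf.
move: (integrable_fubini_F if_) => /integrableP[h _].
apply/measurable_EFinP; apply: eq_measurable_fun h => x _ /=.
rewrite fineK//; apply: integrable_fin_num => //; apply: bddm_itg.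
by split; [exact: measurable_section2 | exists M => y].
Qed.

Lemma bddm_fst (f : T1 -> R) : bddm f -> bddm (fun z : T1 * T2 => f z.1).
Proof. by move=> [mf [M fM]]; split; [exact: measurableT_comp | exists M => z]. Qed.

Lemma bddm_snd (f : T2 -> R) : bddm f -> bddm (fun z : T1 * T2 => f z.2).
Proof. by move=> [mf [M fM]]; split; [exact: measurableT_comp | exists M => z]. Qed.

Lemma Ex_prodM (f : T1 -> R) (g : T2 -> R) : bddm f -> bddm g ->
  Ex PP (fun z => f z.1 * g z.2) = Ex P1 f * Ex P2 g.
Proof.
move=> bf bg; rewrite Ex_prodE; last by apply: bddmM; [exact: bddm_fst | exact: bddm_snd].
rewrite (_ : (fun x => Ex P2 _) = (fun x => Ex P2 g * f x)); last first.
  by apply/funext => x; rewrite /= ExZ 1?mulrC//; exact: bddm_itg.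
by rewrite ExZ 1?mulrC//; exact: bddm_itg.
Qed.

Lemma Ex_fst (f : T1 -> R) : bddm f -> Ex PP (fun z => f z.1) = Ex P1 f.
Proof.
move=> bf; have := Ex_prodM bf (@bddm_cst _ T2 R 1); rewrite Ex_cst mulr1 => <-.
by congr Ex; apply/funext => z; rewrite mulr1.
Qed.

(** The addition formulas split the joint characteristic function into products of one-sided
    expectations; those containing a sine vanish, and the product of the two exponentials
    remains. *)
Lemma gvec_prod (I J : finType) (X : I -> T1 -> R) (Y : J -> T2 -> R)
    (S : I -> I -> R) (S' : J -> J -> R) :
  gvec P1 X S -> gvec P2 Y S' ->
  gvec PP (fun k z => match k with inl i => X i z.1 | inr j => Y j z.2 end)
    (fun k k' => match k, k' with
       | inl i, inl i' => S i i' | inr j, inr j' => S' j j' | _, _ => 0 end).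
Proof.
move=> [mX sS hX] [mY sS' hY]; split.
- by case=> i; [apply: (measurableT_comp (mX i)) | apply: (measurableT_comp (mY i))].
- by case=> i [j|j].
move=> l.
have dE (z : T1 * T2) : dot l (fun k => match k with inl i => X i z.1 | inr j => Y j z.2 end) =
    dot (l \o inl) (X^~ z.1) + dot (l \o inr) (Y^~ z.2).
  by rewrite /dot big_sumType.
have qE : qform (fun k k' => match k, k' with
       | inl i, inl i' => S i i' | inr j, inr j' => S' j j' | _, _ => 0 end) l l =
    qform S (l \o inl) (l \o inl) + qform S' (l \o inr) (l \o inr).
  rewrite /qform big_sumType/=; congr (_ + _); apply: eq_bigr => i _; rewrite big_sumType/=.
    by rewrite [X in _ + X]big1 ?addr0// => j _; rewrite mulr0 mul0r.
  by rewrite [X in X + _]big1 ?add0r// => j _; rewrite mulr0 mul0r.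
have [cX sX] := hX (l \o inl); have [cY sY] := hY (l \o inr).
have mDX := measurable_dot (l \o inl) mX; have mDY := measurable_dot (l \o inr) mY.
have bcX := bddm_cos mDX; have bsX := bddm_sin mDX.
have bcY := bddm_cos mDY; have bsY := bddm_sin mDY.
split.
- rewrite (_ : (fun z => _) = (fun z : T1 * T2 =>
     cos (dot (l \o inl) (X^~ z.1)) * cos (dot (l \o inr) (Y^~ z.2)) -
     sin (dot (l \o inl) (X^~ z.1)) * sin (dot (l \o inr) (Y^~ z.2)))); last first.
    by apply/funext => z; rewrite dE cosD.
  rewrite ExB; last 2 first.
  + by apply: bddm_itg; apply: bddmM; [exact: (bddm_fst bcX) | exact: (bddm_snd bcY)].
  + by apply: bddm_itg; apply: bddmM; [exact: (bddm_fst bsX) | exact: (bddm_snd bsY)].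
  rewrite (Ex_prodM bcX bcY) (Ex_prodM bsX bsY) cX cY sX mul0r subr0 -expRD qE.
  by congr expR; rewrite opprD mulrDl.
- rewrite (_ : (fun z => _) = (fun z : T1 * T2 =>
     sin (dot (l \o inl) (X^~ z.1)) * cos (dot (l \o inr) (Y^~ z.2)) +
     cos (dot (l \o inl) (X^~ z.1)) * sin (dot (l \o inr) (Y^~ z.2)))); last first.
    by apply/funext => z; rewrite dE sinD.
  rewrite ExD; last 2 first.
  + by apply: bddm_itg; apply: bddmM; [exact: (bddm_fst bsX) | exact: (bddm_snd bcY)].
  + by apply: bddm_itg; apply: bddmM; [exact: (bddm_fst bcX) | exact: (bddm_snd bsY)].
  by rewrite (Ex_prodM bsX bcY) (Ex_prodM bcX bsY) sX sY mul0r mulr0 addr0.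
Qed.

End ProductExpectation.

Lemma is_derive_sum {R : realType} {A : Type} (r : seq A) (f : A -> R -> R) (df : A -> R) (t : R) :
  (forall a, is_derive t 1 (f a) (df a)) ->
  is_derive t 1 (fun t => \sum_(a <- r) f a t) (\sum_(a <- r) df a).
Proof.
move=> h; elim: r => [|a r IH].
  rewrite big_nil (_ : (fun _ => _) = cst 0); first exact: is_derive_cst.
  by apply/funext => s; rewrite big_nil.
rewrite big_cons (_ : (fun _ => _) = f a \+ (fun t => \sum_(a <- r) f a t)).
  exact: is_deriveD.
by apply/funext => s; rewrite big_cons.
Qed.

Lemma norm_MVT01 {R : realType} (f : R -> R) (df : R -> R) (M : R) :
  (forall t : R, is_derive t (1 : R) f (df t)) ->
  (forall t, 0 <= t <= 1 -> `|df t| <= M) -> `|f 1 - f 0| <= M.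
Proof.
move=> fd dM.
have fc : {within `[0, 1], continuous f}.
  apply: continuous_subspaceT => t; apply/differentiable_continuous/derivable1_diffP.
  exact: ex_derive.
have [c c01 ->] := MVT ltr01 (fun t _ => fd t) fc.
rewrite subr0 mulr1; apply: dM.
by move: c01; rewrite in_itv/= => /andP[/ltW -> /ltW ->].
Qed.

(** * Gaussian interpolation and the covariance bound *)

Section Interpolation.
Context `{T : measurableType d} {R : realType} (P : probability T R).
Variables (I : finType) (X : I -> T -> R) (S : I -> I -> R).
Hypothesis gX : gvec P X S.

(** The second component is t X + sqrt (1 - t^2) X' with X' an independent copy of X. Both
    components have covariance S and their cross covariance is t S, so t runs from independence at 0
    to equality at 1. *)
Definition icop (t : R) (k : I + I) (z : T * T) : R :=
  match k with
  | inl i => X i z.1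
  | inr i => t * X i z.1 + sqrtr (1 - t ^+ 2) * X i z.2
  end.

Definition icov (t : R) (k k' : I + I) : R :=
  match k, k' with
  | inl i, inl j => S i j | inr i, inr j => S i j
  | inl i, inr j => t * S i j | inr i, inl j => t * S i j
  end.

Lemma qform_delta (J : finType) (Q : J -> J -> R) (a b : J) :
  qform Q (fun i => (i == a)%:R) (fun i => (i == b)%:R) = Q a b.
Proof.
rewrite /qform (bigD1 a)//= [X in _ + X]big1 ?addr0; last first.
  by move=> i /negbTE ia; rewrite big1// => j _; rewrite ia !mul0r.
rewrite eqxx (bigD1 b)//= [X in _ + X]big1 ?addr0 ?eqxx ?mul1r ?mulr1//.
by move=> j /negbTE jb; rewrite jb mulr0.
Qed.

Lemma dot_delta (J : finType) (a : J) (x : J -> R) : dot (fun i => (i == a)%:R) x = x a.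
Proof.
rewrite /dot (bigD1 a)//= big1 ?addr0 ?eqxx ?mul1r// => j /negbTE ->; exact: mul0r.
Qed.

Lemma gvec_icop (t : R) : 0 <= t <= 1 -> gvec (P \x P)%E (icop t) (icov t).
Proof.
move=> /andP[t0 t1].
have t21 : 0 <= 1 - t ^+ 2 by rewrite subr_ge0 expr_le1.
pose A (k : I + I) (j : I + I) : R := match k with
  | inl i => (j == inl i)%:R
  | inr i => t * (j == inl i)%:R + sqrtr (1 - t ^+ 2) * (j == inr i)%:R
  end.
have := gvec_lin A (gvec_prod gX gX); apply: eq_gvec.
- case=> i z; rewrite /A; first by rewrite dot_delta.
  by rewrite dotDl !dotZl !dot_delta.
- case=> i [] j; rewrite /A /= ?qformDl ?qformDr ?qformZl ?qformZr ?qformDr ?qformZr ?qform_delta//=; try ring.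
  rewrite !mulr0 !addr0 add0r !mulrA -!expr2 sqr_sqrtr//; ring.
Qed.

Definition pcorr (t : R) (F G : tpoly R I) : R :=
  Ex (P \x P)%E (fun z => tev F ((icop t)^~ z \o inl) * tev G ((icop t)^~ z \o inr)).

(** Closed form of [pcorr]. The latter has its Gaussian meaning on [0, 1] only; this sum of
    exponentials is smooth in t on the whole line, endpoints included, and is what gets
    differentiated. *)
Definition kcorr (t : R) (F G : tpoly R I) : R :=
  \sum_(a <- F) \sum_(b <- G) a.1.1 * b.1.1 / 2 *
   (expR (- (qform S a.1.2 a.1.2 + qform S b.1.2 b.1.2) / 2 - t * qform S a.1.2 b.1.2) * cos (a.2 + b.2) +
    expR (- (qform S a.1.2 a.1.2 + qform S b.1.2 b.1.2) / 2 + t * qform S a.1.2 b.1.2) * cos (a.2 - b.2)).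

Definition temb1 (F : tpoly R I) : tpoly R (I + I)%type :=
  [seq (t.1.1, (fun k => match k with inl i => t.1.2 i | inr _ => 0 end), t.2) | t <- F].
Definition temb2 (F : tpoly R I) : tpoly R (I + I)%type :=
  [seq (t.1.1, (fun k => match k with inr i => t.1.2 i | inl _ => 0 end), t.2) | t <- F].

Lemma tev_emb1 F (x : I + I -> R) : tev (temb1 F) x = tev F (x \o inl).
Proof.
rewrite /tev big_map; apply: eq_bigr => t _; rewrite /dot big_sumType/=.
by rewrite [X in _ + X + _]big1 ?addr0// => i _; rewrite mul0r.
Qed.

Lemma tev_emb2 F (x : I + I -> R) : tev (temb2 F) x = tev F (x \o inr).
Proof.
rewrite /tev big_map; apply: eq_bigr => t _; rewrite /dot big_sumType/=.
by rewrite [X in X + _ + _]big1 ?add0r// => i _; rewrite mul0r.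
Qed.

Lemma qform_icov (t : R) (l m l' m' : I -> R) :
  qform (icov t) (fun k => match k with inl i => l i | inr i => m i end)
                 (fun k => match k with inl i => l' i | inr i => m' i end) =
  qform S l l' + t * qform S l m' + t * qform S m l' + qform S m m'.
Proof.
rewrite {1}/qform big_sumType/=.
under eq_bigr do rewrite big_sumType/=.
under [X in _ + X]eq_bigr do rewrite big_sumType/=.
rewrite !big_split/= !addrA /qform; congr (_ + _); congr (_ + _); first congr (_ + _).
all: rewrite mulr_sumr; apply: eq_bigr => i _; rewrite mulr_sumr; apply: eq_bigr => j _; ring.
Qed.

Lemma pcorrE (t : R) F G : 0 <= t <= 1 -> pcorr t F G = kcorr t F G.
Proof.
move=> t01; have gI := gvec_icop t01; have [_ sS _] := gX.
rewrite /pcorr (_ : (fun z => _) = (fun z => tev (tmul (temb1 F) (temb2 G)) ((icop t)^~ z))); last first.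
  by apply/funext => z; rewrite tev_mul tev_emb1 tev_emb2.
rewrite (Ex_tev _ gI) big_flatten/= big_allpairs_dep big_map/=; apply: eq_bigr => a _.
rewrite big_map; apply: eq_bigr => b _; rewrite /tmul1 big_cons big_seq1/=.
rewrite (_ : (fun i => _ + _) = (fun k => match k with inl i => a.1.2 i | inr i => b.1.2 i end)); last first.
  by apply/funext => -[] i; rewrite ?addr0 ?add0r.
rewrite (_ : (fun i => _ - _) = (fun k => match k with inl i => a.1.2 i | inr i => (-1) * b.1.2 i end)); last first.
  by apply/funext => -[] i; rewrite ?subr0 ?sub0r ?mulN1r.
rewrite !qform_icov !qformZl !qformZr (qformC b.1.2 a.1.2 sS).
rewrite [RHS]mulrDr; congr (_ * (_ * _) + _ * (_ * _)); congr expR; by field.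
Qed.

(** A pair of cosines contributes exp (c - t A) cos (p + p') + exp (c + t A) cos (p - p') with A =
    [qform S a.1.2 b.1.2]. Shifting both phases by a quarter period changes p + p' by pi and leaves
    p - p' alone, which reproduces the signs of the t-derivative. *)
Lemma kcorr_derive (t : R) F G :
  is_derive t 1 (fun t => kcorr t F G)
    (\sum_i \sum_j S i j * kcorr t (tder i F) (tder j G)).
Proof.
have -> : \sum_i \sum_j S i j * kcorr t (tder i F) (tder j G) =
  \sum_(a <- F) \sum_(b <- G) a.1.1 * b.1.1 / 2 * qform S a.1.2 b.1.2 *
   (- expR (- (qform S a.1.2 a.1.2 + qform S b.1.2 b.1.2) / 2 - t * qform S a.1.2 b.1.2) * cos (a.2 + b.2) +
    expR (- (qform S a.1.2 a.1.2 + qform S b.1.2 b.1.2) / 2 + t * qform S a.1.2 b.1.2) * cos (a.2 - b.2)).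
  under eq_bigr do under eq_bigr do rewrite /kcorr big_map mulr_sumr.
  under eq_bigr do rewrite exchange_big/=.
  rewrite exchange_big/=; apply: eq_bigr => a _.
  under eq_bigr do under eq_bigr do rewrite big_map mulr_sumr.
  under eq_bigr do rewrite exchange_big/=.
  rewrite exchange_big/=; apply: eq_bigr => b _.
  rewrite -[RHS]mulrA mulrCA [in RHS]/qform mulr_suml; apply: eq_bigr => i _.
  rewrite mulr_suml; apply: eq_bigr => j _ /=.
  rewrite (_ : a.2 + pi / 2 + (b.2 + pi / 2) = a.2 + b.2 + pi); last by field.
  rewrite (_ : a.2 + pi / 2 - (b.2 + pi / 2) = a.2 - b.2); last by field.
  by rewrite cosDpi; ring.
rewrite /kcorr.
have D a b : is_derive t 1 (fun t => a.1.1 * b.1.1 / 2 *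
   (expR (- (qform S a.1.2 a.1.2 + qform S b.1.2 b.1.2) / 2 - t * qform S a.1.2 b.1.2) * cos (a.2 + b.2) +
    expR (- (qform S a.1.2 a.1.2 + qform S b.1.2 b.1.2) / 2 + t * qform S a.1.2 b.1.2) * cos (a.2 - b.2)))
   (a.1.1 * b.1.1 / 2 * qform S a.1.2 b.1.2 *
   (- expR (- (qform S a.1.2 a.1.2 + qform S b.1.2 b.1.2) / 2 - t * qform S a.1.2 b.1.2) * cos (a.2 + b.2) +
    expR (- (qform S a.1.2 a.1.2 + qform S b.1.2 b.1.2) / 2 + t * qform S a.1.2 b.1.2) * cos (a.2 - b.2))).
  set A := qform S a.1.2 b.1.2; set B := - (_ + _) / 2; set c := cos _; set c' := cos _.
  by apply: is_derive_eq; rewrite /GRing.scale/=; ring.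
by apply: is_derive_sum => a; apply: is_derive_sum => b; exact: D.
Qed.

Lemma bddm_icop1 F (t : R) : 0 <= t <= 1 -> bddm (fun z => tev F ((icop t)^~ z \o inl)).
Proof.
move=> /gvec_icop[mI _ _]; have := bddm_tev (temb1 F) mI.
congr bddm; apply/funext => z; exact: tev_emb1.
Qed.

Lemma bddm_icop2 F (t : R) : 0 <= t <= 1 -> bddm (fun z => tev F ((icop t)^~ z \o inr)).
Proof.
move=> /gvec_icop[mI _ _]; have := bddm_tev (temb2 F) mI.
congr bddm; apply/funext => z; exact: tev_emb2.
Qed.

Lemma pcorr_sum1 F (t : R) : 0 <= t <= 1 ->
  Ex (P \x P)%E (fun z => tev F ((icop t)^~ z \o inl) ^+ 2) = Ex P (fun w => tev F (X^~ w) ^+ 2).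
Proof.
move=> _; have [mX _ _] := gX.
apply: (@Ex_fst _ _ _ _ _ P P (fun w => tev F (X^~ w) ^+ 2)).
under eq_fun do rewrite expr2.
apply: bddmM; exact: bddm_tev.
Qed.

Lemma pcorr_sum2 F (t : R) : 0 <= t <= 1 ->
  Ex (P \x P)%E (fun z => tev F ((icop t)^~ z \o inr) ^+ 2) = Ex P (fun w => tev F (X^~ w) ^+ 2).
Proof.
move=> t01; have gI := gvec_icop t01.
rewrite (_ : (fun z => _) = (fun z => tev (temb2 (tmul F F)) ((icop t)^~ z))); last first.
  by apply/funext => z; rewrite tev_emb2 tev_mul expr2.
rewrite (_ : (fun w => _) = (fun w => tev (tmul F F) (X^~ w))); last first.
  by apply/funext => w; rewrite tev_mul expr2.
rewrite (Ex_tev _ gI) (Ex_tev _ gX) big_map; apply: eq_bigr => a _ /=.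
have -> : (fun k : I + I => match k with inl _ => 0 | inr i => a.1.2 i end) =
   (fun k : I + I => match k with inl i => (fun=> 0) i | inr i => a.1.2 i end) by [].
rewrite qform_icov; have [_ sS _] := gX.
by rewrite (qformC a.1.2 (fun=> 0) sS) !qform0l !mulr0 !add0r.
Qed.

Lemma pcorr_CS (t : R) F G : 0 <= t <= 1 ->
  `|pcorr t F G| <= sqrtr (Ex P (fun w => tev F (X^~ w) ^+ 2)) *
                    sqrtr (Ex P (fun w => tev G (X^~ w) ^+ 2)).
Proof.
move=> t01; have b1 H := bddm_icop1 H t01; have b2 H := bddm_icop2 H t01.
rewrite -(pcorr_sum1 F t01) -(pcorr_sum2 G t01); apply: Ex_cauchy_schwarz.
- under eq_fun do rewrite expr2; exact/bddm_itg/bddmM.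
- under eq_fun do rewrite expr2; exact/bddm_itg/bddmM.
- exact/bddm_itg/bddmM.
Qed.

Lemma kcorr0 F G : kcorr 0 F G = Ex P (fun w => tev F (X^~ w)) * Ex P (fun w => tev G (X^~ w)).
Proof.
rewrite !(Ex_tev _ gX) mulr_suml; apply: eq_bigr => a _.
rewrite mulr_sumr; apply: eq_bigr => b _; rewrite !mul0r subr0 addr0 opprD mulrDl expRD.
rewrite [RHS](_ : _ = a.1.1 * b.1.1 * (expR (- qform S a.1.2 a.1.2 / 2) *
  expR (- qform S b.1.2 b.1.2 / 2)) * (cos a.2 * cos b.2)); last by ring.
by rewrite (cosM a.2); field.
Qed.

Lemma kcorr1 F G : kcorr 1 F G = Ex P (fun w => tev F (X^~ w) * tev G (X^~ w)).
Proof.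
have [_ sS _] := gX.
rewrite (_ : (fun w => _) = (fun w => tev (tmul F G) (X^~ w))); last first.
  by apply/funext => z; rewrite tev_mul.
rewrite (Ex_tev _ gX) big_flatten/= big_allpairs_dep/=; apply: eq_bigr => a _.
apply: eq_bigr => b _; rewrite /tmul1 big_cons big_seq1/=.
rewrite (_ : (fun i => a.1.2 i - _) = (fun i => a.1.2 i + (-1) * b.1.2 i)); last first.
  by apply/funext => i; rewrite mulN1r.
rewrite !qformDl !qformDr !qformZl !qformZr (qformC b.1.2 a.1.2 sS).
rewrite [LHS]mulrDr; congr (_ * (_ * _) + _ * (_ * _)); congr expR; by field.
Qed.

(** The covariance is the increment of [kcorr] from 0 to 1. Its derivative is a sum of expectations
    over the two copies, and Cauchy-Schwarz removes the dependence on t because each copy has the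
    law of X. *)
Lemma gvec_cov_bound F G :
  `|Ex P (fun w => tev F (X^~ w) * tev G (X^~ w)) -
    Ex P (fun w => tev F (X^~ w)) * Ex P (fun w => tev G (X^~ w))| <=
  \sum_i \sum_j `|S i j| *
    (sqrtr (Ex P (fun w => tev (tder i F) (X^~ w) ^+ 2)) *
     sqrtr (Ex P (fun w => tev (tder j G) (X^~ w) ^+ 2))).
Proof.
rewrite -kcorr0 -kcorr1; apply: (norm_MVT01 (fun t => kcorr_derive t F G)) => t t01.
rewrite (le_trans (ler_norm_sum _ _ _))// ler_sum// => i _.
rewrite (le_trans (ler_norm_sum _ _ _))// ler_sum// => j _.
by rewrite normrM ler_wpM2l// -pcorrE//; exact: pcorr_CS.
Qed.

End Interpolation.

Lemma gvec_sub `{T : measurableType d} {R : realType} (P : probability T R) (I J : finType)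
  (f : J -> I) (X : I -> T -> R) S : gvec P X S -> gvec P (fun j => X (f j)) (fun i j => S (f i) (f j)).
Proof.
move=> gX; have := gvec_lin (fun (j : J) (i : I) => (i == f j)%:R) gX.
by apply: eq_gvec => [j w|i j]; rewrite ?dot_delta ?qform_delta.
Qed.

(** * Sums and powers of trigonometric polynomials *)

Section TrigPolySums.
Context {R : realType} {I : finType}.

Definition tsum {A : Type} (r : seq A) (f : A -> tpoly R I) : tpoly R I :=
  flatten [seq f a | a <- r].

Lemma tev_tsum {A : Type} (r : seq A) (f : A -> tpoly R I) x :
  tev (tsum r f) x = \sum_(a <- r) tev (f a) x.
Proof. by rewrite tev_flatten big_map. Qed.

Lemma tev_tder_tsum {A : Type} (r : seq A) (f : A -> tpoly R I) i x :
  tev (tder i (tsum r f)) x = \sum_(a <- r) tev (tder i (f a)) x.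
Proof. by rewrite tder_flatten tev_flatten big_map big_map. Qed.

Fixpoint tpow (k : nat) (F : tpoly R I) : tpoly R I :=
  if k is k'.+1 then tmul F (tpow k' F) else tcst 1.

Lemma tev_tpow k F x : tev (tpow k F) x = tev F x ^+ k.
Proof. by elim: k => [|k IH] /=; rewrite ?tev_cst ?expr0// tev_mul IH exprS. Qed.

Lemma tev_tder_tpow k F i x :
  tev (tder i (tpow k F)) x = k%:R * tev F x ^+ k.-1 * tev (tder i F) x.
Proof.
elim: k => [|k IH] /=; first by rewrite tev_tder_cst !mul0r.
rewrite tev_tder_mul IH tev_tpow; case: k {IH} => [|k] /=; first by rewrite expr0; ring.
by rewrite [k.+2%:R]mulrS !exprS; ring.
Qed.

(** Substitution of F into a truncated power series. A sine of a trigonometric polynomial is reached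
    as the limit of such substitutions. *)
Definition tpsum (a : nat -> R) (m : nat) (F : tpoly R I) : tpoly R I :=
  tsum (iota 0 m) (fun k => tscale (a k) (tpow k F)).

Lemma tev_tpsum a m F x : tev (tpsum a m F) x = \sum_(0 <= k < m) a k * tev F x ^+ k.
Proof.
by rewrite tev_tsum /index_iota subn0; apply: eq_bigr => k _; rewrite tev_scale tev_tpow.
Qed.

Lemma tev_tder_tpsum a m F i x : tev (tder i (tpsum a m.+1 F)) x =
  (\sum_(0 <= k < m) (a k.+1 * k.+1%:R) * tev F x ^+ k) * tev (tder i F) x.
Proof.
rewrite tev_tder_tsum -[iota 0 m.+1]/(index_iota 0 m.+1) big_nat_recl// tev_tder_scale tev_tder_cst.
rewrite mulr0 add0r mulr_suml; apply: eq_bigr => k _.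
by rewrite tev_tder_scale -/(tpow k.+1 F) tev_tder_tpow; ring.
Qed.

Definition tdelta (a p : R) (i : I) : tpoly R I := [:: (a, fun j => (j == i)%:R, p)].

Lemma tev_tdelta a p i x : tev (tdelta a p i) x = a * cos (x i + p).
Proof. by rewrite /tev big_seq1/= dot_delta. Qed.

Lemma tev_tder_tdelta a p i j x :
  tev (tder j (tdelta a p i)) x = (j == i)%:R * (- a * sin (x i + p)).
Proof. by rewrite /tev big_seq1/= dot_delta addrA cosDpihalf'; ring. Qed.

End TrigPolySums.
Arguments tsum {R I A} r f : simpl never.
Arguments tpsum {R I} a m F : simpl never.
Arguments tdelta {R I} a p i : simpl never.

(** * Taylor series of a sine with phase *)

Section PhasedTaylor.
Context {R : realType}.
Implicit Types (s p y : R).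

(** Taylor coefficients at 0 of y -> sin (s y + p): the k-th derivative of the sine is its shift by
    k quarter periods. *)
Definition sinph_coeff s p (k : nat) : R := s ^+ k / k`!%:R * sin (p + k%:R * (pi / 2)).

Lemma sin_natpihalf (k : nat) : sin (k%:R * (pi / 2)) = (odd k)%:R * (-1) ^+ k.-1./2 :> R.
Proof.
have [n] := ubnP k; elim: n k => // n IH [_|[_|k]]/=; rewrite ?mul0r ?sin0//.
  by rewrite !mul1r sin_pihalf expr0.
rewrite ltnS => kn; rewrite negbK.
have -> : k.+2%:R * (pi / 2) = k%:R * (pi / 2) + pi :> R by rewrite -addn2 natrD; field.
rewrite sinDpi IH; last by rewrite (leq_trans _ kn).
case: k {kn} => [|k]/=; first by rewrite !mul0r oppr0.
by rewrite exprS; ring.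
Qed.

Lemma cos_natpihalf (k : nat) : cos (k%:R * (pi / 2)) = (~~ odd k)%:R * (-1) ^+ k./2 :> R.
Proof.
have [n] := ubnP k; elim: n k => // n IH [_|[_|k]]/=; rewrite ?mul0r ?cos0 ?mul1r//.
  by rewrite cos_pihalf.
rewrite ltnS => kn; rewrite negbK.
have -> : k.+2%:R * (pi / 2) = k%:R * (pi / 2) + pi :> R by rewrite -addn2 natrD; field.
rewrite cosDpi IH; last by rewrite (leq_trans _ kn).
by rewrite exprS; ring.
Qed.

Lemma sinph_coeffE s p y k :
  sinph_coeff s p k * y ^+ k = cos p * sin_coeff (s * y) k + sin p * cos_coeff (s * y) k.
Proof.
rewrite /sinph_coeff sinD sin_natpihalf cos_natpihalf /sin_coeff /cos_coeff /= exprMn.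
have -> : ((-1) ^ k./2 : R) = (-1) ^+ k./2 by [].
ring.
Qed.

Lemma sinph_cvg s p y :
  \sum_(0 <= k < m) sinph_coeff s p k * y ^+ k @[m --> \oo] --> sin (s * y + p).
Proof.
rewrite (_ : (fun m => _) = (fun m => cos p * series (sin_coeff (s * y)) m +
   sin p * series (cos_coeff (s * y)) m)); last first.
  apply/funext => m; rewrite /series/= !mulr_sumr -big_split/=; apply: eq_bigr => k _.
  exact: sinph_coeffE.
rewrite sinD (mulrC (sin (s * y))) (mulrC (cos (s * y))).
have hs : series (sin_coeff (s * y)) @ \oo --> sin (s * y).
  by rewrite unlock; exact: is_cvg_series_sin_coeff.
have hc : series (cos_coeff (s * y)) @ \oo --> cos (s * y).
  by rewrite unlock; exact: is_cvg_series_cos_coeff.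
by apply: cvgD; [exact: (cvgM (cvg_cst _) hs) | exact: (cvgM (cvg_cst _) hc)].
Qed.

Lemma exp_partial_le (x : R) m : 0 <= x -> \sum_(0 <= k < m) x ^+ k / k`!%:R <= expR x.
Proof.
move=> x0.
have h : nondecreasing_seq (series (exp_coeff x)).
  by apply/nondecreasing_series => // n _ _; apply: exp_coeff_ge0.
exact: (nondecreasing_cvgn_le h (is_cvg_series_exp_coeff x) m).
Qed.

Lemma sinph_partial_le s p y m :
  `|\sum_(0 <= k < m) sinph_coeff s p k * y ^+ k| <= expR `|s * y|.
Proof.
apply: le_trans (exp_partial_le m (normr_ge0 _)).
rewrite (le_trans (ler_norm_sum _ _ _))// ler_sum// => k _.
have -> : sinph_coeff s p k * y ^+ k = (s * y) ^+ k / k`!%:R * sin (p + k%:R * (pi / 2)).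
  by rewrite /sinph_coeff exprMn mulrAC; congr (_ * _); rewrite mulrAC.
rewrite normrM normrM normfV normrX [`|k`!%:R|]ger0_norm ?ler0n//.
by rewrite ler_piMr ?divr_ge0 ?exprn_ge0// ler_norml sin_geN1 sin_le1.
Qed.


(** The derivative of the series is s times the series with phase p + pi/2, so the truncated sums
    satisfy the chain rule exactly, with one term fewer. *)
Lemma sinph_coeffS s p k : sinph_coeff s p k.+1 * k.+1%:R = s * sinph_coeff s (p + pi / 2) k.
Proof.
rewrite /sinph_coeff factS natrM exprS.
have -> : p + k.+1%:R * (pi / 2) = p + pi / 2 + k%:R * (pi / 2) by rewrite -addn1 natrD; ring.
have h1 : k.+1%:R != 0 :> R by rewrite pnatr_eq0.
have h2 : k`!%:R != 0 :> R by rewrite pnatr_eq0 -lt0n fact_gt0.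
move: h1 h2; move: (k.+1%:R : R) (k`!%:R : R) => u v h1 h2.
by field; rewrite h1 h2.
Qed.

End PhasedTaylor.

(** * Normal approximation of sums of cosines *)

Section SteinBound.
Context `{T : measurableType d} {R : realType} (P : probability T R).
Variables (I : finType) (X : I -> T -> R) (S : I -> I -> R) (c : I -> R).
Hypothesis gX : gvec P X S.

Definition cosum : tpoly R I := tsum (index_enum I) (fun i => tdelta (c i) 0 i).

Lemma tev_cosum x : tev cosum x = \sum_i c i * cos (x i).
Proof. by rewrite tev_tsum; apply: eq_bigr => i _; rewrite tev_tdelta addr0. Qed.

Lemma tev_tder_cosum j x : tev (tder j cosum) x = - c j * sin (x j).
Proof.
rewrite tev_tder_tsum (bigD1 j)//= [X in _ + X]big1 ?addr0.
  by rewrite tev_tder_tdelta eqxx mul1r addr0.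
by move=> i ij; rewrite tev_tder_tdelta eq_sym (negbTE ij) mul0r.
Qed.

Let sn (k : I + I) : tpoly R (I + I)%type := tdelta 1 (- (pi / 2)) k.

Let tev_sn k x : tev (sn k) x = sin (x k).
Proof. by rewrite tev_tdelta mul1r cosD cosN sinN cos_pihalf sin_pihalf; ring. Qed.

Let tev_tder_sn k j x : tev (tder j (sn k)) x = (j == k)%:R * cos (x k).
Proof. by rewrite tev_tder_tdelta sinD cosN sinN cos_pihalf sin_pihalf; ring. Qed.

(* Averaged over the interpolation time, its expectation given the first copy
   of X is the Stein kernel of [tev cosum X]. *)
Definition steinT : tpoly R (I + I)%type :=
  tsum (index_enum I) (fun i => tsum (index_enum I) (fun j =>
    tscale (S i j * c i * c j) (tmul (sn (inl i)) (sn (inr j))))).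

Lemma tev_steinT z : tev steinT z =
  \sum_i \sum_j S i j * c i * c j * (sin (z (inl i)) * sin (z (inr j))).
Proof.
rewrite tev_tsum; apply: eq_bigr => i _; rewrite tev_tsum; apply: eq_bigr => j _.
by rewrite tev_scale tev_mul !tev_sn.
Qed.

(** Up to the bounded factor [c m * cos], the derivative of [steinT] in one copy is this sum taken
    at the other copy. *)
Definition steinA (m : I) (x : I -> R) : R := \sum_j S m j * c j * sin (x j).

Lemma tev_tder_steinT1 m z : tev (tder (inl m) steinT) z =
  c m * cos (z (inl m)) * steinA m (z \o inr).
Proof.
rewrite tev_tder_tsum (bigD1 m)//= [X in _ + X]big1 ?addr0; last first.
  move=> i im; rewrite tev_tder_tsum big1// => j _.
  rewrite tev_tder_scale tev_tder_mul !tev_tder_sn /=.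
  have /negbTE -> : (inl m != inl i :> I + I) by rewrite eq_sym; apply: contra im => /eqP[->].
  by rewrite !mul0r !(mulr0, addr0, add0r).
rewrite tev_tder_tsum /steinA mulr_sumr; apply: eq_bigr => j _.
rewrite tev_tder_scale tev_tder_mul !tev_tder_sn !tev_sn /= eqxx.
by rewrite /comp/=; ring.
Qed.

Lemma tev_tder_steinT2 m z : tev (tder (inr m) steinT) z =
  c m * cos (z (inr m)) * steinA m (z \o inl).
Proof.
have [_ sS _] := gX.
rewrite tev_tder_tsum /steinA mulr_sumr; apply: eq_bigr => i _.
rewrite tev_tder_tsum (bigD1 m)//= [X in _ + X]big1 ?addr0; last first.
  move=> j jm; rewrite tev_tder_scale tev_tder_mul !tev_tder_sn /=.
  have /negbTE -> : (inr m != inr j :> I + I) by rewrite eq_sym; apply: contra jm => /eqP[->].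
  by rewrite !mul0r !(mulr0, addr0, add0r).
rewrite tev_tder_scale tev_tder_mul !tev_tder_sn !tev_sn /= eqxx (sS m i).
by rewrite /comp/=; ring.
Qed.

(** Each sine has mean 0, so the expectation is a covariance; [gvec_cov_bound] leaves the single
    entry S i j, the derivatives being cosines bounded by 1. *)
Lemma Ex_sinsin i j : `|Ex P (fun w => sin (X i w) * sin (X j w))| <= `|S i j|.
Proof.
have [mX sS _] := gX.
pose F k : tpoly R I := tdelta 1 (- (pi / 2)) k.
have tF k x : tev (F k) x = sin (x k).
  by rewrite tev_tdelta mul1r cosD cosN sinN cos_pihalf sin_pihalf; ring.
have tdF k l x : tev (tder l (F k)) x = (l == k)%:R * cos (x k).
  by rewrite tev_tder_tdelta sinD cosN sinN cos_pihalf sin_pihalf; ring.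
have E0 k : Ex P (fun w => tev (F k) (X^~ w)) = 0.
  by rewrite (Ex_tev _ gX) big_seq1/= cosN cos_pihalf !mulr0.
have := gvec_cov_bound gX (F i) (F j); rewrite !E0 mulr0 subr0.
under [X in `|Ex P X|]eq_fun do rewrite !tF.
move=> /le_trans; apply.
have b k l : sqrtr (Ex P (fun w => tev (tder l (F k)) (X^~ w) ^+ 2)) <= (l == k)%:R.
  rewrite -[leRHS]ger0_norm ?ler0n// -sqrtr_sqr ler_wsqrtr//.
  rewrite -[leRHS](Ex_cst P); apply: Ex_le => [| |w].
  - by apply: bddm_itg; under eq_fun do rewrite expr2; apply: bddmM; exact: bddm_tev.
  - exact: itg_cst.
  - rewrite tdF exprMn ler_piMr ?sqr_ge0//.
rewrite (bigD1 i)//= [X in _ + X]big1 ?addr0.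
  rewrite (bigD1 j)//= [X in _ + X]big1 ?addr0.
    rewrite ler_piMr// mulr_ile1//; rewrite ?sqrtr_ge0//;
    by rewrite (le_trans (b _ _))// eqxx.
  move=> k kj; have := b j k; rewrite (negbTE kj) => h.
  have -> : sqrtr (Ex P (fun w => tev (tder k (F j)) (X^~ w) ^+ 2)) = 0.
    by apply/eqP; rewrite eq_le h sqrtr_ge0.
  by rewrite !mulr0.
move=> k ki; rewrite big1// => l _; have := b i k; rewrite (negbTE ki) => h.
have -> : sqrtr (Ex P (fun w => tev (tder k (F i)) (X^~ w) ^+ 2)) = 0.
  by apply/eqP; rewrite eq_le h sqrtr_ge0.
by rewrite mul0r mulr0.
Qed.


Variables (C rho hs : R).
Hypotheses (C0 : 0 <= C) (rho0 : 0 <= rho) (cC : forall i, `|c i| <= C).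
Hypotheses (rhoS : forall i, \sum_j `|S i j| <= rho) (hsS : \sum_i \sum_j S i j ^+ 2 <= hs).

(** C^2 times this majorizes the second moment of [steinA i]: expand the square and bound each mean
    of a product of sines by an entry of S. *)
Let B (i : I) : R := \sum_j \sum_k `|S i j| * `|S i k| * `|S j k|.

Let B_ge0 i : 0 <= B i.
Proof. by apply: sumr_ge0 => j _; apply: sumr_ge0 => k _; rewrite !mulr_ge0. Qed.

(** By 2 |S i j| |S j k| <= S i j^2 + S j k^2 the triple product splits in two. In each part |S i k|
    is summed over its free index, which gives rho, and the squares give hs. *)
Let sum_B : \sum_i B i <= rho * hs.
Proof.
have [_ sS _] := gX.
have -> : rho * hs = (rho * hs + rho * hs) / 2 by field.
have h i j k : `|S i j| * `|S i k| * `|S j k| <=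
    (`|S i k| * S i j ^+ 2 + `|S i k| * S j k ^+ 2) / 2.
  rewrite -mulrDr mulrAC mulrC -mulrA ler_wpM2l//.
  rewrite -(real_normK (num_real (S i j))) -(real_normK (num_real (S j k))).
  by have := sqr_ge0 (`|S i j| - `|S j k|); nra.
apply: (@le_trans _ _ ((\sum_i \sum_j \sum_k `|S i k| * S i j ^+ 2 +
    \sum_i \sum_j \sum_k `|S i k| * S j k ^+ 2) / 2)).
  rewrite -big_split mulr_suml/=; apply: ler_sum => i _.
  rewrite -big_split mulr_suml/=; apply: ler_sum => j _.
  by rewrite -big_split mulr_suml/=; apply: ler_sum => k _.
rewrite ler_pM2r ?invr_gt0// lerD//.
- apply: (@le_trans _ _ (\sum_i \sum_j rho * S i j ^+ 2)).
    apply: ler_sum => i _; apply: ler_sum => j _.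
    by rewrite -mulr_suml ler_wpM2r ?sqr_ge0.
  under eq_bigr do rewrite -mulr_sumr.
  by rewrite -mulr_sumr ler_wpM2l.
- rewrite exchange_big/=.
  apply: (@le_trans _ _ (\sum_j \sum_k rho * S j k ^+ 2)).
    apply: ler_sum => j _; rewrite exchange_big/=; apply: ler_sum => k _.
    rewrite -mulr_suml ler_wpM2r ?sqr_ge0//.
    by under eq_bigr do rewrite (sS _ k).
  under eq_bigr do rewrite -mulr_sumr.
  by rewrite -mulr_sumr ler_wpM2l.
Qed.

Lemma Ex_steinA i : Ex P (fun w => steinA i (X^~ w) ^+ 2) <= C ^+ 2 * B i.
Proof.
have [mX sS _] := gX.
have bs k l : bddm (fun w => sin (X k w) * sin (X l w)).
  by apply: bddmM; exact: bddm_sin.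
rewrite (_ : (fun w => _) = (fun w => \sum_j \sum_k (S i j * c j * S i k * c k) *
    (sin (X j w) * sin (X k w)))); last first.
  apply/funext => w; rewrite /steinA expr2 mulr_suml; apply: eq_bigr => j _.
  by rewrite mulr_sumr; apply: eq_bigr => k _; ring.
rewrite Ex_sum; last first.
  by move=> j; apply: itg_sum => k; apply: itgZ; exact/bddm_itg/bs.
rewrite /B mulr_sumr; apply: ler_sum => j _.
rewrite Ex_sum; last by move=> k; apply: itgZ; exact/bddm_itg/bs.
rewrite mulr_sumr; apply: ler_sum => k _.
rewrite ExZ; last by exact/bddm_itg/bs.
rewrite (le_trans (ler_norm _))// normrM.
rewrite (_ : `|S i j * c j * S i k * c k| = (`|c j| * `|c k|) * (`|S i j| * `|S i k|)); last first.
  by rewrite !normrM; ring.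
rewrite -[leLHS]mulrA; apply: ler_pM; rewrite ?mulr_ge0//; first by rewrite expr2 ler_pM.
by rewrite ler_wpM2l ?mulr_ge0// Ex_sinsin.
Qed.

Let stA (m : I) : tpoly R I := tsum (index_enum I) (fun j => tdelta (S m j * c j) (- (pi / 2)) j).

Let tev_stA m x : tev (stA m) x = steinA m x.
Proof.
rewrite tev_tsum; apply: eq_bigr => j _.
by rewrite tev_tdelta cosD cosN sinN cos_pihalf sin_pihalf; ring.
Qed.

Let proj (k : I + I) : I := match k with inl i => i | inr i => i end.

Lemma Ex_tder_steinT (t : R) (k : I + I) : 0 <= t <= 1 ->
  sqrtr (Ex (P \x P)%E (fun z => tev (tder k steinT) ((icop X t)^~ z) ^+ 2)) <=
  C ^+ 2 * sqrtr (B (proj k)).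
Proof.
move=> t01; have [mI _ _] := gvec_icop gX t01.
have bF (F : tpoly R (I + I)%type) : bddm (fun z => tev F ((icop X t)^~ z) ^+ 2).
  by under eq_fun do rewrite expr2; apply: bddmM; exact: bddm_tev.
have -> : C ^+ 2 * sqrtr (B (proj k)) = sqrtr (C ^+ 2 * (C ^+ 2 * B (proj k))).
  rewrite mulrA -expr2 sqrtrM ?sqr_ge0// sqrtr_sqr ger0_norm//.
  exact: sqr_ge0.
rewrite ler_wsqrtr//.
apply: (@le_trans _ _ (C ^+ 2 * Ex P (fun w => steinA (proj k) (X^~ w) ^+ 2))); last first.
  by rewrite ler_wpM2l ?sqr_ge0// Ex_steinA.
under [X in _ <= _ * Ex _ X]eq_fun do rewrite -tev_stA.
have key (m : I) (y a : R) : (c m * cos y * a) ^+ 2 <= C ^+ 2 * a ^+ 2.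
  rewrite !exprMn ler_wpM2r ?sqr_ge0// -[leRHS]mulr1 ler_pM ?sqr_ge0//.
  by rewrite -(real_normK (num_real (c m))) lerXn2r ?nnegrE.
case: k => m /=.
- rewrite -(pcorr_sum2 gX (stA m) t01) -ExZ; last first.
    apply: bddm_itg; have := bF (temb2 (stA m)); congr bddm.
    by apply/funext => z; rewrite tev_emb2.
  apply: Ex_le; [exact: bddm_itg | |].
    apply: itgZ; apply: bddm_itg; have := bF (temb2 (stA m)); congr bddm.
    by apply/funext => z; rewrite tev_emb2.
  by move=> z; rewrite tev_tder_steinT1 tev_stA; exact: key.
- rewrite -(pcorr_sum1 gX (stA m) t01) -ExZ; last first.
    apply: bddm_itg; have := bF (temb1 (stA m)); congr bddm.
    by apply/funext => z; rewrite tev_emb1.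
  apply: Ex_le; [exact: bddm_itg | |].
    apply: itgZ; apply: bddm_itg; have := bF (temb1 (stA m)); congr bddm.
    by apply/funext => z; rewrite tev_emb1.
  by move=> z; rewrite tev_tder_steinT2 tev_stA; exact: key.
Qed.

(** Schur test: 2 sqrt (v i v j) <= v i + v j, and by symmetry both rows and columns of |S| sum to
    at most rho. *)
Lemma sum_row_quad (v : I -> R) : (forall i, 0 <= v i) ->
  \sum_i \sum_j `|S i j| * (sqrtr (v i) * sqrtr (v j)) <= rho * \sum_i v i.
Proof.
move=> v0; have [_ sS _] := gX.
have h i j : `|S i j| * (sqrtr (v i) * sqrtr (v j)) <= (`|S i j| * v i + `|S i j| * v j) / 2.
  rewrite -mulrDr -mulrA ler_wpM2l//.
  have := sqr_ge0 (sqrtr (v i) - sqrtr (v j)).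
  rewrite -[X in _ -> _ <= (X + _) / 2](sqr_sqrtr (v0 i)) -[X in _ -> _ <= (_ + X) / 2](sqr_sqrtr (v0 j)).
  nra.
apply: (@le_trans _ _ ((\sum_i \sum_j `|S i j| * v i + \sum_i \sum_j `|S i j| * v j) / 2)).
  rewrite -big_split mulr_suml/=; apply: ler_sum => i _.
  by rewrite -big_split mulr_suml/=; apply: ler_sum => j _.
rewrite [X in _ + X]exchange_big/=.
have -> : \sum_j \sum_i `|S i j| * v j = \sum_i \sum_j `|S i j| * v i.
  by apply: eq_bigr => i _; apply: eq_bigr => j _; rewrite sS.
rewrite -mulr2n -[X in X / 2]mulr_natr mulfK ?pnatr_eq0// mulr_sumr; apply: ler_sum => i _.
by rewrite -mulr_suml ler_wpM2r.
Qed.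

(** The two copies form one Gaussian vector, to which the covariance bound is applied: a second
    interpolation on top of the first. The factor 4 counts the blocks of [icov], each bounded by
    |S|. *)
Lemma var_steinT (t : R) : 0 <= t <= 1 ->
  Ex (P \x P)%E (fun z => tev steinT ((icop X t)^~ z) * tev steinT ((icop X t)^~ z)) -
  Ex (P \x P)%E (fun z => tev steinT ((icop X t)^~ z)) *
  Ex (P \x P)%E (fun z => tev steinT ((icop X t)^~ z)) <= 4 * C ^+ 4 * rho ^+ 2 * hs.
Proof.
move=> t01; have gI := gvec_icop gX t01.
rewrite (le_trans (ler_norm _))// (le_trans (gvec_cov_bound gI _ _))//.
have [t0 t1] := andP t01.
apply: (@le_trans _ _ (\sum_(k : I + I) \sum_(l : I + I) C ^+ 4 *
    (`|S (proj k) (proj l)| * (sqrtr (B (proj k)) * sqrtr (B (proj l)))))).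
  apply: ler_sum => k _; apply: ler_sum => l _.
  have -> : C ^+ 4 * (`|S (proj k) (proj l)| * (sqrtr (B (proj k)) * sqrtr (B (proj l)))) =
    `|S (proj k) (proj l)| * ((C ^+ 2 * sqrtr (B (proj k))) * (C ^+ 2 * sqrtr (B (proj l)))).
    by ring.
  apply: ler_pM; rewrite ?mulr_ge0 ?sqrtr_ge0//; last first.
    by apply: ler_pM; rewrite ?sqrtr_ge0// Ex_tder_steinT.
  by case: k l => i [] j //=; rewrite normrM ger0_norm// ler_piMl.
have -> : \sum_(k : I + I) \sum_(l : I + I) C ^+ 4 *
    (`|S (proj k) (proj l)| * (sqrtr (B (proj k)) * sqrtr (B (proj l)))) =
   4 * C ^+ 4 * \sum_i \sum_j `|S i j| * (sqrtr (B i) * sqrtr (B j)).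
  under eq_bigr do rewrite -mulr_sumr.
  rewrite -mulr_sumr big_sumType/=.
  under eq_bigr do rewrite big_sumType/=.
  by rewrite !big_split/=; ring.
rewrite -[leRHS]mulrA ler_wpM2l ?mulr_ge0 ?exprn_ge0//.
by rewrite (le_trans (sum_row_quad B_ge0))// expr2 -mulrA ler_wpM2l.
Qed.

Let W (w : T) : R := tev cosum (X^~ w).

Lemma pcorr_stein (t s p : R) m : 0 <= t <= 1 ->
  \sum_i \sum_j S i j * pcorr P X t (tder i (tpsum (sinph_coeff s p) m.+1 cosum)) (tder j cosum) =
  Ex (P \x P)%E (fun z => s * tev (tpsum (sinph_coeff s (p + pi / 2)) m cosum) (X^~ z.1) *
     tev steinT ((icop X t)^~ z)).
Proof.
move=> t01; have b1 H := bddm_icop1 gX H t01; have b2 H := bddm_icop2 gX H t01.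
have [mI _ _] := gvec_icop gX t01.
rewrite (_ : (fun z => _) = (fun z => \sum_i \sum_j S i j *
    (tev (tder i (tpsum (sinph_coeff s p) m.+1 cosum)) ((icop X t)^~ z \o inl) *
     tev (tder j cosum) ((icop X t)^~ z \o inr)))); last first.
  apply/funext => z; rewrite tev_steinT mulr_sumr; apply: eq_bigr => i _.
  rewrite mulr_sumr; apply: eq_bigr => j _; rewrite tev_tder_tpsum !tev_tder_cosum tev_tpsum.
  rewrite [s * _]mulr_sumr [in RHS](eq_bigr (fun k => s * (sinph_coeff s (p + pi / 2) k * tev cosum (X^~ z.1) ^+ k))).
    by rewrite /comp/=; ring.
  by move=> k _; rewrite sinph_coeffS mulrA.
rewrite Ex_sum; last first.
  by move=> i; apply: itg_sum => j; apply: itgZ; exact/bddm_itg/bddmM.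
apply: eq_bigr => i _; rewrite Ex_sum; last first.
  by move=> j; apply: itgZ; exact/bddm_itg/bddmM.
by apply: eq_bigr => j _; rewrite ExZ//; exact/bddm_itg/bddmM.
Qed.

(** Let D be the derivative of the test function at the sum. The function of t whose increment is
    estimated has derivative E (D T) - E D * E T, with T the kernel [steinT]; this is E (D (T - E
    T)), and Cauchy-Schwarz separates D from the standard deviation of T. *)
Lemma stein_taylor (s p : R) m :
  `|Ex P (fun w => tev (tpsum (sinph_coeff s p) m.+1 cosum) (X^~ w) * W w) -
    Ex P (fun w => tev (tpsum (sinph_coeff s p) m.+1 cosum) (X^~ w)) * Ex P W -
    Ex P (fun w => s * tev (tpsum (sinph_coeff s (p + pi / 2)) m cosum) (X^~ w)) *
      (Ex P (fun w => W w * W w) - Ex P W * Ex P W)| <=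
  sqrtr (Ex P (fun w => (s * tev (tpsum (sinph_coeff s (p + pi / 2)) m cosum) (X^~ w)) ^+ 2)) *
  sqrtr (4 * C ^+ 4 * rho ^+ 2 * hs).
Proof.
have [mX _ _] := gX.
set F := tpsum (sinph_coeff s p) m.+1 cosum.
set D := tscale s (tpsum (sinph_coeff s (p + pi / 2)) m cosum).
have DE w : s * tev (tpsum (sinph_coeff s (p + pi / 2)) m cosum) (X^~ w) = tev D (X^~ w).
  by rewrite tev_scale.
under [X in _ - Ex P X * (_ - _)]eq_fun do rewrite DE.
under [X in sqrtr (Ex P X)]eq_fun do rewrite DE.
set e := Ex P (fun w => tev D (X^~ w)).
rewrite -(kcorr1 gX) -(kcorr1 gX) -(kcorr0 gX) -(kcorr0 gX).
rewrite (_ : _ - _ = (kcorr S 1 F cosum - e * kcorr S 1 cosum cosum) -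
   (kcorr S 0 F cosum - e * kcorr S 0 cosum cosum)); last by ring.
pose SS (t : R) (F G : tpoly R I) := \sum_i \sum_j S i j * kcorr S t (tder i F) (tder j G).
apply: (@norm_MVT01 _ (fun t => kcorr S t F cosum - e * kcorr S t cosum cosum)
   (fun t => SS t F cosum - e * SS t cosum cosum)).
  move=> t; have h1 := kcorr_derive S t F cosum; have h2 := kcorr_derive S t cosum cosum.
  apply: is_deriveB => //; have := is_deriveZ e h2; exact.
move=> t t01.
have SSE F' G' : SS t F' G' = \sum_i \sum_j S i j * pcorr P X t (tder i F') (tder j G').
  by apply: eq_bigr => i _; apply: eq_bigr => j _; rewrite (pcorrE gX).
rewrite !SSE pcorr_stein//.
have b1 H := bddm_icop1 gX H t01; have b2 H := bddm_icop2 gX H t01.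
have [mI _ _] := gvec_icop gX t01.
have -> : \sum_i \sum_j S i j * pcorr P X t (tder i cosum) (tder j cosum) =
   Ex (P \x P)%E (fun z => tev steinT ((icop X t)^~ z)).
  rewrite (_ : (fun z => _) = (fun z => \sum_i \sum_j S i j *
      (tev (tder i cosum) ((icop X t)^~ z \o inl) *
       tev (tder j cosum) ((icop X t)^~ z \o inr)))); last first.
    apply/funext => z; rewrite tev_steinT; apply: eq_bigr => i _.
    by apply: eq_bigr => j _; rewrite !tev_tder_cosum /comp/=; ring.
  rewrite Ex_sum; last first.
    by move=> i; apply: itg_sum => j; apply: itgZ; exact/bddm_itg/bddmM.
  apply: eq_bigr => i _; rewrite Ex_sum; last first.
    by move=> j; apply: itgZ; exact/bddm_itg/bddmM.
  by apply: eq_bigr => j _; rewrite ExZ//; exact/bddm_itg/bddmM.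
set T' := (fun z : T * T => tev steinT ((icop X t)^~ z)).
pose D' := (fun z : T * T => tev D (X^~ z.1)).
have bT : bddm T' by exact: bddm_tev.
have bD0 : bddm (fun w => tev D (X^~ w)) by exact: bddm_tev.
have bD : bddm D' by exact: (bddm_fst bD0).
have -> : e = Ex (P \x P)%E D' by rewrite /e -(Ex_fst P P bD0).
rewrite (_ : (fun z => _) = (fun z => D' z * T' z)); last first.
  by apply/funext => z; rewrite DE.
set eT := Ex (P \x P)%E T'.
have -> : Ex (P \x P)%E (fun z => D' z * T' z) - Ex (P \x P)%E D' * eT =
    Ex (P \x P)%E (fun z => D' z * (T' z - eT)).
  rewrite mulrC -ExZ; last exact: bddm_itg.
  rewrite -ExB; last 2 first.
  - by exact/bddm_itg/bddmM.
  - by apply: itgZ; exact: bddm_itg.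
  by congr Ex; apply/funext => z; ring.
have bTe : bddm (fun z => T' z - eT) by apply: bddmB => //; exact: bddm_cst.
apply: le_trans (Ex_cauchy_schwarz _ _ _) _.
- by apply: bddm_itg; under eq_fun do rewrite expr2; exact: bddmM.
- by apply: bddm_itg; under eq_fun do rewrite expr2; exact: bddmM.
- by exact/bddm_itg/bddmM.
apply: ler_pM; rewrite ?sqrtr_ge0//.
  rewrite (@Ex_fst _ _ _ _ _ P P (fun w => tev D (X^~ w) ^+ 2))//.
  by under eq_fun do rewrite expr2; exact: bddmM.
rewrite ler_wsqrtr// (le_trans _ (var_steinT t01))// -/T' -/eT.
by rewrite /eT Ex_centered_sqr//; apply: bddm_itg => //; exact: bddmM.
Qed.

Let bW : bddm W.
Proof. by have [mX _ _] := gX; exact: bddm_tev. Qed.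

(** Passage to the limit in the truncation order: W is bounded by some M, so all partial sums are
    dominated by exp (|s| M). *)
Lemma stein_sin (s p : R) :
  `|Ex P (fun w => sin (s * W w + p) * W w) -
    Ex P (fun w => sin (s * W w + p)) * Ex P W -
    Ex P (fun w => s * cos (s * W w + p)) * (Ex P (fun w => W w * W w) - Ex P W * Ex P W)| <=
  `|s| * sqrtr (4 * C ^+ 4 * rho ^+ 2 * hs).
Proof.
have [mX _ _] := gX; have [mW [M WM]] := bW.
have mS q : measurable_fun setT (fun w => sin (s * W w + q)).
  by have [] := @bddm_sin _ T R (fun w => s * W w + q) _;
    first by apply: measurable_funD => //; exact: measurable_funM.
have cF q (Y : T -> R) : bddm Y -> Ex P (fun w => tev (tpsum (sinph_coeff s q) m cosum) (X^~ w) * Y w) @[m --> \oo] -->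
    Ex P (fun w => sin (s * W w + q) * Y w).
  move=> [mY [N YN]].
  apply: (@Ex_dominated _ _ _ _ _ _ (fun=> expR (`|s| * M) * N)).
  - move=> m; apply: measurable_funM => //.
    by have [] := bddm_tev (tpsum (sinph_coeff s q) m cosum) mX.
  - by apply: measurable_funM.
  - move=> w; apply: cvgM; last exact: cvg_cst.
    under eq_fun do rewrite tev_tpsum; exact: sinph_cvg.
  - exact: itg_cst.
  - move=> m w; rewrite normrM; apply: ler_pM => //.
    rewrite tev_tpsum (le_trans (sinph_partial_le _ _ _ _))// ler_expR normrM.
    by apply: ler_wpM2l => //; exact: WM.
have cF1 q : Ex P (fun w => tev (tpsum (sinph_coeff s q) m cosum) (X^~ w)) @[m --> \oo] -->
    Ex P (fun w => sin (s * W w + q)).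
  have := cF q _ (@bddm_cst _ T R 1).
  by under [X in X @ _ --> _ -> _]eq_fun do under [X in Ex P X]eq_fun do rewrite mulr1;
     under [X in _ --> Ex P X -> _]eq_fun do rewrite mulr1.
have sc w : s * sin (s * W w + (p + pi / 2)) = s * cos (s * W w + p).
  by rewrite addrA sinD cos_pihalf sin_pihalf; ring.
have bs q : bddm (fun w => sin (s * W w + q)).
  by split=> //; exists 1 => w; rewrite ler_norml sin_geN1 sin_le1.
have cD : Ex P (fun w => s * tev (tpsum (sinph_coeff s (p + pi / 2)) m cosum) (X^~ w)) @[m --> \oo] -->
    Ex P (fun w => s * cos (s * W w + p)).
  under [X in _ --> Ex P X]eq_fun do rewrite -sc.
  rewrite ExZ; last exact: bddm_itg.
  rewrite (_ : (fun m => _) = (fun m => s * Ex P (fun w => tev (tpsum (sinph_coeff s (p + pi / 2)) m cosum) (X^~ w)))); last first.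
    by apply/funext => m; rewrite ExZ//; exact/bddm_itg/bddm_tev.
  by apply: cvgM; [exact: cvg_cst | exact: cF1].
have cD2 : Ex P (fun w => (s * tev (tpsum (sinph_coeff s (p + pi / 2)) m cosum) (X^~ w)) ^+ 2) @[m --> \oo] -->
    Ex P (fun w => (s * cos (s * W w + p)) ^+ 2).
  under [X in _ --> Ex P X]eq_fun do rewrite -sc.
  apply: (@Ex_dominated _ _ _ _ _ _ (fun=> (`|s| * expR (`|s| * M)) ^+ 2)).
  - move=> m; apply: measurable_funX; apply: measurable_funM => //.
    by have [] := bddm_tev (tpsum (sinph_coeff s (p + pi / 2)) m cosum) mX.
  - by apply: measurable_funX; apply: measurable_funM.
  - move=> w; rewrite expr2; under eq_fun do rewrite expr2.
    have h : s * tev (tpsum (sinph_coeff s (p + pi / 2)) m cosum) (X^~ w) @[m --> \oo] -->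
        s * sin (s * W w + (p + pi / 2)).
      apply: cvgM; first exact: cvg_cst.
      by under eq_fun do rewrite tev_tpsum; exact: sinph_cvg.
    exact: cvgM.
  - exact: itg_cst.
  - move=> m w; rewrite normrX lerXn2r ?nnegrE ?mulr_ge0 ?expR_ge0//.
    rewrite normrM ler_wpM2l// tev_tpsum (le_trans (sinph_partial_le _ _ _ _))// ler_expR normrM.
    by apply: ler_wpM2l => //; exact: WM.
(* The index [m.-1] is there because the derivative has one term fewer; a shift removes it in the
   limit. *)
have L : `|Ex P (fun w => tev (tpsum (sinph_coeff s p) m cosum) (X^~ w) * W w) -
    Ex P (fun w => tev (tpsum (sinph_coeff s p) m cosum) (X^~ w)) * Ex P W -
    Ex P (fun w => s * tev (tpsum (sinph_coeff s (p + pi / 2)) m.-1 cosum) (X^~ w)) *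
      (Ex P (fun w => W w * W w) - Ex P W * Ex P W)| @[m --> \oo] -->
    `|Ex P (fun w => sin (s * W w + p) * W w) -
    Ex P (fun w => sin (s * W w + p)) * Ex P W -
    Ex P (fun w => s * cos (s * W w + p)) * (Ex P (fun w => W w * W w) - Ex P W * Ex P W)|.
  apply: cvg_norm; apply: cvgB.
    by apply: cvgB; [exact: cF | apply: cvgM; [exact: cF1 | exact: cvg_cst]].
  apply: cvgM; last exact: cvg_cst.
  by rewrite -(cvg_shiftS _); exact: cD.
have Rr : sqrtr (Ex P (fun w => (s * tev (tpsum (sinph_coeff s (p + pi / 2)) m.-1 cosum) (X^~ w)) ^+ 2)) *
    sqrtr (4 * C ^+ 4 * rho ^+ 2 * hs) @[m --> \oo] -->
    sqrtr (Ex P (fun w => (s * cos (s * W w + p)) ^+ 2)) * sqrtr (4 * C ^+ 4 * rho ^+ 2 * hs).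
  apply: cvgM; last exact: cvg_cst.
  apply: continuous_cvg; first exact: sqrt_continuous.
  by rewrite -(cvg_shiftS _); exact: cD2.
apply: (@le_trans _ _ (sqrtr (Ex P (fun w => (s * cos (s * W w + p)) ^+ 2)) *
   sqrtr (4 * C ^+ 4 * rho ^+ 2 * hs))).
  apply: (ler_cvg_to L Rr); exists 1%N => // -[//|m] _ /=; exact: stein_taylor.
rewrite ler_wpM2r ?sqrtr_ge0// -sqrtr_sqr ler_wsqrtr// -[leRHS](Ex_cst P).
have bc : bddm (fun w => s * cos (s * W w + p)).
  by under eq_fun do rewrite -sc; apply: bddmZ; exact: bs.
apply: Ex_le; [|exact: itg_cst|].
  by apply: bddm_itg; under eq_fun do rewrite expr2; exact: bddmM.
by move=> w; rewrite exprMn ler_piMr ?sqr_ge0//.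
Qed.

(* If Y is the centred sum and phi s = E cos (s Y + p), then Stein's identity
   gives |phi' s + s V phi s| <= |s| tau, and phi s * exp (s^2 V / 2) is compared
   at 0 and 1. *)
Lemma cosum_clt (p : R) (V := Ex P (fun w => W w * W w) - Ex P W * Ex P W) :
  `|Ex P (fun w => cos ((W w - Ex P W) + p)) - expR (- V / 2) * cos p| <=
  sqrtr (4 * C ^+ 4 * rho ^+ 2 * hs).
Proof.
set tau := sqrtr _.
pose Y w := W w - Ex P W.
have bY : bddm Y by apply: bddmB => //; exact: bddm_cst.
pose phi s := Ex P (fun w => cos (s * Y w + p)).
pose dphi s := Ex P (fun w => - (sin (s * Y w + p) * Y w)).
have V0 : 0 <= V.
  have : 0 <= Ex P (fun w => Y w ^+ 2) by apply: Ex_ge0 => w; exact: sqr_ge0.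
  by rewrite Ex_centered_sqr//; apply: bddm_itg => //; exact: bddmM.
have dphiE s : `|dphi s + s * V * phi s| <= `|s| * tau.
  (* The phase absorbs the centring: s W + (p - s E W) = s (W - E W) + p. *)
  have := stein_sin s (p - s * Ex P W).
  have eqs w : s * W w + (p - s * Ex P W) = s * Y w + p by rewrite /Y; ring.
  rewrite (_ : (fun w => sin _ * W w) = (fun w => sin (s * Y w + p) * W w)); last first.
    by apply/funext => w; rewrite eqs.
  rewrite (_ : (fun w => sin (_ + (p - _))) = (fun w => sin (s * Y w + p))); last first.
    by apply/funext => w; rewrite eqs.
  rewrite (_ : (fun w => s * cos _) = (fun w => s * cos (s * Y w + p))); last first.
    by apply/funext => w; rewrite eqs.
  rewrite -/V.
  have bs : bddm (fun w => sin (s * Y w + p)).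
    by apply: bddm_sin; have [mY _] := bY; apply: measurable_funD => //; exact: measurable_funM.
  have bc : bddm (fun w => cos (s * Y w + p)).
    by apply: bddm_cos; have [mY _] := bY; apply: measurable_funD => //; exact: measurable_funM.
  rewrite ExZ; last exact: bddm_itg.
  rewrite -/(phi s) => h.
  rewrite -normrN (_ : - _ = Ex P (fun w => sin (s * Y w + p) * W w) -
      Ex P (fun w => sin (s * Y w + p)) * Ex P W - s * phi s * V)//.
  rewrite /dphi ExN; last by exact/bddm_itg/bddmM.
  rewrite (_ : (fun w => sin _ * Y w) = (fun w => sin (s * Y w + p) * W w - Ex P W * sin (s * Y w + p))); last first.
    by apply/funext => w; rewrite /Y; ring.
  rewrite ExB ?ExZ; first by ring.
  - exact: bddm_itg.
  - by exact/bddm_itg/bddmM.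
  - by apply: itgZ; exact: bddm_itg.
pose chi s := phi s * expR (s ^+ 2 * V / 2).
have chid (s : R) : is_derive s (1 : R) chi ((dphi s + s * V * phi s) * expR (s ^+ 2 * V / 2)).
  have h := is_derive_Ex_cos p s (bddm_itg P bY); rewrite -/(phi) -/(dphi s) in h.
  by apply: is_derive_eq; rewrite /GRing.scale/=; field.
have := @norm_MVT01 _ chi _ (expR (V / 2) * tau) chid.
rewrite /chi expr1n mul1r expr0n/= mul0r mul0r expR0 mulr1 => key.
have phi0 : phi 0 = cos p.
  by rewrite -[RHS](Ex_cst P); congr Ex; apply/funext => w; rewrite mul0r add0r.
have phi1 : phi 1 = Ex P (fun w => cos ((W w - Ex P W) + p)).
  by congr Ex; apply/funext => w; rewrite mul1r.
rewrite -phi1 mulNr expRN -(ler_pM2l (expR_gt0 (V / 2))).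
rewrite -{1}[expR _]ger0_norm ?expR_ge0// -normrM mulrBr mulrA divff ?gt_eqF ?expR_gt0// mul1r.
rewrite -phi0 mulrC; apply: key => s /andP[s0 s1].
rewrite normrM [leLHS]mulrC ger0_norm ?expR_ge0//.
apply: ler_pM; rewrite ?expR_ge0//.
  by rewrite ler_expR ler_pM2r ?invr_gt0// ler_piMl// expr_le1.
rewrite (le_trans (dphiE s))// ler_piMl ?sqrtr_ge0// ger0_norm//.
Qed.

End SteinBound.
(** * Weierstrass approximation by trigonometric polynomials *)

Section Bernstein.
Context {R : realType}.
Variable p : R.

Definition bern (m k : nat) : R := 'C(m, k)%:R * (p ^+ k * (1 - p) ^+ (m - k)).

(** Mean of h under the binomial law of parameters m and p. The moment identities are polynomial in
    p and hold for every real p. *)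
Definition bernE (m : nat) (h : nat -> R) : R := \sum_(0 <= k < m.+1) bern m k * h k.

(** Conditioning on one trial; Pascal's rule in terms of means. *)
Lemma bernE_rec m h : bernE m.+1 h = (1 - p) * bernE m h + p * bernE m (h \o S).
Proof.
have E1 : p * bernE m (h \o S) = \sum_(0 <= k < m.+1) 'C(m, k)%:R * (p ^+ k.+1 * (1 - p) ^+ (m.+1 - k.+1)) * h k.+1.
  rewrite /bernE mulr_sumr; apply: eq_bigr => k _; rewrite /bern /= subSS exprS; ring.
have E2 : (1 - p) * bernE m h = (1 - p) ^+ m.+1 * h 0%N +
    \sum_(0 <= k < m.+1) 'C(m, k.+1)%:R * (p ^+ k.+1 * (1 - p) ^+ (m.+1 - k.+1)) * h k.+1.
  rewrite big_nat_recr//= bin_small// !mul0r addr0.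
  rewrite /bernE big_nat_recl// mulrDr; congr (_ + _).
    by rewrite /bern bin0 expr0 subn0 exprS; ring.
  rewrite mulr_sumr; apply: eq_big_nat => k /andP[_ km]; rewrite /bern.
  have -> : (m.+1 - k.+1 = (m - k.+1).+1)%N by rewrite subSS subnSK.
  by rewrite [(1 - p) ^+ _.+1]exprS; ring.
rewrite E1 E2 /bernE big_nat_recl//; rewrite -addrA -big_split/=; congr (_ + _).
  by rewrite /bern bin0 expr0 subn0; ring.
by apply: eq_bigr => k _; rewrite /bern binS natrD; ring.
Qed.

Lemma bernE0 h : bernE 0 h = h 0%N.
Proof. by rewrite /bernE big_nat1 /bern bin0 !expr0; ring. Qed.

Lemma bernE_cst m : bernE m (fun=> 1) = 1.
Proof.
elim: m => [|m IH]; first by rewrite bernE0.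
by rewrite bernE_rec (_ : _ \o S = fun=> 1)// IH; ring.
Qed.

Lemma bernED m h g : bernE m (fun k => h k + g k) = bernE m h + bernE m g.
Proof. by rewrite /bernE -big_split/=; apply: eq_bigr => k _; rewrite mulrDr. Qed.

Lemma bernEZ m a h : bernE m (fun k => a * h k) = a * bernE m h.
Proof. by rewrite /bernE mulr_sumr; apply: eq_bigr => k _; ring. Qed.

Lemma bernE_id m : bernE m (fun k => k%:R) = m%:R * p.
Proof.
elim: m => [|m IH]; first by rewrite bernE0 mul0r.
rewrite bernE_rec IH (_ : _ \o _ = (fun k => k%:R + 1)); last first.
  by apply/funext => k; rewrite /= -natr1.
by rewrite bernED IH bernE_cst -natr1; ring.
Qed.

Lemma bernE_sqr m : bernE m (fun k => k%:R ^+ 2) = m%:R * p * (1 - p) + (m%:R * p) ^+ 2.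
Proof.
elim: m => [|m IH]; first by rewrite bernE0; ring.
rewrite bernE_rec IH (_ : _ \o _ = (fun k => k%:R ^+ 2 + (2 * k%:R + 1))); last first.
  by apply/funext => k; rewrite /= -natr1; ring.
by rewrite !bernED bernEZ IH bernE_id bernE_cst -natr1; ring.
Qed.

Lemma bernE_var m : (0 < m)%N -> bernE m (fun k => (k%:R / m%:R - p) ^+ 2) = p * (1 - p) / m%:R.
Proof.
move=> m0; have m1 : m%:R != 0 :> R by rewrite pnatr_eq0 -lt0n.
rewrite (_ : (fun k => _) = (fun k => m%:R ^- 2 * (k%:R ^+ 2 : R) + (- (2 * p / m%:R) * k%:R + p ^+ 2 * 1))); last first.
  by apply/funext => k; field.
by rewrite !bernED !bernEZ bernE_sqr bernE_id bernE_cst; field.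
Qed.

Lemma bern_ge0 m k : 0 <= p <= 1 -> 0 <= bern m k.
Proof.
by move=> /andP[p0 p1]; rewrite mulr_ge0 ?ler0n// mulr_ge0// exprn_ge0// subr_ge0.
Qed.

End Bernstein.

Section Weierstrass.
Context {R : realType} {I : finType}.

Definition tprod {A : Type} (r : seq A) (f : A -> tpoly R I) : tpoly R I :=
  foldr (fun a F => tmul (f a) F) (tcst 1) r.

Lemma tev_tprod {A : Type} (r : seq A) (f : A -> tpoly R I) x :
  tev (tprod r f) x = \prod_(a <- r) tev (f a) x.
Proof.
elim: r => [|a r IH]; first by rewrite big_nil tev_cst.
by rewrite big_cons -IH /= tev_mul.
Qed.

(** Success probability attached to a coordinate. It is itself a trigonometric polynomial, so
    Bernstein polynomials in it are trigonometric polynomials, and on |y| <= A it determines y since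
    the sine is injective on [-pi/2, pi/2]. *)
Let pr (A y : R) : R := (1 + sin (y / A)) / 2.

Let pr01 A y : 0 <= pr A y <= 1.
Proof. by have := sin_geN1 (y / A); have := sin_le1 (y / A); rewrite /pr; lra. Qed.

Let tpr (A : R) (i : I) : tpoly R I :=
  tcst (1 / 2) ++ [:: (1 / 2, (fun j => A^-1 * (j == i)%:R), - (pi / 2))].

Let tev_tpr A i x : tev (tpr A i) x = pr A (x i).
Proof.
rewrite /tpr tev_cat tev_cst /tev big_seq1/= dotZl dot_delta /pr cosD cosN sinN cos_pihalf sin_pihalf.
by rewrite (mulrC A^-1); field.
Qed.

Let tbern (A : R) m (i : I) (k : nat) : tpoly R I :=
  tscale 'C(m, k)%:R (tmul (tpow k (tpr A i)) (tpow (m - k) (tcst 1 ++ tscale (-1) (tpr A i)))).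

Let tev_tbern A m i k x : tev (tbern A m i k) x = bern (pr A (x i)) m k.
Proof.
by rewrite tev_scale tev_mul !tev_tpow tev_cat tev_cst tev_scale !tev_tpr mulN1r.
Qed.

Lemma ler_sin (a b : R) : -(pi / 2) <= a <= pi / 2 -> - (pi / 2) <= b <= pi / 2 ->
  (sin a <= sin b) = (a <= b).
Proof. by move=> ha hb; rewrite !leNgt ltr_sin// in_itv. Qed.

Lemma ler_cos (a b : R) : 0 <= a <= pi -> 0 <= b <= pi -> (cos a <= cos b) = (b <= a).
Proof. by move=> ha hb; rewrite !leNgt ltr_cos// in_itv. Qed.

(** Quantitative injectivity of the sine. After expanding cos (a - b) the claim reads (1 - sin a) (1
    + sin b) <= cos a cos b; squared, it compares (1 - sin a) (1 + sin b) with (1 + sin a) (1 - sin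
    b), and sin b <= sin a. *)
Lemma sinB_ge (a b : R) : - (pi / 2) <= b -> b <= a -> a <= pi / 2 -> 1 - cos (a - b) <= sin a - sin b.
Proof.
move=> hb ba ha.
have ca : 0 <= cos a by apply: cos_ge0_pihalf; rewrite ha (le_trans hb).
have cb : 0 <= cos b by apply: cos_ge0_pihalf; rewrite hb (le_trans ba).
have sab : sin b <= sin a.
  by rewrite ler_sin// ?hb ?ha ?(le_trans hb ba) ?(le_trans ba ha).
have ha2 := cos2Dsin2 a; have hb2 := cos2Dsin2 b.
have s1 := sin_le1 a; have s2 := sin_geN1 b.
rewrite cosB.
suff : (1 - sin a) * (1 + sin b) <= cos a * cos b by lra.
have s3 : 0 <= 1 + sin b by lra.
have s4 : 0 <= 1 - sin a by lra.
rewrite -ler_sqr ?nnegrE ?mulr_ge0//.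
rewrite !exprMn (_ : cos a ^+ 2 = (1 - sin a) * (1 + sin a)); last by nra.
rewrite (_ : cos b ^+ 2 = (1 - sin b) * (1 + sin b)); last by nra.
have h : (1 - sin a) * (1 + sin b) <= (1 + sin a) * (1 - sin b) by nra.
rewrite -subr_ge0 (_ : _ - _ = (1 - sin a) * (1 + sin b) * ((1 + sin a) * (1 - sin b) - (1 - sin a) * (1 + sin b))); last by ring.
by rewrite !mulr_ge0//; lra.
Qed.

Lemma norm_sinB_ge (a b D : R) : -(pi / 2) <= a <= pi / 2 -> - (pi / 2) <= b <= pi / 2 ->
  0 <= D <= pi -> `|sin a - sin b| < 1 - cos D -> `|a - b| <= D.
Proof.
move=> /andP[a1 a2] /andP[b1 b2] /andP[D0 Dpi] h; rewrite leNgt; apply/negP => Dab.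
have : 1 - cos `|a - b| <= `|sin a - sin b|.
  have [ba|ab] := leP b a.
    rewrite ger0_norm ?subr_ge0// ger0_norm; first exact: sinB_ge.
    by rewrite subr_ge0 ler_sin ?a1 ?b1.
  rewrite distrC [leRHS]distrC ger0_norm ?subr_ge0 ?(ltW ab)// ger0_norm.
    by apply: sinB_ge => //; exact: ltW.
  by rewrite subr_ge0 ler_sin ?a1 ?b1 ?(ltW ab).
have : cos `|a - b| <= cos D.
  rewrite ler_cos ?D0 ?normr_ge0 ?(ltW Dab)//=.
  by rewrite ler_norml; apply/andP; split; lra.
by lra.
Qed.

Definition sup_le (L : R) (x : I -> R) : Prop := forall i, `|x i| <= L.

(** Tensorized Bernstein approximation. The value at x is a convex combination of values of f at the
    nodes, whence the bound K on the whole space. The nodes L asin (.) lie in [-L pi/2, L pi/2],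
    which is why continuity is asked on the box of size 2 L. *)
Lemma weierstrass_tpoly (f : (I -> R) -> R) (K L e D : R) :
  (forall x, `|f x| <= K) -> 0 < L -> 0 < e -> 0 < D ->
  (forall x y, sup_le (2 * L) x -> sup_le (2 * L) y -> sup_le D (fun i => x i - y i) ->
     `|f x - f y| <= e) ->
  exists F : tpoly R I, (forall x, `|tev F x| <= K) /\
    forall x, sup_le L x -> `|f x - tev F x| <= 2 * e.
Proof.
move=> fK L0 e0 D0 fu.
have K0 : 0 <= K by rewrite (le_trans _ (fK (fun=> 0))).
pose D' := minr (D / L) 1.
have D'0 : 0 < D' by rewrite lt_min divr_gt0// ltr01.
have D'pi : D' <= pi by rewrite ge_min; apply/orP; right; have := pi_ge2 R; lra.
(* As sin (x / L) = 2 pr - 1, a node whose frequency is within d of pr has its sine within 1 - cos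
   D', hence its angle within D' by [norm_sinB_ge]. *)
pose d := (1 - cos D') / 2.
have d0 : 0 < d.
  rewrite divr_gt0// subr_gt0 -[ltRHS]cos0 ltr_cos ?in_itv/= ?lexx ?pi_ge0//.
  by rewrite (ltW D'0).
(* Chebyshev: a node with some coordinate off by at least d costs at most 2 K, charged to the
   squared deviation over d^2, whose mean is at most 1/(4 m) for each coordinate. *)
pose c := 2 * K * #|I|%:R / d ^+ 2.
have c0 : 0 <= c by rewrite !mulr_ge0// invr_ge0 exprn_ge0// ltW.
pose m := (Num.truncn (c / e)).+1.
have cm : c / m%:R <= e.
  rewrite ler_pdivrMr ?ltr0n// mulrC -ler_pdivrMr//.
  by rewrite ltW// truncnS_gt.
pose y (k : nat) : R := L * asin (2 * (k%:R / m%:R) - 1).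
pose J := {ffun I -> 'I_m.+1}.
pose F := tsum (index_enum J) (fun j => tscale (f (fun i => y (j i)))
   (tprod (index_enum I) (fun i => tbern L m i (j i)))).
pose wt (x : I -> R) (j : J) := \prod_i bern (pr L (x i)) m (j i).
have wt0 x j : 0 <= wt x j by apply: prodr_ge0 => i _; exact: bern_ge0.
have FE x : tev F x = \sum_(j : J) f (fun i => y (j i)) * wt x j.
  rewrite tev_tsum; apply: eq_bigr => j _; rewrite tev_scale tev_tprod.
  by congr (_ * _); apply: eq_bigr => i _; rewrite tev_tbern.
have bE (q : R) h : \sum_(k < m.+1) bern q m k * h (k : nat) = bernE q m h.
  by rewrite /bernE big_mkord.
have sw x : \sum_(j : J) wt x j = 1.
  rewrite -(bigA_distr_bigA (fun i (k : 'I_m.+1) => bern (pr L (x i)) m k)) big1// => i _.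
  by rewrite -(bernE_cst (pr L (x i)) m) -bE; apply: eq_bigr => k _; rewrite mulr1.
have sw2 x i : \sum_(j : J) wt x j * ((j i)%:R / m%:R - pr L (x i)) ^+ 2 <= (4 * m%:R)^-1.
  pose g (i' : I) (k : 'I_m.+1) := bern (pr L (x i')) m k *
    (if i' == i then (k%:R / m%:R - pr L (x i)) ^+ 2 else 1).
  have -> : \sum_(j : J) wt x j * ((j i)%:R / m%:R - pr L (x i)) ^+ 2 = \sum_(j : J) \prod_i' g i' (j i').
    apply: eq_bigr => j _; rewrite /g big_split/=; congr (_ * _).
    by rewrite (bigD1 i)//= eqxx big1 ?mulr1// => i' /negbTE ->.
  rewrite -(bigA_distr_bigA g) (bigD1 i)//= [X in _ * X]big1 ?mulr1; last first.
    move=> i' /negbTE i'i; rewrite /g i'i -[RHS](bernE_cst (pr L (x i')) m) -bE.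
    by apply: eq_bigr => k _.
  rewrite /g eqxx (bE _ (fun k => (k%:R / m%:R - pr L (x i)) ^+ 2)) bernE_var//.
  rewrite invfM ler_pM2r ?invr_gt0 ?ltr0n//.
  by have := sqr_ge0 (pr L (x i) - 1 / 2); lra.
exists F; split=> x.
  rewrite FE (le_trans (ler_norm_sum _ _ _))// -[leRHS]mulr1 -(sw x) mulr_sumr.
  by apply: ler_sum => j _; rewrite normrM (ger0_norm (wt0 x j)) ler_wpM2r.
move=> xL.
have yb k : (k <= m)%N -> - (pi / 2) <= asin (2 * (k%:R / m%:R) - 1 : R) <= pi / 2.
  move=> km; have h : -1 <= (2 * (k%:R / m%:R) - 1 : R) <= 1.
    have : 0 <= (k%:R / m%:R : R) <= 1.
      by rewrite divr_ge0//= ler_pdivrMr ?ltr0n// mul1r ler_nat.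
    lra.
  by rewrite asin_geNpi2// asin_lepi2.
have y2L k : (k <= m)%N -> `|y k| <= 2 * L.
  move=> km; rewrite /y normrM (gtr0_norm L0) mulrC ler_wpM2r ?(ltW L0)//.
  have /andP[h1 h2] := yb _ km; have := pihalf_lt2 R.
  by rewrite ler_norml; lra.
have key (j : J) : `|f x - f (fun i => y (j i))| <= e + \sum_i 2 * K / d ^+ 2 * ((j i)%:R / m%:R - pr L (x i)) ^+ 2.
  have jm i : (j i <= m)%N by rewrite -ltnS.
  have S0 i : 0 <= 2 * K / d ^+ 2 * ((j i)%:R / m%:R - pr L (x i)) ^+ 2.
    by rewrite mulr_ge0 ?sqr_ge0// divr_ge0 ?sqr_ge0// mulr_ge0.
  have [/forallP far|/forallPn[i far]] := boolP [forall i, `|(j i)%:R / m%:R - pr L (x i)| < d].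
    rewrite -[leLHS]addr0 lerD ?sumr_ge0//; apply: fu.
    - by move=> i; have := xL i; lra.
    - by move=> i; exact: y2L.
    - move=> i; have xLi : x i = L * (x i / L) by field; rewrite gt_eqF.
      rewrite {1}xLi /y -mulrBr normrM (gtr0_norm L0) mulrC -ler_pdivlMr//.
      have xi1 : -1 <= x i / L <= 1.
        by rewrite -ler_norml normrM normfV (gtr0_norm L0) ler_pdivrMr// mul1r.
      apply: (@le_trans _ _ D'); last by rewrite ge_min lexx.
      have /andP[xi1' xi1''] := xi1.
      apply: norm_sinB_ge; [| exact: yb | by rewrite (ltW D'0) |].
        by have := pi_ge2 R; move=> ?; apply/andP; split; lra.
      have -> : sin (x i / L) = 2 * pr L (x i) - 1 by rewrite /pr; field.
      have jn : 0 <= ((j i)%:R / m%:R : R) <= 1.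
        by rewrite divr_ge0//= ler_pdivrMr ?ltr0n// mul1r ler_nat.
      rewrite asinK ?in_itv/=; last by move: jn; lra.
      rewrite (_ : _ - _ = - 2 * ((j i)%:R / m%:R - pr L (x i))); last by ring.
      by have := far i; rewrite !ltr_norml /d; lra.
  rewrite -[leLHS]add0r lerD ?(ltW e0)//.
  rewrite (bigD1 i)//= -[leLHS]addr0 lerD ?sumr_ge0//.
  apply: (@le_trans _ _ (2 * K)).
    by rewrite (le_trans (ler_normB _ _))// [leRHS]mulrDl mul1r lerD.
  rewrite -mulrA -[leLHS]mulr1 ler_wpM2l ?mulr_ge0// mulrC ler_pdivlMr ?exprn_gt0// mul1r.
  rewrite -(real_normK (num_real (_ - _))) lerXn2r ?nnegrE ?(ltW d0)//.
  by rewrite leNgt.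
rewrite FE -[X in `|X - _|]mulr1 -(sw x) mulr_sumr -sumrB.
rewrite (le_trans (ler_norm_sum _ _ _))//.
apply: (@le_trans _ _ (\sum_(j : J) (e + \sum_i 2 * K / d ^+ 2 * ((j i)%:R / m%:R - pr L (x i)) ^+ 2) * wt x j)).
  by apply: ler_sum => j _; rewrite -mulrBl normrM (ger0_norm (wt0 x j)) ler_wpM2r.
under [leLHS]eq_bigr do rewrite mulrDl.
rewrite big_split/= -mulr_sumr sw mulr1 [2 * e]mulr_natl mulr2n lerD2l.
under [leLHS]eq_bigr do rewrite mulr_suml.
rewrite exchange_big/=.
apply: (@le_trans _ _ (\sum_(i : I) 2 * K / d ^+ 2 * (4 * m%:R)^-1)).
  apply: ler_sum => i _.
  rewrite (eq_bigr (fun j : J => 2 * K / d ^+ 2 * (wt x j * ((j i)%:R / m%:R - pr L (x i)) ^+ 2))).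
    by rewrite -mulr_sumr ler_wpM2l// divr_ge0 ?sqr_ge0// mulr_ge0.
  by move=> j _; ring.
have -> : \sum_(i : I) 2 * K / d ^+ 2 * (4 * m%:R)^-1 = (2 * K * #|I|%:R / d ^+ 2) / (4 * m%:R).
  rewrite sumr_const -[LHS]mulr_natr cardT -cardE; ring.
apply: le_trans cm; rewrite /c.
rewrite ler_wpM2l// lef_pV2 ?posrE ?mulr_gt0 ?ltr0n//.
by rewrite ler_peMl// ler1n.
Qed.

End Weierstrass.
(** * The standard normal law *)

Section NormalLaw.
Context {R : realType}.
Local Notation mu := (@lebesgue_measure R).

Lemma ge0_integral_normal_prob (m s : R) (f : R -> \bar R) :
  measurable_fun setT f -> (forall x, (0 <= f x)%E) ->
  (\int[normal_prob m s]_x f x = \int[mu]_x (f x * (normal_pdf m s x)%:E))%E.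
Proof.
move=> mf f0.
have dom := normal_prob_dominates m s.
rewrite -(Radon_Nikodym_SigmaFinite.change_of_variables dom)//.
have mN : measurable_fun setT (fun x => (normal_pdf m s x)%:E).
  by apply/measurable_EFinP; exact: measurable_normal_pdf.
have iR := Radon_Nikodym_SigmaFinite.f_integrable dom.
apply: ae_eq_integral => //.
- by apply: emeasurable_funM => //; exact: measurable_int iR.
- exact: emeasurable_funM.
- apply: ae_eqe_mul2l; apply: integral_ae_eq => // E _ mE.
  by rewrite -Radon_Nikodym_SigmaFinite.f_integral.
Qed.

Definition gam : probability (measurableTypeR R) R := normal_prob (0 : R) (1 : R).

Lemma normal_pdf_affine (m s x : R) : 0 < s ->
  normal_pdf m s (m + s * x) * s = normal_pdf 0 1 x.
Proof.
move=> s0; rewrite !normal_pdfE ?gt_eqF ?oner_eq0//.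
rewrite /normal_peak /normal_fun.
rewrite (_ : - (m + s * x - m) ^+ 2 / (s ^+ 2 *+ 2) = - (x - 0) ^+ 2 / (1 ^+ 2 *+ 2)); last first.
  by field; rewrite gt_eqF.
rewrite mulrAC; congr (_ * _).
rewrite expr1n mul1r -mulrnAr sqrtrM ?sqr_ge0// sqrtr_sqr gtr0_norm// invfM.
by rewrite mulrAC mulVf ?mul1r// gt_eqF.
Qed.

Lemma continuous_affine (m s : R) : continuous (fun x : R => m + s * x).
Proof.
move=> x; apply: cvgD; [exact: cvg_cst | apply: cvgM; [exact: cvg_cst | exact: cvg_id]].
Qed.

Lemma derive_affine (m s : R) : derive1 (fun x : R => m + s * x) = cst s.
Proof.
apply/funext => x; rewrite derive1E.
have h : is_derive x (1 : R) (fun x : R => m + s * x) s.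
  by apply: is_derive_eq; rewrite /GRing.scale/=; ring.
by have [_ ->] := h.
Qed.

Lemma cvgNy_affine (m s : R) : 0 < s -> (fun x : R => m + s * x) x @[x --> -oo%R] --> -oo%R.
Proof.
move=> s0; apply/cvgrNyPle => A; near=> x.
suff : s * x <= A - m by lra.
rewrite mulrC -ler_pdivlMr//; near: x; apply: nbhs_ninfty_le; exact: num_real.
Unshelve. all: by end_near. Qed.

Lemma cvgy_affine (m s : R) : 0 < s -> (fun x : R => m + s * x) x @[x --> +oo%R] --> +oo%R.
Proof.
move=> s0; apply/cvgryPge => A; near=> x.
suff : A - m <= s * x by lra.
rewrite mulrC -ler_pdivrMr//; near: x; apply: nbhs_pinfty_ge; exact: num_real.
Unshelve. all: by end_near. Qed.

Lemma ge0_integral_affine (m s : R) (G : R -> R) : 0 < s -> continuous G ->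
  (forall x, 0 <= G x) ->
  (\int[mu]_x (G x)%:E = \int[mu]_x (G (m + s * x) * s)%:E)%E.
Proof.
move=> s0 cG G0.
rewrite (@increasing_ge0_integration_by_substitutionT R (fun x => m + s * x) G)//.
- by rewrite derive_affine.
- by move=> x y xy; rewrite ltrD2l ltr_pM2l.
- by rewrite derive_affine => x; exact: cvg_cst.
- by rewrite derive_affine; exact: is_cvg_cst.
- by rewrite derive_affine; exact: is_cvg_cst.
- apply: cvgNy_affine => //.
- exact: cvgy_affine.
Qed.

Lemma ge0_integral_normal_cont (m s : R) (h : R -> R) : continuous h -> (forall x, 0 <= h x) ->
  (\int[normal_prob m s]_x (h x)%:E = \int[mu]_x (h x * normal_pdf m s x)%:E)%E.
Proof.
move=> ch h0; rewrite (@ge0_integral_normal_prob m s (EFin \o h)).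
- by apply: eq_integral => x _; rewrite -EFinM.
- by apply/measurable_EFinP; exact: continuous_measurable_fun.
- by move=> x; rewrite lee_fin.
Qed.

Lemma ge0_integral_normal_affine (m s : R) (h : R -> R) : 0 < s -> continuous h ->
  (forall x, 0 <= h x) ->
  (\int[normal_prob m s]_x (h x)%:E = \int[gam]_x (h (m + s * x))%:E)%E.
Proof.
move=> s0 ch h0.
have cs : continuous (fun x => h (m + s * x)).
  move=> x; apply: (@continuous_comp _ _ _ (fun x => m + s * x) h); last exact: ch.
  exact: continuous_affine.
rewrite (ge0_integral_normal_cont m s ch h0) /gam (ge0_integral_normal_cont 0 1 cs (fun x => h0 _)).
rewrite (@ge0_integral_affine m s (fun x => h x * normal_pdf m s x))//.
- by apply: eq_integral => x _; rewrite -mulrA normal_pdf_affine.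
- by move=> x; apply: cvgM; [exact: ch | apply: continuous_normal_pdf; rewrite gt_eqF].
- by move=> x; rewrite mulr_ge0// normal_pdf_ge0.
Qed.

(** One-dimensional Cameron-Martin formula: the quotient of the shifted and the original normal
    density is exp (u x - u^2 / 2). *)
Lemma gam_shift_ge0 (u : R) (h : R -> R) : continuous h -> (forall x, 0 <= h x) ->
  (\int[gam]_x (h (x + u))%:E = \int[gam]_x (h x * expR (u * x - u ^+ 2 / 2))%:E)%E.
Proof.
move=> ch h0.
have cs : continuous (fun x => h (x + u)).
  move=> x; apply: (@continuous_comp _ _ _ (fun x => x + u) h); last exact: ch.
  by apply: cvgD; [exact: cvg_id | exact: cvg_cst].
have ce : continuous (fun x : R => expR (u * x - u ^+ 2 / 2)).
  move=> x; apply: (@continuous_comp _ _ _ (fun x => u * x - u ^+ 2 / 2) expR); last exact: continuous_expR.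
  apply: cvgB; last exact: cvg_cst.
  by apply: cvgM; [exact: cvg_cst | exact: cvg_id].
have cg : continuous (fun x => h x * expR (u * x - u ^+ 2 / 2)).
  by move=> x; apply: cvgM; [exact: ch | exact: ce].
have g0 x : 0 <= h x * expR (u * x - u ^+ 2 / 2) by rewrite mulr_ge0// expR_ge0.
rewrite /gam (ge0_integral_normal_cont 0 1 cs (fun x => h0 _)) (ge0_integral_normal_cont 0 1 cg g0).
rewrite [RHS](@ge0_integral_affine u 1 (fun x => h x * expR (u * x - u ^+ 2 / 2) * normal_pdf 0 1 x))//.
- apply: eq_integral => x _; rewrite mul1r mulr1 (addrC u) -mulrA; congr (_ * _)%:E.
  rewrite !normal_pdfE ?oner_eq0// mulrCA; congr (_ * _).
  by rewrite /normal_fun -expRD; congr expR; field.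
- by move=> x; apply: cvgM; [exact: cg | apply: continuous_normal_pdf; rewrite oner_eq0].
- by move=> x; rewrite !mulr_ge0// ?expR_ge0// normal_pdf_ge0.
Qed.

Lemma ge0_itgP {d} {T : measurableType d} (P : probability T R) (X : T -> R) (a : R) :
  measurable_fun setT X -> (forall w, 0 <= X w) -> (\int[P]_w (X w)%:E = a%:E)%E ->
  itg P X /\ Ex P X = a.
Proof.
move=> mX X0 Xa; split; last by rewrite /Ex /Rintegral Xa.
apply/integrableP; split; first exact/measurable_EFinP.
by under eq_integral do rewrite /= ger0_norm//; rewrite Xa ltry.
Qed.

Lemma gam_expR (u : R) : itg gam (fun x => expR (u * x)) /\ Ex gam (fun x => expR (u * x)) = expR (u ^+ 2 / 2).
Proof.
have ce : continuous (fun x : R => expR (u * x)).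
  move=> x; apply: (@continuous_comp _ _ _ (fun x => u * x) expR); last exact: continuous_expR.
  by apply: cvgM; [exact: cvg_cst | exact: cvg_id].
apply: ge0_itgP.
- exact: continuous_measurable_fun.
- by move=> w; exact: expR_ge0.
have := @gam_shift_ge0 u (fun=> expR (u ^+ 2 / 2)) (fun x => @cst_continuous _ _ _ x) (fun=> expR_ge0 _).
rewrite integral_cst//= probability_setT mule1 => ->.
by apply: eq_integral => x _; rewrite -expRD; congr (expR _)%:E; ring.
Qed.

Lemma gam_itg_exp (u : R) : itg gam (fun x => expR (u * `|x|)).
Proof.
have [i1 _] := gam_expR u; have [i2 _] := gam_expR (- u).
apply: (itg_le _ (itgD i1 i2)).
  apply: measurableT_comp => //; apply: measurable_funM => //; exact: measurableT_comp.
move=> x; rewrite ger0_norm ?expR_ge0//.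
have [x0|x0] := leP 0 x.
  by rewrite ger0_norm// lerDl expR_ge0.
by rewrite ltr0_norm// mulNr -mulrN lerDr expR_ge0.
Qed.

Lemma gam_shift (u : R) (h : R -> R) : continuous h -> (exists M, forall x, `|h x| <= M) ->
  itg gam (fun x => h x * expR (u * x - u ^+ 2 / 2)) /\
  Ex gam (fun x => h (x + u)) = Ex gam (fun x => h x * expR (u * x - u ^+ 2 / 2)).
Proof.
move=> ch [M hM].
have M0 : 0 <= M by rewrite (le_trans _ (hM 0)).
have bh : bddm (h : measurableTypeR R -> R) by split; [exact: continuous_measurable_fun | exists M].
have iE : itg gam (fun x => expR (u * x - u ^+ 2 / 2)).
  have [i1 _] := gam_expR u.
  have := itgZ (expR (- (u ^+ 2 / 2))) i1; congr itg.
  by apply/funext => x; rewrite -expRD addrC.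
have i1 : itg gam (fun x => h x * expR (u * x - u ^+ 2 / 2)).
  have := itgM_bdd iE bh; congr itg; apply/funext => x; exact: mulrC.
split => //.
(* The formula is available for nonnegative functions, hence used for h + M; the constant cancels at
   the end because the exponential weight has mean 1. *)
have h1 : forall x, 0 <= h x + M by move=> x; have := hM x; rewrite ler_norml; lra.
have ch1 : continuous (fun x => h x + M) by move=> x; apply: cvgD; [exact: ch | exact: cvg_cst].
have := gam_shift_ge0 u ch1 h1.
have chs : continuous (fun x => h (x + u)).
  move=> x; apply: (@continuous_comp _ _ _ (fun x => x + u) h); last exact: ch.
  by apply: cvgD; [exact: cvg_id | exact: cvg_cst].
have bhs : bddm (fun x : measurableTypeR R => h (x + u)).
  by split; [exact: continuous_measurable_fun | exists M].
move=> /(congr1 fine).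
have -> : fine (\int[gam]_x (h (x + u) + M)%:E)%E = Ex gam (fun x => h (x + u)) + M.
  by rewrite -[X in _ = _ + X](Ex_cst gam) -ExD//; [exact: bddm_itg | exact: itg_cst].
have -> : fine (\int[gam]_x ((h x + M) * expR (u * x - u ^+ 2 / 2))%:E)%E =
    Ex gam (fun x => h x * expR (u * x - u ^+ 2 / 2)) + M.
  rewrite -[LHS]/(Ex gam (fun x => (h x + M) * expR (u * x - u ^+ 2 / 2))).
  rewrite (_ : (fun x => _) = (fun x => h x * expR (u * x - u ^+ 2 / 2) + M * expR (u * x - u ^+ 2 / 2))); last first.
    by apply/funext => x; ring.
  rewrite ExD ?ExZ//; last exact: itgZ.
  congr (_ + _); have [i2 e2] := gam_expR u.
  have -> : Ex gam (fun x => expR (u * x - u ^+ 2 / 2)) = 1; last by rewrite mulr1.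
  rewrite (_ : (fun x => _) = (fun x => expR (- (u ^+ 2 / 2)) * expR (u * x))); last first.
    by apply/funext => x; rewrite -expRD addrC.
  by rewrite ExZ// e2 -expRD addNr expR0.
by move/addIr.
Qed.

End NormalLaw.
Lemma sum_unit {R : realType} (F : unit -> R) : \sum_i F i = F tt.
Proof. by rewrite (bigD1 tt)//= big1 ?addr0// => -[]. Qed.

(** * Characteristic function and moments of the standard normal law *)

Section NormalMoments.
Context {R : realType}.

Lemma measurable_gam_id : measurable_fun setT (fun x : measurableTypeR R => x : R).
Proof. exact: measurable_id. Qed.

Lemma gam_itg_id : itg gam (fun x : R => x).
Proof.
apply: (itg_le _ (gam_itg_exp (1 : R))); first exact: measurable_id.
by move=> x; rewrite mul1r (le_trans _ (expR_ge1Dx _))// lerDr.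
Qed.

Lemma gam_itg_sqr : itg gam (fun x : R => x ^+ 2).
Proof.
apply: (itg_le _ (gam_itg_exp (2 : R))); first exact: measurable_funX.
move=> x; rewrite ger0_norm ?sqr_ge0// mulr_natl mulr2n expRD -(real_normK (num_real x)) expr2.
by apply: ler_pM => //; rewrite (le_trans _ (expR_ge1Dx _))// lerDr.
Qed.

Lemma continuous_cos_affine (l p : R) : continuous (fun x : R => cos (l * x + p)).
Proof.
move=> x; apply: (@continuous_comp _ _ _ (fun x => l * x + p) cos); last exact: continuous_cos.
apply: cvgD; last exact: cvg_cst.
by apply: cvgM; [exact: cvg_cst | exact: cvg_id].
Qed.

(** Gaussian integration by parts, read off by differentiating the Cameron-Martin formula at u = 0:
    on one side the weight is differentiated, on the other cos (l (x + u) + p). *)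
Lemma gam_cos_id (l p : R) :
  Ex gam (fun x => cos (l * x + p) * x) = - l * Ex gam (fun x => sin (l * x + p)).
Proof.
have mc q : measurable_fun setT (fun x : measurableTypeR R => l * x + q).
  by apply: measurable_funD => //; exact: measurable_funM.
have bc q : bddm (fun x : measurableTypeR R => cos (l * x + q)) by exact: bddm_cos.
have bs q : bddm (fun x : measurableTypeR R => sin (l * x + q)) by exact: bddm_sin.
have D1 : is_derive (0 : R) (1 : R)
    (fun u => Ex gam (fun x => cos (l * x + p) * expR (u * x - u ^+ 2 / 2)))
    (Ex gam (fun x => cos (l * x + p) * ((x - 0) * expR (0 * x - 0 ^+ 2 / 2)))).
  apply: (is_derive_Ex (P := gam) (t := 0) (f := fun u x => cos (l * x + p) * expR (u * x - u ^+ 2 / 2))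
    (df := fun u x => cos (l * x + p) * ((x - u) * expR (u * x - u ^+ 2 / 2))) (G := fun x : R => expR (2 * `|x|))).
  - by move=> s w; apply: is_derive_eq; rewrite /GRing.scale/=; field.
  - move=> s; have [|i _] := gam_shift s (@continuous_cos_affine l p); last exact: i.
    by exists 1 => x; rewrite ler_norml cos_geN1 cos_le1.
  - exact: gam_itg_exp.
  - move=> s x; rewrite subr0 => s1; rewrite normrM.
    apply: (@le_trans _ _ `|(x - s) * expR (s * x - s ^+ 2 / 2)|).
      by rewrite ler_piMl// ler_norml cos_geN1 cos_le1.
    rewrite normrM (ger0_norm (expR_ge0 _)).
    have -> : expR (2 * `|x|) = expR `|x| * expR `|x| by rewrite -expRD; congr expR; ring.
    apply: ler_pM => //.
    + rewrite (le_trans (ler_normB _ _))// (le_trans _ (expR_ge1Dx _))// addrC lerD2r ltW//.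
    + rewrite ler_expR; have h : s * x <= `|x|.
        by rewrite (le_trans (ler_norm _))// normrM ler_piMl// ltW.
      by have := sqr_ge0 s; lra.
have D2 : is_derive (0 : R) (1 : R)
    (fun u => cos (l * u) * Ex gam (fun x => cos (l * x + p)) - sin (l * u) * Ex gam (fun x => sin (l * x + p)))
    (- l * Ex gam (fun x => sin (l * x + p))).
  set a := Ex gam _; set b := Ex gam _.
  by apply: is_derive_eq; rewrite /GRing.scale/= !mulr0 sin0 cos0; ring.
have E : (fun u => Ex gam (fun x => cos (l * x + p) * expR (u * x - u ^+ 2 / 2))) =
    (fun u => cos (l * u) * Ex gam (fun x => cos (l * x + p)) - sin (l * u) * Ex gam (fun x => sin (l * x + p))).
  apply/funext => u; have [|_ <-] := gam_shift u (@continuous_cos_affine l p).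
    by exists 1 => x; rewrite ler_norml cos_geN1 cos_le1.
  rewrite -ExZ -?ExZ -?ExB; try by [apply: bddm_itg | apply: itgZ; apply: bddm_itg].
  by congr Ex; apply/funext => x; rewrite (_ : l * (x + u) + p = l * x + p + l * u) ?cosD; ring.
rewrite E in D1; have [_ e1] := D1; have [_ e2] := D2.
rewrite -e2 e1; congr Ex; apply/funext => x.
by rewrite subr0 mul0r expr0n/= mul0r subr0 expR0 mulr1.
Qed.

(** Integration by parts gives phi' = - t phi, so phi(t) exp (t^2 / 2) is constant. *)
Lemma gam_cos (l p : R) : Ex gam (fun x => cos (l * x + p)) = expR (- l ^+ 2 / 2) * cos p.
Proof.
pose phi l := Ex gam (fun x => cos (l * x + p)).
have dphi (t : R) : is_derive t (1 : R) phi (- t * phi t).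
  have := is_derive_Ex_cos p t gam_itg_id.
  have -> : Ex gam (fun x => - (sin (t * x + p) * x)) = - t * phi t => //.
  rewrite (_ : (fun x => _) = (fun x => cos (t * x + (p + pi / 2)) * x)); last first.
    by apply/funext => x; rewrite addrA cosDpihalf mulNr.
  rewrite gam_cos_id; congr (_ * Ex _ _); apply/funext => x.
  by rewrite addrA sinDpihalf.
pose chi t := phi t * expR (t ^+ 2 / 2).
have dchi (t : R) : is_derive t (1 : R) chi 0.
  have h : is_derive t (1 : R) (fun t => expR (t ^+ 2 / 2)) (t * expR (t ^+ 2 / 2)).
    by apply: is_derive_eq; rewrite /GRing.scale/=; field.
  by apply: (is_derive_eq (is_deriveM (dphi t) h)); rewrite /GRing.scale/=; ring.
have c0 : chi l = chi 0.
  apply: is_derive_0_is_cst => t; exact: dchi.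
have phi0 : phi 0 = cos p.
  rewrite -[RHS](Ex_cst gam); congr Ex; apply/funext => x; by rewrite mul0r add0r.
move: c0; rewrite /chi phi0 expr0n/= mul0r expR0 mulr1 => <-.
by rewrite mulrC -mulrA -expRD mulNr subrr expR0 mulr1.
Qed.

Lemma gam_mean : Ex gam (fun x : R => x) = 0.
Proof.
have := gam_cos_id 0 0; rewrite oppr0 mul0r => <-; congr Ex; apply/funext => x.
by rewrite mul0r addr0 cos0 mul1r.
Qed.

(** The second moment is the derivative at 0 of u -> E (x sin (u x)), which integration by parts
    evaluates as u exp (- u^2 / 2). *)
Lemma gam_var : Ex gam (fun x : R => x ^+ 2) = 1.
Proof.
have D1 : is_derive (0 : R) (1 : R)
    (fun u => Ex gam (fun x : R => sin (u * x) * x)) (Ex gam (fun x : R => cos (0 * x) * x ^+ 2)).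
  apply: (is_derive_Ex (P := gam) (t := 0) (f := fun u x => sin (u * x) * x)
    (df := fun u x => cos (u * x) * x ^+ 2) (G := fun x : R => x ^+ 2)).
  - by move=> s w; apply: is_derive_eq; rewrite /GRing.scale/=; ring.
  - move=> s; have h : bddm (fun x : measurableTypeR R => sin (s * x)).
      by apply: bddm_sin; exact: measurable_funM.
    have := itgM_bdd gam_itg_id h; congr itg; apply/funext => x; exact: mulrC.
  - exact: gam_itg_sqr.
  - move=> s x _; rewrite normrM (ger0_norm (sqr_ge0 x)) ler_piMl ?sqr_ge0//.
    by rewrite ler_norml cos_geN1 cos_le1.
have E : (fun u => Ex gam (fun x : R => sin (u * x) * x)) = (fun u => u * expR (- u ^+ 2 / 2)).
  apply/funext => u.
  rewrite (_ : (fun x : R => sin (u * x) * x) = (fun x => cos (u * x - pi / 2) * x)); last first.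
    by apply/funext => x; rewrite cosBpihalf.
  rewrite gam_cos_id (_ : (fun x : R => sin _) = (fun x : R => - cos (u * x + 0))); last first.
    by apply/funext => x; rewrite sinBpihalf addr0.
  rewrite ExN; first by rewrite gam_cos cos0; ring.
  apply: bddm_itg; apply: bddm_cos; apply: measurable_funD => //; exact: measurable_funM.
have D2 : is_derive (0 : R) (1 : R) (fun u => u * expR (- u ^+ 2 / 2)) 1.
  by apply: is_derive_eq; rewrite /GRing.scale/= expr0n/= oppr0 !mul0r expR0; ring.
rewrite E in D1; have [_ e1] := D1; have [_ e2] := D2.
rewrite -e2 e1; congr Ex; apply/funext => x; by rewrite mul0r cos0 mul1r.
Qed.

Lemma gvec_gam : gvec gam (fun (_ : unit) (x : measurableTypeR R) => x) (fun _ _ => 1).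
Proof.
split=> // l.
have dE (x : R) : dot l (fun=> x) = l tt * x by rewrite /dot sum_unit.
have qE : qform (fun _ _ : unit => 1 : R) l l = l tt ^+ 2.
  by rewrite /qform !sum_unit mulr1 expr2.
rewrite qE; split.
- under eq_fun do rewrite dE -[_ * _]addr0.
  by rewrite gam_cos cos0 mulr1.
- under eq_fun do rewrite dE -cosBpihalf.
  by rewrite gam_cos cosN cos_pihalf mulr0.
Qed.

End NormalMoments.
Lemma cvg_derive_seq {R : realType} (f : R -> R) (l : R) :
  is_derive (0 : R) (1 : R) f l ->
  n.+1%:R * (f (n.+1%:R^-1) - f 0) @[n --> \oo] --> l.
Proof.
move=> [df dl]; have := df; rewrite /derivable => /cvg_ex[l' hl'].
have -> : l = l' by rewrite -dl; apply/cvg_lim => //; exact: hl'.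
have hu : (forall n : nat, n.+1%:R^-1 != 0 :> R) /\ n.+1%:R^-1 @[n --> \oo] --> (0 : R).
  by split; [move=> n; rewrite invr_eq0 pnatr_eq0 | exact: cvg_harmonic].
have /cvgr_dnbhsP/(_ _ hu) := hl'.
under eq_fun do rewrite invrK.
have -> // : (fun n : nat => n.+1%:R * (f (n.+1%:R^-1) - f 0)) =
  (fun n : nat => n.+1%:R *: ((f \o shift 0) (n.+1%:R^-1)%:A - f 0)).
by apply/funext => n; rewrite /GRing.scale/= mulr1 addr0.
Qed.

Section SecondMoment.
Context `{T : measurableType d} {R : realType} (P : probability T R).

(** Only the characteristic function is given. The functions 2 a^2 (1 - cos (x / a)) tend to x^2 and
    have mean at most S i i because exp (-z) >= 1 - z; Fatou's lemma then yields integrability and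
    the bound together. *)
Lemma gvec_sqr (I : finType) (X : I -> T -> R) (S : I -> I -> R) (i : I) :
  gvec P X S -> itg P (fun w => X i w ^+ 2) /\ Ex P (fun w => X i w ^+ 2) <= S i i.
Proof.
move=> gX; have [mX _ _] := gX.
pose a (n : nat) : R := n.+1%:R.
have a0 n : 0 < a n by rewrite ltr0n.
pose f (n : nat) w : R := 2 * a n ^+ 2 * (1 - cos ((a n)^-1 * X i w)).
have bf n : bddm (f n).
  apply: bddmZ; apply: bddmB; [exact: bddm_cst | apply: bddm_cos; exact: measurable_funM].
have f0 n w : 0 <= f n w.
  by rewrite mulr_ge0 ?mulr_ge0 ?sqr_ge0// subr_ge0 cos_le1.
have Ef n : Ex P (f n) <= S i i.
  rewrite ExZ; last first.
    apply: bddm_itg; apply: bddmB; [exact: bddm_cst | apply: bddm_cos; exact: measurable_funM].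
  rewrite ExB; last 2 first.
  - exact: itg_cst.
  - by apply: bddm_itg; apply: bddm_cos; exact: measurable_funM.
  rewrite Ex_cst.
  have := Ex_cos_phase (fun j => (a n)^-1 * (j == i)%:R) 0 gX.
  rewrite cos0 mulr1 qformZl qformZr qform_delta.
  under eq_fun do rewrite addr0 dotZl dot_delta.
  move=> ->; have h := expR_ge1Dx (- ((a n)^-1 * ((a n)^-1 * S i i)) / 2).
  have -> : S i i = 2 * a n ^+ 2 * ((a n)^-1 * ((a n)^-1 * S i i) / 2).
    by field; rewrite gt_eqF.
  rewrite ler_wpM2l ?mulr_ge0 ?sqr_ge0//.
  rewrite [in leLHS](_ : 2 * a n ^+ 2 * ((a n)^-1 * ((a n)^-1 * S i i) / 2) = S i i); last first.
    by field; rewrite gt_eqF.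
  move: h; rewrite mulNr; move: (expR _) => E; move: ((a n)^-1 * _) => z; lra.
have S0 : 0 <= S i i by rewrite (le_trans _ (Ef 0%N))// Ex_ge0.
have fX w : f n w @[n --> \oo] --> X i w ^+ 2.
  (* With y = X / (2 a) the function is 4 a^2 sin^2 y, so its limit comes from the derivative of the
     sine at 0. *)
  have D : is_derive (0 : R) (1 : R) (fun h => sin (h * (X i w / 2))) (X i w / 2).
    by apply: is_derive_eq; rewrite /GRing.scale/= mul0r cos0; ring.
  have := cvg_derive_seq D; rewrite mul0r sin0 => h.
  have -> : X i w ^+ 2 = 2 * 2 * (X i w / 2 * (X i w / 2)) by field.
  rewrite (_ : (fun n => _) = (fun n => 2 * 2 * ((a n * (sin ((a n)^-1 * (X i w / 2)) - 0)) * (a n * (sin ((a n)^-1 * (X i w / 2)) - 0))))).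
    by apply: cvgM; [exact: cvg_cst | apply: cvgM].
  apply/funext => n; rewrite /f subr0.
  have -> : (a n)^-1 * X i w = (a n)^-1 * (X i w / 2) + (a n)^-1 * (X i w / 2) by field; rewrite gt_eqF.
  rewrite cosD; set y := (a n)^-1 * (X i w / 2).
  have -> : 1 - (cos y * cos y - sin y * sin y) = 2 * (sin y * sin y) by have := cos2Dsin2 y; rewrite !expr2; lra.
  by ring.
have mX2 : measurable_fun setT (fun w => X i w ^+ 2) by exact: measurable_funX.
have le : (\int[P]_w (X i w ^+ 2)%:E <= (S i i)%:E)%E.
  have mf n : measurable_fun setT (EFin \o f n) by apply/measurable_EFinP; case: (bf n).
  have := @fatou _ _ _ P setT measurableT (fun n => EFin \o f n) mf
    (fun n x _ => (f0 n x : (0 <= (EFin \o f n) x)%E)).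
  have eqX w : limn_einf (fun n => (EFin \o f n) w) = (X i w ^+ 2)%:E.
    have cE : (EFin \o f n) w @[n --> \oo] --> (X i w ^+ 2)%:E.
      by apply: cvg_EFin; [exact: nearW | exact: fX].
    by rewrite is_cvg_limn_einfE; [exact/cvg_lim | apply/cvg_ex; exists (X i w ^+ 2)%:E].
  under eq_integral do rewrite eqX.
  move=> /le_trans; apply; rewrite limn_einf_lim; apply: lime_le; first exact: is_cvg_einfs.
  apply: nearW => n; apply: (@le_trans _ _ (\int[P]_w (f n w)%:E)%E).
    by apply: ereal_inf_lbound; exists n => /=.
  by rewrite -[leLHS]fineK ?lee_fin; [exact: Ef | apply: integrable_fin_num => //; exact: bddm_itg].
split.
  apply/integrableP; split; first exact/measurable_EFinP.
  by under eq_integral do rewrite /= ger0_norm ?sqr_ge0//; exact: le_lt_trans le (ltry _).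
rewrite /Ex /Rintegral -lee_fin fineK// ge0_fin_numE.
  exact: le_lt_trans le (ltry _).
by apply: integral_ge0 => w _; rewrite lee_fin sqr_ge0.
Qed.

End SecondMoment.

(** * Quadratic decorrelation of even functions *)

Section EvenShift.
Context {R : realType}.

(** The left side is sqrt (cosh s - 1), the standard deviation of the weight in [gam_even_shift] at
    s = t^2. It is of order s because cosh s - 1 = exp (-s) (exp s - 1)^2 / 2. *)
Lemma cosh_sub1_le (s : R) : 0 <= s -> s < 1 ->
  sqrtr ((expR s + expR (- s)) / 2 - 1 * 1) <= sqrtr ((3 * s) ^+ 2).
Proof.
move=> s0 s1; apply: ler_wsqrtr.
have e3 : expR s <= 4.
  have e1 := expR_ge1Dx (- (s / 2)); have e2 : expR s * expR (- (s / 2)) ^+ 2 = 1.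
    by rewrite expr2 -!expRD -[RHS]expR0; congr expR; field.
  by have := expR_gt0 s; nra.
have h1 : expR s * expR (- s) = 1 by rewrite -expRD subrr expR0.
have h2 := expR_ge1Dx (- s); have h3 := expR_ge1Dx s.
have h4 : expR s - 1 <= 4 * s by nra.
have h5 := expR_gt0 s; have h6 := expR_gt0 (- s).
have h7 : (expR s - 1) ^+ 2 <= (4 * s) ^+ 2 by rewrite lerXn2r ?nnegrE//; lra.
have h8 : expR (- s) <= 1 by rewrite -expR0 ler_expR; lra.
have h9 : (expR s + expR (- s)) / 2 - 1 * 1 = expR (- s) * (expR s - 1) ^+ 2 / 2.
  have : expR (- s) * (expR s - 1) ^+ 2 = (expR s * expR (- s)) * expR s - 2 * (expR s * expR (- s)) + expR (- s) by ring.
  by rewrite h1; lra.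
rewrite h9 ler_pdivrMr//.
have : expR (- s) * (expR s - 1) ^+ 2 <= 1 * (expR s - 1) ^+ 2 by rewrite ler_wpM2r// sqr_ge0.
by nra.
Qed.

(** Averaging the shifts by t and -t amounts to the weight c, the average of two Cameron-Martin
    densities. It has mean 1 and second moment cosh (t^2), so E |c - 1| is of order t^2 where a
    single shift would give order t. *)
Lemma gam_even_shift (K : R -> R) (t : R) : continuous K -> (forall x, `|K x| <= 1) ->
  `|(Ex gam (fun x => K (x + t)) + Ex gam (fun x => K (x - t))) / 2 - Ex gam K| <= 3 * t ^+ 2.
Proof.
move=> cK K1.
have bs u : bddm (fun x : measurableTypeR R => K (x + u)).
  split; last by exists 1 => x.
  apply: continuous_measurable_fun => x; apply: (@continuous_comp _ _ _ (fun x => x + u) K); last exact: cK.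
  by apply: cvgD; [exact: cvg_id | exact: cvg_cst].
have bK : bddm (K : measurableTypeR R -> R).
  by split; [exact: continuous_measurable_fun | exists 1].
(* For t^2 >= 1 the trivial bound 2 is already below 3 t^2. *)
have [t1|t1] := leP 1 (t ^+ 2).
  apply: (@le_trans _ _ 2); last by lra.
  have [m1 _] := bs t; have [m2 _] := bs (- t); have [m3 _] := bK.
  have h1 := @Ex_bdd _ _ _ gam _ 1 m1 (fun x => K1 _).
  have h2 := @Ex_bdd _ _ _ gam _ 1 m2 (fun x => K1 _).
  have h3 := @Ex_bdd _ _ _ gam _ 1 m3 (fun x => K1 _).
  move: h1 h2 h3; rewrite !ler_norml; lra.
have K1' : exists M, forall x, `|K x| <= M by exists 1.
have [i1 e1] := gam_shift t cK K1'; have [i2 e2] := gam_shift (- t) cK K1'.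
rewrite e1 (_ : Ex gam (fun x => K (x - t)) = Ex gam (fun x => K x * expR (- t * x - (- t) ^+ 2 / 2)))//.
pose c (x : measurableTypeR R) : R := (expR (t * x - t ^+ 2 / 2) + expR (- t * x - (- t) ^+ 2 / 2)) / 2.
have iexp u v : itg gam (fun x : R => expR (u * x + v)).
  have [i _] := gam_expR u; have := itgZ (expR v) i; congr itg; apply/funext => x.
  by rewrite -expRD addrC.
have Eexp u v : Ex gam (fun x : R => expR (u * x + v)) = expR (u ^+ 2 / 2 + v).
  have [i e] := gam_expR u; rewrite expRD -e mulrC -(ExZ _ i); congr Ex; apply/funext => x.
  by rewrite -expRD addrC.
have ic : itg gam c.
  have := itgZ 2^-1 (itgD (iexp t (- (t ^+ 2 / 2))) (iexp (- t) (- ((- t) ^+ 2 / 2)))).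
  by congr itg; apply/funext => x; rewrite mulrC.
have Ec : Ex gam c = 1.
  rewrite (_ : c = fun x => 2^-1 * (expR (t * x - t ^+ 2 / 2) + expR (- t * x - (- t) ^+ 2 / 2))); last first.
    by apply/funext => x; rewrite mulrC.
  rewrite ExZ; last by apply: itgD; exact: iexp.
  by rewrite ExD ?Eexp ?subrr ?expR0; [field | exact: iexp | exact: iexp].
have cc x : c x ^+ 2 = (expR (2 * t * x - t ^+ 2) + expR (- (2 * t) * x - t ^+ 2) + 2 * expR (0 * x - t ^+ 2)) / 4.
  have h1 : expR (t * x - t ^+ 2 / 2) * expR (t * x - t ^+ 2 / 2) = expR (2 * t * x - t ^+ 2) by rewrite -expRD; congr expR; field.
  have h2 : expR (- t * x - (- t) ^+ 2 / 2) * expR (- t * x - (- t) ^+ 2 / 2) = expR (- (2 * t) * x - t ^+ 2) by rewrite -expRD; congr expR; field.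
  have h3 : expR (t * x - t ^+ 2 / 2) * expR (- t * x - (- t) ^+ 2 / 2) = expR (0 * x - t ^+ 2) by rewrite -expRD; congr expR; field.
  by rewrite -h1 -h2 -h3 /c; field.
have icc : itg gam (fun x => c x * c x).
  have := itgZ 4^-1 (itgD (itgD (iexp (2 * t) (- t ^+ 2)) (iexp (- (2 * t)) (- t ^+ 2))) (itgZ 2 (iexp 0 (- t ^+ 2)))).
  by congr itg; apply/funext => x; rewrite -expr2 cc mulrC.
have Ecc : Ex gam (fun x => c x * c x) = (expR (t ^+ 2) + expR (- t ^+ 2)) / 2.
  rewrite (_ : (fun x => _) = fun x => 4^-1 * (expR (2 * t * x - t ^+ 2) + expR (- (2 * t) * x - t ^+ 2) + 2 * expR (0 * x - t ^+ 2))); last first.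
    by apply/funext => x; rewrite -expr2 cc mulrC.
  rewrite ExZ; last by apply: itgD; [apply: itgD; exact: iexp | apply: itgZ; exact: iexp].
  rewrite (ExD (itgD (iexp (2 * t) (- t ^+ 2)) (iexp (- (2 * t)) (- t ^+ 2))) (itgZ 2 (iexp 0 (- t ^+ 2)))).
  rewrite ExD ?ExZ ?Eexp; try exact: iexp.
  rewrite (_ : (2 * t) ^+ 2 / 2 - t ^+ 2 = t ^+ 2); last by field.
  rewrite (_ : (- (2 * t)) ^+ 2 / 2 - t ^+ 2 = t ^+ 2); last by field.
  by rewrite expr0n/= mul0r add0r; field.
have iKc : itg gam (fun x => K x * (c x - 1)).
  have := itgM_bdd (itgB ic (itg_cst gam 1)) bK; congr itg; apply/funext => x; exact: mulrC.
have -> : (Ex gam (fun x => K x * expR (t * x - t ^+ 2 / 2)) + Ex gam (fun x => K x * expR (- t * x - (- t) ^+ 2 / 2))) / 2 - Ex gam K =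
    Ex gam (fun x => K x * (c x - 1)).
  rewrite (_ : (fun x => K x * (c x - 1)) = (fun x => 2^-1 * (K x * expR (t * x - t ^+ 2 / 2) + K x * expR (- t * x - (- t) ^+ 2 / 2)) - K x)); last first.
    by apply/funext => x; rewrite /c; field.
  rewrite (ExB (itgZ 2^-1 (itgD i1 i2)) (bddm_itg gam bK)) (ExZ _ (itgD i1 i2)) (ExD i1 i2).
  by rewrite mulrC.
rewrite (le_trans (Ex_norm iKc))//.
have ic1 := itgB ic (itg_cst gam (1 : R)).
apply: (@le_trans _ _ (Ex gam (fun x => `|c x - 1|))).
  apply: Ex_le; [exact: itg_norm | exact: itg_norm|] => x.
  by rewrite normrM ler_piMl.
have icc1 : itg gam (fun x => (c x - 1) ^+ 2).
  have := itgB icc (itgB (itgZ 2 ic) (itg_cst gam 1)); congr itg; apply/funext => x; ring.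
rewrite (le_trans (Ex_norm_le_sqrt ic1 icc1))//.
have := Ex_centered_sqr ic icc; rewrite Ec Ecc => ->.
have -> : 3 * t ^+ 2 = sqrtr ((3 * t ^+ 2) ^+ 2).
  by rewrite sqrtr_sqr ger0_norm// mulr_ge0// sqr_ge0.
exact: cosh_sub1_le (sqr_ge0 t) t1.
Qed.

End EvenShift.

Section Decorrelation.
Context `{T : measurableType d} {R : realType} (P : probability T R).

Definition tlin {I J : finType} (A : J -> I -> R) (F : tpoly R J) : tpoly R I :=
  [seq (t.1.1, (fun i => \sum_j t.1.2 j * A j i), t.2) | t <- F].

Lemma tev_tlin {I J : finType} (A : J -> I -> R) (F : tpoly R J) x :
  tev (tlin A F) x = tev F (fun j => dot (A j) x).
Proof.
rewrite /tev big_map; apply: eq_bigr => t _ /=; congr (_ * cos (_ + _)).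
rewrite /dot; under eq_bigr do rewrite mulr_suml.
rewrite exchange_big/=; apply: eq_bigr => j _; rewrite mulr_sumr.
by apply: eq_bigr => i _; rewrite mulrA.
Qed.

(* Only even terms: no phases. *)
Definition teven {I : finType} (F : tpoly R I) : bool := all (fun t => t.2 == 0) F.

Lemma teven_tlin {I J : finType} (A : J -> I -> R) (F : tpoly R J) : teven F -> teven (tlin A F).
Proof. by rewrite /teven all_map. Qed.

Lemma tev_even {I : finType} (F : tpoly R I) x : teven F ->
  tev F x = \sum_(t <- F) t.1.1 * cos (dot t.1.2 x).
Proof.
by move=> /allP eF; apply: eq_big_seq => t tF; rewrite (eqP (eF t tF)) addr0.
Qed.

Variables (X Y : bool -> T -> R) (C : bool -> bool -> R) (r : R).

Let Z (k : bool + bool) : T -> R := match k with inl a => X a | inr b => Y b end.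
Let S (k k' : bool + bool) : R := match k, k' with
  | inl a, inl b => (a == b)%:R | inr a, inr b => (a == b)%:R
  | inl a, inr b => C b a | inr b, inl a => C b a end.

Hypotheses (gZ : gvec P Z S) (Cr : forall a b, `|C a b| <= r) (r4 : r <= 1 / 4).

Let sb (f : bool -> R) : \sum_b f b = f true + f false.
Proof. by rewrite big_bool. Qed.

Let gX : gvec P X (fun a b => (a == b)%:R) := gvec_sub inl gZ.

Let n2 (m : bool -> R) : R := m true ^+ 2 + m false ^+ 2.
Let Ct (m : bool -> R) (a : bool) : R := m true * C true a + m false * C false a.

(* Conditional expectation of a trigonometric polynomial in Y given X. *)
Definition tcond (G : tpoly R bool) : tpoly R bool :=
  [seq (t.1.1 * expR (- (n2 t.1.2 - n2 (Ct t.1.2)) / 2), Ct t.1.2, t.2) | t <- G].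

(** Both sides are finite sums of exponentials that agree term by term, so no conditional law has to
    be constructed. *)
Lemma Ex_tcond (F G : tpoly R bool) :
  Ex P (fun w => tev F (X^~ w) * tev G (Y^~ w)) =
  Ex P (fun w => tev F (X^~ w) * tev (tcond G) (X^~ w)).
Proof.
rewrite (_ : (fun w => tev F (X^~ w) * tev G (Y^~ w)) =
   (fun w => tev (tmul (temb1 F) (temb2 G)) (Z^~ w))); last first.
  by apply/funext => w; rewrite tev_mul tev_emb1 tev_emb2.
rewrite (_ : (fun w => tev F (X^~ w) * tev (tcond G) (X^~ w)) =
   (fun w => tev (tmul F (tcond G)) (X^~ w))); last first.
  by apply/funext => w; rewrite tev_mul.
rewrite (Ex_tev _ gZ) big_flatten/= big_allpairs_dep big_map/=.
rewrite [RHS](Ex_tev _ gX) [RHS]big_flatten/= [RHS]big_allpairs_dep/=; apply: eq_bigr => s _.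
rewrite !big_map; apply: eq_bigr => t _; rewrite /tmul1 !big_cons !big_nil !addr0/=.
have q1 (l : bool -> R) : qform (fun a b : bool => (a == b)%:R) l l = n2 l.
  by rewrite /qform !sb /= /n2; ring.
have q2 (m : bool + bool -> R) : qform S m m =
    n2 (m \o inl) + n2 (m \o inr) + 2 * (m (inl true) * Ct (m \o inr) true + m (inl false) * Ct (m \o inr) false).
  by rewrite /qform big_sumType/= !sb !big_sumType/= !sb /= /n2 /Ct /=; ring.
rewrite !q1 !q2.
have h (a b c u v w : R) : u = v + w -> a * b / 2 * (expR u * c) = a * (b * expR v) / 2 * (expR w * c).
  by move=> ->; rewrite expRD; ring.
by congr (_ + _); apply: h; rewrite /n2 /Ct /=; field.
Qed.

(** Given X = x, Y is Gaussian with mean y = C x and a covariance independent of x and close to the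
    identity. In coordinates where the mean moves along one standard normal variable, by a length
    whose square is of order r^2 |x|^2, the other variable is integrated out and [gam_even_shift]
    applies: evenness of G makes the shifts by y and -y equivalent. *)
Lemma tcond_lip (G : tpoly R bool) (x : bool -> R) : teven G -> (forall y, `|tev G y| <= 1) ->
  `|tev (tcond G) x - tev (tcond G) (fun=> 0)| <= 3 * (6 * r ^+ 2 * n2 x).
Proof.
move=> eG G1.
have r0 : 0 <= r by rewrite (le_trans _ (Cr true true)).
pose y b := C b true * x true + C b false * x false.
have dotC (m : bool -> R) : dot (Ct m) x = m true * y true + m false * y false.
  by rewrite /dot sb /Ct /y; ring.
have tE : tev (tcond G) x = \sum_(t <- G) t.1.1 * expR (- (n2 t.1.2 - n2 (Ct t.1.2)) / 2) *
    cos (t.1.2 true * y true + t.1.2 false * y false).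
  rewrite /tev big_map; apply: eq_big_seq => t tG /=.
  by rewrite dotC (eqP (allP eG t tG)) addr0.
have t0E : tev (tcond G) (fun=> 0) = \sum_(t <- G) t.1.1 * expR (- (n2 t.1.2 - n2 (Ct t.1.2)) / 2).
  rewrite /tev big_map; apply: eq_big_seq => t tG /=.
  rewrite (eqP (allP eG t tG)) addr0 (_ : dot _ _ = 0) ?cos0 ?mulr1//.
  by rewrite /dot sb !mulr0 addr0.
(* the covariance of Y given X *)
pose A := 1 - n2 (C true); pose D := 1 - n2 (C false).
pose B := - (C true true * C false true + C true false * C false false).
have Cb a b : - (1 / 4) <= C a b <= 1 / 4.
  by rewrite -ler_norml (le_trans (Cr a b)).
have q a b : C a b ^+ 2 <= 1 / 16 by have /andP[] := Cb a b; nra.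
have hA : 7 / 8 <= A <= 1.
  have := q true true; have := q true false; have := sqr_ge0 (C true true); have := sqr_ge0 (C true false).
  by rewrite /A /n2; lra.
have hD : 7 / 8 <= D <= 1.
  have := q false true; have := q false false; have := sqr_ge0 (C false true); have := sqr_ge0 (C false false).
  by rewrite /D /n2; lra.
have hB : - (1 / 8) <= B <= 1 / 8.
  have := q false true; have := q false false; have := q true true; have := q true false.
  have := sqr_ge0 (C false true - C true true); have := sqr_ge0 (C false true + C true true).
  have := sqr_ge0 (C false false - C true false); have := sqr_ge0 (C false false + C true false).
  by rewrite /B; nra.
pose De := A * D - B ^+ 2.
have hDe : 3 / 4 <= De by rewrite /De; nra.
(* Squared Mahalanobis length of y for the conditional covariance with entries A, B, D and
   determinant De. *)
pose t2 := (D * y true ^+ 2 - 2 * B * y true * y false + A * y false ^+ 2) / De.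
have t2y : t2 <= 3 / 2 * (y true ^+ 2 + y false ^+ 2).
  rewrite /t2 ler_pdivrMr; last by lra.
  have := sqr_ge0 (y true - y false); have := sqr_ge0 (y true + y false).
  have := sqr_ge0 (y true); have := sqr_ge0 (y false).
  move: (y true) (y false) => u v; nra.
have yr b : y b ^+ 2 <= 2 * r ^+ 2 * n2 x.
  have h : (C b true * x true) ^+ 2 <= r ^+ 2 * x true ^+ 2.
    rewrite exprMn ler_wpM2r ?sqr_ge0// -(real_normK (num_real (C b true))) lerXn2r ?nnegrE//.
  have h' : (C b false * x false) ^+ 2 <= r ^+ 2 * x false ^+ 2.
    rewrite exprMn ler_wpM2r ?sqr_ge0// -(real_normK (num_real (C b false))) lerXn2r ?nnegrE//.
  have := sqr_ge0 (C b true * x true - C b false * x false).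
  by rewrite /y /n2; nra.
have t2r : t2 <= 6 * r ^+ 2 * n2 x by have := yr true; have := yr false; lra.
have n20 : 0 <= n2 x by rewrite addr_ge0 ?sqr_ge0.
have [y0|yn0] := boolP ((y true == 0) && (y false == 0)).
  have /andP[/eqP y1 /eqP y2] := y0.
  rewrite tE t0E y1 y2 (eq_bigr (fun t => t.1.1 * expR (- (n2 t.1.2 - n2 (Ct t.1.2)) / 2))).
    by rewrite subrr normr0 !mulr_ge0// sqr_ge0.
  by move=> t _; rewrite !mulr0 addr0 cos0 mulr1.
have t2p : 0 < t2.
  rewrite divr_gt0//; last by lra.
  have : 0 < y true ^+ 2 + y false ^+ 2.
    by rewrite lt_def addr_ge0 ?sqr_ge0// paddr_eq0 ?sqr_ge0// !sqrf_eq0 yn0.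
  have := sqr_ge0 (y true - y false); have := sqr_ge0 (y true + y false).
  have := sqr_ge0 (y true); have := sqr_ge0 (y false).
  by move: (y true) (y false) => u v; nra.
pose ta := sqrtr t2.
have ta0 : 0 < ta by rewrite sqrtr_gt0.
have ta2 : ta ^+ 2 = t2 by rewrite sqr_sqrtr// ltW.
(* The vectors n and n' satisfy n n^T + n' n'^T = conditional covariance (this is [key] below), with
   n parallel to y and y = ta n; so n z + n' e, with z and e independent standard normal, has the
   conditional covariance. *)
pose n b := y b / ta.
pose c := (sqrtr De * ta)^-1.
pose n' b := if b then c * (B * y true - A * y false) else c * (D * y true - B * y false).
have c2 : c ^+ 2 = (De * t2)^-1.
  rewrite /c exprVn exprMn ta2 sqr_sqrtr//; lra.
pose K z := Ex gam (fun e : R => tev G (fun b => n b * z + n' b * e)).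
have mc (a b : R) : measurable_fun setT (fun e : measurableTypeR R => a + b * e).
  by apply: measurable_funD => //; exact: measurable_funM.
have bG z : bddm (fun e : measurableTypeR R => tev G (fun b => n b * z + n' b * e)).
  by apply: bddm_tev => b; exact: mc.
have bcos (a b : R) : bddm (fun e : measurableTypeR R => cos (a * e + b)).
  by apply: bddm_cos; apply: measurable_funD => //; exact: measurable_funM.
have KE z : K z = \sum_(t <- G) t.1.1 * (expR (- (t.1.2 true * n' true + t.1.2 false * n' false) ^+ 2 / 2) *
    cos ((t.1.2 true * n true + t.1.2 false * n false) * z)).
  rewrite /K (_ : (fun e => _) = (fun e => \sum_(t <- G) t.1.1 *
     cos ((t.1.2 true * n' true + t.1.2 false * n' false) * e + (t.1.2 true * n true + t.1.2 false * n false) * z))); last first.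
    apply/funext => e; rewrite tev_even//; apply: eq_bigr => t _; congr (_ * cos _).
    by rewrite /dot sb; ring.
  rewrite Ex_sum; last by move=> t; apply: itgZ; exact/bddm_itg/bcos.
  apply: eq_bigr => t _; rewrite ExZ; last by exact/bddm_itg/bcos.
  by rewrite gam_cos.
have K1 z : `|K z| <= 1 by apply: Ex_bdd => //; have [] := bG z.
have cK : continuous K.
  move=> z; rewrite (_ : K = (fun z => \sum_(t <- G) t.1.1 * (expR (- (t.1.2 true * n' true + t.1.2 false * n' false) ^+ 2 / 2) *
    cos ((t.1.2 true * n true + t.1.2 false * n false) * z)))); last by apply/funext.
  elim: G {eG G1 tE t0E K bG KE K1} => [|t G IH].
    by under eq_fun do rewrite big_nil; exact: cvg_cst.
  under eq_fun do rewrite big_cons.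
  apply: cvgD; last exact: IH.
  apply: cvgM; first exact: cvg_cst.
  apply: cvgM; first exact: cvg_cst.
  by have := @continuous_cos_affine R (t.1.2 true * n true + t.1.2 false * n false) 0 z;
    under eq_fun do rewrite addr0.
have key (m1 m2 : R) : (m1 * n true + m2 * n false) ^+ 2 + (m1 * n' true + m2 * n' false) ^+ 2 =
    m1 ^+ 2 * A + 2 * B * m1 * m2 + m2 ^+ 2 * D.
  pose N := D * y true ^+ 2 - 2 * B * y true * y false + A * y false ^+ 2.
  have De0 : De != 0 by rewrite gt_eqF//; lra.
  have t2N : t2 = N / De by [].
  have N0 : N != 0 by move: t2p; rewrite t2N; apply: contraTneq => ->; rewrite mul0r ltxx.
  have -> : (m1 * n true + m2 * n false) ^+ 2 = (m1 * y true + m2 * y false) ^+ 2 * De / N.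
    rewrite /n (_ : m1 * (y true / ta) + m2 * (y false / ta) = (m1 * y true + m2 * y false) / ta); last by ring.
    by rewrite exprMn exprVn ta2 t2N invfM invrK; ring.
  have -> : (m1 * n' true + m2 * n' false) ^+ 2 = (m1 * (B * y true - A * y false) + m2 * (D * y true - B * y false)) ^+ 2 / N.
    rewrite /n' (_ : m1 * (c * _) + m2 * (c * _) = c * (m1 * (B * y true - A * y false) + m2 * (D * y true - B * y false))); last by ring.
    by rewrite exprMn c2 t2N (_ : De * (N / De) = N) 1?mulrC//; field.
  rewrite -mulrDl; apply: (canLR (mulfK N0)).
  by rewrite /N /De; ring.
have Kshift u : Ex gam (fun e => K (e + u)) = \sum_(t <- G) t.1.1 * expR (- (n2 t.1.2 - n2 (Ct t.1.2)) / 2) *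
    cos ((t.1.2 true * n true + t.1.2 false * n false) * u).
  rewrite (_ : (fun e => K _) = (fun e => \sum_(t <- G) t.1.1 * expR (- (t.1.2 true * n' true + t.1.2 false * n' false) ^+ 2 / 2) *
    cos ((t.1.2 true * n true + t.1.2 false * n false) * e + (t.1.2 true * n true + t.1.2 false * n false) * u))); last first.
    by apply/funext => e; rewrite KE; apply: eq_bigr => t _; rewrite mulrA mulrDr.
  rewrite Ex_sum; last by move=> t; apply: itgZ; exact/bddm_itg/bcos.
  apply: eq_bigr => t _; rewrite ExZ; last by exact/bddm_itg/bcos.
  rewrite gam_cos -!mulrA; congr (_ * _); rewrite mulrA -expRD; congr (expR _ * _).
  have := key (t.1.2 true) (t.1.2 false); rewrite /A /B /D /n2 /Ct => k; lra.
have := gam_even_shift ta cK K1.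
rewrite Kshift Kshift.
have -> : Ex gam K = tev (tcond G) (fun=> 0).
  rewrite t0E -[Ex gam K]/(Ex gam (fun e => K e)); under eq_fun do rewrite -[X in K X]addr0.
  by rewrite Kshift; apply: eq_bigr => t _; rewrite mulr0 cos0 mulr1.
rewrite -big_split mulr_suml/= (eq_bigr (fun t => t.1.1 * expR (- (n2 t.1.2 - n2 (Ct t.1.2)) / 2) *
    cos (t.1.2 true * y true + t.1.2 false * y false))); last first.
  (* Evenness enters here: without phases the shifts by ta and - ta give the same value. *)
  move=> t _; rewrite mulrN cosN.
  have -> : (t.1.2 true * n true + t.1.2 false * n false) * ta = t.1.2 true * y true + t.1.2 false * y false.
    by rewrite /n; field; rewrite gt_eqF.
  by field.
rewrite -tE ta2 => /le_trans; apply; lra.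
Qed.

(* Gebelein: for even G the conditional expectation of G(Y) given X deviates
   from its mean by O(r^2), the term of first order in r being odd. *)
Lemma decorrelation_white (F G : tpoly R bool) : teven G ->
  (forall y, `|tev F y| <= 1) -> (forall y, `|tev G y| <= 1) ->
  `|Ex P (fun w => tev F (X^~ w) * tev G (Y^~ w)) -
    Ex P (fun w => tev F (X^~ w)) * Ex P (fun w => tev G (Y^~ w))| <= 72 * r ^+ 2.
Proof.
move=> eG F1 G1; rewrite Ex_tcond.
have [mX _ _] := gX.
have -> : Ex P (fun w => tev G (Y^~ w)) = Ex P (fun w => tev (tcond G) (X^~ w)).
  have := Ex_tcond (tcst 1) G.
  under eq_fun do rewrite tev_cst mul1r.
  by under [X in _ = Ex P X -> _]eq_fun do rewrite tev_cst mul1r.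
have bF : bddm (fun w => tev F (X^~ w)) by exact: bddm_tev.
have bH : bddm (fun w => tev (tcond G) (X^~ w)) by exact: bddm_tev.
set h0 := tev (tcond G) (fun=> 0).
pose D w := tev (tcond G) (X^~ w) - h0.
have bD : bddm D by apply: bddmB => //; exact: bddm_cst.
have ED : Ex P (fun w => `|D w|) <= 36 * r ^+ 2.
  have [i1 e1] := gvec_sqr true gX; have [i2 e2] := gvec_sqr false gX.
  apply: (@le_trans _ _ (Ex P (fun w => 18 * r ^+ 2 * (X true w ^+ 2 + X false w ^+ 2)))).
    apply: Ex_le.
    - by apply: itg_norm; exact: bddm_itg.
    - by apply: itgZ; exact: itgD.
    - by move=> w; rewrite (le_trans (tcond_lip _ eG G1))//; rewrite /n2; lra.
  rewrite ExZ ?ExD//; last exact: itgD.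
  have e1' : Ex P (fun w => X true w ^+ 2) <= 1 := e1.
  have e2' : Ex P (fun w => X false w ^+ 2) <= 1 := e2.
  by have := sqr_ge0 r; nra.
have -> : Ex P (fun w => tev F (X^~ w) * tev (tcond G) (X^~ w)) -
    Ex P (fun w => tev F (X^~ w)) * Ex P (fun w => tev (tcond G) (X^~ w)) =
    Ex P (fun w => tev F (X^~ w) * D w) - Ex P (fun w => tev F (X^~ w)) * Ex P D.
  rewrite /D (ExB (bddm_itg P bH) (itg_cst P h0)) Ex_cst.
  rewrite (_ : (fun w => _ * (_ - h0)) = (fun w => tev F (X^~ w) * tev (tcond G) (X^~ w) - h0 * tev F (X^~ w))); last first.
    by apply/funext => w; ring.
  rewrite (ExB (bddm_itg P (bddmM bF bH)) (itgZ h0 (bddm_itg P bF))) (ExZ _ (bddm_itg P bF)); ring.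
have iD := bddm_itg P bD.
have h1 : `|Ex P (fun w => tev F (X^~ w) * D w)| <= 36 * r ^+ 2.
  have iFD := bddm_itg P (bddmM bF bD).
  rewrite (le_trans (Ex_norm iFD))// (le_trans _ ED)//.
  apply: Ex_le; [exact: itg_norm | exact: itg_norm|] => w.
  by rewrite normrM ler_piMl.
have h2 : `|Ex P (fun w => tev F (X^~ w)) * Ex P D| <= 36 * r ^+ 2.
  rewrite normrM (le_trans _ ED)//.
  apply: (@le_trans _ _ `|Ex P D|); last exact: Ex_norm.
  by rewrite ler_piMl//; apply: Ex_bdd => //; case: bF.
by rewrite (le_trans (ler_normB _ _))//; lra.
Qed.

End Decorrelation.
Lemma Ex_prodE2 {d1 d2 : measure_display} {T1 : measurableType d1} {T2 : measurableType d2}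
  {R : realType} (P1 : probability T1 R) (P2 : probability T2 R) (f : T1 * T2 -> R) : bddm f ->
  Ex (P1 \x P2)%E f = Ex P2 (fun y => Ex P1 (fun x => f (x, y))).
Proof.
move=> bf; have if_ := bddm_itg (P1 \x P2)%E bf.
rewrite /Ex /Rintegral -(integral21_prod_meas1 if_); congr fine.
apply: eq_integral => x _; rewrite /= fineK//.
apply: integrable_fin_num => //; apply: bddm_itg.
case: bf => mf [M fM]; split; last by exists M => y.
apply: (measurableT_comp mf); exact: measurable_pair2.
Qed.

Section Decorrelation2.
Context `{T : measurableType d} {R : realType} (P : probability T R).

(** Reduction to white pairs by Gram-Schmidt: the second component of each pair is replaced by its
    standardized residual on the first. Evenness and sup bounds survive linear changes of variables;
    only the cross covariance deteriorates, by a factor 7 / v0^2. *)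
Lemma decorrelation (Z : bool + bool -> T -> R) (S : bool + bool -> bool + bool -> R)
    (b b' v v' v0 r : R) (F G : tpoly R bool) :
  gvec P Z S ->
  S (inl false) (inl false) = 1 -> S (inl false) (inl true) = b ->
  S (inl true) (inl true) = b ^+ 2 + v ^+ 2 ->
  S (inr false) (inr false) = 1 -> S (inr false) (inr true) = b' ->
  S (inr true) (inr true) = b' ^+ 2 + v' ^+ 2 ->
  0 < v0 <= 1 -> v0 <= v -> v0 <= v' -> `|b| <= 3 / 2 -> `|b'| <= 3 / 2 ->
  (forall i j, `|S (inl i) (inr j)| <= r) ->
  teven G -> (forall y, `|tev F y| <= 1) -> (forall y, `|tev G y| <= 1) ->
  `|Ex P (fun w => tev F (fun i => Z (inl i) w) * tev G (fun i => Z (inr i) w)) -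
    Ex P (fun w => tev F (fun i => Z (inl i) w)) * Ex P (fun w => tev G (fun i => Z (inr i) w))|
    <= 72 * (7 / v0 ^+ 2 * r) ^+ 2.
Proof.
move=> gZ S1 S2 S3 S4 S5 S6 /andP[v00 v01] vv vv' bb bb' Sr eG F1 G1.
have [mZ sS _] := gZ.
have vp : 0 < v by exact: lt_le_trans vv.
have vp' : 0 < v' by exact: lt_le_trans vv'.
have v_0 : v != 0 by rewrite gt_eqF.
have v_0' : v' != 0 by rewrite gt_eqF.
have r0 : 0 <= r by rewrite (le_trans _ (Sr false false)).
(* Each residual multiplies cross covariances by at most (1 + 3/2) / v0; two of them give 25/4 /
   v0^2, rounded up to 7 / v0^2. *)
pose rr := 7 / v0 ^+ 2 * r.
have v02 : 0 < v0 ^+ 2 by rewrite exprn_gt0.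
have rr0 : 0 <= rr by rewrite mulr_ge0// divr_ge0// sqr_ge0.
rewrite -/rr.
(* If rr > 1/4 the right-hand side exceeds the trivial bound 2. *)
have [r4|r4] := leP rr (1 / 4); last first.
  have bF : bddm (fun w => tev F (fun i => Z (inl i) w)) by apply: (@bddm_tev _ _ _ _ (fun i => Z (inl i))).
  have bG : bddm (fun w => tev G (fun i => Z (inr i) w)) by apply: (@bddm_tev _ _ _ _ (fun i => Z (inr i))).
  have [mF _] := bF; have [mG _] := bG; have [mFG _] := bddmM bF bG.
  have e1 : `|Ex P (fun w => tev F (fun i => Z (inl i) w))| <= 1 by exact: Ex_bdd.
  have e2 : `|Ex P (fun w => tev G (fun i => Z (inr i) w))| <= 1 by exact: Ex_bdd.
  have e3 : `|Ex P (fun w => tev F (fun i => Z (inl i) w) * tev G (fun i => Z (inr i) w))| <= 1.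
    by apply: Ex_bdd => // w; rewrite normrM mulr_ile1.
  rewrite (le_trans (ler_normB _ _))// normrM.
  apply: (@le_trans _ _ (1 + 1)); first by rewrite lerD// mulr_ile1.
  nra.
pose A (k : bool + bool) (l : bool + bool) : R := match k with
  | inl false => (l == inl false)%:R
  | inl true => v^-1 * (l == inl true)%:R + - (b / v) * (l == inl false)%:R
  | inr false => (l == inr false)%:R
  | inr true => v'^-1 * (l == inr true)%:R + - (b' / v') * (l == inr false)%:R end.
pose Ai (k l : bool) : R := match k with
  | false => (l == false)%:R | true => v * (l == true)%:R + b * (l == false)%:R end.
pose Ai' (k l : bool) : R := match k with
  | false => (l == false)%:R | true => v' * (l == true)%:R + b' * (l == false)%:R end.
pose W k w := dot (A k) (Z^~ w).
have dD (K : finType) (a : R) (k : K) (b0 : R) (k' : K) x :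
   dot (fun l => a * (l == k)%:R + b0 * (l == k')%:R) x = a * x k + b0 * x k'.
  by rewrite dotDl !dotZl !dot_delta.
have SC i j : S i j = S j i by exact: sS.
have qD (K : finType) (Q : K -> K -> R) (a : R) (k : K) (b0 : R) (k' : K) m :
   qform Q (fun l => a * (l == k)%:R + b0 * (l == k')%:R) m =
   a * qform Q (fun l => (l == k)%:R) m + b0 * qform Q (fun l => (l == k')%:R) m.
  by rewrite qformDl !qformZl.
have qD' (K : finType) (Q : K -> K -> R) (a : R) (k : K) (b0 : R) (k' : K) m :
   qform Q m (fun l => a * (l == k)%:R + b0 * (l == k')%:R) =
   a * qform Q m (fun l => (l == k)%:R) + b0 * qform Q m (fun l => (l == k')%:R).
  by rewrite qformDr !qformZr.
pose C (i j : bool) := qform S (A (inl j)) (A (inr i)).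
have Cr i j : `|C i j| <= rr.
  have q7 : rr = 7 / v0 ^+ 2 * r by [].
  have vi : v^-1 <= v0^-1 by rewrite lef_pV2.
  have vi' : v'^-1 <= v0^-1 by rewrite lef_pV2.
  have v1 : 1 <= v0^-1 by rewrite invf_ge1.
  have viP : 0 <= v^-1 by rewrite invr_ge0 ltW.
  have viP' : 0 <= v'^-1 by rewrite invr_ge0 ltW.
  have sb k k' : `|S (inl k) (inr k')| <= r by [].
  have le1 (s1 s2 : R) : `|s1| <= r -> `|s2| <= r -> `|v'^-1 * s1 - b' / v' * s2| <= 5 / 2 * v0^-1 * r.
    move=> h1 h2; rewrite (_ : _ - _ = v'^-1 * (s1 - b' * s2)); last by field.
    rewrite normrM (ger0_norm viP').
    have : `|s1 - b' * s2| <= 5 / 2 * r.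
      rewrite (le_trans (ler_normB _ _))// normrM.
      have : `|b'| * `|s2| <= 3 / 2 * r by rewrite ler_pM.
      by lra.
    move: (`|s1 - _|) (normr_ge0 (s1 - b' * s2)) => y y0 h.
    rewrite (_ : 5 / 2 * v0^-1 * r = v0^-1 * (5 / 2 * r)); last by ring.
    by rewrite ler_pM.
  have le2 (s1 s2 q : R) : `|s1| <= q -> `|s2| <= q -> `|v^-1 * s1 - b / v * s2| <= 5 / 2 * v0^-1 * q.
    move=> h1 h2; rewrite (_ : _ - _ = v^-1 * (s1 - b * s2)); last by field.
    rewrite normrM (ger0_norm viP).
    have : `|s1 - b * s2| <= 5 / 2 * q.
      rewrite (le_trans (ler_normB _ _))// normrM.
      have : `|b| * `|s2| <= 3 / 2 * q by rewrite ler_pM.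
      by lra.
    move: (`|s1 - _|) (normr_ge0 (s1 - b * s2)) => y y0 h.
    rewrite (_ : 5 / 2 * v0^-1 * q = v0^-1 * (5 / 2 * q)); last by ring.
    by rewrite ler_pM.
  have w1 : r <= v0^-1 * r by rewrite ler_peMl.
  have w2 : v0^-1 * r <= v0^-1 * (v0^-1 * r) by rewrite ler_wpM2l// invr_ge0 ltW.
  have wE : rr = 7 * (v0^-1 * (v0^-1 * r)) by rewrite /rr; field; rewrite gt_eqF.
  rewrite /C /A; case: i; case: j.
  - rewrite qD !qD' !qform_delta !mulNr.
    rewrite (le_trans (le2 _ _ _ (le1 _ _ (sb true true) (sb true false)) (le1 _ _ (sb false true) (sb false false))))//.
    by rewrite wE; lra.
  - by rewrite !qD' !qform_delta !mulNr (le_trans (le1 _ _ (sb false true) (sb false false)))// wE; lra.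
  - by rewrite !qD !qform_delta !mulNr (le_trans (le2 _ _ _ (sb true false) (sb false false)))// wE; lra.
  - by rewrite qform_delta (le_trans (sb _ _))// wE; lra.
have gW := gvec_lin A gZ.
pose X i := W (inl i); pose Y i := W (inr i).
have gXY : gvec P (fun k => match k with inl a => X a | inr b => Y b end)
   (fun k k' => match k, k' with
  | inl a, inl b => (a == b)%:R | inr a, inr b => (a == b)%:R
  | inl a, inr b => C b a | inr b, inl a => C b a end).
  apply: eq_gvec gW; first by case.
  have S2' : S (inl true) (inl false) = b by rewrite SC.
  have S5' : S (inr true) (inr false) = b' by rewrite SC.
  case=> [][]; case=> [][] //=.
  - by rewrite /A qD !qD' !qform_delta S1 S2 S2' S3; field.
  - by rewrite /A !qD !qform_delta S1 S2'; field.
  - by rewrite /A !qD' !qform_delta S1 S2; field.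
  - by rewrite qform_delta.
  - by rewrite qformC.
  - by rewrite qformC.
  - by rewrite /A qD !qD' !qform_delta S4 S5 S5' S6; field.
  - by rewrite /A !qD !qform_delta S4 S5'; field.
  - by rewrite qformC.
  - by rewrite qformC.
  - by rewrite /A !qD' !qform_delta S4 S5; field.
  - by rewrite qform_delta.
have XE w : (fun j => dot (Ai j) (X^~ w)) = (fun i => Z (inl i) w).
  apply/funext => -[]; rewrite /Ai ?dD ?dot_delta /X /W /A ?dD ?dot_delta//; field; exact: v_0.
have YE w : (fun j => dot (Ai' j) (Y^~ w)) = (fun i => Z (inr i) w).
  apply/funext => -[]; rewrite /Ai' ?dD ?dot_delta /Y /W /A ?dD ?dot_delta//; field; exact: v_0'.
have := @decorrelation_white _ _ _ P X Y C rr gXY Cr r4 (tlin Ai F) (tlin Ai' G) (teven_tlin _ eG).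
have -> : (fun w => tev (tlin Ai F) (X^~ w) * tev (tlin Ai' G) (Y^~ w)) =
  (fun w => tev F (fun i => Z (inl i) w) * tev G (fun i => Z (inr i) w)).
  by apply/funext => w; rewrite !tev_tlin XE YE.
have -> : (fun w => tev (tlin Ai F) (X^~ w)) = (fun w => tev F (fun i => Z (inl i) w)).
  by apply/funext => w; rewrite !tev_tlin XE.
have -> : (fun w => tev (tlin Ai' G) (Y^~ w)) = (fun w => tev G (fun i => Z (inr i) w)).
  by apply/funext => w; rewrite !tev_tlin YE.
move=> /(_ (fun y => _)) h; apply: h.
- by move=> y; rewrite tev_tlin.
- by move=> y; rewrite tev_tlin.
Qed.

End Decorrelation2.

(** * The ratio function psi *)

Section PsiBasics.
Context {R : realType}.

Lemma psi_div (x y : R) :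
  psi x y = `|x + y| / (`|x| + `|y|) + ((x == 0) && (y == 0))%:R.
Proof.
rewrite /psi; case: ifPn => [/andP[/eqP-> /eqP->]|_]; last by rewrite addr0.
by rewrite !normr0 !addr0 normr0 mul0r add0r.
Qed.

Lemma psi_ge0 (x y : R) : 0 <= psi x y.
Proof. by rewrite psi_div addr_ge0// divr_ge0// addr_ge0. Qed.

Lemma psi_le1 (x y : R) : psi x y <= 1.
Proof.
rewrite /psi; case: ifPn => // h; rewrite ler_pdivrMr ?mul1r ?ler_normD//.
by rewrite lt_def addr_ge0// andbT paddr_eq0// !normr_eq0.
Qed.

Lemma norm_psi_le1 (x y : R) : `|psi x y| <= 1.
Proof. by rewrite ger0_norm ?psi_ge0// psi_le1. Qed.

Lemma psiZ (a x y : R) : a != 0 -> psi (a * x) (a * y) = psi x y.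
Proof.
move=> a0; rewrite /psi !mulf_eq0 (negbTE a0) /=; case: ifP => // _.
rewrite -mulrDr !normrM -mulrDr -mulf_div divff ?mul1r// normr_eq0//.
Qed.

Lemma psiN (x y : R) : psi (- x) (- y) = psi x y.
Proof. by rewrite -(mulN1r x) -(mulN1r y) psiZ// oppr_eq0 oner_neq0. Qed.

Lemma measurable_psi `{T : measurableType d} (X Y : T -> R) :
  measurable_fun setT X -> measurable_fun setT Y ->
  measurable_fun setT (fun w => psi (X w) (Y w)).
Proof.
move=> mX mY; apply: measurable_fun_ifT => //.
  by apply: measurable_and; apply: measurable_fun_eqr.
apply: measurable_funM; first by apply: measurableT_comp => //; exact: measurable_funD.
rewrite (_ : (fun w => _) = (fun w => (`|X w| + `|Y w|) `^ (- 1))).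
  apply: (measurableT_comp (measurable_powR _)).
  by apply: measurable_funD; exact: measurableT_comp.
by apply/funext => w; rewrite powR_inv1// addr_ge0.
Qed.

Lemma bddm_psi `{T : measurableType d} (X Y : T -> R) :
  measurable_fun setT X -> measurable_fun setT Y -> bddm (fun w => psi (X w) (Y w)).
Proof. by move=> mX mY; split; [exact: measurable_psi | exists 1 => w; exact: norm_psi_le1]. Qed.

Let psi_lip_pos (x y y' : R) : 0 < x -> y <= y' ->
  `|psi x y - psi x y'| <= 2 * `|y - y'| * `|x| / ((`|x| + `|y|) * (`|x| + `|y'|)).
Proof.
move=> x0 yy.
have p0 : 0 < `|x| + `|y| by rewrite ltr_wpDr// normr_gt0 gt_eqF.
have q0 : 0 < `|x| + `|y'| by rewrite ltr_wpDr// normr_gt0 gt_eqF.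
rewrite /psi (gt_eqF x0)/= ler_pdivlMr ?mulr_gt0//.
have e : 0 <= (`|x| + `|y|) * (`|x| + `|y'|) by rewrite mulr_ge0// ltW.
rewrite -[X in _ * X](ger0_norm e) -normrM.
rewrite (_ : (_ - _) * _ = `|x + y| * (`|x| + `|y'|) - `|x + y'| * (`|x| + `|y|)); last first.
  by field; rewrite !gt_eqF.
rewrite (gtr0_norm x0) (distrC y) (ger0_norm (_ : 0 <= y' - y)) ?subr_ge0//.
rewrite ler_norml.
case: (ger0P (x + y)) => y1; case: (ger0P (x + y')) => y2; try lra;
case: (ger0P y) => y3; case: (ger0P y') => y4; try lra;
by apply/andP; split; nra.
Qed.

(** By homogeneity of degree 0 the slope in y decays as the arguments grow. Keeping both
    denominators lets the estimate absorb unbounded Gaussian values in [Ex_psi_lip]. *)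
Lemma psi_lip (x y y' : R) : x != 0 ->
  `|psi x y - psi x y'| <= 2 * `|y - y'| * `|x| / ((`|x| + `|y|) * (`|x| + `|y'|)).
Proof.
wlog x0 : x y y' / 0 < x.
  move=> W xn; have [x0|x0|x0] := ltgtP 0 x; [exact: W| |by rewrite -x0 eqxx in xn].
  have := W (- x) (- y) (- y'); rewrite !psiN !normrN -opprD normrN; apply; last by rewrite oppr_eq0.
  by rewrite oppr_gt0.
move=> _; wlog yy : y y' / y <= y'.
  move=> W; have [h|h] := leP y y'; first exact: W.
  by have := W _ _ (ltW h); rewrite distrC (distrC y') [X in _ <= _ / X]mulrC.
exact: psi_lip_pos.
Qed.

End PsiBasics.

(** * Approximation of psi in mean *)

Section GaussianBump.
Context {R : realType}.
Local Notation mu := (@lebesgue_measure R).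

(* Twice it majorizes the indicator of [-s, s], and its Gaussian mean is s. *)
Definition bump (s x : R) : R := expR (- ((s ^- 2 - 1) * x ^+ 2 / 2)).

Lemma continuous_bump (s : R) : continuous (bump s).
Proof.
rewrite (_ : bump s = expR \o (fun x => - ((s ^- 2 - 1) * x ^+ 2 / 2)))// => x.
apply: continuous_comp; last exact: continuous_expR.
apply: cvgN; apply: cvgM; last exact: cvg_cst.
by apply: cvgM; [exact: cvg_cst | apply: cvgM; exact: cvg_id].
Qed.

(** The exponent is made so that, after x = s y, the product of [bump s] and the normal density is
    the normal density in y; the Jacobian s remains. *)
Lemma gam_bump (s : R) : 0 < s -> Ex gam (bump s) = s.
Proof.
move=> s0; pose G x := bump s x * normal_pdf 0 1 x.
have cG : continuous G.
  by move=> x; apply: cvgM; [exact: continuous_bump | apply: continuous_normal_pdf; exact: oner_neq0].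
have G0 x : 0 <= G x by rewrite mulr_ge0 ?expR_ge0// normal_pdf_ge0.
have e : (\int[gam]_x (bump s x)%:E = s%:E)%E.
  rewrite (ge0_integral_normal_cont 0 1 (@continuous_bump s) (fun x => expR_ge0 _)).
  rewrite (@ge0_integral_affine _ 0 s G)//.
  have := @ge0_integral_normal_cont R 0 1 (fun=> s) (fun x => @cst_continuous _ _ _ x) (fun=> ltW s0).
  rewrite integral_cst//= probability_setT mule1 => ->.
  apply: eq_integral => x _; congr (_%:E); rewrite /G /bump add0r mulrC; congr (_ * _).
  rewrite !normal_pdfE ?oner_eq0// /normal_peak /normal_fun mulrCA -expRD; congr (_ * expR _).
  by field; rewrite gt_eqF.
by rewrite /Ex /Rintegral e.
Qed.

(** [bump s x] is itself a Gaussian characteristic function, E cos (t x N) with t^2 = s^(-2) - 1.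
    Exchanging the two integrals brings in the characteristic function of X only, and reduces X to a
    standard normal variable. *)
Lemma Ex_bump `{T : measurableType d} (P : probability T R) (X : T -> R) (s : R) :
  0 < s <= 1 -> measurable_fun setT X ->
  (forall l, Ex P (fun w => cos (l * X w)) = expR (- l ^+ 2 / 2)) ->
  Ex P (fun w => bump s (X w)) = s.
Proof.
move=> /andP[s0 s1] mX cX.
pose t := sqrtr (s ^- 2 - 1).
have t2 : t ^+ 2 = s ^- 2 - 1.
  by rewrite sqr_sqrtr// subr_ge0 -exprVn exprn_ege1// invf_ge1.
pose f (z : T * measurableTypeR R) : R := cos (t * X z.1 * z.2).
have bf : bddm f.
  apply: bddm_cos; apply: measurable_funM => //.
  by apply: measurable_funM => //; apply: measurableT_comp.
have := Ex_prodE2 P gam bf; rewrite (Ex_prodE P gam bf).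
rewrite (_ : (fun x => _) = (fun w => bump s (X w))); last first.
  apply/funext => w; rewrite /f /=; have := gam_cos (t * X w) 0.
  rewrite cos0 mulr1; under eq_fun do rewrite addr0.
  by move=> ->; congr expR; rewrite exprMn t2; ring.
move=> ->; rewrite -[RHS](gam_bump s0); congr Ex; apply/funext => y; rewrite /f /=.
rewrite (_ : (fun x => cos _) = (fun w => cos ((t * y) * X w))); last first.
  by apply/funext => w; congr cos; ring.
by rewrite cX /bump; congr expR; rewrite exprMn t2; ring.
Qed.

Lemma bump_ge (s x : R) : 0 < s -> `|x| <= s -> 1 / 2 <= bump s x.
Proof.
move=> s0 xs; rewrite /bump (le_trans _ (expR_ge1Dx _))//.
have : x ^+ 2 <= s ^+ 2 by rewrite -(real_normK (num_real x)) lerXn2r ?nnegrE// ltW.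
have s2 : 0 < s ^+ 2 by rewrite exprn_gt0.
have e : s ^- 2 * s ^+ 2 = 1 by rewrite mulVf// gt_eqF.
have : 0 < s ^- 2 by rewrite invr_gt0.
have := sqr_ge0 x.
by move: (s ^- 2) (s ^+ 2) e s2 (x ^+ 2) => u v ? ? z; nra.
Qed.

End GaussianBump.

Section PsiApprox.
Context {R : realType}.

Definition psib (x : bool -> R) : R := psi (x false) (x true).

(* A Lipschitz version of psi, equal to it once |x false| >= s. *)
Definition psie (s : R) (x : bool -> R) : R :=
  `|x false + x true| / maxr (`|x false| + `|x true|) s.

Lemma psie_bdd (s : R) x : 0 < s -> `|psie s x| <= 1.
Proof.
move=> s0; have m0 : 0 < maxr (`|x false| + `|x true|) s by rewrite lt_max s0 orbT.
by rewrite /psie normrM normfV normr_id (gtr0_norm m0) ler_pdivrMr// mul1r le_max ler_normD.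
Qed.

Lemma psie_psib (s : R) x : 0 < s -> s <= `|x false| -> psie s x = psib x.
Proof.
move=> s0 sx; rewrite /psie /psib /psi.
have -> /= : (x false == 0) = false by rewrite -normr_eq0 gt_eqF//; exact: lt_le_trans sx.
by rewrite max_l// (le_trans sx)// lerDl.
Qed.

Lemma psie_lip (s D : R) x y : 0 < s -> sup_le D (fun i => x i - y i) ->
  `|psie s x - psie s y| <= 4 * D / s.
Proof.
move=> s0 h; have h0 := h false; have h1 := h true.
rewrite /psie; set m := maxr _ _; set m' := maxr (`|y false| + _) _.
have mn : `|x false + x true| <= m by rewrite le_max ler_normD.
have ms : s <= m by rewrite le_max lexx orbT.
have ms' : s <= m' by rewrite le_max lexx orbT.
have d1 : `| `|x false + x true| - `|y false + y true| | <= 2 * D.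
  rewrite (le_trans (ler_dist_dist _ _))// (_ : _ - _ = (x false - y false) + (x true - y true)); last by ring.
  rewrite (le_trans (ler_normD _ _))//; lra.
have d2 : `|m - m'| <= 2 * D.
  have a0 : `| `|x false| - `|y false| | <= D := le_trans (ler_dist_dist _ _) h0.
  have a1 : `| `|x true| - `|y true| | <= D := le_trans (ler_dist_dist _ _) h1.
  have D0 : 0 <= D by exact: le_trans (normr_ge0 _) h0.
  move: a0 a1; rewrite /m /m' !ler_norml.
  by case: (leP (`|x false| + `|x true|) s) => ?; case: (leP (`|y false| + `|y true|) s) => ?; lra.
move: (`|x false + x true|) (normr_ge0 (x false + x true)) mn d1 => n n0 mn d1.
move: (`|y false + y true|) d1 => n' d1.
have mp : 0 < m by exact: lt_le_trans ms.
have mp' : 0 < m' by exact: lt_le_trans ms'.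
rewrite (_ : n / m - n' / m' = ((n - n') * m + n * (m' - m)) / (m * m')); last by field; rewrite !gt_eqF.
rewrite normrM normfV (gtr0_norm (mulr_gt0 mp mp')) ler_pdivrMr ?mulr_gt0//.
apply: (@le_trans _ _ (4 * D * m)).
  rewrite (le_trans (ler_normD _ _))// !normrM (gtr0_norm mp) (ger0_norm n0) (distrC m').
  have : `|n - n'| * m <= 2 * D * m by rewrite ler_wpM2r// ltW.
  have : n * `|m - m'| <= m * (2 * D) by rewrite ler_pM.
  by lra.
have D0 : 0 <= D by exact: le_trans (normr_ge0 _) h0.
have ms1 : 1 <= m' / s by rewrite ler_pdivlMr// mul1r.
rewrite (_ : 4 * D / s * (m * m') = 4 * D * m * (m' / s)); last by ring.
have z : 0 <= 4 * D * m by rewrite !mulr_ge0// ltW.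
by rewrite ler_peMr.
Qed.

(** Even part of F: cos (y + p) + cos (- y + p) = 2 cos p cos y removes every phase. *)
Definition tsym {I : finType} (F : tpoly R I) : tpoly R I :=
  [seq (t.1.1 * cos t.2, t.1.2, 0) | t <- F].

Lemma tev_tsym {I : finType} (F : tpoly R I) x :
  tev (tsym F) x = (tev F x + tev F (fun i => - x i)) / 2.
Proof.
rewrite /tev big_map -big_split/= mulr_suml; apply: eq_bigr => t _ /=.
have -> : dot t.1.2 (fun i => - x i) = - dot t.1.2 x.
  by rewrite /dot -sumrN; apply: eq_bigr => i _; rewrite mulrN.
by rewrite addr0 !cosD cosN sinN; field.
Qed.

Lemma teven_tsym {I : finType} (F : tpoly R I) : teven (tsym F).
Proof. by rewrite /teven all_map; apply/allP => t _ /=. Qed.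

Lemma gvec_cos1 `{T : measurableType d} (P : probability T R)
  (I : finType) (X : I -> T -> R) S i l : gvec P X S -> S i i = 1 ->
  Ex P (fun w => cos (l * X i w)) = expR (- l ^+ 2 / 2).
Proof.
move=> gX Si; have := Ex_cos_phase (fun j => l * (j == i)%:R) 0 gX.
rewrite cos0 mulr1 qformZl qformZr qform_delta Si.
under eq_fun do rewrite addr0 dotZl dot_delta.
by move=> ->; congr expR; ring.
Qed.

(** F is chosen before the probability space and the covariance. This uniformity is what allows one
    polynomial for all indices and all n, and lets equality of covariances be turned into equality
    of means of psi. *)
Lemma psi_approx (e : R) : 0 < e -> exists F : tpoly R bool,
  [/\ teven F, forall x, `|tev F x| <= 1 &
   forall (d : measure_display) (T : measurableType d) (P : probability T R)
     (X : bool -> T -> R) (S : bool -> bool -> R),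
   gvec P X S -> S false false = 1 -> S true true <= 2 ->
   Ex P (fun w => `|psib (X^~ w) - tev F (X^~ w)|) <= e].
Proof.
move=> e0.
(* Here s <= e/16 makes 4 E bump = 4 s at most e/4, and s <= 1 is required by [Ex_bump]; L below
   makes the second-moment term 6 / L^2 at most e/4. *)
pose s := e / (16 + e).
have s0 : 0 < s by rewrite divr_gt0// addr_gt0.
have s1 : s <= 1 by rewrite ler_pdivrMr ?addr_gt0// mul1r lerDr.
have se : s <= e / 16 by rewrite ler_pM2l// lef_pV2 ?posrE ?addr_gt0// lerDl ltW.
pose L := 1 + 24 / e.
have L1 : 1 <= L by rewrite lerDl divr_ge0// ltW.
have L0 : 0 < L by exact: lt_le_trans L1.
have Le : 6 / L ^+ 2 <= e / 4.
  have h : e * L = e + 24 by rewrite /L; field; rewrite gt_eqF.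
  by rewrite ler_pdivrMr ?exprn_gt0//; nra.
have [||||F [F1 FL]] := @weierstrass_tpoly R bool (psie s) 1 L (e / 8) (e / 32 * s) (fun x => psie_bdd x s0).
- exact: L0.
- by rewrite divr_gt0.
- by rewrite mulr_gt0// divr_gt0.
- move=> x y _ _ h; rewrite (le_trans (psie_lip s0 h))//.
  by rewrite (_ : _ / s = e / 8)//; field; rewrite gt_eqF.
exists (tsym F); split; first exact: teven_tsym.
  move=> x; rewrite tev_tsym; have := F1 x; have := F1 (fun i => - x i).
  by rewrite !ler_norml; lra.
(* Three regimes: near x false = 0 the bump dominates the trivial bound 2; outside the box of size L
   the squares do; elsewhere e/4 is the Weierstrass error. As g is even, the bound passes to the
   symmetrized polynomial. *)
pose g (x : bool -> R) := e / 4 + 2 / L ^+ 2 * (x false ^+ 2 + x true ^+ 2) + 4 * bump s (x false).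
have pw0 x : `|psib x - tev F x| <= g x.
  have b0 : 0 <= bump s (x false) by exact: expR_ge0.
  have L20 : 0 <= 2 / L ^+ 2 by rewrite divr_ge0// sqr_ge0.
  have q0 : 0 <= 2 / L ^+ 2 * (x false ^+ 2 + x true ^+ 2) by rewrite mulr_ge0// addr_ge0// sqr_ge0.
  have le2 : `|psib x - tev F x| <= 2.
    rewrite (le_trans (ler_normB _ _))//; have := F1 x; have := @norm_psi_le1 R (x false) (x true).
    by rewrite /psib; lra.
  have [xs|xs] := leP (`|x false|) s.
    by have := bump_ge s0 xs; rewrite /g; lra.
  have [bx|bx] := boolP [forall i, `|x i| <= L].
    have := FL x (fun i => forallP bx i); rewrite (psie_psib s0 (ltW xs)) /g; lra.
  move: bx; rewrite negb_forall => /existsP[i]; rewrite -ltNge => Lx.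
  have q2 : 2 <= 2 / L ^+ 2 * (x false ^+ 2 + x true ^+ 2).
    rewrite mulrAC ler_pdivlMr ?exprn_gt0// ler_pM2l//.
    have : L ^+ 2 <= x i ^+ 2 by rewrite -(real_normK (num_real (x i))) lerXn2r ?nnegrE// ltW.
    by have := sqr_ge0 (x false); have := sqr_ge0 (x true); case: i {Lx} => ? ? ?; lra.
  by rewrite /g; lra.
have pw x : `|psib x - tev (tsym F) x| <= g x.
  have h1 := pw0 x; have h2 := pw0 (fun i => - x i).
  have gE : g (fun i => - x i) = g x by rewrite /g !sqrrN /bump sqrrN.
  have pE : psib (fun i => - x i) = psib x by rewrite /psib psiN.
  by move: h1 h2; rewrite gE pE tev_tsym !ler_norml; lra.
move=> d T P X S gX S0 S1.
have [mX _ _] := gX.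
have [i0 e0'] := gvec_sqr false gX; have [i1 e1'] := gvec_sqr true gX.
have mb : measurable_fun setT (fun w => bump s (X false w)).
  apply: measurableT_comp => //; apply: continuous_measurable_fun; exact: continuous_bump.
have ib : itg P (fun w => bump s (X false w)).
  apply: bddm_itg; split => //; exists 1 => w; rewrite ger0_norm ?expR_ge0// -expR0 ler_expR oppr_le0.
  rewrite divr_ge0// mulr_ge0 ?sqr_ge0// subr_ge0 -exprVn exprn_ege1// invf_ge1//.
have ig : itg P (fun w => g (X^~ w)).
  by apply: itgD; [apply: itgD; [exact: itg_cst | apply: itgZ; exact: itgD] | exact: itgZ].
have bp : bddm (fun w => psib (X^~ w)) by exact: bddm_psi.
have bF : bddm (fun w => tev (tsym F) (X^~ w)) by exact: bddm_tev.
apply: (@le_trans _ _ (Ex P (fun w => g (X^~ w)))).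
  by apply: Ex_le => //; apply: itg_norm; exact/bddm_itg/bddmB.
rewrite /g (ExD (itgD (itg_cst P (e / 4)) (itgZ (2 / L ^+ 2) (itgD i0 i1))) (itgZ 4 ib)).
rewrite (ExD (itg_cst P (e / 4)) (itgZ (2 / L ^+ 2) (itgD i0 i1))) Ex_cst (ExZ _ ib) (ExZ _ (itgD i0 i1)) (ExD i0 i1).
rewrite Ex_bump ?s0//; last by move=> l; exact: gvec_cos1 gX S0.
have L20 : 0 <= 2 / L ^+ 2 by rewrite divr_ge0// sqr_ge0.
have : 2 / L ^+ 2 * (Ex P (fun w => X false w ^+ 2) + Ex P (fun w => X true w ^+ 2)) <= 2 / L ^+ 2 * 3.
  by rewrite ler_wpM2l//; move: e0' e1'; rewrite S0; lra.
have : 2 / L ^+ 2 * 3 = 6 / L ^+ 2 by field; rewrite gt_eqF.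
by lra.
Qed.

End PsiApprox.

(** * Estimates uniform over the laws of Gaussian pairs *)

Section Laws.
Context {R : realType}.

Lemma norm_cos_le1 (x : R) : `|cos x| <= 1.
Proof. by rewrite ler_norml cos_geN1 cos_le1. Qed.

Lemma tev_Ex_cont {I : finType} (F : tpoly R I) : exists2 K : R, 0 <= K &
  forall (d d' : measure_display) (T : measurableType d) (T' : measurableType d')
    (P : probability T R) (P' : probability T' R) (X : I -> T -> R) (X' : I -> T' -> R)
    (S S' : I -> I -> R) (e : R),
  gvec P X S -> gvec P' X' S' -> (forall i j, `|S i j - S' i j| <= e) ->
  `|Ex P (fun w => tev F (X^~ w)) - Ex P' (fun w => tev F (X'^~ w))| <= K * e.
Proof.
pose N (l : I -> R) := \sum_i \sum_j `|l i| * `|l j|.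
have N0 l : 0 <= N l by apply: sumr_ge0 => i _; apply: sumr_ge0 => j _; rewrite mulr_ge0.
exists (\sum_(t <- F) `|t.1.1| * N t.1.2).
  by apply: sumr_ge0 => t _; rewrite mulr_ge0.
move=> d d' T T' P P' X X' S S' e gX gX' SS.
rewrite (Ex_tev _ gX) (Ex_tev _ gX') -sumrB mulr_suml.
rewrite (le_trans (ler_norm_sum _ _ _))//; apply: ler_sum => t _.
(* Positivity of the quadratic form is read off from exp (- q / 2) = E cos <= 1; it keeps the
   exponentials in the range where they are 1-Lipschitz. *)
have q0 (d0 : measure_display) (T0 : measurableType d0) (P0 : probability T0 R) X0 S0 (l : I -> R) :
    gvec P0 X0 S0 -> 0 <= qform S0 l l.
  move=> g0; have := Ex_cos_phase l 0 g0; rewrite cos0 mulr1 => h.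
  have [m0 _ _] := g0.
  have : expR (- qform S0 l l / 2) <= 1.
    rewrite -h (le_trans (ler_norm _))//; apply: Ex_bdd; last by move=> w; exact: norm_cos_le1.
    by under eq_fun do rewrite addr0; case: (bddm_cos (measurable_dot l m0)).
  by move=> h1; have := expR_ge1Dx (- qform S0 l l / 2); lra.
have qq : `|qform S t.1.2 t.1.2 - qform S' t.1.2 t.1.2| <= N t.1.2 * e.
  rewrite /qform -sumrB mulr_suml (le_trans (ler_norm_sum _ _ _))//; apply: ler_sum => i _.
  rewrite -sumrB mulr_suml (le_trans (ler_norm_sum _ _ _))//; apply: ler_sum => j _.
  rewrite (_ : _ - _ = t.1.2 i * t.1.2 j * (S i j - S' i j)); last by ring.
  by rewrite !normrM ler_wpM2l// mulr_ge0.
rewrite -mulrBr normrM -mulrA ler_wpM2l// -mulrBl normrM.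
have c1 : `|cos t.2| <= 1 by exact: norm_cos_le1.
have := q0 _ _ _ _ _ t.1.2 gX; have := q0 _ _ _ _ _ t.1.2 gX'; move: qq.
move: (qform _ _ _) (qform S' _ _) => x y xy y0 x0.
apply: (@le_trans _ _ `|expR (- x / 2) - expR (- y / 2)|); first by rewrite ler_piMr.
apply: (le_trans _ xy).
have L (a b : R) : 0 <= a -> a <= b -> `|expR (- a / 2) - expR (- b / 2)| <= `|a - b|.
  move=> a0 ab; rewrite distrC ler0_norm; last by rewrite subr_le0 ler_expR; lra.
  rewrite distrC (ger0_norm (_ : 0 <= b - a)) ?subr_ge0//.
  have := expR_ge1Dx (- (b - a) / 2); have := expR_gt0 (- a / 2).
  have : expR (- a / 2) <= 1 by rewrite -[leRHS]expR0 ler_expR; lra.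
  have -> : expR (- b / 2) = expR (- a / 2) * expR (- (b - a) / 2) by rewrite -expRD; congr expR; field.
  by move: (expR (- a / 2)) (expR (- (b - a) / 2)) => u v; nra.
have [ab|ba] := leP x y; first exact: L.
by rewrite distrC (distrC x); apply: L => //; exact: ltW.
Qed.

Lemma cov_approx `{T : measurableType d} (P : probability T R)
  (M : R) (f f' g g' : T -> R) : bddm f -> bddm f' -> bddm g -> bddm g' ->
  (forall w, `|f w| <= M) -> (forall w, `|f' w| <= M) ->
  (forall w, `|g w| <= M) -> (forall w, `|g' w| <= M) ->
  `|(Ex P (fun w => f w * g w) - Ex P f * Ex P g) -
    (Ex P (fun w => f' w * g' w) - Ex P f' * Ex P g')| <=
  2 * M * (Ex P (fun w => `|f w - f' w|) + Ex P (fun w => `|g w - g' w|)).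
Proof.
move=> bf bf' bg bg' fM fM' gM gM'.
have iE h : bddm h -> itg P (h : T -> R) by exact: bddm_itg.
have M0 : 0 <= M.
  have [M0|M0] := leP 0 M => //; have := @Ex_bdd _ _ _ P f M bf.1 fM.
  by move/(le_trans (normr_ge0 _)); rewrite leNgt M0.
set a := Ex P (fun w => `|f w - f' w|); set b := Ex P (fun w => `|g w - g' w|).
have h1 : `|Ex P (fun w => f w * g w) - Ex P (fun w => f' w * g' w)| <= M * a + M * b.
  rewrite -(ExB (iE _ (bddmM bf bg)) (iE _ (bddmM bf' bg'))).
  rewrite (le_trans (Ex_norm (iE _ (bddmB (bddmM bf bg) (bddmM bf' bg')))))//.
  rewrite -(ExZ _ (itg_norm (iE _ (bddmB bf bf')))) -(ExZ _ (itg_norm (iE _ (bddmB bg bg')))).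
  rewrite -(ExD (itgZ _ (itg_norm (iE _ (bddmB bf bf')))) (itgZ _ (itg_norm (iE _ (bddmB bg bg'))))).
  apply: Ex_le.
  - exact: itg_norm (iE _ (bddmB (bddmM bf bg) (bddmM bf' bg'))).
  - exact: itgD (itgZ _ (itg_norm (iE _ (bddmB bf bf')))) (itgZ _ (itg_norm (iE _ (bddmB bg bg')))).
  - move=> w; rewrite (_ : _ - _ = g w * (f w - f' w) + f' w * (g w - g' w)); last by ring.
    by rewrite (le_trans (ler_normD _ _))// !normrM lerD// ler_wpM2r.
have hn (h h' : T -> R) : bddm h -> bddm h' -> `|Ex P h - Ex P h'| <= Ex P (fun w => `|h w - h' w|).
  by move=> bh bh'; rewrite -(ExB (iE _ bh) (iE _ bh')); apply: Ex_norm; exact: iE (bddmB bh bh').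
have h2 : `|Ex P f * Ex P g - Ex P f' * Ex P g'| <= M * a + M * b.
  rewrite (_ : _ - _ = Ex P g * (Ex P f - Ex P f') + Ex P f' * (Ex P g - Ex P g')); last by ring.
  rewrite (le_trans (ler_normD _ _))// !normrM lerD//.
    by rewrite ler_pM//; [exact: Ex_bdd bg.1 gM | exact: hn].
  by rewrite ler_pM//; [exact: Ex_bdd bf'.1 fM' | exact: hn].
rewrite (_ : _ - _ = (Ex P (fun w => f w * g w) - Ex P (fun w => f' w * g' w)) - (Ex P f * Ex P g - Ex P f' * Ex P g')); last by ring.
by rewrite (le_trans (ler_normB _ _))//; lra.
Qed.

(* The pairs to which the uniform estimates apply: unit variance first
   component, and conditional variance of the second one at least v0 ^ 2. *)
Definition nice (v0 : R) (S : bool -> bool -> R) : Prop :=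
  [/\ S false false = 1, S false true ^+ 2 + v0 ^+ 2 <= S true true & S true true <= 2].

Definition half1 (S : bool + bool -> bool + bool -> R) (i j : bool) := S (inl i) (inl j).
Definition half2 (S : bool + bool -> bool + bool -> R) (i j : bool) := S (inr i) (inr j).

(** The bound 2 accommodates differences of two approximants; halving both functions costs the
    factor 4. *)
Lemma decorrelation_nice `{T : measurableType d} (P : probability T R)
    (Z : bool + bool -> T -> R) S (v0 r : R) (F G : tpoly R bool) :
  gvec P Z S -> 0 < v0 <= 1 -> nice v0 (half1 S) -> nice v0 (half2 S) ->
  (forall i j, `|S (inl i) (inr j)| <= r) ->
  teven G -> (forall y, `|tev F y| <= 2) -> (forall y, `|tev G y| <= 2) ->
  `|Ex P (fun w => tev F (fun i => Z (inl i) w) * tev G (fun i => Z (inr i) w)) -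
    Ex P (fun w => tev F (fun i => Z (inl i) w)) * Ex P (fun w => tev G (fun i => Z (inr i) w))|
    <= 4 * (72 * (7 / v0 ^+ 2 * r) ^+ 2).
Proof.
move=> gZ v01 [S1 S2 S3] [S1' S2' S3'] Sr eG F2 G2; have [mZ _ _] := gZ; rewrite /half1 /half2 in S1 S2 S3 S1' S2' S3'.
have /andP[v0p v0l] := v01.
have nv (b s : R) : b ^+ 2 + v0 ^+ 2 <= s -> s <= 2 ->
    [/\ s = b ^+ 2 + sqrtr (s - b ^+ 2) ^+ 2, v0 <= sqrtr (s - b ^+ 2) & `|b| <= 3 / 2].
  move=> h1 h2; have v2 := sqr_ge0 v0; have b2 := sqr_ge0 b.
  rewrite sqr_sqrtr; last by lra.
  split; first by ring.
    by rewrite -[leLHS]gtr0_norm// -sqrtr_sqr ler_wsqrtr//; lra.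
  rewrite -(@ler_pXn2r _ 2)// ?nnegrE// real_normK ?num_real//; lra.
have [e1 e2 e3] := nv _ _ S2 S3; have [e1' e2' e3'] := nv _ _ S2' S3'.
have bF : bddm (fun w => tev F (fun i => Z (inl i) w)) by apply: (@bddm_tev _ _ _ _ (fun i => Z (inl i))).
have bG : bddm (fun w => tev G (fun i => Z (inr i) w)) by apply: (@bddm_tev _ _ _ _ (fun i => Z (inr i))).
have := @decorrelation _ _ _ P Z S _ _ _ _ v0 r (tscale (1 / 2) F) (tscale (1 / 2) G)
  gZ S1 erefl e1 S1' erefl e1' v01 e2 e2' e3 e3' Sr.
have -> : teven (tscale (1 / 2) G) by rewrite /teven all_map.
move=> /(_ isT) h.
have tb (H : tpoly R bool) : (forall y, `|tev H y| <= 2) -> forall y, `|tev (tscale (1 / 2) H) y| <= 1.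
  by move=> H2 y; rewrite tev_scale normrM ger0_norm ?divr_ge0//; have := H2 y; lra.
have {h} := h (tb _ F2) (tb _ G2).
have -> : (fun w => tev (tscale (1 / 2) F) (fun i => Z (inl i) w) * tev (tscale (1 / 2) G) (fun i => Z (inr i) w)) =
    (fun w => 1 / 4 * (tev F (fun i => Z (inl i) w) * tev G (fun i => Z (inr i) w))).
  by apply/funext => w; rewrite !tev_scale; field.
have -> : (fun w => tev (tscale (1 / 2) F) (fun i => Z (inl i) w)) = (fun w => 1 / 2 * tev F (fun i => Z (inl i) w)).
  by apply/funext => w; rewrite !tev_scale.
have -> : (fun w => tev (tscale (1 / 2) G) (fun i => Z (inr i) w)) = (fun w => 1 / 2 * tev G (fun i => Z (inr i) w)).
  by apply/funext => w; rewrite !tev_scale.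
rewrite (ExZ _ (bddm_itg P bF)) (ExZ _ (bddm_itg P bG)) (ExZ _ (bddm_itg P (bddmM bF bG))).
move: (Ex P _) (Ex P (fun w => tev F _)) (Ex P (fun w => tev G _)) => x y z.
rewrite (_ : _ - _ = 1 / 4 * (x - y * z)); last by field.
rewrite normrM (ger0_norm (_ : 0 <= 1 / 4)); last by lra.
by move: (72 * _) => B; lra.
Qed.

Definition dpsi (F : tpoly R bool) (x : bool -> R) : R := psib x - tev F x.

(** psi is replaced by a finer approximant G and the estimate is applied to G - F. Its constant
    ignores the degree of G, so G may tend to psi. With F empty this is the decorrelation of psi
    itself; with F an approximant it controls the remainder. *)
Lemma psi_decorrelation `{T : measurableType d} (P : probability T R)
    (Z : bool + bool -> T -> R) S (v0 r : R) (F : tpoly R bool) :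
  gvec P Z S -> 0 < v0 <= 1 -> nice v0 (half1 S) -> nice v0 (half2 S) ->
  (forall i j, `|S (inl i) (inr j)| <= r) ->
  teven F -> (forall y, `|tev F y| <= 1) ->
  `|Ex P (fun w => dpsi F (fun i => Z (inl i) w) * dpsi F (fun i => Z (inr i) w)) -
    Ex P (fun w => dpsi F (fun i => Z (inl i) w)) * Ex P (fun w => dpsi F (fun i => Z (inr i) w))|
    <= 4 * (72 * (7 / v0 ^+ 2 * r) ^+ 2).
Proof.
move=> gZ v01 n1 n2 Sr eF F1; pose h := dpsi F; rewrite -/h; have [mZ _ _] := gZ.
have [S1 _ S3] := n1; have [S1' _ S3'] := n2.
apply/ler_addgt0Pr => e e0.
have e16 : 0 < e / 8 by rewrite divr_gt0.
have [G [eG G1 GX]] := psi_approx e16.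
pose h' x := tev (G ++ tscale (- 1) F) x.
have h'E x : h' x = tev G x - tev F x by rewrite /h' tev_cat tev_scale mulN1r.
have hb x : `|h x| <= 2.
  rewrite (le_trans (ler_normB _ _))//; have := F1 x; have := @norm_psi_le1 R (x false) (x true).
  by rewrite /psib; lra.
have hb' x : `|h' x| <= 2.
  by rewrite h'E (le_trans (ler_normB _ _))//; have := F1 x; have := G1 x; lra.
have bh (X : bool -> T -> R) : (forall i, measurable_fun setT (X i)) -> bddm (fun w => h (X^~ w)).
  by move=> mX; apply: bddmB; [exact: bddm_psi | exact: bddm_tev].
have bh' (X : bool -> T -> R) : (forall i, measurable_fun setT (X i)) -> bddm (fun w => h' (X^~ w)).
  by move=> mX; exact: bddm_tev.
have hG x : `|h x - h' x| = `|psib x - tev G x| by rewrite h'E /h /dpsi; congr `|_|; ring.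
have m1 i : measurable_fun setT (Z (inl i)) by [].
have m2 i : measurable_fun setT (Z (inr i)) by [].
have := @cov_approx _ _ P 2 _ _ _ _ (bh _ m1) (bh' _ m1) (bh _ m2) (bh' _ m2)
   (fun w => hb _) (fun w => hb' _) (fun w => hb _) (fun w => hb' _).
under [X in _ <= _ * (Ex _ X + _)]eq_fun do rewrite hG.
under [X in _ <= _ * (_ + Ex _ X)]eq_fun do rewrite hG.
have := GX _ _ _ _ _ (gvec_sub inl gZ) S1 S3; have := GX _ _ _ _ _ (gvec_sub inr gZ) S1' S3'.
have eFG : teven (G ++ tscale (-1) F).
  by rewrite /teven all_cat all_map; apply/andP; split.
have := decorrelation_nice gZ v01 n1 n2 Sr eFG hb' hb'.
rewrite -/h'.
move: (4 * (72 * _)) (Ex P _ - _) => B x x1 x2 x3; move: (Ex P _ - _) => y xy.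
have : `|y| <= `|y - x| + `|x| by rewrite -{1}(subrK x y) ler_normD.
by lra.
Qed.

(** One approximant serves both laws; what is left is continuity of three expectations of fixed
    trigonometric polynomials in the covariance. *)
Lemma psi_cov_cont (e : R) : 0 < e -> exists2 dlt : R, 0 < dlt &
  forall (d d' : measure_display) (T : measurableType d) (T' : measurableType d')
    (P : probability T R) (P' : probability T' R)
    (Z : bool + bool -> T -> R) (Z' : bool + bool -> T' -> R) (S S' : bool + bool -> bool + bool -> R),
  gvec P Z S -> gvec P' Z' S' ->
  S (inl false) (inl false) = 1 -> S (inl true) (inl true) <= 2 ->
  S (inr false) (inr false) = 1 -> S (inr true) (inr true) <= 2 ->
  S' (inl false) (inl false) = 1 -> S' (inl true) (inl true) <= 2 ->
  S' (inr false) (inr false) = 1 -> S' (inr true) (inr true) <= 2 ->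
  (forall i j, `|S i j - S' i j| <= dlt) ->
  `|(Ex P (fun w => psib (fun i => Z (inl i) w) * psib (fun i => Z (inr i) w)) -
     Ex P (fun w => psib (fun i => Z (inl i) w)) * Ex P (fun w => psib (fun i => Z (inr i) w))) -
    (Ex P' (fun w => psib (fun i => Z' (inl i) w) * psib (fun i => Z' (inr i) w)) -
     Ex P' (fun w => psib (fun i => Z' (inl i) w)) * Ex P' (fun w => psib (fun i => Z' (inr i) w)))|
  <= e.
Proof.
move=> e0; have e16 : 0 < e / 16 by rewrite divr_gt0.
have [F [eF F1 FX]] := psi_approx e16.
pose F2 := tmul (temb1 F) (temb2 F : tpoly R (bool + bool)%type).
have [K K0 FK] := tev_Ex_cont F2.
have [K1 K10 FK1] := tev_Ex_cont (temb1 F : tpoly R (bool + bool)%type).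
have [K2 K20 FK2] := tev_Ex_cont (temb2 F : tpoly R (bool + bool)%type).
exists (e / 4 / (1 + K + K1 + K2)).
  by rewrite !divr_gt0// -!addrA ltr_pwDl// !addr_ge0.
move=> d d' T T' P P' Z Z' S S' gZ gZ' s1 s2 s3 s4 s1' s2' s3' s4'.
set dl := e / 4 / _ => SS.
have D0 : 0 < 1 + K + K1 + K2 by rewrite -!addrA ltr_pwDl// !addr_ge0.
have dle : dl * (1 + K + K1 + K2) = e / 4 by rewrite /dl; field; rewrite gt_eqF.
have dl0 : 0 < dl by rewrite /dl !divr_gt0.
have c (d0 : measure_display) (T0 : measurableType d0) (P0 : probability T0 R)
   (Z0 : bool + bool -> T0 -> R) (S0 : bool + bool -> bool + bool -> R) :
   gvec P0 Z0 S0 -> S0 (inl false) (inl false) = 1 -> S0 (inl true) (inl true) <= 2 ->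
   S0 (inr false) (inr false) = 1 -> S0 (inr true) (inr true) <= 2 ->
   `|(Ex P0 (fun w => psib (fun i => Z0 (inl i) w) * psib (fun i => Z0 (inr i) w)) -
     Ex P0 (fun w => psib (fun i => Z0 (inl i) w)) * Ex P0 (fun w => psib (fun i => Z0 (inr i) w))) -
     (Ex P0 (fun w => tev F2 (Z0^~ w)) - Ex P0 (fun w => tev (temb1 F) (Z0^~ w)) * Ex P0 (fun w => tev (temb2 F) (Z0^~ w)))|
   <= e / 4 /\ (`|Ex P0 (fun w => tev (temb1 F) (Z0^~ w))| <= 1 /\ `|Ex P0 (fun w => tev (temb2 F) (Z0^~ w))| <= 1).
  move=> g0 t1 t2 t3 t4; have [m0 _ _] := g0.
  have bp1 : bddm (fun w => psib (fun i => Z0 (inl i) w)) by exact: bddm_psi.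
  have bp2 : bddm (fun w => psib (fun i => Z0 (inr i) w)) by exact: bddm_psi.
  have bF1 : bddm (fun w => tev F (fun i => Z0 (inl i) w)) by apply: (@bddm_tev _ _ _ _ (fun i => Z0 (inl i))).
  have bF2 : bddm (fun w => tev F (fun i => Z0 (inr i) w)) by apply: (@bddm_tev _ _ _ _ (fun i => Z0 (inr i))).
  rewrite (_ : (fun w => tev F2 (Z0^~ w)) = (fun w => tev F (fun i => Z0 (inl i) w) * tev F (fun i => Z0 (inr i) w))); last first.
    by apply/funext => w; rewrite tev_mul tev_emb1 tev_emb2.
  rewrite (_ : (fun w => tev (temb1 F) (Z0^~ w)) = (fun w => tev F (fun i => Z0 (inl i) w))); last first.
    by apply/funext => w; rewrite tev_emb1.
  rewrite (_ : (fun w => tev (temb2 F) (Z0^~ w)) = (fun w => tev F (fun i => Z0 (inr i) w))); last first.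
    by apply/funext => w; rewrite tev_emb2.
  split; last by split; apply: Ex_bdd => //; [case: bF1|case: bF2].
  rewrite (le_trans (@cov_approx _ _ P0 1 _ _ _ _ bp1 bF1 bp2 bF2 _ _ _ _))//; try (by move=> w; exact: norm_psi_le1).
  have := FX _ _ _ _ _ (gvec_sub inl g0) t1 t2; have := FX _ _ _ _ _ (gvec_sub inr g0) t3 t4.
  by move: (Ex P0 _) => x; move: (Ex P0 _) => y; lra.
have [c1 [c1a c1b]] := c _ _ _ _ _ gZ s1 s2 s3 s4.
have [c2 [c2a c2b]] := c _ _ _ _ _ gZ' s1' s2' s3' s4'.
have h1 := FK _ _ _ _ _ _ _ _ _ _ _ gZ gZ' SS.
have h2 := FK1 _ _ _ _ _ _ _ _ _ _ _ gZ gZ' SS.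
have h3 := FK2 _ _ _ _ _ _ _ _ _ _ _ gZ gZ' SS.
move: (Ex P _ - _) c1 => A c1; move: (Ex P' _ - Ex P' (fun w => psib _) * _) c2 => A' c2.
move: (Ex P _) (Ex P' _) h1 c1 c2 => B B' h1 c1 c2.
move: (Ex P _) (Ex P' _) h2 c1a c2a c1 c2 => x x' h2 xa xa' c1 c2.
move: (Ex P _) (Ex P' _) h3 c1b c2b c1 c2 => y y' h3 yb yb' c1 c2.
have p1 : `|x * y - x' * y'| <= K1 * dl + K2 * dl.
  rewrite (_ : _ - _ = (x - x') * y + x' * (y - y')); last by ring.
  rewrite (le_trans (ler_normD _ _))// !normrM lerD//.
    by rewrite (le_trans _ h2)// ler_piMr.
  by rewrite (le_trans _ h3)// ler_piMl.
rewrite (_ : A - A' = (A - (B - x * y)) - (A' - (B' - x' * y')) + (B - B') - (x * y - x' * y')); last by ring.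
rewrite (le_trans (ler_normB _ _))//.
have := ler_normD (A - (B - x * y) - (A' - (B' - x' * y'))) (B - B').
have := ler_normB (A - (B - x * y)) (A' - (B' - x' * y')).
have : dl * (1 + K + K1 + K2) = dl + K * dl + K1 * dl + K2 * dl by ring.
by lra.
Qed.

(** The two laws are known through characteristic functions only, so equality is obtained for
    trigonometric polynomials and carried to psi by [psi_approx]. It allows any pair to be replaced
    by a convenient realization. *)
Lemma Ex_psi_law (d d' : measure_display) (T : measurableType d) (T' : measurableType d')
    (P : probability T R) (P' : probability T' R)
    (X : bool -> T -> R) (X' : bool -> T' -> R) (S S' : bool -> bool -> R) :
  gvec P X S -> gvec P' X' S' -> S false false = 1 -> S true true <= 2 -> (forall i j, S i j = S' i j) ->
  Ex P (fun w => psib (X^~ w)) = Ex P' (fun w => psib (X'^~ w)).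
Proof.
move=> gX gX' S1 S2 SS; have [mX _ _] := gX; have [mX' _ _] := gX'.
apply/eqP; rewrite -subr_eq0 -normr_le0; apply/ler_addgt0Pr => e e0; rewrite add0r.
have e2 : 0 < e / 2 by rewrite divr_gt0.
have [F [eF F1 FX]] := psi_approx e2.
have h (d0 : measure_display) (T0 : measurableType d0) (P0 : probability T0 R) (X0 : bool -> T0 -> R) S0 :
  gvec P0 X0 S0 -> S0 false false = 1 -> S0 true true <= 2 ->
  `|Ex P0 (fun w => psib (X0^~ w)) - Ex P0 (fun w => tev F (X0^~ w))| <= e / 2.
  move=> g0 s1 s2; have [m0 _ _] := g0.
  have b1 : bddm (fun w => psib (X0^~ w)) by exact: bddm_psi.
  have b2 : bddm (fun w => tev F (X0^~ w)) by exact: bddm_tev.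
  rewrite -(ExB (bddm_itg P0 b1) (bddm_itg P0 b2)).
  by rewrite (le_trans (Ex_norm (bddm_itg P0 (bddmB b1 b2))))//; exact: FX g0 s1 s2.
have h1 := h _ _ _ _ _ gX S1 S2.
have h2 : `|Ex P' (fun w => psib (X'^~ w)) - Ex P' (fun w => tev F (X'^~ w))| <= e / 2.
  by apply: h gX' _ _; rewrite -SS.
have [K _ FK] := tev_Ex_cont F.
have := FK _ _ _ _ _ _ _ _ _ _ 0 gX gX'.
rewrite mulr0 => /(_ _)/wrap[]; first by move=> i j; rewrite SS subrr normr0.
rewrite normr_le0 subr_eq0 => /eqP e3; rewrite e3 in h1.
move: h1 h2; rewrite !ler_norml; lra.
Qed.

End Laws.
Lemma is_derive_ext {R : realType} (x : R) (f g : R -> R) (a b : R) :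
  f =1 g -> a = b -> is_derive x (1 : R) f a -> is_derive x (1 : R) g b.
Proof. by move=> /funext -> ->. Qed.

(** * Closed form of the mean of psi, and Lambda_2 *)

Section CauchyRatio.
Context {R : realType}.
Local Notation mu := (@lebesgue_measure R).

(** Coupling: both pairs are realized as (x, b x + v g) with the same independent standard normal x
    and g, and psi is then compared pointwise. *)
Lemma Ex_psi_lip (d d' : measure_display) (T : measurableType d) (T' : measurableType d')
    (P : probability T R) (P' : probability T' R)
    (X : bool -> T -> R) (X' : bool -> T' -> R) (S S' : bool -> bool -> R) (v v' : R) :
  gvec P X S -> gvec P' X' S' -> S false false = 1 -> S' false false = 1 ->
  S true true <= 2 -> S' true true <= 2 ->
  0 < v -> S true true = S false true ^+ 2 + v ^+ 2 -> S' true true = S' false true ^+ 2 + v' ^+ 2 ->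
  `|Ex P (fun w => psib (X^~ w)) - Ex P' (fun w => psib (X'^~ w))| <=
    2 * `|S false true - S' false true| + 3 / v * `|v - v'|.
Proof.
move=> gX gX' s0 s0' s1 s1' vp sv sv'.
have [_ sS _] := gX; have [_ sS' _] := gX'.
set b := S false true; set b' := S' false true.
pose Q := (@gam R \x @gam R)%E.
have gQ := gvec_prod (@gvec_gam R) (@gvec_gam R).
pose A (b v : R) (i : bool) (k : unit + unit) : R := match i, k with
  | false, inl _ => 1 | false, inr _ => 0 | true, inl _ => b | true, inr _ => v end.
pose Y (b v : R) (i : bool) (z : measurableTypeR R * measurableTypeR R) : R :=
  if i then b * z.1 + v * z.2 else z.1.
have gY c u : gvec Q (Y c u) (fun i j => match i, j with
   | false, false => 1 | true, true => c ^+ 2 + u ^+ 2 | _, _ => c end).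
  have := gvec_lin (A c u) gQ; apply: eq_gvec.
    by case=> z; rewrite /dot big_sumType/= !sum_unit /Y /A/=; ring.
  by case=> -[]; rewrite /qform big_sumType/= !sum_unit !big_sumType/= !sum_unit /A /=; ring.
rewrite (@Ex_psi_law _ _ _ _ _ P Q X (Y b v) _ _ gX (gY b v))//; last first.
  by case=> -[]//; rewrite sS.
rewrite (@Ex_psi_law _ _ _ _ _ P' Q X' (Y b' v') _ _ gX' (gY b' v'))//; last first.
  by case=> -[]//; rewrite sS'.
have [mY _ _] := gY b v; have [mY' _ _] := gY b' v'.
have b1 : bddm (fun w => psib ((Y b v)^~ w)) by exact: bddm_psi.
have b2 : bddm (fun w => psib ((Y b' v')^~ w)) by exact: bddm_psi.
rewrite -(ExB (bddm_itg Q b1) (bddm_itg Q b2)).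
have [mB _] := bddmB b1 b2.
apply: Ex_bdd; first exact: mB.
case=> x g; rewrite /psib /Y /=.
have bb : `|b| <= 3 / 2.
  rewrite -(@ler_pXn2r _ 2)// ?nnegrE// real_normK ?num_real//.
  by have := sqr_ge0 v; rewrite /b; move: sv s1; lra.
(* On x = 0 psi is 1 for every y, at y = 0 by convention. *)
have [->|x0] := eqVneq x 0.
  have p1 (y : R) : psi 0 y = 1.
    rewrite /psi eqxx/=; have [//|y0] := eqVneq y 0.
    by rewrite normr0 !add0r divff// normr_eq0.
  by rewrite !p1 subrr normr0 addr_ge0// mulr_ge0// divr_ge0// ltW.
have xp : 0 < `|x| by rewrite normr_gt0.
rewrite (le_trans (psi_lip _ _ x0))//.
set y := b * x + v * g; set y' := b' * x + v' * g.
have D1 : 0 < `|x| + `|y| by rewrite ltr_wpDr.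
have D2 : 0 < `|x| + `|y'| by rewrite ltr_wpDr.
rewrite ler_pdivrMr ?mulr_gt0//.
have yy : `|y - y'| <= `|b - b'| * `|x| + `|v - v'| * `|g|.
  rewrite -!normrM (le_trans _ (ler_normD _ _))//.
  by rewrite le_eqVlt; apply/orP; left; apply/eqP; congr `|_|; rewrite /y /y'; ring.
(* From v g = y - b x and |b| <= 3/2: the unbounded factor |g| is absorbed by the denominator |x| +
   |y|. *)
have gg : v * `|g| <= 3 / 2 * (`|x| + `|y|).
  have : `|v * g| <= `|y| + `|b| * `|x|.
    by rewrite -normrM (_ : v * g = y - b * x) ?ler_normB// /y; ring.
  rewrite normrM (gtr0_norm vp) => h.
  have : `|b| * `|x| <= 3 / 2 * `|x| by rewrite ler_wpM2r.
  by have := normr_ge0 y; lra.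
have gg' : `|g| <= 3 / 2 / v * (`|x| + `|y|).
  by rewrite (_ : 3 / 2 / v * _ = 3 / 2 * (`|x| + `|y|) / v) ?ler_pdivlMr 1?mulrC//; ring.
have hx : `|x| <= `|x| + `|y| by rewrite lerDl.
have hx' : `|x| <= `|x| + `|y'| by rewrite lerDl.
have k1 : `|y - y'| <= (`|b - b'| + 3 / 2 / v * `|v - v'|) * (`|x| + `|y|).
  rewrite (le_trans yy)// mulrDl lerD ?ler_wpM2l//.
  by rewrite (_ : 3 / 2 / v * _ * _ = `|v - v'| * (3 / 2 / v * (`|x| + `|y|))) ?ler_wpM2l//; ring.
have k2 : `|y - y'| * `|x| <= (`|b - b'| + 3 / 2 / v * `|v - v'|) * (`|x| + `|y|) * (`|x| + `|y'|).
  by rewrite ler_pM.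
rewrite (_ : (2 * _ + _) * _ = 2 * ((`|b - b'| + 3 / 2 / v * `|v - v'|) * (`|x| + `|y|) * (`|x| + `|y'|))); last first.
  by field; rewrite gt_eqF.
by rewrite -mulrA ler_pM2l.
Qed.

(** Mean of min (1, t |s|) for a standard Cauchy variable s. *)
Definition Lam (t : R) : R := (t * ln (1 + t ^- 2) + 2 * atan t) / pi.

Lemma pdf01E (x : R) : normal_pdf 0 1 x = (sqrtr (pi *+ 2))^-1 * expR (- x ^+ 2 / 2).
Proof.
rewrite normal_pdfE ?oner_eq0// /normal_peak /normal_fun expr1n mul1r subr0.
by rewrite mulr2n.
Qed.

Lemma pdf01M (x y : R) : normal_pdf 0 1 x * normal_pdf 0 1 y =
  (pi *+ 2)^-1 * expR (- (x ^+ 2 + y ^+ 2) / 2).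
Proof.
rewrite !pdf01E mulrACA -expRD -invfM -expr2 sqr_sqrtr; last by rewrite mulrn_wge0// pi_ge0.
by congr (_ * expR _); field.
Qed.

Lemma int_abs_gauss (c : R) : 0 < c ->
  (\int[mu]_v (`|v| * expR (- (c * v ^+ 2) / 2))%:E = (2 / c)%:E)%E.
Proof.
move=> c0; pose f (v : R) : R := `|v| * expR (- (c * v ^+ 2) / 2).
have ce : continuous (fun v : R => expR (- (c * v ^+ 2) / 2)).
  move=> v; apply: (@continuous_comp _ _ _ (fun v : R => - (c * v ^+ 2) / 2) expR); last exact: continuous_expR.
  apply: cvgM; last exact: cvg_cst.
  by apply: cvgN; apply: cvgM; [exact: cvg_cst | apply: cvgM; exact: cvg_id].
have cf : continuous f.
  by move=> v; apply: cvgM; [exact: norm_continuous | exact: ce].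
have f0 v : 0 <= f v by rewrite mulr_ge0// expR_ge0.
rewrite (ge0_symfun_integralT f0 cf); last by move=> v; rewrite /f /= normrN sqrrN.
rewrite (_ : [set x | _] = `[0, +oo[%classic); last first.
  by apply/seteqP; split => x/=; rewrite in_itv/= andbT.
pose F (v : R) : R := - c^-1 * expR (- (c * v ^+ 2) / 2).
have dF (v : R) : is_derive v (1 : R) F (v * expR (- (c * v ^+ 2) / 2)).
  by apply: is_derive_eq; rewrite /GRing.scale/=; field; rewrite gt_eqF.
rewrite (@ge0_continuous_FTC2y R f F 0 0).
- rewrite -EFinB -EFinM; congr (_%:E).
  by rewrite /F expr0n/= mulr0 oppr0 mul0r expR0; field; rewrite gt_eqF.
- by [].
- exact: continuous_subspaceT.
- pose a := sqrtr (c / 2).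
  have a0 : 0 < a by rewrite sqrtr_gt0 divr_gt0.
  rewrite (_ : F = (fun v => - c^-1 * (gauss_fun ((fun x => - c^-1 * 0 + a * x) v)))); last first.
    apply/funext => v; rewrite /F /gauss_fun; congr (_ * expR _).
    by rewrite mulr0 add0r exprMn sqr_sqrtr ?divr_ge0 ?ltW//; field.
  rewrite -[X in _ --> X](mulr0 (- c^-1)); apply: cvgM; first exact: cvg_cst.
  by apply: cvg_comp (@cvg_gauss_fun R); exact: (cvgy_affine (- c^-1 * 0) a0).
- by move=> v _; case: (dF v).
- apply: cvg_at_right_filter; rewrite /F; apply: cvgM; [exact: cvg_cst | exact: ce].
- move=> v; rewrite in_itv/= andbT => v0; rewrite derive1E; have [_ ->] := dF v.
  by rewrite /f gtr0_norm.
Qed.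

(** By symmetry the integral is twice that over the half-line, which is cut at 1/t: below, the
    integrand t s / (pi (1 + s^2)) gives the logarithm; above, the Cauchy density gives the
    arctangent. *)
Lemma int_min_cauchy (t : R) : 0 < t ->
  (\int[mu]_s (minr 1 (t * `|s|) * (pi * (1 + s ^+ 2))^-1)%:E = (Lam t)%:E)%E.
Proof.
move=> t0; pose k (s : R) : R := (pi * (1 + s ^+ 2))^-1.
have pi0 := pi_gt0 R.
have q0 (s : R) : 0 < 1 + s ^+ 2 by rewrite ltr_pwDl// sqr_ge0.
have ck : continuous k.
  move=> s; apply: cvgV; first by rewrite mulf_neq0// gt_eqF.
  apply: cvgM; first exact: cvg_cst.
  by apply: cvgD; [exact: cvg_cst | apply: cvgM; exact: cvg_id].
pose f (s : R) : R := minr 1 (t * `|s|) * k s.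
have cf : continuous f.
  move=> s; apply: cvgM; last exact: ck.
  apply: (@continuous_min R R (fun=> 1) (fun s => t * `|s|)); first exact: cvg_cst.
  by apply: cvgM; [exact: cvg_cst | exact: norm_continuous].
have k0 s : 0 < k s by rewrite invr_gt0 mulr_gt0.
have f0 s : 0 <= f s.
  by rewrite mulr_ge0 ?(ltW (k0 s))// le_min ler01 mulr_ge0// ltW.
rewrite (ge0_symfun_integralT f0 cf); last by move=> v; rewrite /f /k /= normrN sqrrN.
rewrite (_ : [set x | _] = `[0, t^-1[%classic `|` `[t^-1, +oo[%classic); last first.
  have ti : 0 < t^-1 by rewrite invr_gt0.
  apply/seteqP; split => x/=; rewrite !in_itv/= !andbT.
    by move=> ->; have [h|h] := leP t^-1 x; [right|left].
  by case=> [/andP[]//|]; apply: le_trans; exact: ltW.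
rewrite ge0_integral_setU//=; last 3 first.
- by apply/measurable_EFinP; apply: measurable_funTS; exact: continuous_measurable_fun.
- by move=> x _; rewrite lee_fin.
- apply/disj_setPS => x /=; rewrite !in_itv/= andbT => -[/andP[_ h1] h2].
  by move: h1; rewrite ltNge h2.
rewrite integral_itv_bndo_bndc; last first.
  by apply/measurable_EFinP; apply: measurable_funTS; exact: continuous_measurable_fun.
have ti : 0 < t^-1 by rewrite invr_gt0.
pose F (s : R) : R := t / (2 * pi) * ln (1 + s ^+ 2).
have dF (s : R) : is_derive s (1 : R) F (t * s * k s).
  have dl := is_derive1_ln (q0 s).
  have d1 : is_derive s (1 : R) (fun s => 1 + s ^+ 2) (2 * s).
    by apply: is_derive_eq; rewrite /GRing.scale/=; ring.
  have := @is_derive1_comp R (@ln R) (fun s : R => 1 + s ^+ 2) s _ _ dl d1 => d2.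
  have := is_deriveZ (t / (2 * pi)) d2.
  apply: is_derive_ext => //; rewrite /GRing.scale/= /k.
  have e (p q : R) : 0 < p -> 0 < q -> t / (2 * p) * (q^-1 * (2 * s)) = t * s * (p * q)^-1.
    by move=> p0 q0'; field; rewrite !gt_eqF.
  exact: e.
have cF : continuous F by move=> s; apply/differentiable_continuous/derivable1_diffP; case: (dF s).
rewrite (@continuous_FTC2 R f F 0 t^-1 ti); last 3 first.
- exact: continuous_subspaceT.
- split; [by move=> s _; case: (dF s) | by apply: cvg_at_right_filter; exact: cF | by apply: cvg_at_left_filter; exact: cF].
- move=> s; rewrite in_itv/= => /andP[s0 st]; rewrite derive1E; have [_ ->] := dF s.
  rewrite /f (gtr0_norm s0) min_r//.
  by rewrite mulrC -ler_pdivlMr// div1r ltW.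
(* This antiderivative vanishes at infinity and takes the value - atan t / pi at 1/t. *)
pose G (s : R) : R := - atan s^-1 / pi.
have dG (s : R) : 0 < s -> is_derive s (1 : R) G (k s).
  move=> s0; have sn : s != 0 by rewrite gt_eqF.
  have d1 : is_derive s (1 : R) (fun s => s^-1) (- s ^- 2).
    by have := is_deriveV sn (is_derive_id s 1); apply: is_derive_ext => //; rewrite /GRing.scale/= mulr1.
  have d2 := @is_derive1_comp R (@atan R) (fun s : R => s^-1) s _ _ (is_derive1_atan _) d1.
  have := is_deriveZ (- pi^-1) d2.
  apply: is_derive_ext; [by move=> x; rewrite /G/= /GRing.scale/=; ring | rewrite /GRing.scale/= /k].
  have e (p : R) : 0 < p -> - p^-1 * ((1 + s^-1 ^+ 2)^-1 * - s ^- 2) = (p * (1 + s ^+ 2))^-1.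
    move=> p0; field; have := q0 s; rewrite addrC => h.
    by rewrite sn !gt_eqF//= addrC.
  exact: e.
rewrite (@ge0_continuous_FTC2y R f G t^-1 0).
- rewrite -EFinB sub0e -EFinN -EFinD -EFinM; congr (_%:E).
  rewrite /F /G /Lam invrK expr0n/= addr0 ln1 exprVn.
  move: (pi : R) pi0 (ln _) (atan _) => p p0 x y; field.
  by rewrite gt_eqF.
- by [].
- exact: continuous_subspaceT.
- rewrite -(mul0r pi^-1) -oppr0 -atan0; apply: cvgM; last exact: cvg_cst.
  apply: cvgN; apply: (cvg_comp (fun s : R => s^-1) (@atan R)); last exact: continuous_atan.
  by apply/gtr0_cvgV0; [exact: nbhs_pinfty_gt | exact: cvg_id].
- by move=> s ts; case: (dG s (lt_trans ti ts)).
- by apply: cvg_at_right_filter; apply/differentiable_continuous/derivable1_diffP; case: (dG _ ti).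
- move=> s; rewrite in_itv/= andbT => ts; have s0 := lt_trans ti ts.
  rewrite derive1E; have [_ ->] := dG s s0.
  rewrite /f (gtr0_norm s0) min_l ?mul1r//.
  by rewrite mulrC -ler_pdivrMr// div1r ltW.
Qed.

End CauchyRatio.
Section PsiLam.
Context {R : realType}.
Local Notation mu := (@lebesgue_measure R).

(** As |x| + |y| = max (|x + y|, |x - y|), psi is the minimum of 1 and |x + y| / |x - y|; the
    arguments are chosen with x + y = a u and x - y = b v. *)
Lemma psi_polar (a b u v : R) : 0 < a -> 0 < b ->
  psi ((a * u + b * v) / 2) ((a * u - b * v) / 2) =
  if v == 0 then 1 else minr 1 (a / b * `|u| / `|v|).
Proof.
move=> a0 b0; set x := _ / 2; set y := _ / 2.
have xy : x + y = a * u by rewrite /x /y; field.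
have [v0|v0] := eqVneq v 0.
  have -> : y = x by rewrite /x /y v0 !mulr0 subr0 addr0.
  rewrite /psi; have [_|x0] := eqVneq x 0; first by [].
  have -> : x + x = 2 * x by ring.
  have -> : `|x| + `|x| = 2 * `|x| by ring.
  by rewrite /= normrM (ger0_norm (_ : 0 <= 2))// divff// mulf_neq0// normr_eq0.
have yx : x - y = b * v by rewrite /x /y; field.
have v0' : 0 < `|v| by rewrite normr_gt0.
have nxy : (x == 0) && (y == 0) = false.
  apply/negP => /andP[/eqP x0 /eqP y0]; move: yx; rewrite x0 y0 subr0 => /esym/eqP.
  by rewrite mulf_eq0 (negbTE v0) gt_eqF.
rewrite /psi nxy xy.
have e1 : `|a * u| = a * `|u| by rewrite normrM gtr0_norm.
have -> : `|x| + `|y| = maxr (a * `|u|) (b * `|v|).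
  rewrite -e1 -(gtr0_norm b0) -normrM -xy -yx.
  case: (ger0P (x + y)) => h1; case: (ger0P (x - y)) => h2;
  case: (ger0P x) => h3; case: (ger0P y) => h4;
  case: leP => h5; lra.
rewrite e1; have bv : 0 < b * `|v| by rewrite mulr_gt0.
have e2 : a / b * `|u| / `|v| = a * `|u| / (b * `|v|) by field; rewrite !gt_eqF.
rewrite e2; have [h|h] := leP (a * `|u|) (b * `|v|).
  by rewrite min_r// ler_pdivrMr// mul1r.
rewrite min_l; last by rewrite ler_pdivlMr// mul1r ltW.
by rewrite divff// gt_eqF// (lt_trans bv).
Qed.

Lemma continuous_abs_gauss (c : R) : continuous (fun v : R => `|v| * expR (- (c * v ^+ 2) / 2)).
Proof.
move=> v; apply: cvgM; first exact: norm_continuous.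
apply: (@continuous_comp _ _ _ (fun v : R => - (c * v ^+ 2) / 2) expR); last exact: continuous_expR.
apply: cvgM; last exact: cvg_cst.
by apply: cvgN; apply: cvgM; [exact: cvg_cst | apply: cvgM; exact: cvg_id].
Qed.

Definition minratio (t v u : R) : R :=
  if v == 0 then 1 else minr 1 (t * `|u| / `|v|).

(** The quotient of two independent standard normal variables is Cauchy: substitute u = |v| s for
    fixed v, exchange the integrals, and integrate v out by [int_abs_gauss]. *)
Lemma gam_min_ratio (t : R) : 0 < t ->
  measurable_fun setT (fun v : measurableTypeR R => Ex gam (minratio t v)) ->
  Ex gam (fun v => Ex gam (minratio t v)) = Lam t.
Proof.
move=> t0; set I := (fun v => _) => mI.
have tu0 (v u : R) : 0 <= minr 1 (t * `|u| / `|v|).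
  by rewrite le_min ler01/= divr_ge0// mulr_ge0// ltW.
have I0 v : 0 <= I v by apply: Ex_ge0 => u; rewrite /minratio; case: eqP.
pose E (s v : R) : R := (pi *+ 2)^-1 * (`|v| * expR (- ((1 + s ^+ 2) * v ^+ 2) / 2)).
have E0 s v : 0 <= E s v.
  by apply: mulr_ge0; [rewrite invr_ge0; apply: mulrn_wge0; exact: pi_ge0 | apply: mulr_ge0 => //; exact: expR_ge0].
have m0 s : 0 <= minr 1 (t * `|s|) by rewrite le_min ler01 mulr_ge0// ltW.
pose g (z : R * R) : \bar R := (minr 1 (t * `|z.2|) * E z.2 z.1)%:E.
have mfst : measurable_fun setT (fun z : measurableTypeR R * measurableTypeR R => z.1 : R) by exact: measurable_fst.
have msnd : measurable_fun setT (fun z : measurableTypeR R * measurableTypeR R => z.2 : R) by exact: measurable_snd.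
have mg : measurable_fun setT (g : measurableTypeR R * measurableTypeR R -> \bar R).
  apply/measurable_EFinP; apply: measurable_funM.
    apply: measurable_minr; first exact: measurable_cst.
    by apply: measurable_funM => //; exact: measurableT_comp.
  apply: measurable_funM => //; apply: measurable_funM; first exact: measurableT_comp.
  apply: measurableT_comp => //; apply: measurable_funM => //; apply: measurableT_comp => //.
  apply: measurable_funM; last exact: measurable_funX.
  by apply: measurable_funD => //; exact: measurable_funX.
have g0 z : (0 <= g z)%E by rewrite lee_fin mulr_ge0.
(* The substitution fails only at v = 0, a null set. *)
have key (v : R) : v != 0 -> ((I v * normal_pdf 0 1 v)%:E = \int[mu]_s g (v, s))%E.
  move=> v0; have v0' : 0 < `|v| by rewrite normr_gt0.
  pose h (u : R) : R := minr 1 (t * `|u| / `|v|).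
  have ch : continuous h.
    move=> s; apply: (@continuous_min R R (fun=> 1) (fun s => t * `|s| / `|v|)); first exact: cvg_cst.
    apply: cvgM; last exact: cvg_cst.
    by apply: cvgM; [exact: cvg_cst | exact: norm_continuous].
  have h0 u : 0 <= h u by exact: tu0.
  have bh : bddm (h : measurableTypeR R -> R).
    split; first exact: continuous_measurable_fun.
    by exists 1 => u; rewrite ger0_norm// ge_min lexx.
  have -> : I v = Ex gam h by rewrite /I; congr Ex; apply/funext => u; rewrite /minratio (negbTE v0).
  rewrite EFinM /Ex /Rintegral fineK; last by apply: integrable_fin_num => //; exact: bddm_itg.
  rewrite (ge0_integral_normal_cont 0 1 ch h0).
  pose G (u : R) := h u * normal_pdf 0 1 u.
  have cG : continuous G.
    by move=> x; apply: cvgM; [exact: ch | apply: continuous_normal_pdf; exact: oner_neq0].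
  have G0 x : 0 <= G x by rewrite mulr_ge0// normal_pdf_ge0.
  rewrite (@ge0_integral_affine _ 0 `|v| G)// muleC -ge0_integralZl_EFin//.
  - apply: eq_integral => s _; rewrite -EFinM /g /=; congr (_%:E).
    rewrite /G add0r (_ : h (`|v| * s) = minr 1 (t * `|s|)); last first.
      by rewrite /h normrM normr_id; congr minr; field; rewrite gt_eqF.
    rewrite (_ : normal_pdf 0 1 v * (_ * _ * _) = minr 1 (t * `|s|) * (`|v| * (normal_pdf 0 1 (`|v| * s) * normal_pdf 0 1 v))); last by ring.
    congr (_ * _); rewrite pdf01M /E mulrCA; congr (_ * (_ * expR _)).
    rewrite exprMn real_normK ?num_real//; ring.
  - by move=> s _; rewrite lee_fin mulr_ge0.
  - apply/measurable_EFinP; apply: measurable_funM => //; apply: continuous_measurable_fun => x.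
    by apply: (@continuous_comp _ _ _ (fun x => 0 + `|v| * x) G); [exact: continuous_affine | exact: cG].
  - exact: normal_pdf_ge0.
have h1 : (\int[gam]_v (I v)%:E = (Lam t)%:E)%E.
  rewrite (@ge0_integral_normal_prob R 0 1 (EFin \o I)); last 2 first.
  - exact/measurable_EFinP.
  - by move=> x; rewrite lee_fin.
  transitivity (\int[mu]_v \int[mu]_s g (v, s))%E.
    apply: ae_eq_integral => //.
    - apply: emeasurable_funM; first exact/measurable_EFinP.
      by apply/measurable_EFinP; exact: measurable_normal_pdf.
    - exact: (@measurable_fun_fubini_tonelli_F _ _ _ _ _ mu).
    - exists [set 0]; split; [exact: measurable_set1 | exact: lebesgue_measure_set1|].
      move=> v /= nv; apply/eqP; apply: contra_notT nv => v0 _.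
      by rewrite -EFinM; exact: key.
  rewrite (@fubini_tonelli _ _ _ _ _ mu mu g mg g0).
  rewrite -(int_min_cauchy t0); apply: eq_integral => s _.
  have c0 : 0 < 1 + s ^+ 2 by rewrite ltr_pwDl// sqr_ge0.
  rewrite (_ : (minr 1 (t * `|s|) / (pi * (1 + s ^+ 2)))%:E =
    ((minr 1 (t * `|s|) / (pi *+ 2))%:E * (2 / (1 + s ^+ 2))%:E)%E); last first.
    rewrite -EFinM; congr (_%:E); rewrite mulr2n -mulr2n -mulr_natl.
    move: (pi : R) (pi_gt0 R) (minr _ _) => p p0 x; field.
    by rewrite !gt_eqF.
  rewrite -(int_abs_gauss c0) -ge0_integralZl_EFin//.
  - by apply: eq_integral => v _; rewrite /g /E /= -EFinM; congr (_%:E); ring.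
  - by apply/measurable_EFinP; apply: continuous_measurable_fun; exact: continuous_abs_gauss.
  - by apply: mulr_ge0 => //; rewrite invr_ge0; apply: mulrn_wge0; exact: pi_ge0.
by rewrite /Ex /Rintegral h1.
Qed.

(** Sum and difference of the two components are independent, with variances 2 (1 + r) and 2 (1 -
    r); the pair is realized through them and [psi_polar] applies. *)
Lemma Ex_psi_Lam (d : measure_display) (T : measurableType d) (P : probability T R)
    (X : bool -> T -> R) (S : bool -> bool -> R) (r : R) :
  gvec P X S -> S false false = 1 -> S true true = 1 -> S false true = r -> -1 < r < 1 ->
  Ex P (fun w => psib (X^~ w)) = Lam (sqrtr (2 * (1 + r)) / sqrtr (2 * (1 - r))).
Proof.
move=> gX s0 s1 sr /andP[r0 r1]; have [_ sS _] := gX.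
pose a := sqrtr (2 * (1 + r)); pose b := sqrtr (2 * (1 - r)).
have a0 : 0 < a by rewrite sqrtr_gt0; lra.
have b0 : 0 < b by rewrite sqrtr_gt0; lra.
have a2 : a ^+ 2 = 2 * (1 + r) by rewrite sqr_sqrtr//; lra.
have b2 : b ^+ 2 = 2 * (1 - r) by rewrite sqr_sqrtr//; lra.
pose Q := (@gam R \x @gam R)%E.
have gQ := gvec_prod (@gvec_gam R) (@gvec_gam R).
pose A (i : bool) (k : unit + unit) : R := match i, k with
  | false, inl _ => b / 2 | false, inr _ => a / 2 | true, inl _ => - b / 2 | true, inr _ => a / 2 end.
pose Y (i : bool) (z : measurableTypeR R * measurableTypeR R) : R :=
  if i then (a * z.2 - b * z.1) / 2 else (a * z.2 + b * z.1) / 2.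
have gY : gvec Q Y S.
  have := gvec_lin A gQ; apply: eq_gvec.
    by case=> z; rewrite /dot big_sumType/= !sum_unit /Y /A/=; field.
  have e1 : b ^+ 2 / 4 + a ^+ 2 / 4 = 1 by rewrite a2 b2; field.
  have e2 : a ^+ 2 / 4 - b ^+ 2 / 4 = r by rewrite a2 b2; field.
  have s2 : S true false = r by rewrite sS.
  case=> -[]; rewrite /qform big_sumType/= !sum_unit !big_sumType/= !sum_unit /A /=.
  - by rewrite s1 -[RHS]e1; field.
  - by rewrite s2 -[RHS]e2; field.
  - by rewrite sr -[RHS]e2; field.
  - by rewrite s0 -[RHS]e1; field.
rewrite (@Ex_psi_law _ _ _ _ _ P Q X Y _ _ gX gY)// ?s1 ?ler1n//.
have [mY _ _] := gY.
have bq : bddm (fun w => psib (Y^~ w)) by exact: bddm_psi.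
rewrite (Ex_prodE _ _ bq).
have qE z u : psib (Y^~ (z, u)) = if z == 0 then 1 else minr 1 (a / b * `|u| / `|z|).
  by rewrite /psib /Y /= psi_polar.
have EE : (fun x => Ex gam (fun y => psib (Y^~ (x, y)))) =
   (fun v => Ex gam (minratio (a / b) v)).
  by apply/funext => v; congr Ex; apply/funext => u; rewrite qE.
have := bddm_Ex2 gam gam bq; rewrite EE => -[mE _].
by rewrite gam_min_ratio// divr_gt0.
Qed.

End PsiLam.
Lemma is_deriveV1 {R : realType} (f : R -> R) (x df : R) : f x != 0 ->
  is_derive x (1 : R) f df -> is_derive x (1 : R) (fun y => (f y)^-1) (- (f x) ^- 2 * df).
Proof. by move=> fx fd; exact: is_deriveV. Qed.

Lemma derivable_lip_at {R : realType} (f : R -> R) (x : R) : derivable f x 1 ->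
  exists K dl : R, [/\ 0 <= K, 0 < dl & forall y, `|y - x| < dl -> `|f y - f x| <= K * `|y - x|].
Proof.
move=> /cvg_ex[l] /cvgrPdist_lt /(_ _ ltr01) H.
have /nbhs_ballP[dl /= dl0 hd] := H.
exists (`|l| + 1), dl; split => // y yx.
have [->|yn] := eqVneq y x; first by rewrite !subrr normr0 mulr0.
have t0 : y - x != 0 by rewrite subr_eq0.
have yb : ball (0 : R) dl (y - x) by rewrite -ball_normE /= sub0r normrN.
have := hd _ yb t0.
rewrite /GRing.scale/= mulr1 subrK => h.
have {h} : `|(y - x)^-1 * (f y - f x)| <= `|l| + 1.
  move: h; move: (_^-1 * _) => z h; have := ler_normB l (l - z).
  by rewrite opprB addrC subrK; lra.
by rewrite normrM normfV mulrC ler_pdivrMr ?normr_gt0.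
Qed.

(** * Monotonicity and smoothness of Lambda_2 and of its inverse *)

Section Lambda.
Context {R : realType}.

Lemma is_derive_Lam (t : R) : 0 < t -> is_derive t (1 : R) Lam (ln (1 + t ^- 2) / pi).
Proof.
move=> t0; have tn : t != 0 by rewrite gt_eqF.
have q0 : 0 < 1 + t ^- 2 by rewrite addr_gt0// invr_gt0 exprn_gt0.
have d1 : is_derive t (1 : R) (fun t => 1 + t ^- 2) (- 2 * t ^- 3).
  have dt : is_derive t (1 : R) (fun t : R => t ^+ 2) (2 * t).
    by apply: is_derive_eq; rewrite /GRing.scale/=; ring.
  have t2 : t ^+ 2 != 0 by rewrite expf_neq0.
  have := @is_deriveV1 R (fun t : R => t ^+ 2) t _ t2 dt => d2; have := is_deriveD (is_derive_cst (1 : R) t 1) d2.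
  by apply: is_derive_ext => //; rewrite /GRing.scale/= add0r; field.
have d2 := @is_derive1_comp R (@ln R) (fun t : R => 1 + t ^- 2) t _ _ (is_derive1_ln q0) d1.
have d3 := is_deriveM (is_derive_id t (1 : R)) d2.
have d4 := is_deriveZ (2 : R) (is_derive1_atan t).
have := is_deriveZ (pi^-1 : R) (is_deriveD d3 d4).
apply: is_derive_ext; first by move=> x; rewrite /Lam/= /GRing.scale/= mulrC.
rewrite /GRing.scale/= mulrC; congr (_ * _).
move: (ln _) => l; field; rewrite tn gt_eqF ?ltr_pwDr ?exprn_gt0//=.
Qed.

(** A = 4^h and C = 9^h. With r the lag-1 correlation of second-order increments, N / M = (1 + r) /
    (1 - r), and K = N' M - N M' is the numerator of its derivative. *)
Let A (h : R) : R := expR (2 * h * ln 2).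
Let C (h : R) : R := expR (2 * h * ln 3).
Let N (h : R) : R := 1 + 2 * A h - C h.
Let M (h : R) : R := 15 - 6 * A h + C h.
Let K (h : R) : R := 4 * (A h * (2 * ln 2) * (9 - C h) - C h * (2 * ln 3) * (4 - A h)).

Definition Lam2 (h : R) : R := Lam (sqrtr (N h / M h)).
Definition dLam2 (h : R) : R :=
  ln (1 + (N h / M h)^-1) / pi * (K h / M h ^+ 2 / (2 * sqrtr (N h / M h))).

Let l2 : 0 < ln 2 :> R. Proof. by rewrite ln_gt0// ltr1n. Qed.
Let l23 : ln 2 < ln 3 :> R. Proof. by rewrite ltr_ln ?posrE// ltr_nat. Qed.
Let l34 : ln 3 < 2 * ln 2 :> R.
Proof. by rewrite mulrDl mul1r -lnM ?posrE// ltr_ln ?posrE// -natrM ltr_nat. Qed.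

(** N, M and K all vanish at h = 1, so the powers are rewritten in terms of 1 - h. *)
Let exp_ln (h : R) (k : nat) : (0 < k)%N ->
  expR (2 * h * ln k%:R) = k%:R ^+ 2 * expR (- (2 * (1 - h) * ln k%:R)).
Proof.
move=> k0; have kp : 0 < k%:R :> R by rewrite ltr0n.
rewrite -{2}(lnK kp) -expRM_natl -expRD; congr expR; ring.
Qed.

Let AE (h : R) : A h = 4 * expR (- (2 * (1 - h) * ln 2)).
Proof. by rewrite /A (exp_ln h (isT : 0 < 2)%N) -natrX. Qed.

Let CE (h : R) : C h = 9 * expR (- (2 * (1 - h) * ln 3)).
Proof. by rewrite /C (exp_ln h (isT : 0 < 3)%N) -natrX. Qed.

Let Aint (h : R) : 0 < h < 1 -> 1 < A h < 4.
Proof.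
move=> /andP[h0 h1]; apply/andP; split; first by rewrite /A expR_gt1 !mulr_gt0.
rewrite AE -[ltRHS]mulr1 ltr_pM2l// -[ltRHS]expR0 ltr_expR oppr_lt0 !mulr_gt0// subr_gt0//.
Qed.

Let l3 : 0 < ln 3 :> R. Proof. exact: lt_trans l23. Qed.

Let M0 (h : R) : 0 < h < 1 -> 0 < M h.
Proof.
move=> /andP[h0 h1]; rewrite /M AE CE.
set q := expR (- (2 * (1 - h) * ln 2)).
have q1 : q < 1 by rewrite -[ltRHS]expR0 ltr_expR oppr_lt0 !mulr_gt0// subr_gt0.
have q0 : 0 < q by exact: expR_gt0.
(* Since 3 < 4, 9^(-(1-h)) exceeds q^2, and M > 15 - 24 q + 9 q^2 = 3 (1 - q) (5 - 3 q) > 0. *)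
have : q ^+ 2 < expR (- (2 * (1 - h) * ln 3)).
  rewrite /q -expRM_natl ltr_expR mulrN ltrN2 -subr_gt0.
  rewrite (_ : _ - _ = 2 * (1 - h) * (2 * ln 2 - ln 3)); last by ring.
  by rewrite !mulr_gt0// subr_gt0.
by nra.
Qed.

Let N0 (h : R) : 0 < h < 1 -> 0 < N h.
Proof.
move=> hh; have /andP[a1 a4] := Aint hh; have /andP[h0 h1] := hh.
(* Hence N > 1 - A / 4, which is positive because A < 4. *)
have : C h < 9 / 4 * A h.
  rewrite CE AE (_ : 9 / 4 * _ = 9 * expR (- (2 * (1 - h) * ln 2))); last by field.
  by rewrite ltr_pM2l// ltr_expR ltrN2 ltr_pM2l// !mulr_gt0// subr_gt0.
by rewrite /N; nra.
Qed.

(** With y = 2 (1 - h), K is 288 * 6^(-y) times ln 2 (3^y - 1) - ln 3 (2^y - 1). This vanishes at y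
    = 0 and has derivative ln 2 ln 3 (3^y - 2^y) > 0. *)
Let K0 (h : R) : 0 < h < 1 -> 0 < K h.
Proof.
move=> hh; have /andP[h0 h1] := hh.
pose y := 2 * (1 - h); have y0 : 0 < y by rewrite mulr_gt0// subr_gt0.
pose f (s : R) : R := ln 2 * (expR (s * ln 3) - 1) - ln 3 * (expR (s * ln 2) - 1).
have df (s : R) : is_derive s (1 : R) f (ln 2 * ln 3 * (expR (s * ln 3) - expR (s * ln 2))).
  by apply: is_derive_eq; rewrite /GRing.scale/=; ring.
have f0 : f 0 < f y.
  apply: (@gtr0_derive1_incr R f 0 y) => //.
  - move=> x; rewrite in_itv/= => /andP[x0 _]; rewrite derive1E; have [_ ->] := df x.
    by rewrite mulr_gt0 ?mulr_gt0// subr_gt0 ltr_expR ltr_pM2l.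
  - apply: continuous_subspaceT => x; apply/differentiable_continuous/derivable1_diffP.
    by case: (df x).
move: f0; rewrite /f !mul0r expR0 subrr !mulr0 subr0 => f0.
rewrite /K AE CE -/y.
have e3 : expR (- (y * ln 3)) * expR (y * ln 3) = 1 by rewrite -expRD addNr expR0.
have e2 : expR (- (y * ln 2)) * expR (y * ln 2) = 1 by rewrite -expRD addNr expR0.
have p3 := expR_gt0 (- (y * ln 3)); have p2 := expR_gt0 (- (y * ln 2)).
move: (expR (- (y * ln 3))) (expR (- (y * ln 2))) (expR (y * ln 3)) (expR (y * ln 2)) f0 e3 e2 p3 p2 => c a C' A' f0 e3 e2 p3 p2.
rewrite (_ : 4 * _ = 4 * 72 * ((a * c) * (ln 2 * (C' - 1) - ln 3 * (A' - 1)))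
   + 4 * 72 * (ln 2 * a * (1 - c * C') - ln 3 * c * (1 - a * A'))); last by ring.
rewrite e3 e2 subrr !mulr0 subr0 mulr0 addr0 mulr_gt0// mulr_gt0//; exact: mulr_gt0.
Qed.

Let dA (h : R) : is_derive h (1 : R) A (A h * (2 * ln 2)).
Proof. by apply: is_derive_eq; rewrite /GRing.scale/= /A; ring. Qed.

Let dC (h : R) : is_derive h (1 : R) C (C h * (2 * ln 3)).
Proof. by apply: is_derive_eq; rewrite /GRing.scale/= /C; ring. Qed.

Let dN (h : R) : is_derive h (1 : R) N (2 * (A h * (2 * ln 2)) - C h * (2 * ln 3)).
Proof.
have := is_deriveB (is_deriveD (is_derive_cst (1 : R) h 1) (is_deriveZ (2 : R) (dA h))) (dC h).
by apply: is_derive_ext => //; rewrite /GRing.scale/= add0r.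
Qed.

Let dM (h : R) : is_derive h (1 : R) M (- 6 * (A h * (2 * ln 2)) + C h * (2 * ln 3)).
Proof.
have := is_deriveD (is_deriveB (is_derive_cst (15 : R) h 1) (is_deriveZ (6 : R) (dA h))) (dC h).
by apply: is_derive_ext => //; rewrite /GRing.scale/= sub0r mulNr.
Qed.

Let Q (h : R) : R := N h / M h.

Let dQ (h : R) : 0 < h < 1 -> is_derive h (1 : R) Q (K h / M h ^+ 2).
Proof.
move=> hh; have m0 : M h != 0 by rewrite gt_eqF// M0.
have := is_deriveM (dN h) (is_deriveV1 m0 (dM h)).
apply: is_derive_ext => //; rewrite /GRing.scale/= /K.
by move: m0; rewrite /M /N; move: (A h) (C h) (ln 2) (ln 3) => a c x y m0; field.
Qed.

Let Q0 (h : R) : 0 < h < 1 -> 0 < Q h.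
Proof. by move=> hh; rewrite divr_gt0// ?N0// M0. Qed.

Let dsQ (h : R) : 0 < h < 1 -> is_derive h (1 : R) (fun h => sqrtr (Q h)) (K h / M h ^+ 2 / (2 * sqrtr (Q h))).
Proof.
move=> hh; have := @is_derive1_comp R sqrtr Q h _ _ (is_derive1_sqrt (Q0 hh)) (dQ hh).
by apply: is_derive_ext => //; rewrite mulrC.
Qed.

Lemma is_derive_Lam2 (h : R) : 0 < h < 1 -> is_derive h (1 : R) Lam2 (dLam2 h).
Proof.
move=> hh; have q0 := Q0 hh; have s0 : 0 < sqrtr (Q h) by rewrite sqrtr_gt0.
have := @is_derive1_comp R Lam (fun h => sqrtr (Q h)) h _ _ (is_derive_Lam s0) (dsQ hh).
by apply: is_derive_ext => //; rewrite /dLam2 -/(Q h) sqr_sqrtr// ltW.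
Qed.

Lemma dLam2_gt0 (h : R) : 0 < h < 1 -> 0 < dLam2 h.
Proof.
move=> hh; have q0 := Q0 hh.
rewrite mulr_gt0//.
  by rewrite divr_gt0 ?pi_gt0// ln_gt0// ltrDl invr_gt0.
by rewrite !divr_gt0 ?K0 ?exprn_gt0 ?M0// mulr_gt0// sqrtr_gt0.
Qed.

Lemma derivable_dLam2 (h : R) : 0 < h < 1 -> derivable dLam2 h 1.
Proof.
move=> hh; have q0 := Q0 hh; have m0 := M0 hh.
have qn : Q h != 0 by rewrite gt_eqF.
have e0 : 0 < 1 + (Q h)^-1 by rewrite addr_gt0// invr_gt0.
have dl := @is_derive1_comp R (@ln R) (fun h => 1 + (Q h)^-1) h _ _ (is_derive1_ln e0)
  (is_deriveD (is_derive_cst (1 : R) h 1) (is_deriveV1 qn (dQ hh))).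
have dK : derivable K h 1.
  have e1 := is_deriveM (dA h) (is_deriveB (is_derive_cst (9 : R) h 1) (dC h)).
  have e2 := is_deriveM (dC h) (is_deriveB (is_derive_cst (4 : R) h 1) (dA h)).
  have e3 := is_deriveZ (4 : R) (is_deriveB (is_deriveZ (2 * ln 2 : R) e1) (is_deriveZ (2 * ln 3 : R) e2)).
  have dK0 l : is_derive h (1 : R) K l -> derivable K h 1 by case.
  apply: dK0; apply: (is_derive_ext _ _ e3).
rewrite /dLam2; apply: derivableM.
  by apply: derivableM; [case: dl | exact: derivable_cst].
apply: derivableM.
  apply: derivableM => //; apply: derivableV; first by rewrite expf_neq0// gt_eqF.
  by case: (is_deriveM (dM h) (dM h)).
apply: derivableV; first by rewrite mulf_neq0// gt_eqF// sqrtr_gt0.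
by apply: derivableM; [exact: derivable_cst | case: (dsQ hh)].
Qed.

Lemma Lam2_incr (x y : R) : 0 < x -> x < y -> y < 1 -> Lam2 x < Lam2 y.
Proof.
move=> x0 xy y1; apply: (@gtr0_derive1_incr R Lam2 x y) => //.
- move=> z; rewrite in_itv/= => /andP[xz zy]; case: (@is_derive_Lam2 z) => //.
  by rewrite (lt_trans x0 xz) (lt_trans zy y1).
- move=> z; rewrite in_itv/= => /andP[xz zy].
  have zz : 0 < z < 1 by rewrite (lt_trans x0 xz) (lt_trans zy y1).
  by rewrite derive1E; have [_ ->] := is_derive_Lam2 zz; exact: dLam2_gt0.
- apply: continuous_in_subspaceT => z; rewrite inE/= in_itv/= => /andP[xz zy].
  have zz : 0 < z < 1 by rewrite (lt_le_trans x0 xz) (le_lt_trans zy y1).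
  by apply/differentiable_continuous/derivable1_diffP; case: (is_derive_Lam2 zz).
Qed.

Lemma Lam2_inj (x y : R) : 0 < x < 1 -> 0 < y < 1 -> Lam2 x = Lam2 y -> x = y.
Proof.
move=> /andP[x0 x1] /andP[y0 y1] e; have [xy|xy|//] := ltgtP x y.
  by have := Lam2_incr x0 xy y1; rewrite e ltxx.
by have := Lam2_incr y0 xy x1; rewrite e ltxx.
Qed.

(** The derivative is differentiable at h, hence Lipschitz at h; the mean value theorem makes the
    remainder quadratic. *)
Lemma Lam2_taylor (h : R) : 0 < h < 1 -> exists K0 dl : R, [/\ 0 <= K0, 0 < dl &
  forall x, `|x - h| < dl -> 0 < x < 1 /\ `|Lam2 x - Lam2 h - dLam2 h * (x - h)| <= K0 * (x - h) ^+ 2].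
Proof.
move=> hh; have /andP[h0 h1] := hh.
have [K1 [dl [K10 dl0 lip]]] := derivable_lip_at (derivable_dLam2 hh).
exists K1, (minr dl (minr h (1 - h))); split => //.
  by rewrite !lt_min dl0 h0 subr_gt0.
move=> x; rewrite !lt_min => /and3P[xd xh xh1].
have x01 : 0 < x < 1 by move: xh xh1; rewrite !ltr_norml; lra.
split => //; have /andP[x0 x1] := x01.
have mvt a b : 0 < a -> a < b -> b < 1 -> exists2 c, a < c < b & Lam2 b - Lam2 a = dLam2 c * (b - a).
  move=> a0 ab b1; have [||c] := @MVT R Lam2 dLam2 a b ab.
  - move=> z; rewrite in_itv/= => /andP[za zb]; apply: is_derive_Lam2.
    by rewrite (lt_trans a0 za) (lt_trans zb b1).
  - apply: continuous_in_subspaceT => z; rewrite inE/= in_itv/= => /andP[za zb].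
    have zz : 0 < z < 1 by rewrite (lt_le_trans a0 za) (le_lt_trans zb b1).
    by apply/differentiable_continuous/derivable1_diffP; case: (is_derive_Lam2 zz).
  - by rewrite in_itv/= => cc e; exists c.
have fin c : `|c - h| <= `|x - h| -> `|dLam2 c * (x - h) - dLam2 h * (x - h)| <= K1 * (x - h) ^+ 2.
  move=> ch; rewrite -mulrBl normrM -[(x - h) ^+ 2]real_normK ?num_real// expr2 mulrA ler_wpM2r//.
  by rewrite (le_trans (lip c (le_lt_trans ch xd)))// ler_wpM2l.
have [xlt|xgt|->] := ltgtP x h; last by rewrite !subrr mulr0 subrr normr0 expr0n/= mulr0.
- have [c /andP[c1 c2] e] := mvt _ _ x0 xlt h1.
  rewrite (_ : Lam2 x - Lam2 h = dLam2 c * (x - h)); last by move: e; lra.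
  by apply: fin; rewrite !ltr0_norm ?subr_lt0//; lra.
- have [c /andP[c1 c2] ->] := mvt _ _ h0 xgt x1.
  by apply: fin; rewrite !gtr0_norm ?subr_gt0//; lra.
Qed.

Lemma continuous_Lam2 (h : R) : 0 < h < 1 -> {for h, continuous Lam2}.
Proof. by move=> hh; apply/differentiable_continuous/derivable1_diffP; case: (is_derive_Lam2 hh). Qed.

Lemma Lam2_corr (h : R) : 0 < h < 1 ->
  let a := expR (2 * h * ln 2) in let r := (- expR (2 * h * ln 3) + 4 * a - 7) / (8 - 2 * a) in
  [/\ 1 < a < 4, -1 < r < 1 &
   Lam2 h = Lam (sqrtr (2 * (1 + r)) / sqrtr (2 * (1 - r)))].
Proof.
move=> hh a r; have /andP[a1 a4] := Aint hh; have n0 := N0 hh; have m0 := M0 hh.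
rewrite -/(A h) in a r *; rewrite -/(C h) in r *.
have d0 : 0 < 8 - 2 * a by rewrite /a; lra.
have e1 : 1 + r = N h / (8 - 2 * a) by rewrite /r /N -/a; field; rewrite gt_eqF.
have e2 : 1 - r = M h / (8 - 2 * a) by rewrite /r /M -/a; field; rewrite gt_eqF.
have p1 : 0 < 1 + r by rewrite e1 divr_gt0.
have p2 : 0 < 1 - r by rewrite e2 divr_gt0.
split; [by rewrite a1 a4 | by apply/andP; split; lra|].
rewrite /Lam2 -sqrtrV; last by rewrite mulr_ge0// ltW.
rewrite -sqrtrM; last by rewrite mulr_ge0// ltW.
congr (Lam (sqrtr _)); rewrite e1 e2; field.
by rewrite !gt_eqF.
Qed.

Section Inverse.
Variables (g : R -> R) (c : R).
Hypothesis gK : forall h, 0 < h < 1 -> g (Lam2 h) = h.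
Hypothesis gc : forall s, (forall h, 0 < h < 1 -> Lam2 h != s) -> g s = c.

Lemma is_derive_Lam2_inv (h : R) : 0 < h < 1 -> is_derive (Lam2 h) (1 : R) g (dLam2 h)^-1.
Proof.
move=> hh; have /andP[h0 h1] := hh.
have nh : \forall x \near h, 0 < x < 1.
  by near=> x; apply/andP; split; near: x; [exact: lt_nbhsr|exact: lt_nbhsl].
apply: is_derive_inverse.
- by near=> x; apply: gK; near: x.
- by near=> x; apply: continuous_Lam2; near: x.
- exact: is_derive_Lam2.
- by rewrite gt_eqF// dLam2_gt0.
Unshelve. all: by end_near.
Qed.

Let I : set R := [set s | exists2 h, 0 < h < 1 & Lam2 h = s].

Let intI : is_interval I.
Proof.
move=> a b [x xx <-] [y yy <-] s /andP[s1 s2].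
have /andP[x0 x1] := xx; have /andP[y0 y1] := yy.
have xy : x <= y.
  rewrite leNgt; apply/negP => yx; have := Lam2_incr y0 yx x1.
  by rewrite ltNge (le_trans s1 s2).
have [||z] := @IVT R Lam2 x y s xy.
- apply: continuous_in_subspaceT => z; rewrite inE/= in_itv/= => /andP[za zb].
  by apply: continuous_Lam2; rewrite (lt_le_trans x0 za) (le_lt_trans zb y1).
- have := le_trans s1 s2; rewrite /minr /maxr.
  by case: ltgtP => // h _; rewrite ?s1 ?s2// -?h ?s1// h s2.
- rewrite in_itv/= => /andP[za zb] <-; exists z => //.
  by rewrite (lt_le_trans x0 za) (le_lt_trans zb y1).
Qed.

(** A superlevel set splits along the range of Lambda_2, which is an interval. Off the range g is
    constant; on it g is increasing, so the remaining part is again an interval. *)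
Lemma measurable_Lam2_inv : measurable_fun setT g.
Proof.
apply: (measurability _ (RGenOInfty.measurableE R)) => //.
move=> _ [_ [a ->] <-]; rewrite setTI.
have mI : measurable I by exact: is_interval_measurable.
rewrite (_ : _ @^-1` _ = ((~` I) `&` [set s | a < c]) `|` [set s | I s /\ a < g s]); last first.
  apply/seteqP; split => s /=; rewrite in_itv/= andbT.
    have [Is|nIs] := pselect (I s); first by right.
    move=> h; left; split => //; rewrite -(@gc s)// => h' hh'.
    by apply/negP => /eqP e; apply: nIs; exists h'.
  case=> [[nIs ac]|[]//]; rewrite gc// => h' hh'.
  by apply/negP => /eqP e; apply: nIs; exists h'.
apply: measurableU.
  apply: measurableI; first exact: measurableC.
  have [ac|ac] := boolP (a < c).
    by rewrite (_ : [set _ | _] = setT)//; apply/seteqP; split.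
  by rewrite (_ : [set _ | _] = set0)//; apply/seteqP; split.
apply: is_interval_measurable => x y [[x' xx <-]]; rewrite gK// => ax' [Iy ay] s /andP[s1 s2].
have [h hh e] : I s by apply: (@intI (Lam2 x') y); rewrite ?s1//; exists x'.
split; first by exists h.
move: s1; rewrite -e gK// => s1; apply: (lt_le_trans ax'); rewrite leNgt; apply/negP => hx'.
have /andP[h0 h1] := hh; have /andP[x0 x1] := xx.
by have := Lam2_incr h0 hx' x1; rewrite ltNge s1.
Qed.

End Inverse.

End Lambda.

(** * From laws to moments and characteristic functions *)

Lemma integral_law `{T : measurableType d} {R : realType} (P : probability T R)
  (Y : T -> R) (h : R -> R) : measurable_fun setT Y -> continuous h -> (forall x, 0 <= h x) ->
  (\int[P]_w (h (Y w))%:E = \int[pushforward P (Y : T -> measurableTypeR R)]_x (EFin \o h) x)%E.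
Proof.
move=> mY ch h0.
have mh : measurable_fun setT (EFin \o h : measurableTypeR R -> \bar R).
  by apply/measurable_EFinP; exact: continuous_measurable_fun.
have h0' (x : measurableTypeR R) : (0 <= (EFin \o h) x)%E by rewrite lee_fin.
have e1 := @ge0_integral_pushforward _ _ T (measurableTypeR R) R Y mY P setT (EFin \o h) measurableT mh (fun x _ => h0' x).
by move: e1; rewrite preimage_setT => <-.
Qed.

Section GaussianExpectation.
Context `{T : measurableType d} {R : realType} (P : probability T R).

Lemma eq_law_integral (d' : measure_display) (T' : measurableType d') (P' : probability T' R)
  (Y : T -> R) (Y' : T' -> R) (h : R -> R) :
  measurable_fun setT Y -> measurable_fun setT Y' ->
  (forall A : set R, measurable A -> P (Y @^-1` A) = P' (Y' @^-1` A)) ->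
  continuous h -> (forall x, 0 <= h x) ->
  (\int[P]_w (h (Y w))%:E = \int[P']_w (h (Y' w))%:E)%E.
Proof.
move=> mY mY' YY ch h0.
rewrite (integral_law _ mY)// (integral_law _ mY')//.
by apply: eq_measure_integral => A mA _; exact: YY.
Qed.

Lemma gauss_law_integral (m s : R) (Y : T -> R) (h : R -> R) : measurable_fun setT Y -> 0 <= s ->
  (forall A : set R, measurable A -> P (Y @^-1` A) = gauss_law m s A) ->
  continuous h -> (forall x, 0 <= h x) ->
  (\int[P]_w (h (Y w))%:E = \int[gam]_x (h (m + s * x))%:E)%E.
Proof.
move=> mY s0 hY ch h0.
rewrite (integral_law _ mY)//.
have [sz|sn] := eqVneq s 0.
  rewrite (@eq_measure_integral _ _ _ setT (dirac (m : measurableTypeR R))); last first.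
    by move=> A mA _; transitivity (gauss_law m s A); [exact: hY | rewrite /gauss_law sz eqxx].
  rewrite integral_dirac//; last by apply/measurable_EFinP; exact: continuous_measurable_fun.
  rewrite diracT mul1e sz/=.
  under [RHS]eq_integral do rewrite mul0r addr0.
  by rewrite integral_cst//= probability_setT mule1.
rewrite (@eq_measure_integral _ _ _ setT (normal_prob m s)); last first.
  by move=> A mA _; transitivity (gauss_law m s A); [exact: hY | rewrite /gauss_law (negbTE sn)].
by apply: ge0_integral_normal_affine => //; rewrite lt_def sn.
Qed.

(** Laws are compared on nonnegative continuous functions only: the mean is extracted from (Y + 1)^2
    and Y^2, the characteristic function from 1 + cos. *)
Lemma gauss_law_moments (m s : R) (Y : T -> R) : measurable_fun setT Y -> 0 <= s ->
  (forall A : set R, measurable A -> P (Y @^-1` A) = gauss_law m s A) ->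
  [/\ itg P Y, itg P (fun w => Y w ^+ 2), Ex P Y = m, Ex P (fun w => Y w ^+ 2) = m ^+ 2 + s ^+ 2 &
    m = 0 -> forall l p, Ex P (fun w => cos (l * Y w + p)) = expR (- (l ^+ 2 * s ^+ 2) / 2) * cos p].
Proof.
move=> mY s0 lY; have hY h := @gauss_law_integral m s Y h mY s0 lY.
have hE (h : R -> R) : continuous h -> (forall x, 0 <= h x) -> itg gam (fun x => h (m + s * x)) ->
    itg P (fun w => h (Y w)) /\ Ex P (fun w => h (Y w)) = Ex gam (fun x => h (m + s * x)).
  move=> ch h0 ih; apply: ge0_itgP => //.
    by apply: (@measurableT_comp _ _ _ _ _ _ (h : measurableTypeR R -> R)) => //; exact: continuous_measurable_fun.
  rewrite (hY _ ch h0) /Ex /Rintegral fineK//; exact: integrable_fin_num ih.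
have sq (b : R) : continuous (fun x : R => (x + b) ^+ 2).
  by move=> x; apply: cvgM; apply: cvgD; (exact: cvg_id || exact: cvg_cst).
have gsq (b : R) : itg gam (fun x => (m + s * x + b) ^+ 2) /\ Ex gam (fun x => (m + s * x + b) ^+ 2) = (m + b) ^+ 2 + s ^+ 2.
  have e : (fun x : measurableTypeR R => (m + s * x + b) ^+ 2) =
      (fun x => (m + b) ^+ 2 + (2 * (m + b) * s * x + s ^+ 2 * x ^+ 2)) by apply/funext => x; ring.
  have i1 := itgZ (2 * (m + b) * s) (@gam_itg_id R); have i2 := itgZ (s ^+ 2) (@gam_itg_sqr R).
  rewrite e; split; first by apply: itgD; [exact: itg_cst | exact: itgD].
  rewrite (ExD (itg_cst gam ((m + b) ^+ 2)) (itgD i1 i2)) (ExD i1 i2) Ex_cst.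
  by rewrite (ExZ _ (@gam_itg_id R)) (ExZ _ (@gam_itg_sqr R)) gam_mean gam_var; ring.
have [g0 e0] := gsq 0; have [g1 e1] := gsq 1.
have [i0 f0] := hE _ (sq 0) (fun x => sqr_ge0 _) g0.
have [i1 f1] := hE _ (sq 1) (fun x => sqr_ge0 _) g1.
have i2 : itg P (fun w => Y w ^+ 2) by move: i0; under eq_fun do rewrite addr0.
have f2 : Ex P (fun w => Y w ^+ 2) = m ^+ 2 + s ^+ 2.
  by move: f0; rewrite e0; under eq_fun do rewrite addr0; rewrite addr0.
have iY : itg P Y.
  apply: (@itg_le _ _ _ _ _ (fun w => 1 + Y w ^+ 2)) => //; first by apply: itgD => //; exact: itg_cst.
  move=> w; have := sqr_ge0 (`|Y w| - 1); rewrite -(real_normK (num_real (Y w))).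
  by have := normr_ge0 (Y w); nra.
have EY : Ex P Y = m.
  move: f1; rewrite e1 (_ : (fun w => (Y w + 1) ^+ 2) = (fun w => Y w ^+ 2 + (2 * Y w + 1))); last first.
    by apply/funext => w; ring.
  rewrite (ExD i2 (itgD (itgZ 2 iY) (itg_cst P 1))) (ExD (itgZ 2 iY) (itg_cst P 1)) (ExZ _ iY) Ex_cst f2.
  by lra.
split => // m0 l p.
pose h (x : R) := 1 + cos (l * x + p).
have ch : continuous h.
  by move=> x; apply: cvgD; [exact: cvg_cst | exact: continuous_cos_affine].
have h0 x : 0 <= h x by have := cos_geN1 (l * x + p); rewrite /h; lra.
have bc (b c : R) : itg gam (fun x => cos (b * x + c)).
  by apply: bddm_itg; apply: bddm_cos; apply: measurable_funD => //; exact: measurable_funM.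
have e : (fun x : measurableTypeR R => h (m + s * x)) = (fun x => 1 + cos ((l * s) * x + p)).
  by apply/funext => x; rewrite /h m0; congr (_ + cos _); ring.
have [ih Eh] := hE h ch h0 (eq_ind_r (fun f => itg gam f) (itgD (itg_cst gam 1) (bc _ _)) e).
have bY : itg P (fun w => cos (l * Y w + p)).
  by apply: bddm_itg; apply: bddm_cos; apply: measurable_funD => //; exact: measurable_funM.
move: Eh; rewrite e /h (ExD (itg_cst P 1) bY) (ExD (itg_cst gam 1) (bc _ _)) !Ex_cst gam_cos => /addrI ->.
by congr (expR _ * _); ring.
Qed.

Lemma is_gaussian_moments (Y : T -> R) : measurable_fun setT Y -> is_gaussian P Y ->
  [/\ itg P Y, itg P (fun w => Y w ^+ 2) &
    Ex P Y = 0 -> forall l p, Ex P (fun w => cos (l * Y w + p)) =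
      expR (- (l ^+ 2 * Ex P (fun w => Y w ^+ 2)) / 2) * cos p].
Proof.
move=> mY [m [s [s0 lY]]]; have [i1 i2 e1 e2 hc] := gauss_law_moments mY s0 lY.
split => // EY0; have m0 : m = 0 by rewrite -e1.
by move=> l p; rewrite hc// e2 m0 expr0n/= add0r.
Qed.

End GaussianExpectation.

(** * Gaussian processes and fractional Brownian motion *)

Section GaussianSpan.
Context `{T : measurableType d} {R : realType}.
Variables (P : probability T R) (D : set R) (Z : R -> {RV P >-> R}).
Hypotheses (gZ : gaussian_process D Z) (zZ : zero_mean D Z).

(* Only the sampling times in D are controlled by the hypotheses on Z. *)
Definition gspan (Y : T -> R) : Prop := exists (n : nat) (c t : 'I_n -> R),
  (forall i, D (t i)) /\ forall w, Y w = \sum_(i < n) c i * Z (t i) w.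

Lemma gspan_id (t : R) : D t -> gspan (Z t).
Proof.
by move=> Dt; exists 1%N, (fun=> 1), (fun=> t); split=> // w; rewrite big_ord1 mul1r.
Qed.

Lemma gspan0 : gspan (fun=> 0).
Proof.
by exists 0%N, (fun=> 0), (fun=> 0); split=> [[]//|w]; rewrite big_ord0.
Qed.

Lemma gspanZ (a : R) (Y : T -> R) : gspan Y -> gspan (fun w => a * Y w).
Proof.
move=> [n [c [t [Dt e]]]]; exists n, (fun i => a * c i), t; split=> // w.
by rewrite e mulr_sumr; apply: eq_bigr => i _; rewrite mulrA.
Qed.

Lemma gspanD (X Y : T -> R) : gspan X -> gspan Y -> gspan (fun w => X w + Y w).
Proof.
move=> [n [c [t [Dt e]]]] [n' [c' [t' [Dt' e']]]].
exists (n + n')%N, (fun i => match fintype.split i with inl j => c j | inr j => c' j end),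
  (fun i => match fintype.split i with inl j => t j | inr j => t' j end).
split=> [i|w]; first by case: fintype.split.
rewrite e e' big_split_ord/=; congr (_ + _); apply: eq_bigr => i _.
  by rewrite (unsplitK (inl i)).
by rewrite (unsplitK (inr i)).
Qed.

Lemma gspan_sum (I : Type) (r : seq I) (l : I -> R) (X : I -> T -> R) :
  (forall i, gspan (X i)) -> gspan (fun w => \sum_(i <- r) l i * X i w).
Proof.
move=> gX; elim: r => [|i r IH].
  by under eq_fun do rewrite big_nil; exact: gspan0.
under eq_fun do rewrite big_cons; apply: gspanD => //; exact: gspanZ.
Qed.

Lemma gspan_measurable (Y : T -> R) : gspan Y -> measurable_fun setT Y.
Proof.
move=> [n [c [t [Dt e]]]]; rewrite (_ : Y = fun w => \sum_(i < n) c i * Z (t i) w); last by apply/funext.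
by apply: measurable_sum => i; exact: measurable_funM.
Qed.

Lemma gspan_gaussian (Y : T -> R) : gspan Y -> is_gaussian P Y.
Proof.
move=> [n [c [t [Dt e]]]]; rewrite (_ : Y = fun w => \sum_(i < n) c i * Z (t i) w); last by apply/funext.
exact: gZ.
Qed.

Lemma gspan_itg (Y : T -> R) : gspan Y -> itg P Y.
Proof. by move=> gY; have [] := is_gaussian_moments (gspan_measurable gY) (gspan_gaussian gY). Qed.

Lemma gspan_itg2 (Y : T -> R) : gspan Y -> itg P (fun w => Y w ^+ 2).
Proof. by move=> gY; have [] := is_gaussian_moments (gspan_measurable gY) (gspan_gaussian gY). Qed.

Lemma gspan_mean (Y : T -> R) : gspan Y -> Ex P Y = 0.
Proof.
move=> [n [c [t [Dt e]]]]; rewrite (_ : Y = fun w => \sum_(i < n) c i * Z (t i) w); last by apply/funext.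
have iZ i : itg P (Z (t i)) by apply: gspan_itg; exact: gspan_id.
rewrite Ex_sum; last by move=> i; exact: itgZ.
rewrite big1// => i _; rewrite ExZ// -fine_expectation.
by rewrite (zZ (Dt i)) mulr0.
Qed.

Lemma gspan_cos (Y : T -> R) (l p : R) : gspan Y ->
  Ex P (fun w => cos (l * Y w + p)) = expR (- (l ^+ 2 * Ex P (fun w => Y w ^+ 2)) / 2) * cos p.
Proof.
move=> gY; have [_ _ h] := is_gaussian_moments (gspan_measurable gY) (gspan_gaussian gY).
by apply: h; exact: gspan_mean.
Qed.

Lemma itg_mul (X Y : T -> R) : itg P X -> itg P Y -> itg P (fun w => X w ^+ 2) -> itg P (fun w => Y w ^+ 2) ->
  itg P (fun w => X w * Y w).
Proof.
move=> /itg_measurable mX /itg_measurable mY iX iY; apply: (itg_le _ (itgD iX iY)); first exact: measurable_funM.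
move=> w; rewrite normrM -(real_normK (num_real (X w))) -(real_normK (num_real (Y w))).
by have := sqr_ge0 (`|X w| - `|Y w|); have := normr_ge0 (X w); have := normr_ge0 (Y w); nra.
Qed.

Lemma gspan_itgM (X Y : T -> R) : gspan X -> gspan Y -> itg P (fun w => X w * Y w).
Proof. by move=> gX gY; apply: itg_mul; (exact: gspan_itg || exact: gspan_itg2). Qed.

(** Every linear combination is a one-dimensional Gaussian, so the characteristic function at l is
    that of [dot l X] at 1; the phases 0 and - pi/2 give its cosine and sine parts. *)
Lemma gspan_gvec (I : finType) (X : I -> T -> R) : (forall i, gspan (X i)) ->
  gvec P X (fun i j => Ex P (fun w => X i w * X j w)).
Proof.
move=> gX; split.
- by move=> i; exact: gspan_measurable.
- by move=> i j; congr Ex; apply/funext => w; rewrite mulrC.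
move=> l; have gd : gspan (fun w => dot l (X^~ w)) by exact: gspan_sum.
have e : qform (fun i j => Ex P (fun w => X i w * X j w)) l l = Ex P (fun w => (dot l (X^~ w)) ^+ 2).
  rewrite (_ : (fun w => _ ^+ 2) = (fun w => \sum_i \sum_j l i * l j * (X i w * X j w))); last first.
    apply/funext => w; rewrite expr2 /dot big_distrlr/=; apply: eq_bigr => i _; apply: eq_bigr => j _; ring.
  have ij i j : itg P (fun w => l i * l j * (X i w * X j w)) by apply: itgZ; exact: gspan_itgM.
  rewrite Ex_sum; last by move=> i; apply: itg_sum.
  apply: eq_bigr => i _; rewrite Ex_sum//; apply: eq_bigr => j _.
  by rewrite [RHS]ExZ; [ring | exact: gspan_itgM].
have h p := gspan_cos 1 p gd.
rewrite e; split.
  by have := h 0; under eq_fun do rewrite mul1r addr0; rewrite cos0 mulr1 expr1n mul1r.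
have := h (- (pi / 2)); rewrite cosN cos_pihalf mulr0.
under eq_fun do rewrite mul1r.
rewrite (_ : (fun w => cos _) = (fun w => sin (dot l (X^~ w))))//.
by apply/funext => w; rewrite cosB cos_pihalf sin_pihalf mulr0 add0r mulr1.
Qed.

Lemma gspan_covariance (X Y : T -> R) : gspan X -> gspan Y ->
  fine (covariance P X Y) = Ex P (fun w => X w * Y w).
Proof.
move=> gX gY; rewrite covariance.unlock !fine_expectation (gspan_mean gX) (gspan_mean gY).
congr Ex; apply/funext => w /=.
by rewrite -[(_ * _) w]/((X w - 0) * (Y w - 0)) !subr0.
Qed.

Lemma gspan_variance (X : T -> R) : gspan X -> fine 'V_P[X]%E = Ex P (fun w => X w ^+ 2).
Proof. by move=> gX; rewrite /variance gspan_covariance. Qed.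

End GaussianSpan.

Section FBMCovariance.
Context `{T : measurableType d} {R : realType}.
Variables (P : probability T R) (h : R) (B : R -> {RV P >-> R}).
Hypotheses (h01 : 0 < h < 1) (fB : is_fbm h B).

Let gB : gaussian_process setT B. Proof. by case: fB. Qed.
Let zB : zero_mean setT B. Proof. by case: fB. Qed.
Let gid t : gspan setT B (B t). Proof. exact: gspan_id. Qed.

Lemma fbm_sqr (t : R) : Ex P (fun w => B t w ^+ 2) = `|t| `^ (2 * h).
Proof. by case: fB => _ _ _ /(_ t) e; rewrite -fine_expectation e. Qed.

(** Stationarity replaces the increment over [s, t] by that over [0, t - s]. The value at 0 has
    second moment 0, so by Cauchy-Schwarz it drops out of the square. *)
Lemma fbm_incr (s t : R) : Ex P (fun w => (B t w - B s w) ^+ 2) = `|t - s| `^ (2 * h).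
Proof.
have [_ _ stat _] := fB; have /andP[h0 h1] := h01.
pose D1 w := B (t - s + s) w - B (0 + s) w; pose D2 w := B (t - s) w - B 0 w.
have gB' t1 t2 : gspan setT B (fun w => B t1 w - B t2 w).
  by have := gspanD (gid t1) (gspanZ (-1) (gid t2)); under eq_fun do rewrite mulN1r.
have law (A : set R) : measurable A -> P (D1 @^-1` A) = P (D2 @^-1` A).
  move=> mA; have := stat 1%N (fun=> 0) (fun=> t - s) s [set x | A (tnth x ord0)].
  have mA' : measurable [set x : 1.-tuple R | A (tnth x ord0)].
    by have := @measurable_tnth _ (measurableTypeR R) 1 ord0 measurableT A mA; rewrite setTI.
  move=> /(_ mA'); rewrite (_ : [set w | _] = D1 @^-1` A); last first.
    by apply/seteqP; split => w /=; rewrite tnth_mktuple.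
  rewrite (_ : [set w | _] = D2 @^-1` A)//.
  by apply/seteqP; split => w /=; rewrite tnth_mktuple.
have cs : continuous (fun x : R => x ^+ 2) by move=> x; apply: cvgM; exact: cvg_id.
have := eq_law_integral (gspan_measurable (gB' _ _) : measurable_fun setT D1)
  (gspan_measurable (gB' _ _) : measurable_fun setT D2) law cs (fun x => sqr_ge0 _).
move=> /(congr1 fine); rewrite -[X in X = _]/(Ex P (fun w => D1 w ^+ 2)) -[X in _ = X]/(Ex P (fun w => D2 w ^+ 2)).
rewrite {1}/D1 subrK add0r => ->; rewrite -fbm_sqr.
have e0 : Ex P (fun w => B 0 w ^+ 2) = 0 by rewrite fbm_sqr normr0 powR0// mulf_neq0// gt_eqF.
have i2 t := gspan_itg2 gB (gid t).
have i00 := gspan_itgM gB (gid (t - s)) (gid 0).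
have c0 : Ex P (fun w => B (t - s) w * B 0 w) = 0.
  apply/eqP; rewrite -normr_le0 (le_trans (Ex_cauchy_schwarz (i2 _) (i2 _) i00))//.
  by rewrite e0 sqrtr0 mulr0.
rewrite (_ : (fun w => D2 w ^+ 2) = (fun w => B (t - s) w ^+ 2 + (- 2 * (B (t - s) w * B 0 w) + B 0 w ^+ 2))); last first.
  by apply/funext => w; rewrite /D2; ring.
rewrite (ExD (i2 _) (itgD (itgZ _ i00) (i2 _))) (ExD (itgZ _ i00) (i2 _)) (ExZ _ i00) c0 e0.
by rewrite mulr0 !addr0.
Qed.

Lemma fbm_cov (s t : R) : Ex P (fun w => B s w * B t w) =
  (`|s| `^ (2 * h) + `|t| `^ (2 * h) - `|t - s| `^ (2 * h)) / 2.
Proof.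
have i2 t := gspan_itg2 gB (gid t).
have ist := gspan_itgM gB (gid s) (gid t).
rewrite -fbm_incr (_ : (fun w => (B t w - B s w) ^+ 2) =
  (fun w => B t w ^+ 2 + (- 2 * (B s w * B t w) + B s w ^+ 2))); last first.
  by apply/funext => w; ring.
rewrite (ExD (i2 _) (itgD (itgZ _ ist) (i2 _))) (ExD (itgZ _ ist) (i2 _)) (ExZ _ ist) !fbm_sqr.
by field.
Qed.

(** In the covariance of B the terms |s|^(2h) and |t|^(2h) depend on one index only and are killed
    by the vanishing coefficient sums. *)
Lemma fbm_cov_sum (m n : nat) (a s : 'I_m -> R) (b t : 'I_n -> R) :
  \sum_i a i = 0 -> \sum_j b j = 0 ->
  Ex P (fun w => (\sum_i a i * B (s i) w) * (\sum_j b j * B (t j) w)) =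
  - 2^-1 * \sum_i \sum_j a i * b j * `|t j - s i| `^ (2 * h).
Proof.
move=> a0 b0.
rewrite (_ : (fun w => _) = (fun w => \sum_i \sum_j a i * b j * (B (s i) w * B (t j) w))); last first.
  apply/funext => w; rewrite big_distrlr/=; apply: eq_bigr => i _; apply: eq_bigr => j _; ring.
have ij i j : itg P (fun w => a i * b j * (B (s i) w * B (t j) w)).
  by apply: itgZ; exact: (gspan_itgM gB).
rewrite Ex_sum; last by move=> i; apply: itg_sum.
transitivity (\sum_i \sum_j (a i * `|s i| `^ (2 * h) * b j / 2 + a i * (b j * `|t j| `^ (2 * h)) / 2
   + - 2^-1 * (a i * b j * `|t j - s i| `^ (2 * h)))).
  apply: eq_bigr => i _; rewrite Ex_sum//; apply: eq_bigr => j _.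
  by rewrite ExZ ?fbm_cov; [field | exact: (gspan_itgM gB)].
rewrite mulr_sumr.
under eq_bigr do rewrite !big_split/=.
rewrite !big_split/=.
rewrite (_ : \sum_i \sum_j a i * `|s i| `^ (2 * h) * b j / 2 = 0); last first.
  by apply: big1 => i _; rewrite -mulr_suml -mulr_sumr b0 mulr0 mul0r.
rewrite (_ : \sum_i \sum_j a i * (b j * `|t j| `^ (2 * h)) / 2 = 0); last first.
  rewrite exchange_big/=; apply: big1 => j _; rewrite -mulr_suml -mulr_suml a0 !mul0r.
  by [].
by rewrite !add0r; apply: eq_bigr => i _; rewrite mulr_sumr.
Qed.

End FBMCovariance.

(** * Filters and second-order increments of fractional Brownian motion *)

Section Filters.
Context {R : realType}.

Definition star (l : nat) : R := match l with 0%N => 1 | 1%N => - 2 | 2%N => 1 | _ => 0 end.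
Definition shstar (j l : nat) : R := if (l < j)%N then 0 else star (l - j).

Lemma sum_star (g : nat -> R) (M : nat) : (2 < M)%N ->
  \sum_(l < M) star l * g l = g 0%N - 2 * g 1%N + g 2%N.
Proof.
case: M => [|[|[|M]]]// _; rewrite !big_ord_recl/= big1 ?addr0; last first.
  by move=> i _; rewrite /= mul0r.
by rewrite /bump/= !mul1r; ring.
Qed.

Lemma sum_shstar (g : nat -> R) (j : nat) :
  \sum_(l < j.+3) shstar j l * g l = g j - 2 * g j.+1 + g j.+2.
Proof.
rewrite !big_ord_recr/= big1 ?add0r; last first.
  by move=> i _; rewrite /shstar ltn_ord mul0r.
rewrite /shstar ltnn subnn !ltnNge leqnSn (leq_trans (leqnSn j) (leqnSn j.+1))/=.
by rewrite subSnn -add2n addnK /=; ring.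
Qed.

(** Padding with zeros moves the increment j steps ahead while the filter stays anchored at k. (A)
    then compares the variance at k + j with H and c taken at k/n, so their variation between the
    two points never enters. *)
Definition afilt (j : nat) : j.+3.-tuple R := [tuple shstar j l | l < j.+3].
Definition bfilt (j : nat) : j.+3.-tuple R := [tuple star l + shstar j l | l < j.+3].

Let j1 (j : nat) : j.+1%:R = j%:R + 1 :> R. Proof. by rewrite -addn1 natrD. Qed.
Let j2 (j : nat) : j.+2%:R = j%:R + 2 :> R. Proof. by rewrite -addn2 natrD. Qed.

Lemma afilt_order (j : nat) : is_filter_of_order 2 (afilt j).
Proof.
have s p : \sum_(l < j.+3) l%:R ^+ p * tnth (afilt j) l = j%:R ^+ p - 2 * j.+1%:R ^+ p + j.+2%:R ^+ p :> R.
  by rewrite -(sum_shstar (fun l => l%:R ^+ p)); apply: eq_bigr => l _; rewrite tnth_mktuple mulrC.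
split => //; last by rewrite s (j2 j) (j1 j) (_ : j%:R ^+ 2 - 2 * (j%:R + 1) ^+ 2 + (j%:R + 2) ^+ 2 = 2) ?pnatr_eq0//; ring.
by case=> [|[|//]] _; rewrite s (j2 j) (j1 j); [rewrite !expr0|]; ring.
Qed.

Lemma bfilt_order (j : nat) : is_filter_of_order 2 (bfilt j).
Proof.
have s p : \sum_(l < j.+3) l%:R ^+ p * tnth (bfilt j) l =
    (0 ^+ p - 2 * 1 ^+ p + 2%:R ^+ p) + (j%:R ^+ p - 2 * j.+1%:R ^+ p + j.+2%:R ^+ p) :> R.
  rewrite -(sum_shstar (fun l => l%:R ^+ p)) -(@sum_star (fun l => l%:R ^+ p) j.+3)// -big_split/=.
  by apply: eq_bigr => l _; rewrite tnth_mktuple mulrDr mulrC; congr (_ + _); rewrite mulrC.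
split => //; last by rewrite s (j2 j) (j1 j) (_ : 0 ^+ 2 - 2 * 1 ^+ 2 + 2 ^+ 2 + (j%:R ^+ 2 - 2 * (j%:R + 1) ^+ 2 + (j%:R + 2) ^+ 2) = 4) ?pnatr_eq0//; ring.
by case=> [|[|//]] _; rewrite s (j2 j) (j1 j); [rewrite !expr0|]; ring.
Qed.

Lemma tnth_astar (l : 'I_3) : tnth astar l = star l :> R.
Proof. by rewrite (tnth_nth 0); case: l => [[|[|[|//]]]]. Qed.

Lemma gvar_star (n : nat) (z : R -> R) (t : R) :
  gvar astar n z t = z (t + 0%:R / n%:R) - 2 * z (t + 1%:R / n%:R) + z (t + 2%:R / n%:R).
Proof.
rewrite -(@sum_star (fun l => z (t + l%:R / n%:R)) 3)//.
by apply: eq_bigr => l _; rewrite tnth_astar.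
Qed.

Lemma astar_order : is_filter_of_order 2 (astar : 3.-tuple R).
Proof.
have s p : \sum_(l < 3) l%:R ^+ p * tnth astar l = 0 ^+ p - 2 * 1 ^+ p + 2%:R ^+ p :> R.
  by rewrite -(@sum_star (fun l => l%:R ^+ p) 3)//; apply: eq_bigr => l _; rewrite tnth_astar mulrC.
split => //; last by rewrite s (_ : _ + _ = 2) ?pnatr_eq0//; ring.
by case=> [|[|//]] _; rewrite s; [rewrite !expr0|]; ring.
Qed.

Lemma gvar_afilt (n j : nat) (z : R -> R) (t : R) :
  gvar (afilt j) n z t = gvar astar n z (t + j%:R / n%:R).
Proof.
rewrite gvar_star /gvar.
under eq_bigr do rewrite tnth_mktuple.
rewrite (sum_shstar (fun l => z (t + l%:R / n%:R))).
by rewrite (j2 j) (j1 j); congr (z _ - 2 * z _ + z _); ring.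
Qed.

Lemma gvar_bfilt (n j : nat) (z : R -> R) (t : R) :
  gvar (bfilt j) n z t = gvar astar n z t + gvar astar n z (t + j%:R / n%:R).
Proof.
rewrite -gvar_afilt gvar_star -(@sum_star (fun l => z (t + l%:R / n%:R)) j.+3)// -big_split/=.
by apply: eq_bigr => l _; rewrite !tnth_mktuple mulrDl.
Qed.

End Filters.

Section FBMVariations.
Context `{T : measurableType d} {R : realType}.
Variables (P : probability T R).

(* fc h x is the covariance of the second-order increments of a fractional
   Brownian motion at lag x, and rc h x their correlation. *)
Definition fc (h x : R) : R :=
  - 2^-1 * \sum_(i < 3) \sum_(j < 3) star i * star j * `|x + j%:R - i%:R| `^ (2 * h).

Definition rc (h : R) (x : R) : R := fc h x / fc h 0.

Lemma fcE (h x : R) : fc h x = - 2^-1 * (6 * `|x| `^ (2 * h) - 4 * `|x + 1| `^ (2 * h)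
  - 4 * `|x - 1| `^ (2 * h) + `|x + 2| `^ (2 * h) + `|x - 2| `^ (2 * h)).
Proof.
rewrite /fc; congr (_ * _).
under eq_bigr => i _.
  under eq_bigr do rewrite -mulrA.
  rewrite -mulr_sumr (@sum_star R (fun j => `|x + j%:R - i%:R| `^ (2 * h)))//.
  over.
rewrite (@sum_star R (fun i => `|x + 0%:R - i%:R| `^ (2 * h) - 2 * `|x + 1%:R - i%:R| `^ (2 * h) + `|x + 2%:R - i%:R| `^ (2 * h)))//.
rewrite !addr0 !subr0 !addrK (_ : x + 2 - 1 = x + 1); last by ring.
rewrite (_ : x + 1 - 2 = x - 1); last by ring.
ring.
Qed.

Lemma fcN (h x : R) : fc h (- x) = fc h x.
Proof.
rewrite !fcE normrN -(normrN (- x + 1)) -(normrN (- x - 1)) -(normrN (- x + 2)) -(normrN (- x - 2)).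
by rewrite !opprD !opprK; congr (_ * _); ring.
Qed.

Lemma fc0E (h : R) : 0 < h < 1 -> fc h 0 = 4 - expR (2 * h * ln 2).
Proof.
move=> /andP[h0 h1]; rewrite fcE !add0r !normrN normr0 normr1 powR0; last by rewrite mulf_neq0// gt_eqF.
by rewrite powR1 (ger0_norm (_ : 0 <= 2))// /powR pnatr_eq0/=; field.
Qed.

Lemma fc1E (h : R) : 0 < h < 1 ->
  fc h 1 = (- expR (2 * h * ln 3) + 4 * expR (2 * h * ln 2) - 7) / 2.
Proof.
move=> /andP[h0 h1]; rewrite fcE subrr normr0 normr1 powR0; last by rewrite mulf_neq0// gt_eqF.
rewrite (_ : 1 - 2 = -1 :> R); last by ring.
rewrite normrN normr1 powR1 (_ : 1 + 1 = 2 :> R) 1?(_ : 1 + 2 = 3 :> R); try ring.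
by rewrite (ger0_norm (_ : 0 <= 2))// (ger0_norm (_ : 0 <= 3))// /powR !pnatr_eq0/=; field.
Qed.

Lemma fc0_gt0 (h : R) : 0 < h < 1 -> 0 < fc h 0.
Proof. by move=> hh; rewrite fc0E//; have [/andP[_ a4] _ _] := Lam2_corr hh; lra. Qed.

Lemma rc1_Lam2 (h : R) : 0 < h < 1 -> -1 < rc h 1 < 1 /\
  Lam2 h = Lam (sqrtr (2 * (1 + rc h 1)) / sqrtr (2 * (1 - rc h 1))).
Proof.
move=> hh; have [/andP[_ a4] r1 e] := Lam2_corr hh.
have -> // : rc h 1 = (- expR (2 * h * ln 3) + 4 * expR (2 * h * ln 2) - 7) / (8 - 2 * expR (2 * h * ln 2)).
rewrite /rc fc0E// fc1E//; field; apply/andP; split; rewrite gt_eqF//; lra.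
Qed.

Lemma continuous_rc (h x : R) : 0 < h < 1 -> {for h, continuous (rc^~ x)}.
Proof.
move=> hh; have /andP[h0 h1] := hh.
have cf y : {for h, continuous (fc^~ y)}.
  rewrite (_ : fc^~ y = (fun h => - 2^-1 * (6 * `|y| `^ (2 * h) - 4 * `|y + 1| `^ (2 * h)
     - 4 * `|y - 1| `^ (2 * h) + `|y + 2| `^ (2 * h) + `|y - 2| `^ (2 * h)))); last first.
    by apply/funext => z; rewrite fcE.
  have cp (a : R) : {for h, continuous (fun k : R => `|a| `^ (2 * k))}.
    (* At a = 0 the power is 0 for positive exponents but 1 for exponent 0, so continuity rests on h
       > 0. *)
    have [->|a0] := eqVneq a 0.
      apply: cvg_near_cst; near=> k; rewrite normr0 !powR0// mulf_neq0// gt_eqF//.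
      by near: k; exact: lt_nbhsr.
    have ap : `|a| == 0 = false by rewrite normr_eq0; exact: negbTE.
    rewrite (_ : (fun h => _) = expR \o (fun h : R => 2 * h * ln `|a|)); last first.
      by apply/funext => k; rewrite /powR ap.
    apply: continuous_comp; last exact: continuous_expR.
    apply: cvgM; last exact: cvg_cst.
    by apply: cvgM; [exact: cvg_cst | exact: cvg_id].
  have cZ (k a : R) : {for h, continuous (fun e : R => k * `|a| `^ (2 * e))}.
    by apply: cvgM; [exact: cvg_cst | exact: cp].
  apply: cvgM; first exact: cvg_cst.
  by apply: cvgD; [apply: cvgD; [apply: cvgB; [apply: cvgB|]|]|]; (exact: cZ || exact: cp).
apply: cvgM; first exact: cf.
by apply: cvgV; [rewrite gt_eqF// fc0_gt0 | exact: cf].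
Unshelve. all: by end_near.
Qed.

Section Process.
Variables (h : R) (B : R -> {RV P >-> R}).
Hypotheses (h01 : 0 < h < 1) (fB : is_fbm h B).

Lemma fbm_gvar_cov (n : nat) (s s' : R) : (0 < n)%N ->
  Ex P (fun w => gvar_rv astar n B s w * gvar_rv astar n B s' w) =
  n%:R^-1 `^ (2 * h) * fc h ((s' - s) * n%:R).
Proof.
move=> n0; have np : 0 < n%:R :> R by rewrite ltr0n.
have z : \sum_(i < 3) star i = 0 :> R.
  by rewrite !big_ord_recl big_ord0/=; ring.
have := @fbm_cov_sum _ _ _ P h B h01 fB 3 3 star (fun i => s + i%:R / n%:R) star (fun j => s' + j%:R / n%:R) z z.
rewrite (_ : (fun w => _) = (fun w => gvar_rv astar n B s w * gvar_rv astar n B s' w)); last first.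
  by apply/funext => w; congr (_ * _); apply: eq_bigr => i _; rewrite tnth_astar.
move=> ->; rewrite /fc mulrCA; congr (_ * _); rewrite mulr_sumr; apply: eq_bigr => i _.
rewrite mulr_sumr; apply: eq_bigr => j _; rewrite mulrCA; congr (_ * _).
rewrite -powRM// ?invr_ge0 ?ler0n//; congr (_ `^ _).
rewrite -[X in X * `|_|](@ger0_norm _ n%:R^-1) ?invr_ge0 ?ler0n// -normrM; congr `|_|.
by field; rewrite gt_eqF.
Qed.

Let gB : gaussian_process setT B. Proof. by case: fB. Qed.
Let zB : zero_mean setT B. Proof. by case: fB. Qed.

Lemma gspan_gvar_fbm (n q : nat) (a : q.+1.-tuple R) (t : R) : gspan setT B (gvar_rv a n B t).
Proof. by exists q.+1, (tnth a), (fun l => t + l%:R / n%:R). Qed.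

Lemma rc_norm_le1 (j : nat) : `|rc h j%:R| <= 1.
Proof.
have g s := @gspan_gvar_fbm 1 2 astar s.
have f0 := fc0_gt0 h01.
have e (s s' : R) : Ex P (fun w => gvar_rv astar 1 B s w * gvar_rv astar 1 B s' w) = fc h (s' - s).
  by rewrite fbm_gvar_cov// invr1 powR1 mul1r mulr1.
have := Ex_cauchy_schwarz (gspan_itg2 gB (g 0)) (gspan_itg2 gB (g j%:R)) (gspan_itgM gB (g 0) (g j%:R)).
rewrite e (_ : (fun w => _ ^+ 2) = (fun w => gvar_rv astar 1 B 0 w * gvar_rv astar 1 B 0 w))//.
rewrite e (_ : (fun w => _ ^+ 2) = (fun w => gvar_rv astar 1 B j%:R w * gvar_rv astar 1 B j%:R w))//.
rewrite e !subrr subr0 -expr2 (sqr_sqrtr (ltW f0)) => h1.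
by rewrite /rc normrM normfV (gtr0_norm f0) ler_pdivrMr// mul1r.
Qed.

End Process.

(** Divided by sqrt (fc h 0), the two increments are a standard pair with correlation [rc h 1]; psi
    is invariant under the scaling. *)
Lemma Lambda2E (B : R -> R -> {RV P >-> R}) (h : R) : 0 < h < 1 -> is_fbm h (B h) ->
  Lambda2 B h = Lam2 h.
Proof.
move=> hh fB; have f0 := fc0_gt0 hh.
have gB : gaussian_process setT (B h) by case: fB.
have zB : zero_mean setT (B h) by case: fB.
pose s := sqrtr (fc h 0).
have s0 : 0 < s by rewrite sqrtr_gt0.
pose X (i : bool) w := s^-1 * gvar_rv astar 1 (B h) (if i then 1 else 0) w.
have gX i : gspan setT (B h) (X i) by apply: gspanZ; exact: gspan_gvar_fbm.
have gv := gspan_gvec gB zB gX.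
have [r1 ->] := rc1_Lam2 hh.
have cX i j : Ex P (fun w => X i w * X j w) = rc h ((if j then 1 else 0) - (if i then 1 else 0)).
  rewrite (_ : (fun w => _) = (fun w => (fc h 0)^-1 * (gvar_rv astar 1 (B h) (if i then 1 else 0) w * gvar_rv astar 1 (B h) (if j then 1 else 0) w))); last first.
    by apply/funext => w; rewrite /X -[in RHS](sqr_sqrtr (ltW f0)) -/s; field; rewrite gt_eqF.
  rewrite ExZ; last by apply: (gspan_itgM gB); exact: gspan_gvar_fbm.
  by rewrite (fbm_gvar_cov hh fB)// invr1 powR1 mul1r mulr1 mulrC.
rewrite -(@Ex_psi_Lam _ _ _ P X _ (rc h 1) gv)//.
- rewrite /Lambda2 fine_expectation; congr Ex; apply/funext => w.
  by rewrite /psib /X psiZ// invr_eq0 gt_eqF.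
- by rewrite cX subrr /rc divff// gt_eqF.
- by rewrite cX subrr /rc divff// gt_eqF.
- by rewrite cX subr0.
Qed.

End FBMVariations.
(** * Local correlations *)

Section AssumptionA.
Context {R : realType} `{T : measurableType d} `{T' : measurableType d'}.
Variables (P : probability T R) (PB : probability T' R) (B : R -> R -> {RV PB >-> R}).
Hypothesis hB : forall h : R, 0 < h < 1 -> is_fbm h (B h).
Variable Z : R -> {RV P >-> R}.
Hypotheses (gZ : gaussian_process `]0, 1[ Z) (zZ : zero_mean `]0, 1[ Z).
Variables (kappa eta : R) (H c : R -> R).
Hypotheses (kap0 : 0 <= kappa) (hA : assumption_A B 2 kappa eta H c Z).

Definition vz (n k : nat) : T -> R := gvar_rv astar n Z (k%:R / n%:R).

Lemma sampled_in (n q k : nat) (l : 'I_q.+1) : sampled n q k -> 0 < (k%:R / n%:R + l%:R / n%:R : R) < 1.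
Proof.
move=> /andP[k0 kq]; have n0 : (0 < n)%N by rewrite (leq_ltn_trans _ kq).
have np : 0 < n%:R :> R by rewrite ltr0n.
rewrite -mulrDl -natrD divr_gt0 ?ltr0n ?addn_gt0 ?k0//= ltr_pdivrMr// mul1r ltr_nat.
by rewrite (leq_ltn_trans _ kq)// leq_add2l -ltnS.
Qed.

Lemma gspan_gvar (n q k : nat) (a : q.+1.-tuple R) : sampled n q k ->
  gspan `]0, 1[ Z (gvar_rv a n Z (k%:R / n%:R)).
Proof.
move=> sk; exists q.+1, (tnth a), (fun l => k%:R / n%:R + l%:R / n%:R); split => //.
by move=> i; rewrite /= in_itv/= sampled_in.
Qed.

Lemma gspan_vz (n k : nat) : sampled n 2 k -> gspan `]0, 1[ Z (vz n k).
Proof. exact: gspan_gvar. Qed.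

Definition mid (eps : R) (n k : nat) : bool :=
  (Num.truncn (n%:R * eps) <= k <= Num.truncn ((1 - eps) * n%:R))%N.

Lemma mid_bounds (eps : R) (n k : nat) : 0 < eps < 2^-1 -> mid eps n k -> (0 < n)%N ->
  2 / eps <= n%:R -> eps / 2 <= k%:R / n%:R <= 1 - eps.
Proof.
move=> /andP[e0 e1] /andP[k1 k2] n0 ne; have np : 0 < n%:R :> R by rewrite ltr0n.
rewrite ler_pdivlMr// ler_pdivrMr//; apply/andP; split.
  (* Truncation loses less than 1, and n >= 2 / eps turns this into the bound eps / 2. *)
  have h1 : n%:R * eps < (Num.truncn (n%:R * eps)).+1%:R by exact: truncnS_gt.
  have h2 : (Num.truncn (n%:R * eps)).+1%:R <= k%:R + 1 :> R by rewrite natr1 ler_nat.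
  have h3 : 2 <= n%:R * eps by rewrite -ler_pdivrMr.
  by lra.
have h0 : 0 <= (1 - eps) * n%:R by rewrite mulr_ge0//; lra.
have := truncn_le ((1 - eps) * n%:R); rewrite h0 => h1.
by rewrite (le_trans _ h1)// ler_nat.
Qed.

Lemma A_ratio (eps : R) (q : nat) (a : q.+1.-tuple R) (e : R) : 0 < eps < 2^-1 ->
  is_filter_of_order 2 a -> 0 < e ->
  \forall n \near \oo, forall k, mid eps n k -> sampled n q k ->
    n%:R `^ kappa *
     `| fine 'V_P[gvar_rv a n Z (k%:R / n%:R)]%E /
        fine 'V_PB[gvar_rv a n (B (H (k%:R / n%:R))) 0]%E - c (k%:R / n%:R) | <= e.
Proof.
move=> he fa e0; have [_ _ _ _ /(_ eps q a he fa)] := hA.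
move=> /cvgrPdist_le /(_ e e0); apply: filterS => n.
rewrite sub0r normrN => h k /andP[k1 k2] sk.
apply: le_trans (le_trans (ler_norm _) h).
apply: (@le_bigmax_seq _ _ _ (index_iota _ _) _ k) => //.
by rewrite mem_index_iota k1 ltnS.
Qed.

(** A positive lower bound for c on a compact interval allows division by the variance at k without
    losing the rate in (A). *)
Lemma c_min (eps : R) : 0 < eps < 2^-1 -> exists2 m : R, 0 < m & forall x, eps / 2 <= x <= 1 - eps -> m <= c x.
Proof.
move=> /andP[e0 e1]; have [_ _ _ hc _] := hA.
have le : eps / 2 <= 1 - eps by lra.
have [|x0 x0i hx] := @EVT_min R c _ _ le.
  apply: continuous_in_subspaceT => x; rewrite inE/= in_itv/= => /andP[xa xb].
  by have [] := hc x; [apply/andP; split; lra|].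
have x01 : 0 < x0 < 1 by move: x0i; rewrite in_itv/= => /andP[? ?]; apply/andP; split; lra.
have [_ _ _ cx] := hc x0 x01.
exists (c x0) => // x xx; apply: hx; by rewrite in_itv/=.
Qed.

(** Polarization: the variances along [astar], [afilt j] and [bfilt j], each divided by its value
    for fractional Brownian motion, are all within e1 n^(-kappa) of the same number c(k/n). Hence
    the unknown c cancels in quotients and the rate is kept. *)
Lemma A_cov (eps : R) (j : nat) (e : R) : 0 < eps < 2^-1 -> 0 < e ->
  \forall n \near \oo, forall k, mid eps n k -> sampled n j.+2 k ->
   [/\ 0 < Ex P (fun w => vz n k w ^+ 2),
    n%:R `^ kappa * `|Ex P (fun w => vz n k w * vz n (k + j) w) / Ex P (fun w => vz n k w ^+ 2)
       - rc (H (k%:R / n%:R)) j%:R| <= e &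
    n%:R `^ kappa * `|Ex P (fun w => vz n (k + j) w ^+ 2) / Ex P (fun w => vz n k w ^+ 2) - 1| <= e].
Proof.
move=> he e0; have [m m0 cm] := c_min he; have /andP[ep0 ep1] := he.
have [_ _ _ hc _] := hA.
(* m / 4 keeps the normalized variance x1 above 3 m / 4; e m / 16 leaves room for the at most 5 e1
   accumulated in the numerators. *)
pose e1 := minr (m / 4) (e * m / 16).
have e10 : 0 < e1 by rewrite lt_min !divr_gt0// mulr_gt0.
have e1m : e1 <= m / 4 by rewrite ge_min lexx.
have e1e : e1 <= e * m / 16 by rewrite ge_min lexx orbT.
have A1 := A_ratio he astar_order e10.
have A2 := A_ratio he (afilt_order j) e10.
have A3 := A_ratio he (bfilt_order j) e10.
apply: filter_app A1; apply: filter_app A2; apply: filter_app A3.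
near=> n => A3 A2 A1 k mk sk.
have n0 : (0 < n)%N by near: n; exact: nbhs_infty_gt.
have n0' : (1 < n)%N by near: n; exact: nbhs_infty_gt.
have sk2 : sampled n 2 k.
  by move: sk => /andP[k0 kj]; rewrite /sampled k0 (leq_ltn_trans _ kj)// leq_add2l.
have skj : sampled n 2 (k + j).
  by move: sk => /andP[k0 kj]; rewrite /sampled addn_gt0 k0 -addnA addn2.
have nk1 : 1 <= n%:R `^ kappa.
  by rewrite -[leLHS](powRr0 n%:R) ler_powR ?ler1n.
have x01 : eps / 2 <= k%:R / n%:R <= 1 - eps.
  by apply: mid_bounds => //; near: n; exact: nbhs_infty_ger.
have x01' : 0 < (k%:R / n%:R : R) < 1 by move: x01 => /andP[? ?]; apply/andP; split; lra.
have [_ _ hh c0] := hc (k%:R / n%:R) x01'.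
have mc := cm _ x01.
have np : 0 < n%:R :> R by rewrite ltr0n.
set h := H (k%:R / n%:R) in hh *.
have h1 := A1 k mk sk2; have h2 := A2 k mk sk; have h3 := A3 k mk sk.
have f0 := fc0_gt0 hh; have fB := hB hh.
have gB : gaussian_process setT (B h) by case: fB.
have zB : zero_mean setT (B h) by case: fB.
pose w0 := n%:R^-1 `^ (2 * h) * fc h 0.
have w00 : 0 < w0 by rewrite mulr_gt0// powR_gt0// invr_gt0.
have gBs s := @gspan_gvar_fbm _ _ _ PB (B h) n 2 astar s.
have VBs s : Ex PB (fun w => gvar_rv astar n (B h) s w ^+ 2) = w0.
  by have := fbm_gvar_cov hh fB s s n0; rewrite subrr mul0r.
have VB1 : fine 'V_PB[gvar_rv astar n (B h) 0]%E = w0.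
  by rewrite (gspan_variance gB zB (gBs _)) VBs.
have VB2 : fine 'V_PB[gvar_rv (afilt j) n (B h) 0]%E = w0.
  rewrite (_ : gvar_rv (afilt j) n (B h) 0 = gvar_rv astar n (B h) (0 + j%:R / n%:R)); last first.
    by apply/funext => w; rewrite /gvar_rv gvar_afilt.
  by rewrite (gspan_variance gB zB (gBs _)) VBs.
set r := rc h j%:R.
have VB3 : fine 'V_PB[gvar_rv (bfilt j) n (B h) 0]%E = w0 * (2 * (1 + r)).
  rewrite (_ : gvar_rv (bfilt j) n (B h) 0 = (fun w => gvar_rv astar n (B h) 0 w + gvar_rv astar n (B h) (0 + j%:R / n%:R) w)); last first.
    by apply/funext => w; rewrite /gvar_rv gvar_bfilt.
  rewrite (gspan_variance gB zB); last exact: gspanD.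
  have i0 := gspan_itg2 gB (gBs 0); have i1 := gspan_itg2 gB (gBs (0 + j%:R / n%:R)).
  have i2 := gspan_itgM gB (gBs 0) (gBs (0 + j%:R / n%:R)).
  rewrite (_ : (fun w => _) = (fun w => gvar_rv astar n (B h) 0 w ^+ 2 + (gvar_rv astar n (B h) (0 + j%:R / n%:R) w ^+ 2 +
     2 * (gvar_rv astar n (B h) 0 w * gvar_rv astar n (B h) (0 + j%:R / n%:R) w)))); last first.
    by apply/funext => w; ring.
  rewrite (ExD i0 (itgD i1 (itgZ 2 i2))) (ExD i1 (itgZ 2 i2)) (ExZ _ i2) !VBs (fbm_gvar_cov hh fB _ _ n0) add0r subr0 divfK; last by rewrite gt_eqF.
  by rewrite /r /rc /w0; field; rewrite gt_eqF.
set v := Ex P (fun w => vz n k w ^+ 2); set v' := Ex P (fun w => vz n (k + j) w ^+ 2).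
set cc := Ex P (fun w => vz n k w * vz n (k + j) w).
have kj : (k + j)%:R / n%:R = k%:R / n%:R + j%:R / n%:R :> R by rewrite natrD mulrDl.
have gk := gspan_vz sk2; have gkj := gspan_vz skj.
have VZ1 : fine 'V_P[gvar_rv astar n Z (k%:R / n%:R)]%E = v.
  by rewrite (gspan_variance gZ zZ gk).
have VZ2 : fine 'V_P[gvar_rv (afilt j) n Z (k%:R / n%:R)]%E = v'.
  rewrite (_ : gvar_rv (afilt j) n Z (k%:R / n%:R) = vz n (k + j)); last first.
    by apply/funext => w; rewrite /vz /gvar_rv gvar_afilt kj.
  by rewrite (gspan_variance gZ zZ gkj).
have VZ3 : fine 'V_P[gvar_rv (bfilt j) n Z (k%:R / n%:R)]%E = v + v' + 2 * cc.
  rewrite (_ : gvar_rv (bfilt j) n Z (k%:R / n%:R) = (fun w => vz n k w + vz n (k + j) w)); last first.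
    by apply/funext => w; rewrite /vz /gvar_rv gvar_bfilt kj.
  rewrite (gspan_variance gZ zZ); last exact: gspanD.
  have i0 := gspan_itg2 gZ gk; have i1 := gspan_itg2 gZ gkj; have i2 := gspan_itgM gZ gk gkj.
  rewrite (_ : (fun w => _) = (fun w => vz n k w ^+ 2 + (vz n (k + j) w ^+ 2 + 2 * (vz n k w * vz n (k + j) w)))); last first.
    by apply/funext => w; ring.
  by rewrite (ExD i0 (itgD i1 (itgZ 2 i2))) (ExD i1 (itgZ 2 i2)) (ExZ _ i2) -addrA.
move: h1 h2 h3; rewrite -/h VZ1 VZ2 VZ3 VB1 VB2 VB3.
move: (n%:R `^ kappa) nk1 (c _) mc c0 => N N1 c0 mc c00.
have rle : `|r| <= 1 := rc_norm_le1 hh fB j.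
clearbody v v' cc r w0.
(* If r were -1, the model variance along [bfilt j] would be 0 and the quotient 0 by convention; (A)
   would then force c(k/n) <= e1 <= m / 4, against c(k/n) >= m. *)
have [r1|r1] := eqVneq (1 + r) 0.
  rewrite r1 !mulr0 invr0 mulr0 sub0r normrN (gtr0_norm c00) => _ _ h3.
  have : c0 <= N * c0 by rewrite ler_peMl// ltW.
  by lra.
set x1 := v / w0; set x2 := v' / w0; set x3 := _ / (w0 * (2 * (1 + r))) => h1 h2 h3.
have v1E : v = x1 * w0 by rewrite /x1 divfK// gt_eqF.
have v2E : v' = x2 * w0 by rewrite /x2 divfK// gt_eqF.
have ccE : cc = (x3 * (w0 * (2 * (1 + r))) - v - v') / 2.
  by rewrite /x3; field; rewrite r1 gt_eqF.
have x1c : `|x1 - c0| <= e1 by rewrite (le_trans _ h1)// ler_peMl.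
have x1m : 3 / 4 * m <= x1 by move: x1c; rewrite ler_norml; lra.
have x10 : 0 < x1 by rewrite (lt_le_trans _ x1m)// mulr_gt0// divr_gt0.
have N0 : 0 < N by exact: lt_le_trans N1.
have n13 : N * `|x3 - x1| <= 2 * e1.
  rewrite (_ : x3 - x1 = (x3 - c0) - (x1 - c0)); last by ring.
  by have := ler_normB (x3 - c0) (x1 - c0); rewrite -(ler_pM2l N0); lra.
have n12 : N * `|x1 - x2| <= 2 * e1.
  rewrite (_ : x1 - x2 = (x1 - c0) - (x2 - c0)); last by ring.
  by have := ler_normB (x1 - c0) (x2 - c0); rewrite -(ler_pM2l N0); lra.
clearbody x1 x2 x3; split.
- by rewrite v1E mulr_gt0.
- rewrite ccE v1E v2E (_ : _ - r = ((1 + r) * (x3 - x1) + (x1 - x2) / 2) / x1); last first.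
    by field; rewrite !gt_eqF.
  rewrite normrM normfV (gtr0_norm x10) mulrA ler_pdivrMr//.
  have b1 : `|(1 + r) * (x3 - x1) + (x1 - x2) / 2| <= 2 * `|x3 - x1| + `|x1 - x2| / 2.
    rewrite (le_trans (ler_normD _ _))// !normrM lerD//.
      by rewrite ler_wpM2r//; move: rle; rewrite !ler_norml; lra.
    by rewrite [X in _ * X]ger0_norm// invr_ge0.
  have b2 : N * `|(1 + r) * (x3 - x1) + (x1 - x2) / 2| <= N * (2 * `|x3 - x1| + `|x1 - x2| / 2).
    by rewrite ler_pM2l.
  have b3 : e * (3 / 4 * m) <= e * x1 by rewrite ler_pM2l.
  by lra.
- rewrite v1E v2E (_ : _ - 1 = - (x1 - x2) / x1); last by field; rewrite !gt_eqF.
  rewrite normrM normfV normrN (gtr0_norm x10) mulrA ler_pdivrMr//.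
  have b3 : e * (3 / 4 * m) <= e * x1 by rewrite ler_pM2l.
  have : 0 < e * m by rewrite mulr_gt0.
  by lra.
Unshelve. all: by end_near.
Qed.

End AssumptionA.
Lemma sum_CS {R : realType} (I : finType) (pp : pred I) (f : I -> R) :
  (\sum_(i | pp i) f i) ^+ 2 <= (\sum_(i | pp i) 1) * (\sum_(i | pp i) f i ^+ 2).
Proof.
have : 0 <= \sum_(i | pp i) \sum_(j | pp j) (f i - f j) ^+ 2.
  by apply: sumr_ge0 => i _; apply: sumr_ge0 => j _; exact: sqr_ge0.
under eq_bigr => i _.
  rewrite (eq_bigr (fun j => f i ^+ 2 * 1 + (- 2 * f i * f j + 1 * f j ^+ 2))); last by move=> j _; ring.
  rewrite big_split/= -mulr_sumr big_split/= -!mulr_sumr; over.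
rewrite !big_split/= -!mulr_suml -!mulr_sumr.
by move: (\sum_(i | pp i) f i ^+ 2) (\sum_(i | pp i) f i) (\sum_(i | pp i) 1) => a b e; lra.
Qed.

(** * Sums over triangular arrays and windows *)

Section Array.
Context `{T : measurableType d} {R : realType}.
Variables (P : probability T R) (M : nat).
Variables (X : 'I_M -> bool -> T -> R) (S : 'I_M * bool -> 'I_M * bool -> R).
Variables (act : pred 'I_M) (w : 'I_M -> R) (r : 'I_M -> 'I_M -> R) (N C v0 : R).

Hypotheses (gX : gvec P (fun kb => X kb.1 kb.2) S) (v01 : 0 < v0 <= 1).
Hypotheses (niceX : forall k, act k -> nice v0 (fun a b => S (k, a) (k, b))) (N0 : 0 < N) (C0 : 0 <= C).
Hypotheses (wC : forall k, `|w k| <= C / sqrtr N) (w0 : forall k, ~~ act k -> w k = 0).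
Hypothesis actC : (\sum_(k | act k) 1 : R) <= C * N.
Hypothesis Sr : forall k k' a b, `|S (k, a) (k', b)| <= r k k'.

Definition closeby (J : nat) (k k' : 'I_M) : bool := (k' <= k + J)%N && (k <= k' + J)%N.

Lemma card_closeby (J : nat) (k : 'I_M) : (\sum_(k' | closeby J k k') 1 : R) <= (2 * J).+1%:R.
Proof.
rewrite -[X in \sum_(_ | _) X]/(1%N%:R) -natr_sum sum1_card ler_nat cardE -(size_map val) -[leqRHS](size_iota (k - J)).
apply: uniq_leq_size; first by rewrite map_inj_uniq ?enum_uniq//; exact: val_inj.
move=> x /mapP[y]; rewrite mem_enum => /andP[h1 h2] ->; rewrite mem_iota leq_subLR addnC h2/=.
by rewrite addnS ltnS mul2n -addnn addnA (leq_trans h1)// leq_add2r addnC -leq_subLR.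
Qed.

Let gXk k k' : gvec P (fun z : bool + bool => match z with inl a => X k a | inr b => X k' b end)
  (fun z z' => S (match z with inl a => (k, a) | inr b => (k', b) end)
                 (match z' with inl a => (k, a) | inr b => (k', b) end)).
Proof.
have := gvec_lin (fun (z : bool + bool) (kb : 'I_M * bool) =>
   (kb == match z with inl a => (k, a) | inr b => (k', b) end)%:R) gX.
by apply: eq_gvec => [[a|b] x|i j]; rewrite ?dot_delta ?qform_delta.
Qed.

Let mX k b : measurable_fun setT (X k b).
Proof. by have [m _ _] := gX; exact: (m (k, b)). Qed.

Lemma Ex_sum_cov (h : 'I_M -> T -> R) : (forall k, bddm (h k)) ->
  Ex P (fun x => (\sum_k w k * h k x) * (\sum_k w k * h k x)) -
  Ex P (fun x => \sum_k w k * h k x) * Ex P (fun x => \sum_k w k * h k x) =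
  \sum_k \sum_k' w k * w k' * (Ex P (fun x => h k x * h k' x) - Ex P (h k) * Ex P (h k')).
Proof.
move=> bh.
have i1 k : itg P (fun x => w k * h k x) by apply: itgZ; exact: bddm_itg.
have i2 k k' : itg P (fun x => w k * w k' * (h k x * h k' x)).
  by apply: itgZ; exact/bddm_itg/bddmM.
rewrite (_ : (fun x => _ * _) = (fun x => \sum_k \sum_k' w k * w k' * (h k x * h k' x))); last first.
  apply/funext => x; rewrite big_distrlr/=; apply: eq_bigr => k _; apply: eq_bigr => k' _; ring.
rewrite Ex_sum; last by move=> k; exact: itg_sum.
rewrite Ex_sum// big_distrlr/= -sumrB; apply: eq_bigr => k _.
rewrite Ex_sum// -sumrB; apply: eq_bigr => k' _.
rewrite ExZ; last by exact/bddm_itg/bddmM.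
by rewrite !ExZ; [ring | exact: bddm_itg | exact: bddm_itg].
Qed.

Lemma sum_pair_delta (g : 'I_M * bool -> R) (k : 'I_M) :
  \sum_(z : 'I_M * bool) (z.1 == k)%:R * g z = \sum_b g (k, b).
Proof.
rewrite (eq_bigr (fun z : 'I_M * bool => (z.1 == k)%:R * g (z.1, z.2))); last by case.
rewrite -(pair_bigA _ (fun k1 b => (k1 == k)%:R * g (k1, b)))/= (bigD1 k)//=.
rewrite [X in _ + X]big1 ?addr0; last first.
  by move=> k1 /negbTE ->; apply: big1 => b _; rewrite mul0r.
by rewrite eqxx; apply: eq_bigr => b _; rewrite mul1r.
Qed.

(** Near the diagonal each covariance is at most 4 e1 by smallness in mean; away from it
    decorrelation gives r^2. The factor C^3 is the C N active rows times the squared weight C^2 /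
    N. *)
Lemma array_var (F : tpoly R bool) (e1 eJ : R) (J : nat)
  (W := fun x => \sum_k w k * dpsi F ((X k)^~ x)) : teven F ->
  (forall x, `|tev F x| <= 1) -> 0 <= e1 -> 0 <= eJ ->
  (forall k, act k -> Ex P (fun x => `|psib ((X k)^~ x) - tev F ((X k)^~ x)|) <= e1) ->
  (forall k, act k -> \sum_(k' | act k' && ~~ closeby J k k') r k k' ^+ 2 <= eJ) ->
  Ex P (fun x => W x * W x) - Ex P W * Ex P W <=
  C ^+ 3 * ((2 * J).+1%:R * (4 * e1) + 4 * (72 * (7 / v0 ^+ 2) ^+ 2) * eJ).
Proof.
move=> eF F1 e10 eJ0 hF hJ.
pose h k x := dpsi F ((X k)^~ x).
have bh k : bddm (h k) by apply: bddmB; [exact: bddm_psi | exact: bddm_tev].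
have h2 k x : `|h k x| <= 2.
  rewrite (le_trans (ler_normB _ _))//; have := F1 ((X k)^~ x).
  by have := @norm_psi_le1 R (X k false x) (X k true x); rewrite /psib; lra.
rewrite /W (Ex_sum_cov bh).
set Kd := 4 * (72 * (7 / v0 ^+ 2) ^+ 2).
have Kd0 : 0 <= Kd by have := sqr_ge0 (7 / v0 ^+ 2); rewrite /Kd; lra.
pose b (k k' : 'I_M) : R := if closeby J k k' then 4 * e1 else Kd * r k k' ^+ 2.
have b0 k k' : 0 <= b k k' by rewrite /b; case: ifP => _; rewrite mulr_ge0// sqr_ge0.
have eh k : act k -> `|Ex P (h k)| <= e1.
  move=> ak; apply: le_trans (hF k ak).
  exact: (Ex_norm (bddm_itg P (bh k))).
have cov k k' : act k -> act k' -> `|Ex P (fun x => h k x * h k' x) - Ex P (h k) * Ex P (h k')| <= b k k'.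
  move=> ak ak'; rewrite /b; case: ifP => _.
    have i1 := bddm_itg P (bddmM (bh k) (bh k')).
    have z1 : `|Ex P (fun x => h k x * h k' x)| <= 2 * e1.
      rewrite (le_trans (Ex_norm i1))//.
      apply: (@le_trans _ _ (Ex P (fun x => 2 * `|h k' x|))).
        apply: Ex_le; [exact: itg_norm | by apply: itgZ; apply: itg_norm; exact: bddm_itg|].
        by move=> x; rewrite normrM ler_wpM2r.
      rewrite ExZ; last by apply: itg_norm; exact: bddm_itg.
      by rewrite ler_pM2l//; exact: hF.
    have z2 : `|Ex P (h k) * Ex P (h k')| <= 2 * e1.
      rewrite normrM ler_pM//; last exact: eh.
      by apply: Ex_bdd => //; case: (bh k).
    by rewrite (le_trans (ler_normB _ _))//; lra.
  have := @psi_decorrelation _ _ _ P _ _ v0 (r k k') F (gXk k k') v01 (niceX ak) (niceX ak') _ eF F1.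
  rewrite /Kd; have -> : 4 * (72 * (7 / v0 ^+ 2 * r k k') ^+ 2) = 4 * (72 * (7 / v0 ^+ 2) ^+ 2) * r k k' ^+ 2 by ring.
  by apply => i j; exact: Sr.
have sN : 0 < sqrtr N by rewrite sqrtr_gt0.
have sN2 : sqrtr N ^+ 2 = N by rewrite sqr_sqrtr// ltW.
have Cs : 0 <= C / sqrtr N by rewrite divr_ge0// ltW.
apply: (@le_trans _ _ (\sum_(k | act k) \sum_(k' | act k') (C / sqrtr N) ^+ 2 * b k k')).
  rewrite [leLHS](bigID act)/= [X in _ + X]big1 ?addr0; last first.
    by move=> k ak; apply: big1 => k' _; rewrite w0// !mul0r.
  apply: ler_sum => k ak.
  rewrite [leLHS](bigID act)/= [X in _ + X]big1 ?addr0; last first.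
    by move=> k' ak'; rewrite (w0 ak') mulr0 mul0r.
  apply: ler_sum => k' ak'; rewrite (le_trans (ler_norm _))// normrM.
  rewrite ler_pM//; last exact: cov.
  by rewrite normrM expr2 ler_pM.
have row k : act k -> \sum_(k' | act k') (C / sqrtr N) ^+ 2 * b k k' <=
    C ^+ 2 / N * ((2 * J).+1%:R * (4 * e1) + Kd * eJ).
  move=> ak; rewrite -mulr_sumr expr_div_n sN2.
  rewrite ler_wpM2l ?divr_ge0 ?sqr_ge0 ?(ltW N0)//.
  rewrite (bigID (closeby J k))/= lerD//.
    apply: (@le_trans _ _ (\sum_(k' | closeby J k k') 4 * e1)).
      rewrite big_mkcondl/=; apply: ler_sum => k' cl; rewrite /b cl; case: ifP => // _.
      by rewrite mulr_ge0.
    rewrite -[X in \sum_(_ | _) X]mulr1 -mulr_sumr mulrC ler_wpM2r ?mulr_ge0//.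
    exact: card_closeby.
  rewrite (eq_bigr (fun k' => Kd * r k k' ^+ 2)); last first.
    by move=> k' /andP[_ ncl]; rewrite /b (negbTE ncl).
  by rewrite -mulr_sumr ler_wpM2l//; exact: hJ.
apply: (le_trans (ler_sum _ row)).
rewrite -[X in \sum_(_ | _) X]mulr1 -mulr_sumr mulrC.
set D := (2 * J).+1%:R * (4 * e1) + Kd * eJ.
have D0 : 0 <= D by rewrite addr_ge0// mulr_ge0// mulr_ge0.
rewrite (_ : C ^+ 3 * D = C * N * (C ^+ 2 / N * D)); last by field; rewrite gt_eqF.
by rewrite ler_wpM2r// mulr_ge0// divr_ge0 ?sqr_ge0// ltW.
Qed.

(** Only square sums of r are controlled, so a row sum is bounded by its 2 J + 1 central entries
    plus, by Cauchy-Schwarz over the C N active indices, sqrt (C N) sqrt eJ; small eJ makes this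
    small against sqrt N. *)
Lemma array_trig (F : tpoly R bool) (K eJ p : R) (J : nat)
  (A := \sum_(t <- F) `|t.1.1|) (L := \sum_(t <- F) \sum_b `|t.1.2 b|) (m := (size F)%:R : R)
  (W := fun x => \sum_k w k * tev F ((X k)^~ x)) : teven F -> 0 <= K -> 0 <= eJ ->
  (forall k k', ~~ (act k && act k') -> r k k' = 0) ->
  (forall k, \sum_k' r k k' ^+ 2 <= K) ->
  (forall k, act k -> \sum_(k' | act k' && ~~ closeby J k k') r k k' ^+ 2 <= eJ) ->
  `|Ex P (fun x => cos (W x - Ex P W + p)) -
    expR (- (Ex P (fun x => W x * W x) - Ex P W * Ex P W) / 2) * cos p| <=
  sqrtr (4 * (C * A / sqrtr N) ^+ 4 *
    (m * L ^+ 2 * ((2 * J).+1%:R * sqrtr K + sqrtr (C * N) * sqrtr eJ)) ^+ 2 *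
    (m ^+ 2 * L ^+ 4 * (C * N * K))).
Proof.
move=> eF K0 eJ0 rz rK hJ.
pose t0 : R * (bool -> R) * R := (0, fun=> 0, 0).
pose tt (j : 'I_(size F)) := nth t0 F j.
(* Each triple of F at each k is one cosine of a linear form in the pair X k, without phase by
   evenness; the weighted sum is thus a [cosum] indexed by pairs (k, j). *)
pose I := ('I_M * 'I_(size F))%type.
pose Y (i : I) (x : T) := dot (tt i.2).1.2 ((X i.1)^~ x).
pose c (i : I) : R := w i.1 * (tt i.2).1.1.
pose G (i : I) (kb : 'I_M * bool) : R := (kb.1 == i.1)%:R * (tt i.2).1.2 kb.2.
pose Q (i j : I) : R := \sum_a \sum_b (tt i.2).1.2 a * S (i.1, a) (j.1, b) * (tt j.2).1.2 b.
have gY : gvec P Y Q.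
  have := gvec_lin G gX; apply: eq_gvec.
    move=> [k j] x; rewrite /dot /G /Y /= (eq_bigr (fun z : 'I_M * bool => (z.1 == k)%:R * ((tt j).1.2 z.2 * X z.1 z.2 x))); last first.
      by move=> z _; rewrite mulrA.
    by rewrite (sum_pair_delta (fun z => (tt j).1.2 z.2 * X z.1 z.2 x)).
  move=> [k j] [k' j']; rewrite /qform /G /Q /=.
  rewrite (eq_bigr (fun z : 'I_M * bool => (z.1 == k)%:R * (\sum_b (tt j).1.2 z.2 * S z (k', b) * (tt j').1.2 b))).
    by rewrite (sum_pair_delta (fun z => \sum_b (tt j).1.2 z.2 * S z (k', b) * (tt j').1.2 b)).
  move=> z _; rewrite -(sum_pair_delta (fun z' => (tt j).1.2 z.2 * S z z' * (tt j').1.2 z'.2)) mulr_sumr.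
  by apply: eq_bigr => z' _; ring.
have sumF (g : R * (bool -> R) * R -> R) : \sum_(t <- F) g t = \sum_j g (tt j).
  by rewrite (big_nth t0) big_mkord.
have WE : (fun x => tev (cosum c) (Y^~ x)) = W.
  apply/funext => x; rewrite tev_cosum -(pair_bigA _ (fun k j => c (k, j) * cos (Y (k, j) x)))/=.
  apply: eq_bigr => k _; rewrite tev_even// sumF mulr_sumr; apply: eq_bigr => j _.
  by rewrite /c /Y/= mulrA.
have A0 : 0 <= A by exact: sumr_ge0.
have L0 : 0 <= L by apply: sumr_ge0 => t _; exact: sumr_ge0.
have m0 : 0 <= m by exact: ler0n.
have sN : 0 < sqrtr N by rewrite sqrtr_gt0.
have Aj j : `|(tt j).1.1| <= A.
  by rewrite /A sumF (bigD1 j)//= lerDl sumr_ge0.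
have Lj j : \sum_b `|(tt j).1.2 b| <= L.
  by rewrite /L (sumF (fun t => \sum_b `|t.1.2 b|)) (bigD1 j)//= lerDl sumr_ge0// => ? _; exact: sumr_ge0.
have Qr i j : `|Q i j| <= L ^+ 2 * r i.1 j.1.
  apply: (@le_trans _ _ (\sum_a \sum_b `|(tt i.2).1.2 a| * `|(tt j.2).1.2 b| * r i.1 j.1)).
    rewrite (le_trans (ler_norm_sum _ _ _))//; apply: ler_sum => a _.
    rewrite (le_trans (ler_norm_sum _ _ _))//; apply: ler_sum => b _.
    by rewrite !normrM mulrAC ler_wpM2l// mulr_ge0.
  under eq_bigr do rewrite -mulr_suml; rewrite -mulr_suml ler_wpM2r//.
    exact: le_trans (normr_ge0 _) (Sr i.1 j.1 true true).
  rewrite -big_distrlr/= expr2 ler_pM//; exact: sumr_ge0.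
have r0 k k' : 0 <= r k k' by exact: le_trans (normr_ge0 _) (Sr k k' true true).
have sumI (g : 'I_M -> R) : \sum_(i : I) g i.1 = m * \sum_k g k.
  rewrite -(pair_bigA _ (fun k _ => g k))/= mulr_sumr; apply: eq_bigr => k _.
  by rewrite sumr_const card_ord mulr_natl.
set rho := m * L ^+ 2 * _.
have sK k k' : r k k' <= sqrtr K.
  rewrite -[leLHS]ger0_norm// -sqrtr_sqr ler_wsqrtr// (le_trans _ (rK k))//.
  by rewrite (bigD1 k')//= lerDl sumr_ge0// => ? _; exact: sqr_ge0.
have rowr k : \sum_k' r k k' <= (2 * J).+1%:R * sqrtr K + sqrtr (C * N) * sqrtr eJ.
  have [ak|nak] := boolP (act k); last first.
    rewrite big1; first by rewrite addr_ge0// mulr_ge0// sqrtr_ge0.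
    by move=> k' _; apply: rz; rewrite (negbTE nak).
  rewrite (bigID (closeby J k))/= lerD//.
    apply: (@le_trans _ _ (\sum_(k' | closeby J k k') sqrtr K)); first by apply: ler_sum.
    rewrite -[X in \sum_(_ | _) X]mulr1 -mulr_sumr mulrC ler_wpM2r ?sqrtr_ge0//.
    exact: card_closeby.
  rewrite (bigID act)/= [X in _ + X]big1 ?addr0; last first.
    by move=> k' /andP[_ nak']; apply: rz; rewrite negb_and nak' orbT.
  rewrite (eq_bigl (fun k' => act k' && ~~ closeby J k k')); last by move=> k'; rewrite andbC.
  rewrite -sqrtrM ?mulr_ge0 ?(ltW N0)//.
  rewrite -[leLHS]ger0_norm; last exact: sumr_ge0.
  rewrite -sqrtr_sqr ler_wsqrtr//.
  have CS : (\sum_(k' | act k' && ~~ closeby J k k') r k k') ^+ 2 <=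
     (\sum_(k' | act k' && ~~ closeby J k k') 1) * (\sum_(k' | act k' && ~~ closeby J k k') r k k' ^+ 2).
    exact: (@sum_CS R _ (fun k' => act k' && ~~ closeby J k k') (r k)).
  apply: (le_trans CS); rewrite ler_pM//; [exact: sumr_ge0 | by apply: sumr_ge0 => ? _; exact: sqr_ge0 | | exact: hJ].
  by rewrite (le_trans _ actC)// big_mkcondr/=; apply: ler_sum => k' _; case: ifP.
have rho0 : 0 <= rho.
  by rewrite mulr_ge0 ?mulr_ge0 ?sqr_ge0// addr_ge0// mulr_ge0// sqrtr_ge0.
have Cs : 0 <= C * A / sqrtr N by rewrite divr_ge0 ?mulr_ge0// ltW.
have cC i : `|c i| <= C * A / sqrtr N.
  by rewrite /c normrM mulrAC ler_pM.
have Qrow i : \sum_j `|Q i j| <= rho.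
  apply: (@le_trans _ _ (\sum_(j : I) L ^+ 2 * r i.1 j.1)); first by apply: ler_sum => j _; exact: Qr.
  rewrite -mulr_sumr (sumI (r i.1)) /rho mulrCA mulrA ler_wpM2l ?mulr_ge0 ?sqr_ge0//.
have Qhs : \sum_i \sum_j Q i j ^+ 2 <= m ^+ 2 * L ^+ 4 * (C * N * K).
  apply: (@le_trans _ _ (\sum_(i : I) \sum_(j : I) L ^+ 4 * r i.1 j.1 ^+ 2)).
    apply: ler_sum => i _; apply: ler_sum => j _.
    rewrite (_ : L ^+ 4 * _ = (L ^+ 2 * r i.1 j.1) ^+ 2); last by ring.
    by rewrite -(real_normK (num_real (Q i j))) lerXn2r ?nnegrE// mulr_ge0 ?sqr_ge0.
  under eq_bigr => i _ do rewrite -mulr_sumr (sumI (fun k' => r i.1 k' ^+ 2)).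
  rewrite -mulr_sumr -mulr_sumr (sumI (fun k => \sum_k' r k k' ^+ 2)).
  rewrite (_ : L ^+ 4 * (m * (m * _)) = m ^+ 2 * L ^+ 4 * (\sum_k \sum_k' r k k' ^+ 2)); last by ring.
  rewrite ler_wpM2l ?mulr_ge0 ?sqr_ge0 ?exprn_ge0//.
  rewrite (bigID act)/= [X in _ + X]big1 ?addr0; last first.
    by move=> k nak; apply: big1 => k' _; rewrite rz ?expr0n// (negbTE nak).
  apply: (@le_trans _ _ (\sum_(k | act k) K * 1)); first by apply: ler_sum => k _; rewrite mulr1.
  by rewrite -mulr_sumr mulrC ler_wpM2r.
have := @cosum_clt _ _ _ P I Y Q c gY (C * A / sqrtr N) rho (m ^+ 2 * L ^+ 4 * (C * N * K)) Cs rho0 cC Qrow Qhs p.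
by rewrite -WE.
Qed.

End Array.

(** * Power sequences and tails of power sums *)

Section Powers.
Context {R : realType}.

Lemma powR_nat_cvgy (s M : R) : 0 < s -> \forall n \near \oo, M <= n%:R `^ s.
Proof.
move=> s0; have [M0|M0] := leP M 0.
  by apply: nearW => n; exact: le_trans (powR_ge0 _ _).
near=> n; have h : M `^ s^-1 <= n%:R by near: n; exact: nbhs_infty_ger.
have -> : M = (M `^ s^-1) `^ s by rewrite -powRrM mulVf ?powRr1 ?gt_eqF// ltW.
by apply: ge0_ler_powR; rewrite ?nnegrE ?powR_ge0// ?ltW// ler0n.
Unshelve. all: by end_near.
Qed.

Lemma powR_nat_cvg0 (s e : R) : s < 0 -> 0 < e -> \forall n \near \oo, n%:R `^ s <= e.
Proof.
move=> s0 e0; have s0' : 0 < - s by rewrite oppr_gt0.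
apply: filterS (powR_nat_cvgy e^-1 s0') => n h.
have -> : n%:R `^ s = (n%:R `^ (- s))^-1 by rewrite -powRN opprK.
by rewrite -[leRHS]invrK lef_pV2// ?posrE ?invr_gt0// (lt_le_trans _ h)// invr_gt0.
Qed.

(** Substitute for comparing a sum with an integral: ln (1 + x) <= x at x = -1/(j+1), followed by
    exp x >= 1 + x, bounds a term by a difference of consecutive values of j^(-b). *)
Lemma powR_telescope (b : R) (j : nat) : 0 < b -> (0 < j)%N ->
  b * j.+1%:R `^ (- (b + 1)) <= j%:R `^ (- b) - j.+1%:R `^ (- b) :> R.
Proof.
move=> b0 j0; have jp : 0 < j%:R :> R by rewrite ltr0n.
have j1p : 0 < j.+1%:R :> R by rewrite ltr0n.
rewrite opprD powRD; last by rewrite pnatr_eq0 implybT.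
rewrite powR_inv1 ?ler0n//.
have E (x : R) : 0 < x -> x `^ (- b) = expR (- b * ln x) by move=> x0; rewrite /powR gt_eqF.
rewrite (E _ jp) (E _ j1p).
have l1 : ln j%:R <= ln j.+1%:R - j.+1%:R^-1 :> R.
  have h : 0 < j%:R / j.+1%:R :> R by rewrite divr_gt0.
  have h1 : ln (j%:R / j.+1%:R) <= - j.+1%:R^-1 :> R.
    have -> : j%:R / j.+1%:R = 1 + - j.+1%:R^-1 :> R by rewrite -natr1; field; rewrite natr1 gt_eqF.
    have q : -1 < - j.+1%:R^-1 :> R by rewrite ltrN2 invf_lt1// ltr1n ltnS.
    exact: le_ln1Dx.
  by move: h1; rewrite ln_div ?posrE//; move: (ln j%:R) (ln j.+1%:R) (j.+1%:R^-1) => x y z; lra.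
have : expR (- b * ln j.+1%:R) * (1 + b * j.+1%:R^-1) <= expR (- b * ln j%:R).
  have e1 := expR_ge1Dx (b * j.+1%:R^-1 : R).
  apply: (@le_trans _ _ (expR (- b * ln j.+1%:R) * expR (b * j.+1%:R^-1))).
    by rewrite ler_pM2l ?expR_gt0.
  rewrite -expRD ler_expR.
  have : b * ln j%:R <= b * (ln j.+1%:R - j.+1%:R^-1) by rewrite ler_pM2l.
  by move: (ln j%:R) (ln j.+1%:R) (j.+1%:R^-1) => x y z; lra.
by move: (expR _) (expR _) (j.+1%:R^-1) => x y z; lra.
Qed.

Lemma powR_tail (s e : R) : 1 < s -> 0 < e -> exists2 J : nat, (0 < J)%N &
  forall J' m : nat, (J <= J')%N -> \sum_(i < m) (J'.+1 + i)%:R `^ (- s) <= e.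
Proof.
move=> s1 e0; pose b := s - 1; have b0 : 0 < b by rewrite subr_gt0.
have [J _ hJ] : \forall n \near \oo, n%:R `^ (- b) <= e * b.
  by apply: powR_nat_cvg0; rewrite ?oppr_lt0// mulr_gt0.
exists J.+1 => // J' m JJ.
have JJ' : (0 < J')%N by exact: leq_ltn_trans JJ.
have tel (k : nat) : b * \sum_(i < k) (J'.+1 + i)%:R `^ (- s) <= J'%:R `^ (- b) - (J' + k)%:R `^ (- b).
  elim: k => [|k IH]; first by rewrite big_ord0 mulr0 addn0 subrr.
  rewrite big_ord_recr/= mulrDr.
  have := @powR_telescope b (J' + k) b0; rewrite addn_gt0 JJ' => /(_ isT).
  have -> : b + 1 = s by rewrite /b subrK.
  by rewrite addnS addSn; lra.
rewrite -(ler_pM2l b0) (le_trans (tel m))//.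
rewrite mulrC (le_trans _ (hJ J' _))//; last by rewrite /= (leq_trans _ JJ).
by rewrite lerBlDr lerDl powR_ge0.
Qed.

Definition dst (k k' : nat) : nat := (k - k') + (k' - k).

Lemma dstC k k' : dst k k' = dst k' k. Proof. by rewrite /dst addnC. Qed.

(** The indices to the right and to the left of k are re-indexed separately by their distance minus
    J + 1. *)
Lemma tail_sum (M J : nat) (k : 'I_M) (f : nat -> R) : (forall j, 0 <= f j) ->
  \sum_(k' < M | ~~ closeby J k k') f (dst k k') <= 2 * \sum_(i < M) f (J.+1 + i)%N.
Proof.
move=> f0.
have sub (m : nat) : (m <= M)%N -> \sum_(0 <= i < m) f (J.+1 + i)%N <= \sum_(i < M) f (J.+1 + i)%N.
  move=> mM; rewrite -(big_mkord xpredT (fun i => f (J.+1 + i)%N)) [leRHS](@big_cat_nat _ _ _ m)//= lerDl.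
  exact: sumr_ge0.
rewrite (bigID (fun k' : 'I_M => (k + J < k')%N))/= mulr2n mulrDl mul1r lerD//.
  apply: (@le_trans _ _ (\sum_(0 <= i < M - (k + J).+1) f (J.+1 + i)%N)); last by apply: sub; exact: leq_subr.
  rewrite -(big_mkord (fun k' => ~~ ((k' <= k + J)%N && (k <= k' + J)%N) && (k + J < k')%N) (fun k' => f (dst k k'))).
  have [le|lt] := leqP (k + J).+1 M; last first.
    rewrite big_nat_cond big1 ?sumr_ge0// => i /andP[/andP[_ iM] /andP[_ kJ]].
    by move: (ltn_trans kJ iM); rewrite ltnNge -ltnS lt.
  rewrite (@big_cat_nat _ _ _ (k + J).+1)//= big_nat_cond big1 ?add0r; last first.
    by move=> i /andP[/andP[_ h1] /andP[_ h2]]; rewrite ltnNge -ltnS h1 in h2.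
  rewrite -{1}[(k + J).+1]add0n big_addn big_mkcond/=; apply: ler_sum_nat => i _.
  case: ifP => // _; rewrite /dst.
  have -> : (k - (i + (k + J).+1) = 0)%N by apply/eqP; rewrite subn_eq0 -addnS addnCA leq_addr.
  by rewrite add0n -addnS addnCA addKn addnC.
apply: (@le_trans _ _ (\sum_(0 <= i < k - J) f (J.+1 + i)%N)); last first.
  by apply: sub; rewrite (leq_trans (leq_subr _ _))// ltnW.
rewrite -(big_mkord (fun k' => ~~ ((k' <= k + J)%N && (k <= k' + J)%N) && ~~ (k + J < k')%N) (fun k' => f (dst k k'))).
have le : (k - J <= M)%N by rewrite (leq_trans (leq_subr _ _))// ltnW.
rewrite (@big_cat_nat _ _ _ (k - J))//= [X in _ + X]big_nat_cond [X in _ + X]big1 ?addr0; last first.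
  move=> i /andP[/andP[h1 _]]; rewrite -leqNgt => /andP[h2 h3].
  by move: h2; rewrite h3/= addnC -leq_subLR h1.
rewrite [leRHS]big_nat_rev/= add0n big_mkcond/= !big_nat; apply: ler_sum => i /andP[_ ik].
case: ifP => // _; rewrite /dst.
have ik' : (i <= k)%N by rewrite (leq_trans (ltnW ik))// leq_subr.
have kJ : (J <= k)%N by rewrite ltnW// -subn_gt0 (leq_ltn_trans _ ik).
have -> : (i - k = 0)%N by apply/eqP; rewrite subn_eq0.
rewrite addn0 (_ : (J.+1 + (k - J - i.+1) = k - i)%N)//.
rewrite -subnDA -addSnnS (addnC J.+1 i) subnDA addnC subnK//.
by rewrite ltn_subRL addnC -ltn_subRL.
Qed.

End Powers.

(** * Windows as intervals of indices *)

Section Windows.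
Context {R : realType}.

(** Here 2 a + v - 1 is the sum of the first and the last index. Its closeness to x + y expresses
    that the discrete interval is centred up to one unit, which later cancels the linear term of the
    bias. *)
Lemma filter_iota_interval (x y : R) (m : nat) : 1 <= x -> x + 1 <= y -> y <= m%:R ->
  exists a v : nat, [/\ [seq k <- iota 1 m | x <= k%:R <= y] = iota a v, (0 < a)%N, (a + v <= m.+1)%N,
    y - x - 1 <= v%:R <= y - x + 1 & `|2 * a%:R + v%:R - 1 - (x + y)| <= 1].
Proof.
move=> x1 xy ym.
have [a [ax xa]] : exists a : nat, a%:R < x + 1 /\ x <= a%:R.
  have h1 : (Num.truncn x)%:R <= x by rewrite truncn_le (le_trans _ x1).
  have h2 := truncnS_gt x.
  have [e|ne] := eqVneq ((Num.truncn x)%:R) x; first by exists (Num.truncn x); rewrite e ltrDl.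
  exists (Num.truncn x).+1; split; last exact: ltW.
  by rewrite -natr1 ltrD2r lt_neqAle ne.
have h1 : (Num.truncn y)%:R <= y by rewrite truncn_le; lra.
have h2 := truncnS_gt y.
set b := Num.truncn y in h1 h2.
have ap : (0 < a)%N by rewrite -(ltr0n R) (lt_le_trans _ xa)// (lt_le_trans _ x1).
have ab : (a <= b)%N.
  rewrite -ltnS -(ltr_nat R) (le_lt_trans _ h2)// (le_trans (ltW ax))//.
have bm : (b <= m)%N by rewrite -(ler_nat R) (le_trans h1).
exists a, (b.+1 - a)%N; split => //.
- apply: (@irr_sorted_eq _ ltn) => [||||k].
  + exact: ltn_trans.
  + exact: ltnn.
  + by apply: sorted_filter; [exact: ltn_trans | exact: iota_ltn_sorted].
  + exact: iota_ltn_sorted.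
  + rewrite mem_filter !mem_iota subnKC; last by rewrite leqW.
    apply/idP/idP => [/andP[/andP[k1 k2] _]|/andP[k1 k2]].
      rewrite !ltnS; apply/andP; split.
        by rewrite -ltnS -(ltr_nat R) (lt_le_trans ax)// -natr1 lerD2r.
      by rewrite -ltnS -(ltr_nat R) (le_lt_trans k2 h2).
    rewrite (le_trans xa) ?ler_nat// (le_trans _ h1) ?ler_nat -1?ltnS//=.
    by rewrite ltnS (leq_trans ap k1)/= add1n ltnS (leq_trans _ bm)// -ltnS.
- by rewrite subnKC ?ltnS// leqW.
- rewrite natrB ?leqW// -natr1; move: h2; rewrite -natr1 => h2; apply/andP; split; lra.
- rewrite natrB ?leqW// -natr1; move: h2; rewrite -natr1 => h2; rewrite ler_norml; apply/andP; split; lra.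
Qed.

Lemma nbr_iota (alpha t : R) : 0 < alpha < 1 -> 0 < t < 1 ->
  \forall n \near \oo, exists a v : nat,
    [/\ nbr alpha n 2 t = iota a v, (0 < a)%N /\ (a + v <= n - 2)%N,
      2 * n%:R `^ (1 - alpha) - 1 <= v%:R <= 2 * n%:R `^ (1 - alpha) + 1, `|2 * a%:R + v%:R - 1 - 2 * (t * n%:R)| <= 1 &
      forall k, k \in iota a v -> `|k%:R / n%:R - t| <= n%:R `^ (- alpha)].
Proof.
move=> /andP[a0 a1] /andP[t0 t1].
have h1 : \forall n \near \oo, n%:R `^ (- alpha) <= t / 2.
  by apply: powR_nat_cvg0; rewrite ?oppr_lt0// divr_gt0.
have h2 : \forall n \near \oo, n%:R `^ (- alpha) <= (1 - t) / 2.
  by apply: powR_nat_cvg0; rewrite ?oppr_lt0// divr_gt0// subr_gt0.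
have h3 : \forall n \near \oo, 1 <= n%:R `^ (1 - alpha) by apply: powR_nat_cvgy; rewrite subr_gt0.
apply: filter_app h3; apply: filter_app h2; apply: filter_app h1.
near=> n => h1 h2 h3; set q := n%:R `^ (1 - alpha).
have n0 : (0 < n)%N by near: n; exact: nbhs_infty_gt.
have np : 0 < n%:R :> R by rewrite ltr0n.
have qE : q = n%:R * n%:R `^ (- alpha).
  rewrite /q powRD; last by rewrite pnatr_eq0 -lt0n n0 implybT.
  by rewrite powRr1// ltW.
have q1 : 1 <= q by exact: h3.
have qt : q <= t / 2 * n%:R by rewrite qE mulrC ler_pM2r.
have qt' : q <= (1 - t) / 2 * n%:R by rewrite qE mulrC ler_pM2r.
have nt : 2 / t <= n%:R by near: n; exact: nbhs_infty_ger.
have nt' : 6 / (1 - t) <= n%:R by near: n; exact: nbhs_infty_ger.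
have nt2 : 2 <= n%:R * t by rewrite -ler_pdivrMr.
have nt3 : 6 <= n%:R * (1 - t) by rewrite -ler_pdivrMr// subr_gt0.
have n3 : (3 <= n)%N by near: n; exact: nbhs_infty_ge.
have nm : (n - 2 - 1)%:R = n%:R - 3 :> R by rewrite -subnDA natrB.
have [|||a [v [e a0' av vq c]]] := @filter_iota_interval (t * n%:R - q) (t * n%:R + q) (n - 2 - 1).
- lra.
- lra.
- by rewrite nm; lra.
have pE (k : nat) : (`|k%:R / n%:R - t| <= n%:R `^ (- alpha)) = (t * n%:R - q <= k%:R <= t * n%:R + q).
  rewrite ler_distl qE -(ler_pM2r np) -[in X in _ && X](ler_pM2r np) divfK ?gt_eqF//.
  by rewrite mulrBl mulrDl (mulrC n%:R).
have nE : nbr alpha n 2 t = iota a v by rewrite -e /nbr; apply: eq_filter => k; exact: pE.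
exists a, v; split => //.
- by split => //; move: av; rewrite -subSn ?subn1//= ltn_subRL addn0.
- by move: vq; rewrite (_ : t * n%:R + q - (t * n%:R - q) = 2 * q)//; ring.
- by move: c; rewrite (_ : t * n%:R - q + (t * n%:R + q) = 2 * (t * n%:R))//; ring.
- by move=> k; rewrite -nE /nbr mem_filter => /andP[].
Unshelve. all: by end_near.
Qed.

End Windows.
(* The filter of pairs (n, k) with n large and k in the window of t. *)
Definition win {R : realType} (alpha t : R) : set_system (nat * nat) :=
  [set A | \forall n \near \oo, forall k, k \in nbr alpha n 2 t -> A (n, k)].

Global Instance win_filter {R : realType} (alpha t : R) : Filter (win alpha t).
Proof.
split; rewrite /win /=.
- exact: nearW.
- move=> A B hA hB; have hA' : \forall n \near \oo, forall k, k \in nbr alpha n 2 t -> A (n, k) := hA.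
  have hB' : \forall n \near \oo, forall k, k \in nbr alpha n 2 t -> B (n, k) := hB.
  have : \forall n \near \oo, forall k, k \in nbr alpha n 2 t -> (A `&` B) (n, k); last by [].
  by apply: filterS2 hA' hB' => n h1 h2 k kn; split; [exact: h1 | exact: h2].
- move=> A B AB hA; have hA' : \forall n \near \oo, forall k, k \in nbr alpha n 2 t -> A (n, k) := hA.
  have : \forall n \near \oo, forall k, k \in nbr alpha n 2 t -> B (n, k); last by [].
  by apply: filterS hA' => n h k kn; exact/AB/h.
Qed.

Lemma winI {R : realType} (alpha t : R) (A : nat * nat -> Prop) :
  (\forall n \near \oo, forall k, k \in nbr alpha n 2 t -> A (n, k)) -> \forall x \near win alpha t, A x.
Proof. by []. Qed.

Lemma win_inf {R : realType} (alpha t : R) (m : nat) : \forall x \near win alpha t, (m <= x.1)%N.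
Proof. by apply: winI; near=> n => k _ /=; near: n; exact: nbhs_infty_ge. Unshelve. all: by end_near. Qed.

(** * Limits along the windows *)

Section WindowFilter.
Context {R : realType}.
Variables (alpha t : R).
Hypotheses (alpha01 : 0 < alpha < 1) (t01 : 0 < t < 1).
Local Notation F := (win alpha t).

Lemma win_time (p : nat) : (x.2 + p)%:R / x.1%:R @[x --> F] --> t.
Proof.
have /andP[a0 a1] := alpha01.
apply/cvgrPdist_le => e e0.
have e2 : 0 < e / 2 by rewrite divr_gt0.
have h1 : \forall n \near \oo, n%:R `^ (- alpha) <= e / 2 by apply: powR_nat_cvg0; rewrite ?oppr_lt0.
apply: winI; near=> n => k; rewrite /nbr mem_filter => /andP[kt _] /=.
have n0 : (0 < n)%N by near: n; exact: nbhs_infty_gt.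
have np : 0 < n%:R :> R by rewrite ltr0n.
have pn : p%:R / n%:R <= e / 2.
  by rewrite ler_pdivrMr// mulrC -ler_pdivrMr//; near: n; exact: nbhs_infty_ger.
have h2 : n%:R `^ (- alpha) <= e / 2 by near: n.
have p0 : 0 <= p%:R / n%:R :> R by rewrite divr_ge0.
rewrite natrD mulrDl; move: kt; move: (k%:R / n%:R) (p%:R / n%:R) pn p0 => x y yl y0.
rewrite !ler_norml; lra.
Unshelve. all: by end_near.
Qed.

Lemma win_mid (eps : R) (p q : nat) : 0 < eps -> eps < t < 1 - eps ->
  \forall x \near F, mid eps x.1 (x.2 + p) /\ sampled x.1 q (x.2 + p).
Proof.
move=> e0 /andP[et te].
have h1 := win_time p; have h2 := win_time (p + q).
move: h1 => /cvgrPdist_lt /(_ (minr (t - eps) (1 - eps - t))).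
rewrite lt_min !subr_gt0 et te => /(_ isT) h1.
move: h2 => /cvgrPdist_lt /(_ (1 - t)); rewrite subr_gt0 => h2.
have {}h2 := h2 (proj2 (andP t01)).
apply: filterS3 h1 h2 (win_inf _ _ 1) => -[n k]/=; rewrite lt_min => /andP[h1 h3] h2 n0.
have np : 0 < n%:R :> R by rewrite ltr0n.
set y := (k + p)%:R / n%:R in h1 h3.
have yn : (k + p)%:R = y * n%:R by rewrite /y divfK// gt_eqF.
have y1 : eps < y by move: h1; rewrite ltr_norml => /andP[]; lra.
have y2 : y < 1 - eps by move: h3; rewrite ltr_norml => /andP[]; lra.
split.
  apply/andP; split.
    rewrite -(ler_nat R) yn (@le_trans _ _ (n%:R * eps))//.
      by rewrite truncn_le mulr_ge0// ltW.
    by rewrite mulrC ler_pM2r// ltW//.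
  rewrite -ltnS -(ltr_nat R) (le_lt_trans _ (truncnS_gt _))// yn ler_pM2r// ltW//.
rewrite /sampled; apply/andP; split; first by rewrite -(ltr_nat R) yn mulr_gt0// (lt_trans e0).
rewrite -(ltr_nat R).
move: h2; rewrite ltr_norml addnA => /andP[h2 _].
by rewrite -[ltRHS]mul1r -ltr_pdivrMr//; move: (_ / _) h2 => z; lra.
Qed.

End WindowFilter.

(** Half the distance from t to the ends of the unit interval, taken as eps in the assumptions. *)
Definition margin {R : realType} (t : R) : R := minr t (1 - t) / 2.

Lemma margin_gt0 {R : realType} (t : R) : 0 < t < 1 -> 0 < margin t.
Proof. by move=> /andP[a b]; rewrite divr_gt0// lt_min a subr_gt0. Qed.

Lemma margin_lt {R : realType} (t : R) : 0 < t < 1 -> margin t < t < 1 - margin t.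
Proof.
move=> /andP[a b].
have h1 : minr t (1 - t) <= t by rewrite ge_min lexx.
have h2 : minr t (1 - t) <= 1 - t by rewrite ge_min lexx orbT.
by rewrite /margin; apply/andP; split; lra.
Qed.

Section WindowProcess.
Context {R : realType} `{T : measurableType d} `{T' : measurableType d'}.
Variables (P : probability T R) (PB : probability T' R) (B : R -> R -> {RV PB >-> R}).
Variables (Z : R -> {RV P >-> R}) (alpha kappa eta : R) (H c : R -> R).
Hypotheses (hB : forall h : R, 0 < h < 1 -> is_fbm h (B h)) (gZ : gaussian_process `]0, 1[ Z).
Hypotheses (zZ : zero_mean `]0, 1[ Z) (alpha01 : 0 < alpha < 1) (kap0 : 0 <= kappa).
Hypothesis hA : assumption_A B 2 kappa eta H c Z.
Variable t : R.
Hypothesis t01 : 0 < t < 1.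
Local Notation F := (win alpha t).
Local Notation vz := (vz Z).

Definition vv (n k : nat) : R := Ex P (fun w => vz n k w ^+ 2).
Definition cz (n k k' : nat) : R := Ex P (fun w => vz n k w * vz n k' w).

Lemma czC n k k' : cz n k k' = cz n k' k.
Proof. by congr Ex; apply/funext => w; rewrite mulrC. Qed.

Lemma czz n k : cz n k k = vv n k. Proof. by congr Ex; apply/funext => w; rewrite -expr2. Qed.

Lemma H_in (s : R) : 0 < s < 1 -> {for s, continuous H} /\ 0 < H s < 1.
Proof. by move=> s01; have [_ _ _ /(_ s s01)[]] := hA. Qed.

Lemma win_rc (p : nat) (x : R) : rc (H ((y.2 + p)%:R / y.1%:R)) x @[y --> F] --> rc (H t) x.
Proof.
have [cH H01] := H_in t01.
apply: (@continuous_cvg _ _ _ _ _ _ (fun h => rc h x)); first exact: continuous_rc.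
apply: (@continuous_cvg _ _ _ _ _ _ H); first exact: cH.
exact: win_time.
Qed.

Local Notation eps := (margin t).
Let eps0 : 0 < eps := margin_gt0 t01.
Let epst : eps < t < 1 - eps := margin_lt t01.
Let epsh : 0 < eps < 2^-1. Proof. by rewrite eps0; have /andP[a b] := epst; lra. Qed.

Lemma win_A (p j : nat) (e : R) : 0 < e -> \forall x \near F,
   [/\ 0 < vv x.1 (x.2 + p),
    `|cz x.1 (x.2 + p) (x.2 + p + j) / vv x.1 (x.2 + p) - rc (H ((x.2 + p)%:R / x.1%:R)) j%:R| <= e &
    `|vv x.1 (x.2 + p + j) / vv x.1 (x.2 + p) - 1| <= e].
Proof.
move=> e0.
have h1 := A_cov hB gZ zZ kap0 hA j epsh e0.
have h2 := win_mid alpha01 t01 p j.+2 eps0 epst.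
have h1' : \forall x \near F, forall k, mid eps x.1 k -> sampled x.1 j.+2 k ->
   [/\ 0 < vv x.1 k, x.1%:R `^ kappa * `|cz x.1 k (k + j) / vv x.1 k - rc (H (k%:R / x.1%:R)) j%:R| <= e &
    x.1%:R `^ kappa * `|vv x.1 (k + j) / vv x.1 k - 1| <= e].
  by apply: filterS h1 => n h k _.
apply: filterS3 h1' h2 (win_inf _ _ 1) => -[n k]/= h [mk sk] n1.
have [h3 h4 h5] := h _ mk sk; split => //.
  by apply: le_trans h4; rewrite ler_peMl// -[leLHS](powRr0 n%:R) ler_powR// ler1n.
by apply: le_trans h5; rewrite ler_peMl// -[leLHS](powRr0 n%:R) ler_powR// ler1n.
Qed.

Lemma win_vpos (p : nat) : \forall x \near F, 0 < vv x.1 (x.2 + p).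
Proof. by apply: filterS (@win_A p 0 1 ltr01) => x [].  Qed.

Lemma win_vratio (p j : nat) : vv x.1 (x.2 + p + j) / vv x.1 (x.2 + p) @[x --> F] --> (1 : R).
Proof.
apply/cvgrPdist_le => e e0; apply: filterS (@win_A p j e e0) => x [_ _].
by rewrite distrC.
Qed.

Lemma win_cz_ratio (p j : nat) : cz x.1 (x.2 + p) (x.2 + p + j) / vv x.1 (x.2 + p) @[x --> F] --> rc (H t) j%:R.
Proof.
apply/cvgrPdist_le => e e0; have e2 : 0 < e / 2 by rewrite divr_gt0.
have h1 := @win_A p j _ e2.
have /cvgrPdist_le /(_ _ e2) h2 := @win_rc p j%:R.
apply: filterS2 h1 h2 => x [_ h1 _] h2.
by rewrite -(subrKA (rc (H ((x.2 + p)%:R / x.1%:R)) j%:R)) (le_trans (ler_normD _ _))// (distrC _ (cz _ _ _ / _)) [leRHS]splitr lerD.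
Qed.

(** (A) gives the limit normalized at the earlier point; the ratio of variances moves the
    normalization to the window index, and negative lags follow from evenness of [fc]. *)
Lemma win_cz (p p' : nat) : cz x.1 (x.2 + p) (x.2 + p') / vv x.1 x.2 @[x --> F] --> rc (H t) (p'%:R - p%:R).
Proof.
wlog pp : p p' / (p <= p')%N => [h|].
  have [/h//|/ltnW /h] := leqP p p'.
  rewrite -opprB /rc fcN; under eq_fun do rewrite czC; exact.
rewrite -natrB//.
have h1 := @win_cz_ratio p (p' - p).
have h2 := @win_vratio 0 p.
rewrite -[X in _ --> X]mulr1; apply: cvg_trans; last exact: cvgM h1 h2.
apply: near_eq_cvg; apply: filterS2 (win_vpos p) (win_vpos 0) => x v1 v2.
rewrite /= (_ : (x.2 + p + (p' - p) = x.2 + p')%N); last by rewrite -addnA subnKC.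
move: v2; rewrite !addn0 => v2.
by field; rewrite !gt_eqF.
Qed.

Lemma win_sqrt_ratio (j : nat) : sqrtr (vv x.1 x.2) / sqrtr (vv x.1 (x.2 + j)) @[x --> F] --> (1 : R).
Proof.
have h := @win_vratio 0 j.
have h1 : (sqrtr (vv x.1 (x.2 + 0 + j) / vv x.1 (x.2 + 0)))^-1 @[x --> F] --> (sqrtr 1)^-1.
  apply: cvgV; first by rewrite sqrtr1 oner_neq0.
  by apply: continuous_cvg h; exact: sqrt_continuous.
rewrite sqrtr1 invr1 in h1; apply: cvg_trans h1.
apply: near_eq_cvg; apply: filterS2 (win_vpos 0) (win_vpos j) => x v1 v2.
by rewrite addn0 in v1 *; rewrite sqrtrM ?sqrtrV ?invfM ?invrK 1?mulrC// ltW.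
Qed.

(* Both components are scaled by the variance at k: psi is invariant under a
   common scaling, and [vv n k.+1] need not be known. *)
Definition xz (n k : nat) (b : bool) (w : T) : R := (sqrtr (vv n k))^-1 * vz n (k + b) w.

Lemma psib_xz n k w : 0 < vv n k -> psib ((xz n k)^~ w) = psi (vz n k w) (vz n k.+1 w).
Proof.
by move=> v0; rewrite /psib /xz psiZ ?addn0 ?addn1// invr_eq0 gt_eqF// sqrtr_gt0.
Qed.

Lemma gspan_xz n k (b : bool) : sampled n 2 (k + b) -> gspan `]0, 1[ Z (xz n k b).
Proof. by move=> s; apply: gspanZ; exact: gspan_vz. Qed.

Lemma Ex_xz n k k' (a b : bool) : sampled n 2 (k + a) -> sampled n 2 (k' + b) ->
  Ex P (fun w => xz n k a w * xz n k' b w) =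
  cz n (k + a) (k' + b) / (sqrtr (vv n k) * sqrtr (vv n k')).
Proof.
move=> s s'; rewrite (_ : (fun w => _) = (fun w => (sqrtr (vv n k) * sqrtr (vv n k'))^-1 * (vz n (k + a) w * vz n (k' + b) w))).
  by rewrite ExZ 1?mulrC//; apply: (gspan_itgM gZ); exact: gspan_vz.
by apply/funext => w; rewrite /xz invfM; ring.
Qed.

Lemma win_xz (i j : nat) (a b : bool) :
  Ex P (fun w => xz x.1 (x.2 + i) a w * xz x.1 (x.2 + j) b w) @[x --> F] --> rc (H t) ((j + b)%:R - (i + a)%:R).
Proof.
have h := @win_cz (i + a) (j + b); have hi := win_sqrt_ratio i; have hj := win_sqrt_ratio j.
have := cvgM h (cvgM hi hj); rewrite !mulr1 => {h hi hj} h.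
apply: cvg_trans; last exact: h.
apply: near_eq_cvg; apply: filterS3 (win_vpos 0) (win_mid alpha01 t01 (i + a) 2 eps0 epst) (win_mid alpha01 t01 (j + b) 2 eps0 epst).
move=> x; rewrite addn0 => v0 [_ s] [_ s']; rewrite Ex_xz -?addnA//.
rewrite /=; have sq := sqr_sqrtr (ltW v0); have := sqrtr_gt0 (vv x.1 x.2); rewrite v0.
move: (sqrtr (vv x.1 x.2)) sq => z <- z0; rewrite !invfM.
move: ((sqrtr _)^-1) ((sqrtr _)^-1) => y y'; field; by rewrite gt_eqF.
Qed.

End WindowProcess.
Lemma fine_covariance `{T : measurableType d} {R : realType} (P : probability T R)
  (X Y : T -> R) : bddm X -> bddm Y ->
  fine (covariance P X Y) = Ex P (fun w => X w * Y w) - Ex P X * Ex P Y.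
Proof.
move=> bX bY; rewrite covariance.unlock !fine_expectation.
rewrite (_ : Ex P _ = Ex P (fun w => X w * Y w + (- Ex P Y * X w + (- Ex P X * Y w + Ex P X * Ex P Y)))); last first.
  by congr Ex; apply/funext => w /=; rewrite -[(_ * _) w]/((X w - Ex P X) * (Y w - Ex P Y)); ring.
have i1 := bddm_itg P (bddmM bX bY).
have i2 := itgZ (- Ex P Y) (bddm_itg P bX).
have i3 := itgZ (- Ex P X) (bddm_itg P bY).
have i4 := itg_cst P (Ex P X * Ex P Y).
rewrite (ExD i1 (itgD i2 (itgD i3 i4))) (ExD i2 (itgD i3 i4)) (ExD i3 i4) Ex_cst.
rewrite ExZ ?ExZ; [ring | exact: bddm_itg | exact: bddm_itg].
Qed.

(** * Covariances of psi along fractional Brownian motion *)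

Section FBMPsi.
Context {R : realType} `{T' : measurableType d'}.
Variables (PB : probability T' R) (h : R) (Bh : R -> {RV PB >-> R}).
Hypotheses (h01 : 0 < h < 1) (fB : is_fbm h Bh).

Definition xb (k : int) (b : bool) (w : T') : R :=
  (sqrtr (fc h 0))^-1 * gvar_rv astar 1 Bh (k + b%:Z)%:~R w.

Let gB : gaussian_process setT Bh. Proof. by case: fB. Qed.
Let zB : zero_mean setT Bh. Proof. by case: fB. Qed.

Lemma gspan_xb k b : gspan setT Bh (xb k b).
Proof. by apply: gspanZ; exact: gspan_gvar_fbm. Qed.

Lemma Ex_xb k k' a b : Ex PB (fun w => xb k a w * xb k' b w) = rc h ((k' + b%:Z)%:~R - (k + a%:Z)%:~R).
Proof.
have f0 := fc0_gt0 h01; have s0 : 0 < sqrtr (fc h 0) by rewrite sqrtr_gt0.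
rewrite (_ : (fun w => _) = (fun w => (fc h 0)^-1 * (gvar_rv astar 1 Bh (k + a%:Z)%:~R w * gvar_rv astar 1 Bh (k' + b%:Z)%:~R w))); last first.
  by apply/funext => w; rewrite /xb -[in RHS](sqr_sqrtr (ltW f0)); field; rewrite gt_eqF.
rewrite ExZ; last by apply: (gspan_itgM gB); exact: gspan_gvar_fbm.
by rewrite (fbm_gvar_cov h01 fB)// invr1 powR1 mul1r mulr1 mulrC.
Qed.

Lemma psib_xb k w : psib ((xb k)^~ w) = psi (gvar_rv astar 1 Bh k%:~R w) (gvar_rv astar 1 Bh (k + 1)%:~R w).
Proof. by rewrite /psib /xb psiZ ?addr0// invr_eq0 gt_eqF// sqrtr_gt0 fc0_gt0. Qed.

Lemma measurable_xb k b : measurable_fun setT (xb k b).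
Proof. exact: gspan_measurable (gspan_xb k b). Qed.

Lemma bddm_psib_xb k : bddm (fun w => psib ((xb k)^~ w)).
Proof. by apply: bddm_psi; exact: measurable_xb. Qed.

Definition cvb (i j : int) : R :=
  Ex PB (fun w => psib ((xb i)^~ w) * psib ((xb j)^~ w)) -
  Ex PB (fun w => psib ((xb i)^~ w)) * Ex PB (fun w => psib ((xb j)^~ w)).

Definition xbp (i j : int) (z : bool + bool) : T' -> R :=
  match z with inl a => xb i a | inr b => xb j b end.

Lemma gvec_xbp i j : gvec PB (xbp i j) (fun z z' => Ex PB (fun w => xbp i j z w * xbp i j z' w)).
Proof. by apply: (gspan_gvec gB zB) => -[a|b]; exact: gspan_xb. Qed.

Lemma rc00 : rc h 0 = 1. Proof. by rewrite /rc divff// gt_eqF// fc0_gt0. Qed.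

(** Both pairs of pairs have the same covariance matrix, so [psi_cov_cont] bounds the difference by
    every e > 0. *)
Lemma cvb_shift (i j k : int) : cvb (i + k) (j + k) = cvb i j.
Proof.
apply/eqP; rewrite -subr_eq0 -normr_le0; apply/ler_addgt0Pr => e e0; rewrite add0r.
have [dlt dlt0 H] := psi_cov_cont e0.
apply: (H _ _ _ _ _ _ _ _ _ _ (gvec_xbp (i + k) (j + k)) (gvec_xbp i j)).
1-8: by rewrite Ex_xb subrr rc00// ler1n.
move=> z z'; rewrite (_ : _ - _ = 0) ?normr0 ?ltW//; apply/eqP; rewrite subr_eq0; apply/eqP.
by case: z z' => a [b|b] /=; rewrite !Ex_xb; congr rc; rewrite -!intrB; congr _%:~R; ring.
Qed.

Lemma cvbC (i j : int) : cvb i j = cvb j i.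
Proof. by rewrite /cvb [X in _ - X]mulrC; congr (Ex _ _ - _); apply/funext => w; rewrite mulrC. Qed.

End FBMPsi.

Section CovPsi.
Context {R : realType} `{T' : measurableType d'}.
Variables (PB : probability T' R) (B : R -> R -> {RV PB >-> R}) (h : R).
Hypotheses (h01 : 0 < h < 1) (fB : is_fbm h (B h)).

Lemma cov_psiE (k : int) : cov_psi B h k = cvb h (B h) 0 k.
Proof.
rewrite /cov_psi /cvb -fine_covariance; [|exact: bddm_psib_xb..].
by congr (fine (covariance PB _ _)); apply/funext => w; rewrite psib_xb// ?add0r.
Qed.

Lemma cov_psiN (k : int) : cov_psi B h (- k) = cov_psi B h k.
Proof. by rewrite !cov_psiE -(cvb_shift h01 fB 0 (- k) k) add0r addNr cvbC. Qed.

End CovPsi.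
Lemma dst_lt k k' : (k < k')%N -> maxn 1 (dst k k') = (k' - k)%N.
Proof. rewrite /dst; lia. Qed.

Lemma dst_neq k k' (a b : bool) : (1 < dst k k')%N -> (k + a)%N != (k' + b)%N.
Proof. by rewrite /dst; case: a; case: b => /= h; apply/eqP; lia. Qed.

(** The components of a pair sit at k and k + 1, so passing to components can bring a distance 2
    down to 1. *)
Lemma dst_half k k' (a b : bool) : (1 < dst k k')%N ->
  (maxn 1 (dst k k') <= 2 * maxn 1 (dst (k + a) (k' + b)))%N.
Proof. rewrite /dst; case: a; case: b => /=; lia. Qed.

(** What (B) gives for theta = 0 and the filter [astar]. *)
Definition corr_decay {R : realType} `{T : measurableType d} (P : probability T R)
    (Z : R -> {RV P >-> R}) (alpha gam : R) : Prop :=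
  forall eps : R, 0 < eps < 2^-1 -> exists2 C : R, 0 < C & forall n k k' : nat, (0 < n)%N ->
    (Num.truncn (n%:R * eps) <= k)%N -> (k < k')%N -> (k' <= Num.truncn ((1 - eps) * n%:R))%N ->
    sampled n 2 k -> sampled n 2 k' ->
    `|correlation P (vz Z n k) (vz Z n k')| <=
      C * (minr `|k'%:R - k%:R| (n%:R `^ (1 - alpha))) `^ (- gam).

Section WindowCovariance.
Context {R : realType} `{T : measurableType d} `{T' : measurableType d'}.
Variables (P : probability T R) (PB : probability T' R) (B : R -> R -> {RV PB >-> R}).
Variables (Z : R -> {RV P >-> R}) (alpha kappa eta : R) (H c : R -> R).
Hypotheses (hB : forall h : R, 0 < h < 1 -> is_fbm h (B h)) (gZ : gaussian_process `]0, 1[ Z).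
Hypotheses (zZ : zero_mean `]0, 1[ Z) (alpha01 : 0 < alpha < 1) (kap0 : 0 <= kappa).
Hypothesis hA : assumption_A B 2 kappa eta H c Z.
Local Notation vz := (vz Z).
Local Notation vv := (vv Z).
Local Notation cz := (cz Z).
Local Notation xz := (xz Z).

Definition psz (n k : nat) (w : T) : R := psi (vz n k w) (vz n k.+1 w).

Definition cc (n k k' : nat) : R :=
  Ex P (fun w => psz n k w * psz n k' w) - Ex P (psz n k) * Ex P (psz n k').

Lemma ccC n k k' : cc n k k' = cc n k' k.
Proof. by rewrite /cc [X in _ - X]mulrC; congr (Ex _ _ - _); apply/funext => w; rewrite mulrC. Qed.

Lemma measurable_vz n k : measurable_fun setT (vz n k).
Proof.
apply: measurable_sum => i; apply: measurable_funM; first exact: measurable_cst.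
exact: (measurable_funPT (Z _)).
Qed.

Lemma bddm_psz n k : bddm (psz n k).
Proof. by apply: (@bddm_psi _ _ _ (vz n k) (vz n k.+1)); exact: measurable_vz. Qed.

Definition xzp (n k k' : nat) (z : bool + bool) : T -> R :=
  match z with inl a => xz n k a | inr b => xz n k' b end.

(** The room up to k + 4 covers the increment at k + 1 and the lag-1 filters, which reach k + 3. *)
Definition good (eps : R) (n k : nat) : bool := [&& mid eps n k, mid eps n k.+1 & sampled n 4 k].

Lemma good_sampled eps n k (b : bool) : good eps n k -> sampled n 2 (k + b).
Proof.
move=> /and3P[_ _ /andP[h1 h2]]; rewrite /sampled addn_gt0 h1/= (leq_ltn_trans _ h2)//.
by rewrite -addnA leq_add2l; case: b.
Qed.

Lemma win_good (eps t : R) (p : nat) : 0 < eps -> eps < t < 1 - eps ->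
  \forall x \near win alpha t, good eps x.1 (x.2 + p).
Proof.
move=> e0 h; have t01 : 0 < t < 1 by move: h => /andP[? ?]; apply/andP; split; lra.
apply: filterS2 (win_mid alpha01 t01 p 4 e0 h) (win_mid alpha01 t01 p.+1 4 e0 h) => x [h1 h2] [h3 _].
by rewrite /good h1 h2 -addnS h3.
Qed.

Lemma gvec_xzp eps n k k' : good eps n k -> good eps n k' ->
  gvec P (xzp n k k') (fun z z' => Ex P (fun w => xzp n k k' z w * xzp n k k' z' w)).
Proof.
by move=> h h'; apply: (gspan_gvec gZ zZ) => -[a|b]; apply: gspan_xz; [exact: good_sampled h | exact: good_sampled h'].
Qed.

Section OneTime.
Variable t : R.
Hypothesis t01 : 0 < t < 1.
Local Notation F := (win alpha t).

Local Notation eps := (margin t).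
Let eps0 : 0 < eps := margin_gt0 t01.
Let epst : eps < t < 1 - eps := margin_lt t01.

Let Ht : 0 < H t < 1. Proof. by have [] := H_in hA t01. Qed.

Lemma Ex_xz00 n k : sampled n 2 k -> 0 < vv n k -> Ex P (fun w => xz n k false w * xz n k false w) = 1.
Proof.
move=> s v0; rewrite (Ex_xz gZ (a := false) (b := false)) ?addn0//.
by rewrite czz -expr2 sqr_sqrtr ?divff ?gt_eqF// ltW.
Qed.

Lemma win_xz11 (i : nat) : \forall x \near F, Ex P (fun w => xz x.1 (x.2 + i) true w * xz x.1 (x.2 + i) true w) <= 2.
Proof.
have := win_xz hB gZ zZ alpha01 kap0 hA t01 (i:=i) (j:=i) (a:=true) (b:=true); rewrite subrr rc00// => /cvgrPdist_le /(_ 1 ltr01).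
by apply: filterS => x; rewrite ler_norml => /andP[h _]; lra.
Qed.

(** All entries of the covariance of the two normalized pairs converge to those of fractional
    Brownian motion of index H(t); [psi_cov_cont] carries this to psi. *)
Lemma win_cov (j : nat) : cc x.1 x.2 (x.2 + j) @[x --> F] --> cov_psi B (H t) j%:Z.
Proof.
rewrite (cov_psiE B Ht); apply/cvgrPdist_le => e e0.
have [dlt dlt0 K] := psi_cov_cont e0.
have near_ent : \forall x \near F, forall z z' : bool + bool,
    `|Ex P (fun w => xzp x.1 x.2 (x.2 + j) z w * xzp x.1 x.2 (x.2 + j) z' w) -
      Ex PB (fun w => xbp (H t) (B (H t)) 0 j%:Z z w * xbp (H t) (B (H t)) 0 j%:Z z' w)| <= dlt.
  apply: filter_forall => z; apply: filter_forall => z'.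
  pose idx (z : bool + bool) := match z with inl a => 0%N | inr b => j end.
  pose bt (z : bool + bool) := match z with inl a => a | inr b => b end.
  have := win_xz hB gZ zZ alpha01 kap0 hA t01 (i:=idx z) (j:=idx z') (a:=bt z) (b:=bt z').
  move=> /cvgrPdist_le /(_ dlt dlt0); apply: filterS => x; rewrite distrC.
  by case: z => a; case: z' => b /=; rewrite ?addn0 (Ex_xb Ht (hB Ht)) ?add0r -?PoszD; exact.
apply: filterS3 near_ent (filterI (win_xz11 0) (win_xz11 j)) (filterI (filterI (win_good 0 eps0 epst) (win_good j eps0 epst))
  (filterI (win_vpos hB gZ zZ alpha01 kap0 hA t01 0) (win_vpos hB gZ zZ alpha01 kap0 hA t01 j))).
move=> [n k]/= ent [l1 l2] [[g1 g2] [v1 v2]]; rewrite addn0 in l1 g1 v1.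
have s1 : sampled n 2 k by have := good_sampled false g1; rewrite addn0.
have s2 : sampled n 2 (k + j) by have := good_sampled false g2; rewrite addn0.
have rcH : rc (H t) 0 = 1 by exact: rc00.
have := K _ _ _ _ _ _ _ _ _ _ (gvec_xzp g1 g2) (gvec_xbp (hB Ht) 0 j%:Z).
rewrite distrC /cvb /cc; have pE m : 0 < vv n m -> (fun w => psib ((xz n m)^~ w)) = psz n m.
  by move=> v0; apply/funext => w; rewrite psib_xz.
rewrite /= (pE _ v1) (pE _ v2) (_ : (fun w => psib _ * psib _) = (fun w => psz n k w * psz n (k + j) w)); last first.
  by rewrite -(pE _ v1) -(pE _ v2).
apply => //; rewrite ?(Ex_xb Ht (hB Ht)) ?subrr ?rcH ?ler1n//; exact: Ex_xz00.
Qed.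

(** The conditional variance of the second component tends to 1 - r^2 > 0, where r is the lag-1
    correlation at H(t); half of it is kept. Every smaller v1 is allowed so that finitely many times
    can share one constant. *)
Lemma win_nice : exists2 v0 : R, 0 < v0 <= 1 &
  forall v1, 0 < v1 <= v0 -> forall p,
  \forall x \near F, nice v1 (fun a b => Ex P (fun w => xz x.1 (x.2 + p) a w * xz x.1 (x.2 + p) b w)).
Proof.
have [/andP[r1 r2] _] := rc1_Lam2 Ht; set r := rc (H t) 1 in r1 r2.
have q0 : 0 < 1 - r ^+ 2 by rewrite (_ : _ - _ = (1 - r) * (1 + r)) ?mulr_gt0//; [lra | lra | ring].
have q1 : 1 - r ^+ 2 <= 1 by rewrite lerBlDr lerDl sqr_ge0.
exists (sqrtr ((1 - r ^+ 2) / 2)).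
  by rewrite sqrtr_gt0 divr_gt0//= -[leRHS]sqrtr1 ler_wsqrtr//; lra.
move=> v1 /andP[v10 v1v] p.
have v2 : v1 ^+ 2 <= (1 - r ^+ 2) / 2.
  by rewrite -[leRHS]sqr_sqrtr ?divr_ge0 ?(ltW q0)// lerXn2r ?nnegrE ?sqrtr_ge0// ltW.
have h1 := win_xz hB gZ zZ alpha01 kap0 hA t01 (i:=p) (j:=p) (a:=false) (b:=true).
have h2 := win_xz hB gZ zZ alpha01 kap0 hA t01 (i:=p) (j:=p) (a:=true) (b:=true).
rewrite subrr rc00// in h2; rewrite addn0 addn1 -addn1 natrD addrAC subrr add0r -/r in h1.
have h3 : Ex P (fun w => xz x.1 (x.2 + p) true w * xz x.1 (x.2 + p) true w)
   - Ex P (fun w => xz x.1 (x.2 + p) false w * xz x.1 (x.2 + p) true w) ^+ 2 @[x --> F] --> 1 - r ^+ 2.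
  by apply: (cvgB h2); rewrite expr2; under eq_fun do rewrite expr2; apply: cvgM; exact: h1.
have q2 : 0 < (1 - r ^+ 2) / 2 by rewrite divr_gt0.
move: h3 => /cvgrPdist_le /(_ _ q2) h3.
apply: filterS3 h3 (win_xz11 p) (filterI (win_good p eps0 epst) (win_vpos hB gZ zZ alpha01 kap0 hA t01 p)).
move=> [n k]/= h3 l1 [g1 v0].
have s1 : sampled n 2 (k + p) by have := good_sampled false g1; rewrite addn0.
split => //; first exact: Ex_xz00.
by move: h3 v2; rewrite ler_norml => /andP[_]; lra.
Qed.

End OneTime.

Section Decay.
Variable gam : R.
Hypotheses (gam0 : 2^-1 < gam) (hBa : corr_decay Z alpha gam).

(** A sum of two powers majorizes the negative power of the minimum in (B) and separates the true
    decay from the plateau; [maxn 1] covers lag 0. *)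
Definition drate (n j : nat) : R := (maxn 1 j)%:R `^ (- gam) + (n%:R `^ (1 - alpha)) `^ (- gam).

Lemma cz_decay (eps : R) : 0 < eps < 2^-1 -> exists2 C : R, 0 < C & forall n k k', (0 < n)%N ->
  mid eps n k -> mid eps n k' -> sampled n 2 k -> sampled n 2 k' -> k != k' ->
  `|cz n k k'| <= sqrtr (vv n k) * sqrtr (vv n k') * (C * drate n (dst k k')).
Proof.
move=> he; have [C C0 hC] := hBa he; exists C => // n.
have main k k' : (0 < n)%N -> mid eps n k -> mid eps n k' -> sampled n 2 k -> sampled n 2 k' -> (k < k')%N ->
   `|cz n k k'| <= sqrtr (vv n k) * sqrtr (vv n k') * (C * drate n (dst k k')).
  move=> n0 /andP[mk _] /andP[_ mk'] s s' kk.
  have := hC n k k' n0 mk kk mk' s s'.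
  have g1 := gspan_vz Z s; have g2 := gspan_vz Z s'.
  rewrite /correlation (gspan_covariance gZ zZ g1 g2) (gspan_variance gZ zZ g1) (gspan_variance gZ zZ g2) -/(cz n k k') -/(vv n k) -/(vv n k').
  set s1 := sqrtr (vv n k); set s2 := sqrtr (vv n k').
  have CS : `|cz n k k'| <= s1 * s2.
    exact: (Ex_cauchy_schwarz (gspan_itg2 gZ g1) (gspan_itg2 gZ g2) (gspan_itgM gZ g1 g2)).
  have s10 : 0 <= s1 by exact: sqrtr_ge0.
  have s20 : 0 <= s2 by exact: sqrtr_ge0.
  (* With a vanishing variance the correlation is 0 by convention and says nothing; Cauchy-Schwarz
     gives the bound instead. *)
  have [z|nz] := eqVneq (s1 * s2) 0.
    by move: CS; rewrite z mul0r.
  have sp : 0 < s1 * s2 by rewrite lt_neqAle eq_sym nz mulr_ge0.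
  rewrite normrM normfV (gtr0_norm sp) ler_pdivrMr// => h; rewrite (le_trans h)// mulrC ler_pM2l// ler_pM2l//.
  have -> : `|k'%:R - k%:R| = (maxn 1 (dst k k'))%:R :> R.
    rewrite -natrB ?(ltnW kk)// normr_nat; by rewrite dst_lt.
  rewrite /drate minEle; case: ifP => _; rewrite ?lerDl ?lerDr powR_ge0//.
move=> k k' n0 m m' s s'; rewrite neq_ltn => /orP[lt|lt]; first exact: main.
by rewrite czC dstC (mulrC (sqrtr _)); exact: main.
Qed.

(** The second component is scaled by the variance at k instead of its own, so the ratio of
    neighbouring variances must be bounded; (A) gives at most 4 for large n, hence a factor 2 for
    each component. *)
Lemma xz_decay (eps : R) : 0 < eps < 2^-1 -> exists2 C : R, 0 < C & \forall n \near \oo, forall k k' a b,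
  good eps n k -> good eps n k' ->
  `|Ex P (fun w => xz n k a w * xz n k' b w)| <= C * drate n (dst k k').
Proof.
move=> he; have [C C0 hC] := cz_decay he.
have gp : 0 < gam by rewrite (lt_trans _ gam0)// invr_gt0.
have g2 : 1 <= 2 `^ gam :> R by rewrite -[leLHS](powRr0 2) ler_powR ?ler1n// ltW.
exists (4 * (1 + C * 2 `^ gam)).
  by rewrite mulr_gt0// addr_gt0// mulr_gt0// (lt_le_trans _ g2).
have e2 : 0 < 2^-1 :> R by rewrite invr_gt0.
have hv := A_cov hB gZ zZ kap0 hA 1 he e2.
apply: filterS2 hv (nbhs_infty_gt 0) => n hv n0 k k' a b gk gk'.
have {}hv : forall k, good eps n k -> 0 < vv n k /\ vv n k.+1 <= 4 * vv n k.
  move=> i /and3P[m1 _ si]; have si' : sampled n 3 i.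
    by move: si; rewrite /sampled => /andP[-> h]/=; rewrite (leq_ltn_trans _ h)// leq_add2l.
  have := hv i m1 si'.
move=> [v0 _ h]; split => //.
  have {h} : `|vv n (i + 1) / vv n i - 1| <= 2^-1.
    by apply: le_trans h; rewrite ler_peMl// -[leLHS](powRr0 n%:R) ler_powR// ler1n.
  rewrite ler_norml addn1 => /andP[_ h].
  by rewrite -ler_pdivrMr// (le_trans (_ : _ <= 2))//; lra.
have [v1 w1] := hv k gk; have [v2 w2] := hv k' gk'.
have sa : sqrtr (vv n (k + a)) <= 2 * sqrtr (vv n k).
  rewrite (_ : 2 = sqrtr (2 ^+ 2)); last by rewrite sqrtr_sqr ger0_norm.
  rewrite -sqrtrM// ler_wsqrtr//; case: a; rewrite ?addn1 ?addn0 ?(le_trans w1)//; lra.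
have sb : sqrtr (vv n (k' + b)) <= 2 * sqrtr (vv n k').
  rewrite (_ : 2 = sqrtr (2 ^+ 2)); last by rewrite sqrtr_sqr ger0_norm.
  rewrite -sqrtrM// ler_wsqrtr//; case: b; rewrite ?addn1 ?addn0 ?(le_trans w2)//; lra.
have s1 : 0 < sqrtr (vv n k) by rewrite sqrtr_gt0.
have s2 : 0 < sqrtr (vv n k') by rewrite sqrtr_gt0.
have sk := good_sampled a gk; have sk' := good_sampled b gk'.
have mk : mid eps n (k + a) by move: gk => /and3P[m1 m2 _]; case: a {sa sk}; rewrite ?addn1 ?addn0.
have mk' : mid eps n (k' + b) by move: gk' => /and3P[m1 m2 _]; case: b {sb sk'}; rewrite ?addn1 ?addn0.
rewrite Ex_xz// normrM normfV (gtr0_norm (mulr_gt0 s1 s2)) ler_pdivrMr ?mulr_gt0//.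
have ss : sqrtr (vv n (k + a)) * sqrtr (vv n (k' + b)) <= 4 * (sqrtr (vv n k) * sqrtr (vv n k')).
  rewrite (_ : 4 * _ = 2 * sqrtr (vv n k) * (2 * sqrtr (vv n k'))); last by ring.
  by rewrite ler_pM ?sqrtr_ge0.
have dr0 m : 0 <= drate n m by rewrite addr_ge0 ?powR_ge0.
suff [K Kb hK] : exists2 K, `|cz n (k + a) (k' + b)| <= sqrtr (vv n (k + a)) * sqrtr (vv n (k' + b)) * K &
    0 <= K <= (1 + C * 2 `^ gam) * drate n (dst k k').
  move: hK => /andP[K0 hK]; rewrite (le_trans Kb)// (le_trans (ler_wpM2r K0 ss))//.
  move: (sqrtr (vv n k) * sqrtr (vv n k')) (mulr_gt0 s1 s2) => s s0.
  by rewrite -[4 * _ * drate _ _]mulrA mulrAC ler_pM2r// ler_pM2l.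
(* At distance at most 1 the components may coincide and Cauchy-Schwarz is used, [drate] being at
   least 1; from distance 2 on they are distinct. *)
have [ds|ds] := leqP (dst k k') 1.
  exists 1; rewrite ?mulr1.
    exact: (Ex_cauchy_schwarz (gspan_itg2 gZ (gspan_vz Z sk)) (gspan_itg2 gZ (gspan_vz Z sk')) (gspan_itgM gZ (gspan_vz Z sk) (gspan_vz Z sk'))).
  rewrite ler01/= /drate (_ : maxn 1 _ = 1%N); last by exact/maxn_idPl.
  rewrite powR1 -[leLHS]mulr1 ler_pM// ?lerDl ?powR_ge0//.
  by rewrite mulr_ge0 ?powR_ge0// ltW.
exists (C * drate n (dst (k + a) (k' + b))).
  by apply: hC => //; exact: dst_neq.
rewrite mulr_ge0 ?(ltW C0)//= (@le_trans _ _ (C * (2 `^ gam * drate n (dst k k'))))//; last first.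
  by rewrite mulrA ler_wpM2r// lerDr.
rewrite ler_pM2l// /drate mulrDr lerD//; last by rewrite ler_peMl ?powR_ge0.
have -> : 2 `^ gam = (2^-1) `^ (- gam) :> R by rewrite powRN -(powR_inv1 (ler0n _ 2)) -powRrM mulN1r powRN invrK.
rewrite -powRM// ?invr_ge0 ?ler0n//.
rewrite powRN powRN lef_pV2; last 2 first.
- by rewrite posrE powR_gt0// ltr0n leq_max.
- by rewrite posrE powR_gt0// mulr_gt0// ltr0n leq_max.
apply: ge0_ler_powR; rewrite ?nnegrE ?(ltW gp)// ?mulr_ge0 ?invr_ge0 ?ler0n//.
by rewrite mulrC ler_pdivrMr// -natrM ler_nat mulnC; exact: dst_half.
Qed.

End Decay.

End WindowCovariance.
(** * The limit variance *)

Section Toeplitz.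
Context {R : realType}.

Lemma sum_powR_bdd (s : R) : 1 < s -> exists2 K : R, 0 < K & forall m, \sum_(j < m) (maxn 1 j)%:R `^ (- s) <= K.
Proof.
move=> s1; have [J J0 hJ] := powR_tail s1 (@ltr01 R).
have p1 (j : nat) : (maxn 1 j)%:R `^ (- s) <= 1 :> R.
  rewrite -[leRHS](powRr0 (maxn 1 j)%:R) ler_powR ?ler1n ?leq_max// oppr_le0.
  by rewrite (le_trans (@ler01 R))// ltW.
exists (J.+1%:R + 1) => [|m]; first by rewrite addr_gt0// ltr0n.
have h (f : nat -> R) : (forall j, 0 <= f j) -> \sum_(j < m) f j <= \sum_(j < J.+1) f j + \sum_(i < m) f (J.+1 + i)%N.
  move=> f0; have -> : \sum_(j < J.+1) f j + \sum_(i < m) f (J.+1 + i)%N = \sum_(j < J.+1 + m) f j by rewrite big_split_ord.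
  rewrite -(big_mkord xpredT f) -[leRHS](big_mkord xpredT f) addnC.
  rewrite [leRHS](@big_cat_nat _ _ _ m)//= ?leq_addr// lerDl.
  exact: sumr_ge0.
have h1 := h (fun j => (maxn 1 j)%:R `^ (- s)) (fun j => powR_ge0 _ _); rewrite (le_trans h1)// lerD//.
  apply: (@le_trans _ _ (\sum_(j < J.+1) 1)); first by apply: ler_sum.
  by rewrite sumr_const card_ord.
have := hJ J m (leqnn _); apply: le_trans; apply: ler_sum => i _.
by rewrite (_ : maxn 1 (J.+1 + i) = J.+1 + i)%N//; apply/maxn_idPr; rewrite addSn.
Qed.

(** Enlarging the square by one row and one column adds the m-th partial sums of both one-sided
    series, so the normalized double sum is a Cesaro mean. *)
Lemma sum_toeplitz (s : nat -> R) (v : nat) :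
  \sum_(i < v) \sum_(i' < v) s (dst i i') = \sum_(m < v) (\sum_(0 <= j < m.+1) s j + \sum_(0 <= j < m) s j.+1).
Proof.
elim: v => [|v IH]; first by rewrite !big_ord0.
rewrite big_ord_recr/= [in RHS]big_ord_recr/= -IH.
under eq_bigr do rewrite big_ord_recr/=.
rewrite big_split/= -addrA; congr (_ + _).
have dE (i : nat) : (i < v)%N -> dst v i = (v - i)%N /\ dst i v = (v - i)%N by rewrite /dst; lia.
have rev (g : nat -> R) : \sum_(i < v) g (v - i)%N = \sum_(0 <= j < v) g j.+1.
  rewrite -(big_mkord xpredT (fun i => g (v - i)%N)) big_nat_rev/= !big_nat; apply: eq_bigr => i /andP[_ iv].
  by rewrite add0n; congr g; lia.
rewrite (eq_bigr (fun i : 'I_v => s (v - i)%N)); last by move=> i _; have [_ ->] := dE i (ltn_ord i).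
rewrite rev big_ord_recr/= (eq_bigr (fun i : 'I_v => s (v - i)%N)); last by move=> i _; have [-> _] := dE i (ltn_ord i).
by rewrite rev big_nat_recl//= (_ : dst v v = 0)%N ?addrA 1?addrC ?addrA//; rewrite /dst subnn.
Qed.

Lemma summable_powR (s : nat -> R) (K p : R) : 1 < p -> (forall j, `|s j| <= K * (maxn 1 j)%:R `^ (- p)) ->
  cvgn (series s).
Proof.
move=> p1 hs; have [K1 K10 hK1] := sum_powR_bdd p1.
have K0 : 0 <= K by have := hs 0%N; rewrite maxn0 powR1 mulr1; apply: le_trans.
apply: normed_cvg; apply: nondecreasing_is_cvgn.
  apply/nondecreasing_seqP => n; change (\sum_(0 <= k < n) `|s k| <= \sum_(0 <= k < n.+1) `|s k|).
  by rewrite big_nat_recr//= lerDl.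
exists (K * K1) => _ [m _ <-]; change (\sum_(0 <= k < m) `|s k| <= K * K1); rewrite big_mkord.
apply: (@le_trans _ _ (\sum_(j < m) K * (maxn 1 j)%:R `^ (- p))); first by apply: ler_sum => j _; exact: hs.
by rewrite -mulr_sumr ler_wpM2l.
Qed.

Lemma toeplitz_mean (s : nat -> R) (K p e : R) (S := limn (series s) + limn (series (fun j => s j.+1))) :
  1 < p -> (forall j, `|s j| <= K * (maxn 1 j)%:R `^ (- p)) -> 0 < e ->
  exists v0 : nat, forall v, (v0 <= v)%N -> `|v%:R^-1 * \sum_(i < v) \sum_(i' < v) s (dst i i') - S| <= e.
Proof.
move=> p1 hs e0.
have c1 := summable_powR p1 hs.
have c2 : cvgn (series (fun j => s j.+1)).
  apply: (@summable_powR _ K p p1) => j; apply: (le_trans (hs j.+1)).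
  have K0 : 0 <= K by have := hs 0%N; rewrite maxn0 powR1 mulr1; apply: le_trans.
  rewrite ler_wpM2l// !powRN lef_pV2 ?posrE ?powR_gt0 ?ltr0n ?leq_max//.
  apply: ge0_ler_powR; rewrite ?nnegrE ?ler0n//; first by rewrite (le_trans (@ler01 R))// ltW.
  by rewrite ler_nat; lia.
pose D (m : nat) := series s m.+1 + series (fun j => s j.+1) m.
have cD : D n @[n --> \oo] --> S.
  by apply: cvgD; [move/cvg_ex: c1 => [l cl]; rewrite (cvg_lim _ cl)//; have := cl; rewrite -cvg_shiftS | exact: c2].
have := cesaro cD => /cvgrPdist_le /(_ e e0) [v0 _ h].
exists v0.+1 => -[//|v] /ltnSE vv; have := h v vv; rewrite /arithmetic_mean /series/= => h'.
rewrite distrC sum_toeplitz; apply: le_trans h'; by rewrite big_mkord.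
Qed.

End Toeplitz.
Lemma dst_le k k' : (k <= k')%N -> dst k k' = (k' - k)%N.
Proof. rewrite /dst; lia. Qed.

Lemma dst_addl k j : dst k (k + j) = j.
Proof. by rewrite dst_le ?leq_addr// addKn. Qed.

Lemma dst_add a k k' : dst (a + k) (a + k') = dst k k'.
Proof. by rewrite /dst !subnDl. Qed.

Section VarianceLimit.
Context {R : realType} `{T : measurableType d} `{T' : measurableType d'}.
Variables (P : probability T R) (PB : probability T' R) (B : R -> R -> {RV PB >-> R}).
Variables (Z : R -> {RV P >-> R}) (alpha kappa eta : R) (H c : R -> R).
Hypotheses (hB : forall h : R, 0 < h < 1 -> is_fbm h (B h)) (gZ : gaussian_process `]0, 1[ Z).
Hypotheses (zZ : zero_mean `]0, 1[ Z) (alpha01 : 0 < alpha < 1) (kap0 : 0 <= kappa).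
Hypothesis hA : assumption_A B 2 kappa eta H c Z.
Local Notation vz := (vz Z).
Local Notation vv := (vv Z).
Local Notation xz := (xz Z).
Local Notation psz := (psz Z).
Local Notation cc := (cc Z).
Local Notation W n t := (nbr alpha n 2 t).
Variable gam : R.
Hypotheses (gam0 : 2^-1 < gam) (hBa : corr_decay Z alpha gam).

(** Half the number of points of a window up to a bounded error; [pw] and [qw] below are the squares
    of the two terms of [drate]. *)
Definition qn (n : nat) : R := n%:R `^ (1 - alpha).
Definition pw (j : nat) : R := (maxn 1 j)%:R `^ (- (2 * gam)).
Definition qw (n : nat) : R := qn n `^ (- (2 * gam)).

Lemma pw_ge0 j : 0 <= pw j. Proof. exact: powR_ge0. Qed.
Lemma qw_ge0 n : 0 <= qw n. Proof. exact: powR_ge0. Qed.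
Lemma gam2 : 1 < 2 * gam. Proof. by rewrite mulrC -ltr_pdivrMr// mul1r. Qed.

Lemma drate_sqr n j : drate alpha gam n j ^+ 2 <= 2 * (pw j + qw n).
Proof.
have e (x : R) : x `^ (- (2 * gam)) = (x `^ (- gam)) ^+ 2.
  by rewrite mulrC -mulNr powRrM powR_mulrn// powR_ge0.
rewrite /drate /pw /qw !e /qn; move: (_ `^ _) (_ `^ _) => x y.
by have := sqr_ge0 (x - y); rewrite !expr2; lra.
Qed.

Lemma qn_ge1 n : (0 < n)%N -> 1 <= qn n.
Proof.
move=> n0; rewrite /qn -[leLHS](powRr0 n%:R) ler_powR// ?ler1n//.
by have /andP[_ ?] := alpha01; rewrite subr_ge0 ltW.
Qed.

Lemma qn_le n : (0 < n)%N -> qn n <= n%:R.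
Proof.
move=> n0; rewrite /qn -[leRHS]powRr1// ler_powR// ?ler1n//.
by have /andP[? _] := alpha01; rewrite gerBl ltW.
Qed.

Lemma qn_big (M : R) : \forall n \near \oo, M <= qn n.
Proof. by apply: powR_nat_cvgy; have /andP[_ ?] := alpha01; rewrite subr_gt0. Qed.

(** Because 2 gamma > 1, the squared plateau of the correlations summed over a whole window is
    negligible. *)
Lemma qnqw (e : R) : 0 < e -> \forall n \near \oo, qn n * qw n <= e.
Proof.
move=> e0; have /andP[a0 a1] := alpha01; have g1 := gam2.
have s0 : (1 - alpha) * (1 - 2 * gam) < 0 by rewrite nmulr_llt0 ?subr_gt0// subr_lt0.
apply: filterS2 (powR_nat_cvg0 s0 e0) (nbhs_infty_gt 0) => n h n0.
apply: le_trans h; have := qn_ge1 n0; rewrite /qw /qn => q1.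
rewrite powRrM -{1}(powRr1 (powR_ge0 n%:R (1 - alpha))) -powRD//.
have q0 : 0 < n%:R `^ (1 - alpha) by rewrite (lt_le_trans _ q1).
by rewrite (gt_eqF q0) implybT.
Qed.

Definition okk (eps v0 : R) (n k : nat) : Prop :=
  [/\ good eps n k, 0 < vv n k & nice v0 (fun a b => Ex P (fun w => xz n k a w * xz n k b w))].

Lemma psz_decay (eps v0 : R) : 0 < eps < 2^-1 -> 0 < v0 <= 1 -> exists2 K : R, 0 < K &
  \forall n \near \oo, forall k k', okk eps v0 n k -> okk eps v0 n k' ->
  `|cc n k k'| <= K * (pw (dst k k') + qw n).
Proof.
move=> he v01; have /andP[v0p _] := v01.
have [C C0 hC] := xz_decay hB gZ zZ kap0 hA gam0 hBa he.
exists (4 * (72 * (7 / v0 ^+ 2) ^+ 2) * C ^+ 2 * 2).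
  have v2 : 0 < 7 / v0 ^+ 2 by rewrite divr_gt0// exprn_gt0.
  have v3 : 0 < 72 * (7 / v0 ^+ 2) ^+ 2 by apply: mulr_gt0 => //; exact: exprn_gt0.
  have v4 : 0 < C ^+ 2 by exact: exprn_gt0.
  by apply: mulr_gt0 => //; apply: mulr_gt0 => //; apply: mulr_gt0.
apply: filterS hC => n hC k k' [g v ni] [g' v' ni'].
have gx := gvec_xzp gZ zZ g g'.
have ent i j : `|Ex P (fun w => xzp Z n k k' (inl i) w * xzp Z n k k' (inr j) w)| <= C * drate alpha gam n (dst k k').
  exact: hC.
have t1 (y : bool -> R) : `|tev [::] y| <= 1 by rewrite tev_nil normr0.
have := psi_decorrelation gx v01 ni ni' ent (isT : teven ([::] : tpoly R bool)) t1.
have pE m : 0 < vv n m -> (fun w => dpsi [::] ((xz n m)^~ w)) = psz n m.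
  by move=> vm; apply/funext => w; rewrite /dpsi tev_nil subr0 psib_xz.
rewrite /= (pE _ v) (pE _ v') (_ : (fun w => dpsi _ _ * dpsi _ _) = (fun w => psz n k w * psz n k' w)); last first.
  by rewrite -(pE _ v) -(pE _ v').
move=> /le_trans; apply.
rewrite (_ : 4 * _ = 4 * (72 * (7 / v0 ^+ 2) ^+ 2) * C ^+ 2 * drate alpha gam n (dst k k') ^+ 2); last by ring.
rewrite -[leRHS]mulrA; apply: ler_wpM2l; last exact: drate_sqr.
by apply: mulr_ge0; [apply: mulr_ge0 => //; apply: mulr_ge0 => //; exact: sqr_ge0 | exact: sqr_ge0].
Qed.

(** Windows are nonempty for large n; an estimate that holds along a window can thus be evaluated at
    an actual index and passed on to the limit. *)
Lemma win_ex (t : R) (A : nat * nat -> Prop) : 0 < t < 1 -> (\forall x \near win alpha t, A x) -> exists x, A x.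
Proof.
move=> t01 hA'; have hA2 : \forall n \near \oo, forall k, k \in W n t -> A (n, k) := hA'.
have [n [h1 [h2 h3]]] : exists n, (forall k, k \in W n t -> A (n, k)) /\ (1 <= qn n /\
   exists a v : nat, [/\ W n t = iota a v, (0 < a)%N /\ (a + v <= n - 2)%N,
      2 * qn n - 1 <= v%:R <= 2 * qn n + 1, `|2 * a%:R + v%:R - 1 - 2 * (t * n%:R)| <= 1 &
      forall k, k \in iota a v -> `|k%:R / n%:R - t| <= n%:R `^ (- alpha)]).
  have [n _ hn] := filterS3 _ (fun n h1 h2 h3 => conj h1 (conj h2 h3)) hA2 (qn_big 1) (nbr_iota alpha01 t01).
  by exists n; apply: (hn n) => /=.
have [a [v [e _ /andP[v1 _] _ _]]] := h3.
exists (n, a); apply: h1; rewrite e mem_iota leqnn/= -[ltnLHS]addn0 ltn_add2l -(ltr0n R).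
by lra.
Qed.

Section Window.
Variables (eps v0 : R).
Hypotheses (heps : 0 < eps < 2^-1) (v01 : 0 < v0 <= 1).

Definition wok (t : R) : Prop := 0 < t < 1 /\ forall p, \forall x \near win alpha t, okk eps v0 x.1 (x.2 + p).

(** The limit covariance inherits the bound of [psz_decay], whose plateau vanishes as n grows.
    Summability of the series for sigma^2 thus comes from the process Z, without asymptotics of
    [rc]. *)
Lemma cov_psi_decay (t : R) : wok t -> exists2 K : R, 0 < K & forall j : nat, `|cov_psi B (H t) j%:Z| <= K * pw j.
Proof.
move=> [t01 okt]; have [K K0 hK] := psz_decay heps v01; exists K => // j.
apply/ler_addgt0Pr => e e0; have e2 : 0 < e / 2 by rewrite divr_gt0.
have := win_cov hB gZ zZ alpha01 kap0 hA t01 (j:=j) => /cvgrPdist_le /(_ _ e2) h1.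
have e3 : 0 < e / (2 * K) by rewrite divr_gt0// mulr_gt0.
have h2 : \forall x \near win alpha t, (forall k k', okk eps v0 x.1 k -> okk eps v0 x.1 k' ->
  `|cc x.1 k k'| <= K * (pw (dst k k') + qw x.1)) /\ qw x.1 <= e / (2 * K).
  apply: winI; apply: filterS3 hK (qn_big 1) (qnqw e3) => n h1' q1 qe k _; split => //=.
  by apply: le_trans qe; rewrite ler_peMl// qw_ge0.
have [[n k]] := win_ex t01 (filterI h1 (filterI h2 (filterI (okt 0) (okt j)))).
move=> /= [] dcov [] [] hk qe [] o1 o2; rewrite addn0 in o1; have := hk _ _ o1 o2; rewrite dst_addl.
have qe' : K * qw n <= e / 2.
  have -> : e / 2 = K * (e / (2 * K)) by field; rewrite gt_eqF.
  by rewrite ler_pM2l.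
move=> h; rewrite -(subrK (cc n k (k + j)) (cov_psi _ _ _)) (le_trans (ler_normD _ _))//.
by rewrite mulrDr in h; rewrite addrC (splitr e) addrA lerD// (le_trans h)// lerD2l.
Qed.

Lemma dst_norm k k' : (dst k k')%:R = `|k%:R - k'%:R| :> R.
Proof.
rewrite /dst; have [le|/ltnW le] := leqP k k'.
  by rewrite (_ : k - k' = 0)%N ?add0n ?natrB// 1?distrC ?ger0_norm ?subr_ge0 ?ler_nat//; apply/eqP; rewrite subn_eq0.
by rewrite (_ : k' - k = 0)%N ?addn0 ?natrB// ?ger0_norm ?subr_ge0 ?ler_nat//; apply/eqP; rewrite subn_eq0.
Qed.

Lemma big_iota_ord (a v : nat) (f : nat -> R) : \sum_(k <- iota a v) f k = \sum_(i < v) f (a + i)%N.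
Proof. by rewrite -{1}[a]addn0 iotaDl big_map -(big_mkord xpredT (fun i => f (a + i)%N)) /index_iota subn0. Qed.

Lemma win_uniform (J : nat) (t : R) (A : nat -> nat -> nat -> Prop) :
  (forall j, \forall x \near win alpha t, A j x.1 x.2) ->
  \forall n \near \oo, forall j, (j <= J)%N -> forall k, k \in W n t -> A j n k.
Proof.
move=> h; have h' (j : 'I_J.+1) : \forall n \near \oo, forall k, k \in W n t -> A j n k by exact: (h j).
have h2 : \forall n \near \oo, forall (j : 'I_J.+1) k, k \in W n t -> A j n k by exact: filter_forall.
apply: filterS h2 => n hn j jJ k kW.
exact: (hn (Ordinal (jJ : (j < J.+1)%N))).
Qed.

(** The double sum is compared with the Toeplitz sum of limit covariances: entries within distance J
    by convergence, uniform over finitely many lags, the others by decay of both arrays;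
    [toeplitz_mean] does the rest. *)
Lemma var_limit (t e : R) : wok t -> 0 < e -> \forall n \near \oo,
  `|(size (W n t))%:R^-1 * \sum_(k <- W n t) \sum_(k' <- W n t) cc n k k' - sigma2 B (H t)| <= e.
Proof.
move=> hw e0; have [t01 okt] := hw.
have [K K0 hK] := psz_decay heps v01; have [K' K'0 hs] := cov_psi_decay hw.
pose s (j : nat) := cov_psi B (H t) j%:Z.
have sE : sigma2 B (H t) = limn (series s) + limn (series (fun j => s j.+1)).
  rewrite /sigma2; congr (_ + limn (series _)); apply/funext => j; rewrite /s cov_psiN//; last exact: hB (proj2 (H_in hA t01)).
  exact: (proj2 (H_in hA t01)).
have e2 : 0 < e / 2 by rewrite divr_gt0.
have [m0 hm0] := toeplitz_mean gam2 hs e2; rewrite -sE in hm0.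
pose e1 := e / (16 * (K + K')).
have e10 : 0 < e1 by rewrite divr_gt0// mulr_gt0// addr_gt0.
have [J J0 hJ] := powR_tail gam2 e10.
pose e4 := e / (8 * (2 * J).+1%:R).
have e40 : 0 < e4 by rewrite divr_gt0// mulr_gt0.
pose e3 := e / (24 * K).
have e30 : 0 < e3 by rewrite divr_gt0// mulr_gt0.
have E1 : \forall n \near \oo, forall j, (j <= J)%N -> forall k, k \in W n t -> `|cc n k (k + j) - s j| <= e4.
  apply: (@win_uniform J t (fun j n k => `|cc n k (k + j) - s j| <= e4)) => j.
  have := win_cov hB gZ zZ alpha01 kap0 hA t01 (j:=j) => /cvgrPdist_le /(_ _ e40).
  by apply: filterS => x; rewrite distrC.
have E2 : \forall n \near \oo, forall k, k \in W n t -> okk eps v0 n k.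
  have : \forall x \near win alpha t, okk eps v0 x.1 x.2 by apply: filterS (okt 0) => x; rewrite addn0.
  by [].
apply: filter_app (nbr_iota alpha01 t01); apply: filter_app E1; apply: filter_app E2; apply: filter_app hK.
apply: filter_app (qnqw e30); apply: filter_app (qn_big m0.+1%:R).
near=> n => qm qe hK' E2 E1 [a [v [WE [a0 av] /andP[v1 v2] _ _]]].
rewrite WE size_iota in E1 E2 *; rewrite -/(qn n) in v1 v2.
have q1 : 1 <= qn n by rewrite (le_trans _ qm)// ler1n.
have vm : (m0 <= v)%N by rewrite -(ler_nat R); move: qm; rewrite -natr1; lra.
have vp : 0 < v%:R :> R by lra.
have v3 : v%:R <= 3 * qn n by lra.
rewrite -(subrK (v%:R^-1 * \sum_(i < v) \sum_(i' < v) s (dst i i')) (_ * _)) -addrA.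
rewrite (le_trans (ler_normD _ _))// (splitr e) lerD//; last exact: hm0.
rewrite big_iota_ord; under eq_bigr do rewrite big_iota_ord.
rewrite -mulrBr -sumrB normrM normfV (gtr0_norm vp) mulrC ler_pdivrMr//.
rewrite (le_trans (ler_norm_sum _ _ _))//.
apply: (@le_trans _ _ (\sum_(i < v) e / 2)); last by rewrite sumr_const card_ord mulr_natr.
apply: ler_sum => i _; rewrite -sumrB (le_trans (ler_norm_sum _ _ _))//.
have iW (j : 'I_v) : (a + j)%N \in iota a v by rewrite mem_iota leq_addr ltn_add2l ltn_ord.
rewrite (bigID (closeby J i))/=.
(* The shares are e/8 for the entries near the diagonal, e/8 for the two tails and e/4 for the
   plateau. *)
have -> : e / 2 = (2 * J).+1%:R * e4 + ((K + K') * (2 * e1) + 6 * K * e3).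
  rewrite /e4 /e1 /e3; move: (ltr0Sn R (2 * J)); move: (2 * J).+1%:R => z z0.
  field; apply/and3P; split; rewrite gt_eqF// addr_gt0//.
apply: lerD.
  apply: (@le_trans _ _ (\sum_(i' | closeby J i i') e4)); last first.
    rewrite -[X in \sum_(_ | _) X]mulr1 -mulr_sumr mulrC ler_wpM2r ?(ltW e40)//; exact: card_closeby.
  apply: ler_sum => i' /andP[c1 c2]; have [le|/ltnW le] := leqP i i'.
    have := E1 (i' - i)%N; rewrite leq_subLR c1 => /(_ isT (a + i)%N (iW i)).
    by rewrite -addnA subnKC// dst_le.
  have := E1 (i - i')%N; rewrite leq_subLR c2 => /(_ isT (a + i')%N (iW i')).
  by rewrite -addnA subnKC// ccC dstC dst_le.
apply: (@le_trans _ _ (\sum_(i' | ~~ closeby J i i') ((K + K') * pw (dst i i') + K * qw n))).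
  apply: ler_sum => i' _; rewrite (le_trans (ler_normB _ _))//.
  have := hK' _ _ (E2 _ (iW i)) (E2 _ (iW i')); rewrite dst_add; have := hs (dst i i').
  rewrite -/(s _) mulrDr mulrDl; lra.
rewrite big_split/= lerD//.
  rewrite -mulr_sumr ler_wpM2l ?addr_ge0 ?(ltW K0) ?(ltW K'0)//.
  apply: (le_trans (tail_sum _ _ pw_ge0)); rewrite ler_pM2l//.
  apply: le_trans (hJ J v (leqnn _)); apply: ler_sum => j _.
  by rewrite /pw (_ : maxn 1 (J.+1 + j) = J.+1 + j)%N//; apply/maxn_idPr; rewrite addSn.
apply: (@le_trans _ _ (\sum_(i' < v) K * qw n)).
  rewrite [leRHS](bigID (closeby J i))/= lerDr sumr_ge0// => j _.
  by rewrite mulr_ge0 ?qw_ge0 ?(ltW K0).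
rewrite sumr_const card_ord (_ : 6 * K * e3 = K * (6 * e3)); last by ring.
rewrite -[leLHS]mulr_natr -mulrA ler_pM2l//.
apply: (@le_trans _ _ (3 * (qn n * qw n))); last by move: qe e30; lra.
by rewrite mulrA mulrC ler_wpM2r ?qw_ge0.
Unshelve. all: by end_near.
Qed.

(** Indices of two different windows are at distance at least dl n >= dl qn, so the decay term is
    itself at most a constant times [qw], and [qnqw] concludes. *)
Lemma cross_limit (t t' e : R) : wok t -> wok t' -> t != t' -> 0 < e -> \forall n \near \oo,
  `|(size (W n t))%:R^-1 * \sum_(k <- W n t) \sum_(k' <- W n t') cc n k k'| <= e.
Proof.
move=> [t01 okt] [t01' okt'] tt e0.
have [K K0 hK] := psz_decay heps v01.
pose dl := `|t - t'| / 3.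
have dl0 : 0 < dl by rewrite divr_gt0// normr_gt0 subr_eq0.
pose D := dl `^ (- (2 * gam)) + 1.
have D0 : 0 < D by rewrite addr_gt0// powR_gt0.
pose e3 := e / (3 * K * D).
have e30 : 0 < e3 by rewrite divr_gt0// !mulr_gt0.
have a0 : - alpha < 0 by have /andP[? _] := alpha01; rewrite oppr_lt0.
have E2 (s : R) : wok s -> \forall n \near \oo, forall k, k \in W n s -> okk eps v0 n k.
  move=> [_ oks]; have : \forall x \near win alpha s, okk eps v0 x.1 x.2 by apply: filterS (oks 0) => x; rewrite addn0.
  by [].
apply: filter_app (nbr_iota alpha01 t01); apply: filter_app (nbr_iota alpha01 t01').
apply: filter_app (E2 t _) => //; apply: filter_app (E2 t' _) => //; apply: filter_app hK.
apply: filter_app (qnqw e30); apply: filter_app (qn_big 1); apply: filter_app (powR_nat_cvg0 a0 dl0).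
apply: filter_app (nbhs_infty_gt 0).
near=> n => n0 nd q1 qe hK' E2' E2t [a' [v' [WE' [a0' av'] /andP[v1' v2'] _ near']]] [a [v [WE [a00 av] /andP[v1 v2] _ near]]].
rewrite -/(qn n) in v1 v2 v1' v2'; rewrite -WE in near; rewrite -WE' in near'.
have vp : 0 < v%:R :> R by lra.
have v3' : v'%:R <= 3 * qn n by lra.
have sz : size (W n t) = v by rewrite WE size_iota.
have sz' : size (W n t') = v' by rewrite WE' size_iota.
rewrite sz normrM normfV (gtr0_norm vp) mulrC ler_pdivrMr//.
rewrite (le_trans (ler_norm_sum _ _ _))// big_seq_cond.
apply: (@le_trans _ _ (\sum_(k <- W n t | (k \in W n t) && true) e)); last first.
  by rewrite -big_seq_cond big_const_seq count_predT sz iter_addr_0 mulr_natr.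
apply: ler_sum => k /andP[kW _]; rewrite (le_trans (ler_norm_sum _ _ _))// big_seq_cond.
apply: (@le_trans _ _ (\sum_(k' <- W n t' | (k' \in W n t') && true) K * D * qw n)).
  apply: ler_sum => k' /andP[kW' _]; rewrite (le_trans (hK' _ _ (E2t _ kW) (E2' _ kW')))//.
  rewrite -mulrA ler_pM2l// mulrDl mul1r lerD2r /pw /qw -powRM ?ler0n//; last 2 first.
  - exact: ltW.
  - by rewrite (le_trans _ q1).
  have np : 0 < n%:R :> R by rewrite ltr0n.
  have qp : 0 < qn n by rewrite (lt_le_trans _ q1).
  rewrite !powRN lef_pV2; last 2 first.
  - by rewrite posrE powR_gt0// ltr0n leq_max.
  - by rewrite posrE powR_gt0// mulr_gt0.
  apply: ge0_ler_powR; rewrite ?nnegrE ?mulr_ge0 ?ler0n ?(ltW dl0) ?(ltW qp)//.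
    by rewrite (le_trans _ (ltW gam0))// invr_ge0.
  apply: (@le_trans _ _ (dl * n%:R)); first by rewrite ler_pM2l// qn_le.
  apply: (@le_trans _ _ (dst k k')%:R); last by rewrite ler_nat leq_maxr.
  rewrite dst_norm.
  have -> : `|k%:R - k'%:R| = `|k%:R / n%:R - k'%:R / n%:R| * n%:R :> R.
    by rewrite -mulrBl normrM normfV (gtr0_norm np) divfK// gt_eqF.
  rewrite ler_pM2r//; have := near _ kW; have := near' _ kW'.
  move: (k%:R / n%:R) (k'%:R / n%:R) => x y h1 h2.
  have h3 : `|t - t'| <= `|x - t| + `|x - y| + `|y - t'|.
    rewrite (_ : t - t' = - (x - t) + (x - y) + (y - t')); last by ring.
    by rewrite (le_trans (ler_normD _ _))// lerD2r (le_trans (ler_normD _ _))// normrN.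
  have : `|t - t'| = 3 * dl by rewrite /dl; field.
  move: h1 h2 h3 nd; lra.
rewrite -big_seq_cond big_const_seq count_predT sz' iter_addr_0 -[leLHS]mulr_natr.
have -> : e = K * D * (3 * e3) by rewrite /e3; field; rewrite !gt_eqF.
rewrite -mulrA ler_pM2l ?mulr_gt0//.
apply: (@le_trans _ _ (3 * (qn n * qw n))); last by rewrite ler_pM2l.
by rewrite mulrA mulrC ler_wpM2r ?qw_ge0.
Unshelve. all: by end_near.
Qed.

End Window.

End VarianceLimit.
Lemma norm_cosB_le {R : realType} (a b : R) : `|cos a - cos b| <= `|a - b|.
Proof.
have dc (x : R) : is_derive x (1 : R) (cos : R -> R) (- sin x) by exact: is_derive_cos.
wlog ab : a b / a <= b.
  by move=> h; have [/h//|/ltW /h] := leP a b; rewrite distrC (distrC b).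
rewrite distrC (distrC a); have [|c _ ->] := @MVT_segment R cos (fun x => - sin x) a b ab.
  by apply: continuous_subspaceT; exact: continuous_cos.
by rewrite normrM normrN ler_piMl// ler_norml sin_geN1 sin_le1.
Qed.

(** * The central limit theorem on the windows *)

Section Vr.
Context `{T : measurableType d} {R : realType} (P : probability T R).

Definition Vr (X : T -> R) : R := Ex P (fun w => X w * X w) - Ex P X * Ex P X.

Lemma Vr_centered (X : T -> R) : bddm X -> Vr X = Ex P (fun w => (X w - Ex P X) ^+ 2).
Proof. by move=> bX; rewrite Ex_centered_sqr//; [exact: bddm_itg | exact/bddm_itg/bddmM]. Qed.

Lemma Vr_ge0 (X : T -> R) : bddm X -> 0 <= Vr X.
Proof. by move=> bX; rewrite Vr_centered//; apply: Ex_ge0 => w; exact: sqr_ge0. Qed.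

Lemma bddm_centered (X : T -> R) : bddm X -> bddm (fun w => X w - Ex P X).
Proof. by move=> bX; apply: bddmB => //; exact: bddm_cst. Qed.

Lemma Ex_norm_centered (X : T -> R) : bddm X -> Ex P (fun w => `|X w - Ex P X|) <= sqrtr (Vr X).
Proof.
move=> bX; rewrite Vr_centered//; have b := bddm_centered bX.
apply: Ex_norm_le_sqrt; first exact: bddm_itg.
by under [X in itg _ X]eq_fun do rewrite expr2; exact/bddm_itg/bddmM.
Qed.

(** The cosine is 1-Lipschitz and the mean absolute deviation is at most the standard deviation. *)
Lemma Ex_cos_perturb (X D : T -> R) (p : R) : bddm X -> bddm D ->
  `|Ex P (fun w => cos (X w + D w - Ex P (fun w => X w + D w) + p)) -
    Ex P (fun w => cos (X w - Ex P X + p))| <= sqrtr (Vr D).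
Proof.
move=> bX bD; have iX := bddm_itg P bX; have iD := bddm_itg P bD.
have bc (Y : T -> R) : bddm Y -> bddm (fun w => cos (Y w - Ex P Y + p)).
  by move=> bY; apply: bddm_cos; case: (bddmD (bddm_centered bY) (bddm_cst p)).
have i1 := bddm_itg P (bc _ (bddmD bX bD)); have i2 := bddm_itg P (bc _ bX).
rewrite -ExB// (le_trans (Ex_norm (itgB i1 i2)))//.
apply: le_trans (Ex_norm_centered bD); apply: Ex_le.
- exact: itg_norm (itgB i1 i2).
- by apply: itg_norm; exact/bddm_itg/bddm_centered.
move=> w; rewrite (le_trans (norm_cosB_le _ _))// ExD// le_eqVlt; apply/orP; left; apply/eqP.
by congr `|_|; ring.
Qed.

Lemma Vr_perturb (X D : T -> R) : bddm X -> bddm D ->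
  `|Vr (fun w => X w + D w) - Vr X| <= 2 * sqrtr (Vr X) * sqrtr (Vr D) + Vr D.
Proof.
move=> bX bD; have iX := bddm_itg P bX; have iD := bddm_itg P bD.
have cX := bddm_centered bX; have cD := bddm_centered bD.
have i1 := bddm_itg P (bddmM cX cX); have i2 := bddm_itg P (bddmM cX cD); have i3 := bddm_itg P (bddmM cD cD).
have sE (Y : T -> R) : (fun w => Y w ^+ 2) = (fun w => Y w * Y w) by apply/funext => w; rewrite expr2.
have e : Vr (fun w => X w + D w) = Vr X + (2 * Ex P (fun w => (X w - Ex P X) * (D w - Ex P D)) + Vr D).
  rewrite !Vr_centered//; last exact: bddmD.
  rewrite !sE -ExZ// -(ExD (itgZ 2 i2) i3) -(ExD i1 (itgD (itgZ 2 i2) i3)); congr Ex.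
  by apply/funext => w; rewrite ExD//; ring.
rewrite e addrC addKr (le_trans (ler_normD _ _))// lerD//; last by rewrite ger0_norm// Vr_ge0.
rewrite normrM (ger0_norm (ler0n _ 2)) -mulrA ler_pM2l// !Vr_centered//.
by apply: Ex_cauchy_schwarz => //; rewrite sE.
Qed.

End Vr.

(** * The triangular array of all windows at fixed n *)

Section WindowArray.
Context {R : realType} `{T : measurableType d}.
Variable (P : probability T R) (Z : R -> {RV P >-> R}).
Hypotheses (gZ : gaussian_process `]0, 1[ Z) (zZ : zero_mean `]0, 1[ Z).
Variables (alpha gam eps v0 Cx K1 : R) (n u : nat) (t lam : 'I_u -> R).
Local Notation xz := (xz Z).
Local Notation psz := (psz Z).
Local Notation W i := (nbr alpha n 2 (t i)).
Local Notation q := (qn alpha n).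
Local Notation pw := (pw gam).
Local Notation qw := (qw alpha gam n).
Hypotheses (v01 : 0 < v0 <= 1) (Wok : forall i k, k \in W i -> okk Z eps v0 n k).
Hypothesis Cxdec : forall k k' a b, good eps n k -> good eps n k' ->
  `|Ex P (fun w => xz n k a w * xz n k' b w)| <= Cx * drate alpha gam n (dst k k').
Hypotheses (Wsize : forall i, q <= (size (W i))%:R <= 3 * q) (Wlt : forall i k, k \in W i -> (k < n)%N).
Hypotheses (q1 : 1 <= q) (qqw1 : q * qw <= 1) (K1pw : forall m, \sum_(j < m) pw j <= K1).

(** Coefficient of the index k in the combination, with weights lam i, of the window means
    multiplied by sqrt (2 q). Summing over i keeps it correct if windows overlap. *)
Definition wgt (k : nat) : R := \sum_i lam i * (sqrtr (2 * q) / (size (W i))%:R) * (k \in W i)%:R.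
Definition act (k : 'I_n) : bool := [exists i, (k : nat) \in W i].
(* Inactive indices are replaced by 0 so that all bounds hold for every k < n. *)
Definition Xa (k : 'I_n) (b : bool) : T -> R := if act k then xz n k b else fun=> 0.
Definition Sa (kb kb' : 'I_n * bool) : R := Ex P (fun w => Xa kb.1 kb.2 w * Xa kb'.1 kb'.2 w).
Definition ra (k k' : 'I_n) : R := if act k && act k' then Cx * drate alpha gam n (dst k k') else 0.
(** One constant for two bounds: the first term serves the weights, the second the number of active
    indices. *)
Definition Ca : R := 2 * \sum_i `|lam i| + 3 * u%:R.

Let Ca0 : 0 <= Ca.
Proof. by rewrite addr_ge0 ?mulr_ge0 ?sumr_ge0. Qed.

Let c0 : 0 <= 2 * Cx ^+ 2.
Proof. by apply: mulr_ge0 => //; exact: sqr_ge0. Qed.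

Let q0 : 0 < q. Proof. exact: lt_le_trans q1. Qed.

Lemma sum_win (f : nat -> R) (i : 'I_u) : \sum_(k <- W i) f k = \sum_(k < n) ((k : nat) \in W i)%:R * f k.
Proof.
have uW : uniq (W i) by rewrite filter_uniq// iota_uniq.
rewrite -(big_mkord xpredT (fun k => (k \in W i)%:R * f k)) [RHS](bigID (fun k => k \in W i))/=.
rewrite [X in _ + X]big1 ?addr0; last by move=> k /negbTE ->; rewrite mul0r.
rewrite [RHS](eq_bigr f); last by move=> k ->; rewrite mul1r.
rewrite -[RHS]big_filter; apply: perm_big; apply: uniq_perm => //; first by rewrite filter_uniq// iota_uniq.
move=> k; rewrite [RHS]mem_filter mem_index_iota leq0n/=.
by case: (boolP (k \in W i)) => // kW; rewrite (Wlt kW).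
Qed.

Lemma act_okk k : act k -> okk Z eps v0 n k.
Proof. by move=> /existsP[i kW]; exact: Wok kW. Qed.

Lemma gvec_Xa : gvec P (fun kb => Xa kb.1 kb.2) Sa.
Proof.
apply: (gspan_gvec gZ zZ) => -[k b]; rewrite /Xa/=; case: ifP => [ak|_]; last exact: gspan0.
by apply: gspan_xz; have [g _ _] := act_okk ak; exact: good_sampled g.
Qed.

Lemma nice_Xa k : act k -> nice v0 (fun a b => Sa (k, a) (k, b)).
Proof. by move=> ak; rewrite /Sa /Xa /= ak; have [] := act_okk ak. Qed.

Lemma wgt_le k : `|wgt k| <= Ca / sqrtr q.
Proof.
have sq : 0 < sqrtr q by rewrite sqrtr_gt0.
rewrite (le_trans (ler_norm_sum _ _ _))//.
apply: (@le_trans _ _ (\sum_i `|lam i| * (2 / sqrtr q))); last first.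
  by rewrite -mulr_suml mulrA ler_pM2r ?invr_gt0// mulrC /Ca lerDl mulr_ge0.
apply: ler_sum => i _; rewrite -mulrA normrM ler_wpM2l//.
have /andP[s1 _] := Wsize i; have s0 : 0 < (size (W i))%:R :> R by rewrite (lt_le_trans q0).
have h : sqrtr (2 * q) / (size (W i))%:R <= 2 / sqrtr q.
  rewrite ler_pdivrMr// mulrAC ler_pdivlMr//.
  rewrite sqrtrM// -mulrA -expr2 sqr_sqrtr ?(ltW q0)//.
  rewrite ler_pM ?sqrtr_ge0 ?(ltW q0)//.
  by rewrite -[leRHS](ger0_norm (ler0n _ 2)) -sqrtr_sqr ler_wsqrtr// expr2 ler_peMr// ler1n.
rewrite normrM (le_trans _ h)// (ger0_norm (divr_ge0 (sqrtr_ge0 _) (ltW s0))).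
by rewrite ler_piMr ?divr_ge0 ?sqrtr_ge0 ?(ltW s0)//; case: (_ \in _); rewrite ?normr1 ?normr0.
Qed.

Lemma wgt_act k : ~~ act k -> wgt k = 0.
Proof.
rewrite negb_exists => /forallP h; rewrite /wgt big1// => i _; rewrite (negbTE (h i)) mulr0//.
Qed.

Lemma act_count : (\sum_(k | act k) 1 : R) <= Ca * q.
Proof.
apply: (@le_trans _ _ (\sum_i (size (W i))%:R)).
  apply: (@le_trans _ _ (\sum_(k < n) \sum_i ((k : nat) \in W i)%:R)).
    rewrite big_mkcond/=; apply: ler_sum => k _; case: ifP => [/existsP[i kW]|_]; last exact: sumr_ge0.
    by rewrite (bigD1 i)//= kW lerDl sumr_ge0.
  rewrite exchange_big/=; apply: ler_sum => i _.
  have := sum_win (fun=> 1) i; rewrite big_const_seq count_predT iter_addr_0 => ->.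
  by apply: ler_sum => k _; rewrite mulr1.
apply: (@le_trans _ _ (\sum_(i < u) 3 * q)); first by apply: ler_sum => i _; have /andP[] := Wsize i.
rewrite sumr_const card_ord -[leLHS]mulr_natr mulrAC ler_pM2r// /Ca lerDr mulr_ge0// sumr_ge0//.
Qed.

Lemma Sa_le k k' a b : `|Sa (k, a) (k', b)| <= ra k k'.
Proof.
rewrite /Sa /ra /Xa/=; case: (boolP (act k)) => ak /=; last by under eq_fun do rewrite mul0r; rewrite Ex_cst normr0.
case: (boolP (act k')) => ak' /=; last by under eq_fun do rewrite mulr0; rewrite Ex_cst normr0.
by have [g _ _] := act_okk ak; have [g' _ _] := act_okk ak'; exact: Cxdec.
Qed.

Lemma ra_sqr k k' : ra k k' ^+ 2 <= 2 * Cx ^+ 2 * (pw (dst k k') + (act k')%:R * qw).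
Proof.
rewrite /ra; case: (boolP (act k && act k')) => [/andP[_ ->]|_].
  rewrite exprMn mul1r (_ : 2 * Cx ^+ 2 * _ = Cx ^+ 2 * (2 * (pw (dst k k') + qw))); last by ring.
  by apply: ler_wpM2l; [exact: sqr_ge0 | exact: drate_sqr].
by rewrite expr0n/= mulr_ge0// addr_ge0 ?pw_ge0// mulr_ge0// qw_ge0.
Qed.

Lemma sum_act_qw : \sum_(k' : 'I_n) (act k')%:R * qw <= Ca * (q * qw).
Proof.
rewrite -mulr_suml mulrA ler_wpM2r ?qw_ge0//; apply: le_trans act_count.
by rewrite [leRHS]big_mkcond/=; apply: ler_sum => k' _; case: (act k').
Qed.

Lemma ra_row k : \sum_k' ra k k' ^+ 2 <= 2 * Cx ^+ 2 * (1 + 2 * K1 + Ca).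
Proof.
apply: (le_trans (ler_sum _ (fun k' _ => ra_sqr k k'))).
rewrite -mulr_sumr ler_wpM2l// big_split/= lerD//; last first.
  by rewrite (le_trans sum_act_qw)// ler_piMr.
rewrite (bigID (closeby 0 k))/= lerD//.
  apply: (@le_trans _ _ (\sum_(k' | closeby 0 k k') 1)); last exact: (card_closeby 0 k).
  apply: ler_sum => k' /andP[h1 h2]; rewrite !addn0 in h1 h2.
  by rewrite dst_le// (_ : k' - k = 0)%N ?/pw ?powR1//; apply/eqP; rewrite subn_eq0.
apply: (le_trans (tail_sum _ _ (pw_ge0 gam))); rewrite ler_pM2l//.
apply: le_trans (K1pw n.+1); rewrite big_ord_recl/= ler_wpDl ?pw_ge0//.
Qed.

Lemma ra_tail J e1 k : \sum_(i < n) pw (J.+1 + i) <= e1 ->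
  \sum_(k' | act k' && ~~ closeby J k k') ra k k' ^+ 2 <= 2 * Cx ^+ 2 * (2 * e1 + Ca * (q * qw)).
Proof.
move=> he; apply: (@le_trans _ _ (\sum_(k' | ~~ closeby J k k') ra k k' ^+ 2)).
  by rewrite big_mkcondl/=; apply: ler_sum => k' _; case: ifP => // _; exact: sqr_ge0.
apply: (le_trans (ler_sum _ (fun k' _ => ra_sqr k k'))).
rewrite -mulr_sumr ler_wpM2l// big_split/= lerD//.
  by apply: (le_trans (tail_sum _ _ (pw_ge0 gam))); rewrite ler_pM2l.
apply: le_trans sum_act_qw; rewrite [leRHS](bigID (closeby J k))/= lerDr sumr_ge0// => k' _.
by rewrite mulr_ge0// qw_ge0.
Qed.

Definition Yw (w : T) : R := \sum_(k < n) wgt k * psz n k w.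
Definition Yt (F : tpoly R bool) (w : T) : R := \sum_(k < n) wgt k * tev F ((Xa k)^~ w).
Definition Yd (F : tpoly R bool) (w : T) : R := \sum_(k < n) wgt k * dpsi F ((Xa k)^~ w).

Lemma YwE F w : Yw w = Yt F w + Yd F w.
Proof.
rewrite /Yw /Yt /Yd -big_split/=; apply: eq_bigr => k _; rewrite /dpsi -mulrDr addrC subrK.
case: (boolP (act k)) => [ak|nak]; last by rewrite wgt_act// !mul0r.
by have [_ v _] := act_okk ak; rewrite /Xa ak psib_xz.
Qed.

Let mXa k b : measurable_fun setT (Xa k b).
Proof. by have [m _ _] := gvec_Xa; exact: (m (k, b)). Qed.

Lemma bddm_Yt F : bddm (Yt F).
Proof. by apply: bddm_sum => k; apply: bddmZ; apply: bddm_tev. Qed.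

Lemma bddm_Yd F : bddm (Yd F).
Proof. by apply: bddm_sum => k; apply: bddmZ; apply: bddmB; [exact: bddm_psi | exact: bddm_tev]. Qed.

Lemma bddm_Yw : bddm Yw.
Proof. by apply: bddm_sum => k; apply: bddmZ; exact: bddm_psz. Qed.

Let eJ_ge0 (e : R) : 0 <= e -> 0 <= 2 * Cx ^+ 2 * (2 * e + Ca * (q * qw)).
Proof.
move=> e0; apply: mulr_ge0 => //; apply: addr_ge0; [exact: mulr_ge0 | apply: mulr_ge0 => //; apply: mulr_ge0; [exact: ltW | exact: qw_ge0]].
Qed.

Lemma Yd_var (F : tpoly R bool) (e1 e2 : R) (J : nat) (eJ := 2 * Cx ^+ 2 * (2 * e2 + Ca * (q * qw))) : teven F ->
  (forall x, `|tev F x| <= 1) -> 0 <= e1 -> 0 <= e2 ->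
  (forall (d : measure_display) (T : measurableType d)
        (P : probability T R) (X : bool -> T -> R) (S : bool -> bool -> R),
      gvec P X S -> S false false = 1 -> S true true <= 2 ->
      Ex P (fun w => `|psib (X^~ w) - tev F (X^~ w)|) <= e1) ->
  \sum_(i < n) pw (J.+1 + i) <= e2 ->
  Vr P (Yd F) <= Ca ^+ 3 * ((2 * J).+1%:R * (4 * e1) + 4 * (72 * (7 / v0 ^+ 2) ^+ 2) * eJ).
Proof.
move=> eF F1 e10 e20 hF he.
have eJ0 : 0 <= eJ := eJ_ge0 e20.
apply: (array_var gvec_Xa v01 nice_Xa q0 Ca0 wgt_le wgt_act act_count Sa_le eF F1 e10 eJ0).
  move=> k ak; have gk : gvec P (Xa k) (fun a b => Sa (k, a) (k, b)) := gvec_sub (pair k) gvec_Xa.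
  by apply: hF gk _ _; have [] := nice_Xa ak.
by move=> k ak; exact: ra_tail.
Qed.

Lemma Yt_clt (F : tpoly R bool) (p e2 : R) (J : nat) (eJ := 2 * Cx ^+ 2 * (2 * e2 + Ca * (q * qw)))
  (K := 2 * Cx ^+ 2 * (1 + 2 * K1 + Ca))
  (A := \sum_(t <- F) `|t.1.1|) (L := \sum_(t <- F) \sum_b `|t.1.2 b|) (m := (size F)%:R : R) :
  teven F -> 0 <= e2 -> \sum_(i < n) pw (J.+1 + i) <= e2 ->
  `|Ex P (fun w => cos (Yt F w - Ex P (Yt F) + p)) - expR (- Vr P (Yt F) / 2) * cos p| <=
  sqrtr (4 * (Ca * A / sqrtr q) ^+ 4 *
    (m * L ^+ 2 * ((2 * J).+1%:R * sqrtr K + sqrtr (Ca * q) * sqrtr eJ)) ^+ 2 *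
    (m ^+ 2 * L ^+ 4 * (Ca * q * K))).
Proof.
move=> eF e20 he.
have eJ0 : 0 <= eJ := eJ_ge0 e20.
have K10 : 0 <= K1 by apply: le_trans (K1pw 0); rewrite big_ord0.
have K0 : 0 <= K.
  by rewrite /K; apply: mulr_ge0; [exact: c0 | rewrite addr_ge0// addr_ge0// mulr_ge0].
apply: (array_trig gvec_Xa q0 Ca0 wgt_le act_count Sa_le p eF K0 eJ0).
- by move=> k k' /negbTE h; rewrite /ra h.
- exact: ra_row.
- by move=> k ak; exact: ra_tail.
Qed.

End WindowArray.
Lemma cvgn_sum {R : realType} {I : Type} (r : seq I) (f : I -> nat -> R) (a : I -> R) :
  (forall i, f i n @[n --> \oo] --> a i) -> \sum_(i <- r) f i n @[n --> \oo] --> \sum_(i <- r) a i.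
Proof.
move=> h; elim: r => [|i r IH].
  by rewrite big_nil; under eq_fun do rewrite big_nil; exact: cvg_cst.
by rewrite big_cons; under eq_fun do rewrite big_cons; exact: cvgD.
Qed.

Lemma expR_half_lip {R : realType} (x y : R) : 0 <= x -> 0 <= y -> `|expR (- x / 2) - expR (- y / 2)| <= `|x - y| / 2.
Proof.
wlog xy : x y / x <= y.
  by move=> h x0 y0; have [/h|/ltW /h] := leP x y; [apply | rewrite distrC (distrC x); apply].
move=> x0 y0; rewrite (ler0_norm (_ : x - y <= 0)) ?subr_le0// ger0_norm ?subr_ge0 ?ler_expR; last by lra.
have -> : expR (- y / 2) = expR (- x / 2) * expR ((x - y) / 2) by rewrite -expRD; congr expR; lra.
have h1 := expR_ge1Dx ((x - y) / 2).
have h2 : expR (- x / 2) <= 1 by rewrite -[leRHS]expR0 ler_expR; lra.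
have h3 := expR_ge0 (- x / 2).
have h4 : 1 - expR ((x - y) / 2) <= (y - x) / 2 by lra.
have h5 : 0 <= 1 - expR ((x - y) / 2) by rewrite subr_ge0 -[leRHS]expR0 ler_expR; lra.
have : expR (- x / 2) * (1 - expR ((x - y) / 2)) <= 1 - expR ((x - y) / 2) by rewrite ler_piMl.
rewrite mulrBr mulr1; lra.
Qed.

(** The powers of q cancel: the central entries of the rows contribute order 1/q, and the distant
    ones a multiple of eJ that does not grow with q. *)
Lemma trig_err {R : realType} (C A q m L K s eJ : R) : 0 < q -> 0 <= C -> 0 <= A -> 0 <= m -> 0 <= L -> 0 <= K -> 0 <= eJ ->
  4 * (C * A / sqrtr q) ^+ 4 * (m * L ^+ 2 * (s * sqrtr K + sqrtr (C * q) * sqrtr eJ)) ^+ 2 *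
    (m ^+ 2 * L ^+ 4 * (C * q * K)) <= 2 * (4 * C ^+ 5 * A ^+ 4 * m ^+ 4 * L ^+ 8 * K) * (s ^+ 2 * K / q + C * eJ).
Proof.
move=> q0 C0 A0 m0 L0 K0 e0.
set M := 4 * C ^+ 5 * A ^+ 4 * m ^+ 4 * L ^+ 8 * K.
have M0 : 0 <= M by rewrite !mulr_ge0 ?exprn_ge0.
have rq : 0 < sqrtr q by rewrite sqrtr_gt0.
have := sqr_sqrtr (ltW q0); have := sqr_sqrtr K0; have := sqr_sqrtr e0.
have := sqr_sqrtr (mulr_ge0 C0 (ltW q0)).
move: (sqrtr (C * q)) (sqrtr eJ) (sqrtr K) (sqrtr q) rq => b c a r r0 hb hc ha hr.
have -> : 4 * (C * A / r) ^+ 4 * (m * L ^+ 2 * (s * a + b * c)) ^+ 2 * (m ^+ 2 * L ^+ 4 * (C * q * K)) =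
    M / q * (s * a + b * c) ^+ 2.
  by rewrite -hr /M; field; rewrite gt_eqF.
have h : (s * a + b * c) ^+ 2 <= 2 * (s ^+ 2 * K + C * q * eJ).
  rewrite -hb -hc -ha; have := sqr_ge0 (s * a - b * c); rewrite !expr2; lra.
apply: (@le_trans _ _ (M / q * (2 * (s ^+ 2 * K + C * q * eJ)))).
  by rewrite ler_wpM2l// divr_ge0// ltW.
by rewrite le_eqVlt; apply/orP; left; apply/eqP; field; rewrite gt_eqF.
Qed.

Lemma VrN `{T : measurableType d} {R : realType} (P : probability T R) (X : T -> R) :
  bddm X -> Vr P (fun w => - X w) = Vr P X.
Proof.
move=> bX; rewrite /Vr (ExN (bddm_itg P bX)) mulrNN; congr (Ex _ _ - _).
by apply/funext => w; rewrite mulrNN.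
Qed.

Section VarYw.
Context {R : realType} `{T : measurableType d}.
Variables (P : probability T R) (Z : R -> {RV P >-> R}) (alpha : R) (n u : nat) (t lam : 'I_u -> R).
Local Notation W i := (nbr alpha n 2 (t i)).
Local Notation q := (qn alpha n).
Hypotheses (Wlt : forall i k, k \in W i -> (k < n)%N) (q0 : 0 <= q).

Lemma Vr_Yw : Vr P (Yw Z alpha n t lam) = \sum_i \sum_i' lam i * lam i' * (2 * q / (size (W i'))%:R) *
  ((size (W i))%:R^-1 * \sum_(k <- W i) \sum_(k' <- W i') cc Z n k k').
Proof.
rewrite /Vr (@Ex_sum_cov _ _ _ P n (wgt alpha n t lam) (fun k => psz Z n k)); last first.
  by move=> k; exact: bddm_psz.
pose ci i := lam i * (sqrtr (2 * q) / (size (W i))%:R).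
pose I i (k : nat) : R := (k \in W i)%:R.
transitivity (\sum_(k < n) \sum_(k' < n) \sum_i \sum_i' ci i * ci i' * (I i k * (I i' k' * cc Z n k k'))).
  apply: eq_bigr => k _; apply: eq_bigr => k' _; rewrite /wgt big_distrlr/= mulr_suml.
  by apply: eq_bigr => i _; rewrite mulr_suml; apply: eq_bigr => i' _; rewrite /ci /I -/(cc Z n k k'); ring.
transitivity (\sum_i \sum_i' ci i * ci i' * \sum_(k < n) \sum_(k' < n) (I i k * (I i' k' * cc Z n k k'))).
  under eq_bigr do rewrite exchange_big/=.
  rewrite exchange_big/=; apply: eq_bigr => i _.
  under eq_bigr do rewrite exchange_big/=.
  rewrite exchange_big/=; apply: eq_bigr => i' _.
  by rewrite mulr_sumr; apply: eq_bigr => k _; rewrite mulr_sumr.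
apply: eq_bigr => i _; apply: eq_bigr => i' _.
rewrite (sum_win Wlt).
under [in RHS]eq_bigr do rewrite (sum_win Wlt).
rewrite [RHS]mulrA; congr (_ * _); last by apply: eq_bigr => k _; rewrite mulr_sumr.
have s2 : sqrtr (2 * q) * sqrtr (2 * q) = 2 * q by rewrite -expr2 sqr_sqrtr// mulr_ge0.
rewrite /ci -[in RHS]s2; ring.
Qed.

End VarYw.

Section WindowCLT.
Context {R : realType} `{T : measurableType d} `{T' : measurableType d'}.
Variables (P : probability T R) (PB : probability T' R) (B : R -> R -> {RV PB >-> R}).
Variables (Z : R -> {RV P >-> R}) (alpha kappa eta : R) (H c : R -> R).
Hypotheses (hB : forall h : R, 0 < h < 1 -> is_fbm h (B h)) (gZ : gaussian_process `]0, 1[ Z).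
Hypotheses (zZ : zero_mean `]0, 1[ Z) (alpha01 : 0 < alpha < 1) (kap0 : 0 <= kappa).
Hypothesis hA : assumption_A B 2 kappa eta H c Z.
Local Notation W n t := (nbr alpha n 2 t).
Local Notation q := (qn alpha).
Variable gam : R.
Hypotheses (gam0 : 2^-1 < gam) (hBa : corr_decay Z alpha gam).
Variables (eps v0 : R).
Hypotheses (heps : 0 < eps < 2^-1) (v01 : 0 < v0 <= 1).
Variables (u : nat) (t : 'I_u -> R).
Hypotheses (tinj : injective t) (tok : forall i, wok Z alpha eps v0 (t i)).

Let t01 i : 0 < t i < 1. Proof. by have [] := tok i. Qed.

Lemma near_window i : \forall n \near \oo, [/\ q n <= (size (W n (t i)))%:R <= 3 * q n,
  `|(size (W n (t i)))%:R - 2 * q n| <= 1 :> R & forall k, k \in W n (t i) -> (k < n)%N].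
Proof.
apply: filter_app (nbr_iota alpha01 (t01 i)); apply: filter_app (qn_big alpha01 1).
near=> n => q1 [a [v [-> [a0 av] /andP[v1 v2] _ _]]]; rewrite size_iota -/(q n) in v1 v2 *.
split; [by apply/andP; split; lra | by rewrite ler_norml; apply/andP; split; lra |].
move=> k; rewrite mem_iota => /andP[_ h]; apply: leq_trans h _; apply: leq_trans av _; exact: leq_subr.
Unshelve. all: by end_near.
Qed.

Lemma near_windows : \forall n \near \oo, forall i, [/\ q n <= (size (W n (t i)))%:R <= 3 * q n,
  `|(size (W n (t i)))%:R - 2 * q n| <= 1 :> R & forall k, k \in W n (t i) -> (k < n)%N].
Proof. by apply: filter_forall => i; exact: near_window. Qed.

Lemma near_ok i : \forall n \near \oo, forall k, k \in W n (t i) -> okk Z eps v0 n k.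
Proof.
have [_ h] := tok i; have : \forall x \near win alpha (t i), okk Z eps v0 x.1 x.2.
  by apply: filterS (h 0) => x; rewrite addn0.
by [].
Qed.

Lemma size_ratio i : 2 * q n / (size (W n (t i)))%:R @[n --> \oo] --> (1 : R).
Proof.
apply/cvgrPdist_le => e e0; apply: filterS3 (near_window i) (qn_big alpha01 1) (qn_big alpha01 e^-1).
move=> n [/andP[s1 _] s2 _] q1 qe.
have s0 : 0 < (size (W n (t i)))%:R :> R by lra.
rewrite (_ : 1 - _ = ((size (W n (t i)))%:R - 2 * q n) / (size (W n (t i)))%:R); last first.
  by field; rewrite gt_eqF.
rewrite normrM normfV (gtr0_norm s0) ler_pdivrMr// (le_trans s2)//.
by rewrite mulrC -ler_pdivrMr// div1r (le_trans qe).
Qed.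

(** Diagonal blocks converge to sigma^2 and blocks of two different windows to 0, which is the
    asymptotic independence; 2 q over the window size tends to 1, whence the normalization by sqrt
    (2 n^(1-alpha)). *)
Lemma Vr_limit (lam : 'I_u -> R) :
  Vr P (Yw Z alpha n t lam) @[n --> \oo] --> \sum_i lam i ^+ 2 * sigma2 B (H (t i)).
Proof.
have Gl i i' : (size (W n (t i)))%:R^-1 * (\sum_(k <- W n (t i)) \sum_(k' <- W n (t i')) cc Z n k k') @[n --> \oo] -->
    (i' == i)%:R * sigma2 B (H (t i)).
  apply/cvgrPdist_le => e e0; have [->|ne] := eqVneq i' i.
    rewrite mul1r; apply: filterS (var_limit hB gZ zZ alpha01 kap0 hA gam0 hBa heps v01 (tok i) e0) => n.
    by rewrite distrC.
  have tn : t i != t i' by apply: contraNN ne => /eqP /tinj ->.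
  rewrite mul0r; apply: filterS (cross_limit hB gZ zZ alpha01 kap0 hA gam0 hBa heps v01 (tok i) (tok i') tn e0) => n.
  by rewrite sub0r normrN.
have e : \sum_i lam i ^+ 2 * sigma2 B (H (t i)) = \sum_i \sum_i' lam i * lam i' * 1 * ((i' == i)%:R * sigma2 B (H (t i))).
  apply: eq_bigr => i _; rewrite (bigD1 i)//= eqxx big1 ?addr0; first by rewrite mul1r mulr1 expr2.
  by move=> i' /negbTE ->; rewrite mul0r mulr0.
have lim : \sum_i \sum_i' lam i * lam i' * (2 * q n / (size (W n (t i')))%:R) *
  ((size (W n (t i)))%:R^-1 * \sum_(k <- W n (t i)) \sum_(k' <- W n (t i')) cc Z n k k') @[n --> \oo] -->
  \sum_i \sum_i' lam i * lam i' * 1 * ((i' == i)%:R * sigma2 B (H (t i))).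
  apply: cvgn_sum => i; apply: cvgn_sum => i'; apply: cvgM; last exact: Gl.
  by apply: cvgM; [exact: cvg_cst | exact: size_ratio].
rewrite e; apply: cvg_trans lim; apply: near_eq_cvg.
have hW := near_windows.
apply: filterS hW => n hW; rewrite Vr_Yw//; last exact: powR_ge0.
by move=> i k; have [_ _] := hW i; apply.
Qed.

(** Not visible on the series; the sum is a limit of variances. *)
Lemma sigma2_ge0 (lam : 'I_u -> R) : 0 <= \sum_i lam i ^+ 2 * sigma2 B (H (t i)).
Proof.
rewrite leNgt; apply/negP => V0; have := @Vr_limit lam; set V := \sum_i _ in V0 *.
move=> /cvgrPdist_lt /(_ (- V)); rewrite oppr_gt0 => /(_ V0) [n _ /(_ n (leqnn n))]/=.
have := Vr_ge0 P (@bddm_Yw _ _ _ P Z alpha n u t lam).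
by move=> h; rewrite ltr_norml => /andP[h1 _]; lra.
Qed.

(** The order of choices matters: the tolerance dl, then the cut-off J, then the polynomial F, and
    only afterwards J' and e3, since the error of the trigonometric part depends on the
    coefficients, frequencies and length of F. *)
Theorem window_clt (lam : 'I_u -> R) (p e : R) (V := \sum_i lam i ^+ 2 * sigma2 B (H (t i))) : 0 < e ->
  \forall n \near \oo,
  `|Ex P (fun w => cos (Yw Z alpha n t lam w - Ex P (Yw Z alpha n t lam) + p)) - expR (- V / 2) * cos p| <= e.
Proof.
move=> e0; have V0 : 0 <= V := sigma2_ge0 lam.
pose C := Ca lam; have C0 : 0 <= C by rewrite addr_ge0 ?mulr_ge0 ?sumr_ge0.
have [Cx Cx0 hCx] := xz_decay hB gZ zZ kap0 hA gam0 hBa heps.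
have [K1 K10 hK1] := sum_powR_bdd (gam2 gam0).
pose s := sqrtr (V + 1); have s0 : 0 <= s by exact: sqrtr_ge0.
(* Target for the standard deviation of the remainder. It enters once through the cosine and once,
   multiplied by 2 s + 1, through the change of variance, where s bounds the standard deviation of
   the full sum. *)
pose dl := minr 1 (e / (8 * (s + 1))).
have s1 : 0 < s + 1 by rewrite ltr_wpDl.
have dl0 : 0 < dl by rewrite lt_min ltr01/= divr_gt0// mulr_gt0.
have dl1 : dl <= 1 by rewrite ge_min lexx.
have dle : dl * (s + 1) <= e / 8.
  rewrite -ler_pdivlMr// (_ : e / 8 / (s + 1) = e / (8 * (s + 1))); first by rewrite ge_min lexx orbT.
  by field; rewrite gt_eqF.
have d20 : 0 < dl ^+ 2 by rewrite exprn_gt0.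
pose Kd : R := 4 * (72 * (7 / v0 ^+ 2) ^+ 2).
have Kd0 : 0 <= Kd by apply: mulr_ge0 => //; apply: mulr_ge0 => //; exact: sqr_ge0.
pose Cy := 2 * Cx ^+ 2 * (2 + C).
have Cy0 : 0 <= Cy by apply: mulr_ge0; [apply: mulr_ge0 => //; exact: sqr_ge0 | exact: addr_ge0].
have C30 : 0 <= C ^+ 3 by exact: exprn_ge0.
have eJ_le e2 n : qn alpha n * qw alpha gam n <= e2 ->
    2 * Cx ^+ 2 * (2 * e2 + C * (qn alpha n * qw alpha gam n)) <= Cy * e2.
  move=> h; rewrite /Cy -[leRHS]mulrA; apply: ler_wpM2l; first by apply: mulr_ge0 => //; exact: sqr_ge0.
  by rewrite [leRHS]mulrDl lerD2l ler_wpM2l.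
pose M := C ^+ 3 * Kd * Cy + 1.
have M0 : 0 < M by apply: ltr_wpDl => //; apply: mulr_ge0 => //; exact: mulr_ge0.
(* e2 and e1 allot half of dl^2 each to the distant covariances and to those near the diagonal. *)
pose e2 := dl ^+ 2 / (2 * M).
have e20 : 0 < e2 by rewrite divr_gt0// mulr_gt0.
have [J J0 hJ] := powR_tail (gam2 gam0) e20.
pose M' : R := C ^+ 3 * ((2 * J).+1%:R * 4) + 1.
have M'0 : 0 < M' by apply: ltr_wpDl => //; apply: mulr_ge0 => //; exact: mulr_ge0.
pose e1 := dl ^+ 2 / (2 * M').
have e10 : 0 < e1 by rewrite divr_gt0// mulr_gt0.
have [F [eF F1 hF]] := psi_approx e10.
pose A : R := \sum_(t <- F) `|t.1.1|.
pose L : R := \sum_(t <- F) \sum_b `|t.1.2 b|.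
pose m : R := (size F)%:R.
have A0 : 0 <= A by exact: sumr_ge0.
have L0 : 0 <= L by apply: sumr_ge0 => x _; exact: sumr_ge0.
pose K := 2 * Cx ^+ 2 * (1 + 2 * K1 + C).
have K0 : 0 <= K.
  apply: mulr_ge0; first by apply: mulr_ge0 => //; exact: sqr_ge0.
  by rewrite addr_ge0// addr_ge0// mulr_ge0// ltW.
pose M1 := 4 * C ^+ 5 * A ^+ 4 * m ^+ 4 * L ^+ 8 * K.
have m0 : 0 <= m by exact: ler0n.
have M10 : 0 <= M1.
  apply: mulr_ge0 => //; apply: mulr_ge0; last exact: exprn_ge0.
  apply: mulr_ge0; last exact: exprn_ge0.
  apply: mulr_ge0; last exact: exprn_ge0.
  by apply: mulr_ge0 => //; exact: exprn_ge0.
pose D := 2 * M1 * (C * Cy) + 1.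
have D0 : 0 < D by apply: ltr_wpDl => //; apply: mulr_ge0; exact: mulr_ge0.
have ee0 : 0 < e ^+ 2 by rewrite exprn_gt0.
(* Half of (e / 2)^2 is allotted to distant correlations through e3; the other half is the term Q /
   q, which large n makes small. *)
pose e3 := e ^+ 2 / (8 * D).
have e30 : 0 < e3 by rewrite divr_gt0// mulr_gt0.
have [J' J'0 hJ'] := powR_tail (gam2 gam0) e30.
pose Q := 2 * M1 * ((2 * J').+1%:R ^+ 2 * K).
have Q0 : 0 <= Q by apply: mulr_ge0; [exact: mulr_ge0 | apply: mulr_ge0 => //; exact: exprn_ge0].
pose ev := minr 1 (e / 2).
have ev0 : 0 < ev by rewrite lt_min ltr01/= divr_gt0.
have ev1 : ev <= 1 by rewrite ge_min lexx.
have ev2 : ev <= e / 2 by rewrite ge_min lexx orbT.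
have hW := near_windows.
have hO : \forall n \near \oo, forall i k, k \in W n (t i) -> okk Z eps v0 n k.
  by apply: filter_forall => i; exact: near_ok.
have := @Vr_limit lam => /cvgrPdist_le /(_ _ ev0) hV.
apply: filter_app hW; apply: filter_app hO; apply: filter_app hV; apply: filter_app hCx.
apply: filter_app (qnqw alpha01 gam0 e20); apply: filter_app (qnqw alpha01 gam0 e30).
apply: filter_app (qnqw alpha01 gam0 ltr01); apply: filter_app (qn_big alpha01 1).
apply: filter_app (qn_big alpha01 (Q * 8 / e ^+ 2)).
near=> n => qQ q1 qq1 qq3 qq2 hC hV hO hW.
have Wsz i : q n <= (size (W n (t i)))%:R <= 3 * q n by have [] := hW i.
have Wlt i k : k \in W n (t i) -> (k < n)%N by have [_ _] := hW i; apply.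
have tl (e' : R) (j : nat) : (0 < j)%N -> (forall J'' m : nat, (j <= J'')%N -> \sum_(i < m) (J''.+1 + i)%:R `^ (- (2 * gam)) <= e') ->
    \sum_(i < n) pw gam (j.+1 + i) <= e'.
  move=> j0 h; apply: le_trans (h j n (leqnn _)); apply: ler_sum => i _.
  by rewrite /pw (_ : maxn 1 (j.+1 + i) = j.+1 + i)%N//; apply/maxn_idPr; rewrite addSn.
have vD := Yd_var gZ zZ lam v01 hO hC Wsz Wlt q1 eF F1 (ltW e10) (ltW e20) hF (tl _ _ J0 hJ).
have cT := Yt_clt gZ zZ lam hO hC Wsz Wlt q1 qq1 hK1 p eF (ltW e30) (tl _ _ J'0 hJ').
have bT : bddm (Yt Z alpha n t lam F) by exact: (bddm_Yt gZ zZ lam hO F).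
have bD : bddm (Yd Z alpha n t lam F) by exact: (bddm_Yd gZ zZ lam hO F).
have bY : bddm (Yw Z alpha n t lam) by exact: bddm_Yw.
have YE : Yw Z alpha n t lam = (fun w => Yt Z alpha n t lam F w + Yd Z alpha n t lam F w).
  by apply/funext => w; exact: (YwE lam hO).
have TE : Yt Z alpha n t lam F = (fun w => Yw Z alpha n t lam w + - Yd Z alpha n t lam F w).
  by apply/funext => w; rewrite YE addrK.
have {vD} vD : sqrtr (Vr P (Yd Z alpha n t lam F)) <= dl.
  rewrite -[leRHS](ger0_norm (ltW dl0)) -sqrtr_sqr ler_wsqrtr// (le_trans vD)//.
  rewrite mulrDr (splitr (dl ^+ 2)) lerD//.
    rewrite (_ : dl ^+ 2 / 2 = M' * e1); last by rewrite /e1; field; rewrite gt_eqF.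
    by rewrite [leLHS](_ : _ = C ^+ 3 * ((2 * J).+1%:R * 4) * e1) ?ler_pM2r// ?lerDl//; rewrite -/C; ring.
  rewrite (_ : dl ^+ 2 / 2 = M * e2); last by rewrite /e2; field; rewrite gt_eqF.
  apply: (@le_trans _ _ (C ^+ 3 * (Kd * (Cy * e2)))).
    by apply: ler_wpM2l => //; apply: ler_wpM2l => //; exact: eJ_le.
  by rewrite [leLHS](_ : _ = C ^+ 3 * Kd * Cy * e2) ?ler_pM2r// ?lerDl//; ring.
have q0 : 0 < q n by exact: lt_le_trans q1.
have qqw0 : 0 <= q n * qw alpha gam n by rewrite mulr_ge0 ?qw_ge0// ltW.
pose eJ := 2 * Cx ^+ 2 * (2 * e3 + C * (q n * qw alpha gam n)).
have eJ0 : 0 <= eJ.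
  apply: mulr_ge0; first by apply: mulr_ge0 => //; exact: sqr_ge0.
  by apply: addr_ge0; [apply: mulr_ge0 => //; exact: ltW | exact: mulr_ge0].
have {cT} cT : `|Ex P (fun w => cos (Yt Z alpha n t lam F w - Ex P (Yt Z alpha n t lam F) + p)) -
    expR (- Vr P (Yt Z alpha n t lam F) / 2) * cos p| <= e / 2.
  apply: (le_trans cT); have e2p : 0 <= e / 2 by rewrite divr_ge0// ltW.
  rewrite -[leRHS](ger0_norm e2p) -sqrtr_sqr ler_wsqrtr//.
  apply: (le_trans (trig_err (2 * J').+1%:R q0 C0 A0 (ler0n _ _) L0 K0 eJ0)).
  rewrite -/M1 mulrDr (_ : (e / 2) ^+ 2 = e ^+ 2 / 8 + e ^+ 2 / 8); last by field.
  rewrite lerD//.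
    rewrite (_ : _ * _ = Q / q n); last by rewrite /Q; field; rewrite gt_eqF.
    rewrite ler_pdivrMr// mulrC -ler_pdivrMr ?divr_gt0//.
    by rewrite (_ : Q / (e ^+ 2 / 8) = Q * 8 / e ^+ 2)//; field; rewrite gt_eqF.
  apply: (@le_trans _ _ (2 * M1 * (C * (Cy * e3)))).
    by apply: ler_wpM2l; [rewrite mulr_ge0 | apply: ler_wpM2l => //; exact: eJ_le].
  rewrite (_ : e ^+ 2 / 8 = D * e3); last by rewrite /e3; field; rewrite gt_eqF.
  by rewrite [leLHS](_ : _ = 2 * M1 * (C * Cy) * e3) ?ler_pM2r// ?lerDl//; ring.
have cY : `|Ex P (fun w => cos (Yw Z alpha n t lam w - Ex P (Yw Z alpha n t lam) + p)) -
    Ex P (fun w => cos (Yt Z alpha n t lam F w - Ex P (Yt Z alpha n t lam F) + p))| <= sqrtr (Vr P (Yd Z alpha n t lam F)).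
  by rewrite YE; exact: Ex_cos_perturb.
have VT : `|Vr P (Yt Z alpha n t lam F) - Vr P (Yw Z alpha n t lam)| <= dl * (2 * s + 1).
  have := Vr_perturb P bY (bddmN bD); rewrite -TE (VrN _ bD) => /le_trans; apply.
  have vd0 := sqrtr_ge0 (Vr P (Yd Z alpha n t lam F)).
  rewrite -[X in _ + X](sqr_sqrtr (Vr_ge0 P bD)).
  have ws : sqrtr (Vr P (Yw Z alpha n t lam)) <= s.
    rewrite ler_wsqrtr//; move: hV; rewrite ler_norml => /andP[h _]; move: h ev1; rewrite -/V; lra.
  have ws0 := sqrtr_ge0 (Vr P (Yw Z alpha n t lam)).
  move: (sqrtr _) (sqrtr (Vr P (Yd _ _ _ _ _ _))) vd0 vD ws ws0 => x y y0 yd xs x0.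
  have h1 : x * y <= s * dl by exact: ler_pM.
  have h2 : y ^+ 2 <= dl by rewrite expr2 -[leRHS]mulr1 ler_pM// (le_trans yd).
  lra.
have xp := expR_half_lip (Vr_ge0 P bT) V0.
have h3 : `|expR (- Vr P (Yt Z alpha n t lam F) / 2) * cos p - expR (- V / 2) * cos p| <= (dl * (2 * s + 1) + ev) / 2.
  rewrite -mulrBl normrM (le_trans (_ : _ <= `|expR (- Vr P (Yt Z alpha n t lam F) / 2) - expR (- V / 2)|)).
  - by [].
  - by rewrite ler_piMr// norm_cos_le1.
  rewrite (le_trans xp)// ler_pM2r ?invr_gt0//.
  rewrite -(subrK (Vr P (Yw Z alpha n t lam)) (Vr P (Yt Z alpha n t lam F))) -addrA.
  by rewrite (le_trans (ler_normD _ _))// lerD// distrC.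
move: cY cT h3.
move: (Ex P _) (Ex P _) (expR (- Vr P _ / 2) * cos p) (expR (- V / 2) * cos p) => y x z w' cY cT h3.
have h4 : `|x - w'| <= `|x - y| + `|y - z| + `|z - w'|.
  rewrite (_ : x - w' = (x - y) + (y - z) + (z - w')); last by ring.
  by rewrite (le_trans (ler_normD _ _))// lerD2r ler_normD.
have h5 : `|x - y| <= dl := le_trans cY vD.
have e1' : dl * (2 * s + 1) = 2 * (dl * s) + dl by ring.
have e2' : dl * (s + 1) = dl * s + dl by ring.
rewrite e1' in h3; rewrite e2' in dle.
have ds0 : 0 <= dl * s by apply: mulr_ge0 => //; exact: ltW.
by move: (dl * s) ds0 h3 h4 h5 cT dle ev2 dl0 => ds; lra.
Unshelve. all: by end_near.
Qed.

End WindowCLT.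
(** * The bias *)

Section Holder.
Context {R : realType}.

Lemma taylor1_holder (f : R -> R) (t K s dl : R) : 0 <= s -> 0 <= K -> 0 < dl ->
  (forall y, `|y - t| < dl -> derivable f y 1) ->
  (forall y, `|y - t| < dl -> `|derive1 f y - derive1 f t| <= K * `|y - t| `^ s) ->
  forall x, `|x - t| < dl -> `|f x - f t - derive1 f t * (x - t)| <= K * `|x - t| `^ (s + 1).
Proof.
move=> s0 K0 dl0 df hf x xd.
have [->|xt] := eqVneq x t; first by rewrite !subrr mulr0 subr0 normr0 mulr_ge0// powR_ge0.
have xt0 : 0 < `|x - t| by rewrite normr_gt0 subr_eq0.
have [c [cl ->]] : exists c, `|c - t| <= `|x - t| /\ f x - f t = derive1 f c * (x - t).
  have mvt a b : a < b -> (forall z, a <= z <= b -> `|z - t| < dl) ->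
      exists2 c, a < c < b & f b - f a = derive1 f c * (b - a).
    move=> ab h; have [||c] := @MVT R f (derive1 f) a b ab.
    - move=> z; rewrite in_itv/= => /andP[az zb]; apply: DeriveDef; first by apply: df; apply: h; rewrite !ltW.
      by rewrite derive1E.
    - apply: derivable_within_continuous => z; rewrite in_itv/= => zab; apply: df; exact: h.
    by rewrite in_itv/= => cab e; exists c.
  move: xd; have [lt|lt|e] := ltgtP x t; last by rewrite e eqxx in xt.
    rewrite ltr0_norm ?subr_lt0// => xd.
    have [|c /andP[c1 c2] e] := mvt x t lt.
      by move=> z /andP[z1 z2]; rewrite ler0_norm ?subr_le0//; lra.
    exists c; rewrite (ltr0_norm (_ : c - t < 0)) ?subr_lt0//; split; first lra.
    by move: e; lra.
  rewrite gtr0_norm ?subr_gt0// => xd.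
  have [|c /andP[c1 c2] e] := mvt t x lt.
    by move=> z /andP[z1 z2]; rewrite ger0_norm ?subr_ge0//; lra.
  by exists c; rewrite (gtr0_norm (_ : 0 < c - t)) ?subr_gt0//; split => //; lra.
rewrite -mulrBl normrM powRD; last by rewrite (gt_eqF xt0) implybT.
rewrite powRr1// mulrA ler_wpM2r// (le_trans (hf c (le_lt_trans cl xd)))//.
by rewrite ler_wpM2l// ge0_ler_powR ?nnegrE.
Qed.

(** Three cases on the integer part of eta: for 0 take D = 0; for 1 the derivative is Hoelder of
    order eta - 1; from 2 on the derivative is differentiable, hence Lipschitz at t, and the
    exponent stops at 2. *)
Lemma holder_taylor (eta t : R) (f : R -> R) : 0 < eta -> 0 < t < 1 -> holder_class eta f ->
  exists D K rho : R, [/\ 0 <= K, 0 < rho & forall x, `|x - t| < rho ->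
    `|f x - f t - D * (x - t)| <= K * `|x - t| `^ (minr eta 2)].
Proof.
move=> eta0 /andP[t0 t1] [hd _ [K K0 hK]].
pose rho := minr t (1 - t).
have rho0 : 0 < rho by rewrite lt_min t0 subr_gt0.
have rin x : `|x - t| < rho -> 0 < x < 1 by rewrite lt_min !ltr_norml; lra.
have t01 : 0 < t < 1 by rewrite t0.
have := truncn_itv (ltW eta0); set p := Num.truncn eta in hd hK *; case: p hd hK => [|[|p]] hd hK /andP[p0 p1].
- exists 0, K, rho; split => // x xr; rewrite mul0r subr0.
  rewrite (min_idPl (_ : eta <= 2)); last by lra.
  by have := hK x t (rin _ xr) t01; rewrite subr0.
- exists (derive1 f t), K, rho; split => // x xr.
  rewrite (min_idPl (_ : eta <= 2)); last by lra.
  rewrite -(subrK 1 eta); apply: (@taylor1_holder f t K _ rho) => //; first by rewrite subr_ge0.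
    by move=> y yr; exact: (hd 0%N y _ (rin _ yr)).
  by move=> y yr; have := hK y t (rin _ yr) t01.
- have [K1 [dl [K10 dl0 lip]]] := derivable_lip_at (hd 1%N t isT t01).
  have r0 : 0 < minr rho dl by rewrite lt_min rho0.
  exists (derive1 f t), K1, (minr rho dl); split => // x xr.
  have p2 : 2 <= eta by apply: le_trans p0; rewrite ler_nat.
  rewrite (min_idPr p2) (_ : 2 = 1 + 1); last by [].
  apply: (@taylor1_holder f t K1 1 (minr rho dl)) => //.
    by move=> y; rewrite lt_min => /andP[yr _]; exact: (hd 0%N y _ (rin _ yr)).
  by move=> y; rewrite lt_min powRr1// => /andP[_ yd]; exact: lip.
Qed.

(** Since b <= 2 and |z| <= 1, the inner increment df is of order |z|^(b/2), so its square, which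
    bounds the outer remainder, is again of order |z|^b. *)
Lemma comp_taylor (z b D K d0 K0 df dg : R) : 0 < b <= 2 -> 0 <= K -> 0 <= K0 -> `|z| <= 1 ->
  `|df - D * z| <= K * `|z| `^ b -> `|dg - d0 * df| <= K0 * df ^+ 2 ->
  `|dg - d0 * D * z| <= (K0 * (`|D| + K) ^+ 2 + `|d0| * K) * `|z| `^ b.
Proof.
move=> /andP[b0 b2] K00 K0' z1 h1 h2.
have pw1 (s s' : R) : 0 < s -> s <= s' -> `|z| `^ s' <= `|z| `^ s.
  have [->|zn0] := eqVneq z 0.
    by move=> s0 ss; rewrite normr0 !powR0// gt_eqF// (lt_le_trans s0).
  by move=> s0 ss; rewrite ger_powR// normr_gt0 zn0.
have b20 : 0 < b / 2 by rewrite divr_gt0.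
have df_le : `|df| <= (`|D| + K) * `|z| `^ (b / 2).
  have : `|df| <= `|D| * `|z| + K * `|z| `^ b.
    by rewrite -(subrK (D * z) df) addrC (le_trans (ler_normD _ _))// normrM lerD2l.
  move=> /le_trans; apply; rewrite mulrDl lerD// ler_wpM2l//.
    by rewrite -{1}(powRr1 (normr_ge0 z)); apply: pw1 => //; lra.
  by apply: pw1 => //; lra.
have df2 : df ^+ 2 <= (`|D| + K) ^+ 2 * `|z| `^ b.
  rewrite -(real_normK (num_real df)) (_ : `|z| `^ b = (`|z| `^ (b / 2)) ^+ 2).
    by rewrite -exprMn lerXn2r ?nnegrE// mulr_ge0 ?powR_ge0// addr_ge0.
  by rewrite -powR_mulrn ?powR_ge0// -powRrM divfK.
rewrite (_ : dg - _ = (dg - d0 * df) + d0 * (df - D * z)); last by ring.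
rewrite (le_trans (ler_normD _ _))// mulrDl lerD//.
  by rewrite (le_trans h2)// -mulrA ler_wpM2l.
by rewrite normrM -mulrA ler_wpM2l.
Qed.

End Holder.

Lemma sum_seq_cst {R : realType} {I : Type} (r : seq I) (x : R) : \sum_(k <- r) x = (size r)%:R * x.
Proof. by rewrite big_const_seq count_predT iter_addr_0 mulr_natl. Qed.

Lemma sum_iota {R : realType} (a v : nat) :
  \sum_(k <- iota a v) k%:R = v%:R * (2 * a%:R + v%:R - 1) / 2 :> R.
Proof.
elim: v a => [|v IH] a; first by rewrite big_nil !mul0r.
by rewrite /= big_cons IH -(natr1 a) -(natr1 v); field.
Qed.

Section Bias.
Context {R : realType} `{T : measurableType d} `{T' : measurableType d'}.
Variables (P : probability T R) (PB : probability T' R) (B : R -> R -> {RV PB >-> R}).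
Variables (Z : R -> {RV P >-> R}) (alpha kappa eta : R) (H c : R -> R).
Hypotheses (hB : forall h : R, 0 < h < 1 -> is_fbm h (B h)) (gZ : gaussian_process `]0, 1[ Z).
Hypotheses (zZ : zero_mean `]0, 1[ Z) (alpha01 : 0 < alpha < 1) (kap : (1 - alpha) / 2 <= kappa).
Hypotheses (hA : assumption_A B 2 kappa eta H c Z) (alpha_eta : 1 / (1 + 2 * minr eta 2) < alpha).
Local Notation W n t := (nbr alpha n 2 t).
Local Notation q := (qn alpha).
Local Notation psz := (psz Z).

Let kap0 : 0 <= kappa.
Proof. by rewrite (le_trans _ kap)// divr_ge0// subr_ge0 ltW//; have /andP[] := alpha01. Qed.

Lemma Ex_psib_xb (h : R) : 0 < h < 1 -> Ex PB (fun w => psib ((xb h (B h) 0)^~ w)) = Lam2 h.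
Proof.
move=> hh; rewrite -(Lambda2E hh (hB hh)) /Lambda2 fine_expectation; congr Ex; apply/funext => w.
by rewrite psib_xb// add0r.
Qed.

Variables (eps v0 : R).
Hypotheses (heps : 0 < eps < 2^-1) (v01 : 0 < v0 <= 1).

(** The rate n^(-kappa) passes from the covariance entries to the mean through the Lipschitz bound
    [Ex_psi_lip], whose constant is uniform thanks to v0. *)
Lemma Ex_psz_Lam2 (e : R) : 0 < e -> \forall n \near \oo, forall k, okk Z eps v0 n k ->
  n%:R `^ kappa * `|Ex P (psz n k) - Lam2 (H (k%:R / n%:R))| <= e.
Proof.
move=> e0; have /andP[v00 v0le1] := v01.
(* 2 + 12 / v0^2 is the sum of the coefficients 2 + 9 / v0^2 and 3 / v0^2 of the two entry errors
   below. *)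
pose e1 := e / (2 + 12 / v0 ^+ 2).
have D0 : 0 < 2 + 12 / v0 ^+ 2 by rewrite addr_gt0// divr_gt0// exprn_gt0.
have e10 : 0 < e1 by rewrite divr_gt0.
apply: filterS2 (A_cov hB gZ zZ kap0 hA 1 heps e10) (nbhs_infty_gt 0) => n hn n0 k [g v ni].
have sk : sampled n 3 k.
  by move: g => /and3P[_ _]; rewrite /sampled => /andP[-> h]/=; rewrite (leq_ltn_trans _ h)// leq_add2l.
have mk : mid eps n k by case/and3P: g.
have [_ A1 A2] := hn k mk sk.
have h01 : 0 < H (k%:R / n%:R) < 1.
  have := @sampled_in R n 3 k ord0 sk; rewrite mul0r addr0 => kn.
  exact: (proj2 (H_in hA kn)).
set h := H (k%:R / n%:R) in A1 h01 *.
have f0 := fc0_gt0 h01.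
have [/andP[r1 r2] _] := rc1_Lam2 h01; set r := rc h 1 in A1 r1 r2.
have [n1 n2 n3] := ni.
have s0 := good_sampled false g; have s1 := good_sampled true g.
have sv : sqrtr (vv Z n k) * sqrtr (vv Z n k) = vv Z n k by rewrite -expr2 sqr_sqrtr// ltW.
have SE a b : Ex P (fun w => xz Z n k a w * xz Z n k b w) = cz Z n (k + a) (k + b) / vv Z n k.
  by rewrite (Ex_xz gZ (good_sampled a g) (good_sampled b g)) sv.
pose b := Ex P (fun w => xz Z n k false w * xz Z n k true w).
pose tt := Ex P (fun w => xz Z n k true w * xz Z n k true w).
rewrite -/b -/tt in n2 n3.
have b_e : n%:R `^ kappa * `|b - r| <= e1 by rewrite /b SE addn0; exact: A1.
have t_e : n%:R `^ kappa * `|tt - 1| <= e1 by rewrite /tt SE czz; exact: A2.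
have v2 : 0 < tt - b ^+ 2 by rewrite subr_gt0 (lt_le_trans _ n2)// ltrDl exprn_gt0.
have rr : 0 < 1 - r ^+ 2 by rewrite (_ : _ - _ = (1 - r) * (1 + r)) ?mulr_gt0//; [lra | lra | ring].
pose w := sqrtr (tt - b ^+ 2); pose w' := sqrtr (1 - r ^+ 2).
have w0 : 0 < w by rewrite sqrtr_gt0.
have w'0 : 0 < w' by rewrite sqrtr_gt0.
have wE : w ^+ 2 = tt - b ^+ 2 by rewrite sqr_sqrtr// ltW.
have w'E : w' ^+ 2 = 1 - r ^+ 2 by rewrite sqr_sqrtr// ltW.
have v0w : v0 <= w by rewrite -(ler_sqr) ?nnegrE ?(ltW v00) ?(ltW w0)// wE; lra.
have gx : gvec P (xz Z n k) (fun a b => Ex P (fun w => xz Z n k a w * xz Z n k b w)).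
  by apply: (gspan_gvec gZ zZ) => a; apply: gspan_xz; exact: good_sampled g.
have gB : gaussian_process setT (B h) by have [] := hB h01.
have zB : zero_mean setT (B h) by have [] := hB h01.
have gb : gvec PB (xb h (B h) 0) (fun a b => Ex PB (fun w => xb h (B h) 0 a w * xb h (B h) 0 b w)).
  by apply: (gspan_gvec gB zB) => a; exact: gspan_xb.
have S'1 a : Ex PB (fun w => xb h (B h) 0 a w * xb h (B h) 0 a w) = 1.
  by rewrite (Ex_xb h01 (hB h01)) subrr rc00.
have S'b : Ex PB (fun w => xb h (B h) 0 false w * xb h (B h) 0 true w) = r.
  by rewrite (Ex_xb h01 (hB h01)) !add0r subr0.
have t2 : Ex P (fun w => xz Z n k true w * xz Z n k true w) = b ^+ 2 + w ^+ 2 by rewrite wE -/tt; ring.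
have := Ex_psi_lip gx gb n1 (S'1 false) n3 _ w0 t2 (v' := w').
rewrite !S'1 S'b w'E ler1n => /(_ isT); rewrite addrC subrK => /(_ erefl).
have -> : (fun x => psib ((xz Z n k)^~ x)) = psz n k by apply/funext => x; rewrite psib_xz.
rewrite Ex_psib_xb// -/b => lip.
have b2 : `|b| <= 2.
  rewrite -(ler_sqr) ?nnegrE// real_normK ?num_real//.
  have v20 : 0 < v0 ^+ 2 by rewrite exprn_gt0.
  by move: n2 n3 v20; rewrite (_ : 2 ^+ 2 = 4 :> R); [lra | ring].
(* Difference of squares over the sum: w + w' >= v0 keeps the square roots Lipschitz. *)
have ww : `|w - w'| <= (`|tt - 1| + 3 * `|b - r|) / v0.
  rewrite ler_pdivlMr//.
  have e' : (w - w') * (w + w') = (tt - 1) - (b - r) * (b + r).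
    by rewrite -subr_sqr wE w'E; ring.
  apply: (@le_trans _ _ `|(w - w') * (w + w')|).
    rewrite normrM ler_wpM2l// (ger0_norm (_ : 0 <= w + w')); lra.
  rewrite e' (le_trans (ler_normB _ _))// lerD2l normrM mulrC ler_wpM2r//.
  rewrite (le_trans (ler_normD _ _))// (_ : 3 = 2 + 1); last by ring.
  by rewrite lerD// ler_norml; lra.
have N0 : 0 <= n%:R `^ kappa :> R by exact: powR_ge0.
apply: (@le_trans _ _ (n%:R `^ kappa * ((2 + 9 / v0 ^+ 2) * `|b - r| + 3 / v0 ^+ 2 * `|tt - 1|))).
  rewrite ler_wpM2l// (le_trans lip)//.
  apply: (@le_trans _ _ (2 * `|b - r| + 3 / v0 * ((`|tt - 1| + 3 * `|b - r|) / v0))).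
    rewrite lerD2l ler_pM ?divr_ge0 ?(ltW w0)//.
    by rewrite ler_pM2l// lef_pV2 ?posrE.
  by rewrite le_eqVlt; apply/orP; left; apply/eqP; field; rewrite gt_eqF.
apply: (@le_trans _ _ ((2 + 9 / v0 ^+ 2) * e1 + 3 / v0 ^+ 2 * e1)).
  have k1 : 0 <= 2 + 9 / v0 ^+ 2 by rewrite addr_ge0// divr_ge0// exprn_ge0// ltW.
  have k2 : 0 <= 3 / v0 ^+ 2 by rewrite divr_ge0// exprn_ge0// ltW.
  rewrite mulrDr mulrCA lerD ?ler_wpM2l//.
  by rewrite mulrCA ler_wpM2l.
rewrite /e1 le_eqVlt; apply/orP; left; apply/eqP; field.
have v20 : 0 < v0 ^+ 2 by rewrite exprn_gt0.
by apply/andP; split; rewrite gt_eqF//; lra.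
Qed.

Lemma sqrt_qn n : sqrtr (q n) = n%:R `^ ((1 - alpha) / 2).
Proof. by rewrite /qn powRrM powR12_sqrt// powR_ge0. Qed.

(** Three errors against sqrt q = n^((1-alpha)/2): that of (A), handled by kappa >= (1-alpha)/2; the
    Hoelder remainder n^(-alpha b) with b = min (eta, 2); and the asymmetry of the discrete window,
    of order 1/n. *)
Lemma window_bias (t e : R) : wok Z alpha eps v0 t -> 0 < e -> \forall n \near \oo,
  `|sqrtr (2 * q n) * ((size (W n t))%:R^-1 * \sum_(k <- W n t) Ex P (psz n k) - Lam2 (H t))| <= e.
Proof.
move=> [t01 okt] e0; have [eta0 hH _ _ _] := hA; have [cH Ht] := H_in hA t01.
pose b := minr eta 2; have b0 : 0 < b by rewrite lt_min eta0/=.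
have b2 : b <= 2 by rewrite ge_min lexx orbT.
have /andP[a0 a1] := alpha01.
have [D [K [rho [K0 rho0 hD]]]] := holder_taylor eta0 t01 hH.
have [K1 [dl [K10 dl0 hL]]] := Lam2_taylor Ht.
pose C := K1 * (`|D| + K) ^+ 2 + `|dLam2 (H t)| * K.
have C0 : 0 <= C.
  apply: addr_ge0; last exact: mulr_ge0.
  by apply: mulr_ge0 => //; exact: sqr_ge0.
pose C' := `|dLam2 (H t) * D|.
have C'0 : 0 <= C' by exact: normr_ge0.
have s2 : 0 < sqrtr 2 :> R by rewrite sqrtr_gt0.
pose e1 := e / (3 * sqrtr 2).
have e10 : 0 < e1 by rewrite divr_gt0// mulr_gt0.
have h1 := Ex_psz_Lam2 e10.
have h2 : \forall n \near \oo, n%:R `^ ((1 - alpha) / 2 - alpha * b) <= e1 / (C + 1).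
  apply: powR_nat_cvg0; last by rewrite divr_gt0// ltr_wpDl.
  (* This is the lower bound assumed on alpha; it makes the exponent (1 - alpha)/2 - alpha b
     negative. *)
  have h : 1 < alpha * (1 + 2 * b) by move: alpha_eta; rewrite ltr_pdivrMr// addr_gt0// mulr_gt0.
  have h' : alpha * (1 + 2 * b) = alpha + 2 * (alpha * b) by ring.
  by rewrite h' in h; move: (alpha * b) h => x; lra.
have h3 : \forall n \near \oo, n%:R `^ ((1 - alpha) / 2 - 1) <= e1 / (C' + 1).
  by apply: powR_nat_cvg0; [lra | rewrite divr_gt0// ltr_wpDl].
have r10 : 0 < minr rho 1 / 2 by rewrite divr_gt0// lt_min rho0/=.
have h4 : \forall n \near \oo, n%:R `^ (- alpha) <= minr rho 1 / 2.
  by apply: powR_nat_cvg0 => //; rewrite oppr_lt0.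
have h5 : \forall n \near \oo, forall k, k \in W n t -> okk Z eps v0 n k.
  have : \forall x \near win alpha t, okk Z eps v0 x.1 x.2 by apply: filterS (okt 0) => x; rewrite addn0.
  by [].
have h6 : \forall n \near \oo, forall k, k \in W n t -> `|H (k%:R / n%:R) - H t| < dl.
  have : H ((x.2 + 0)%:R / x.1%:R) @[x --> win alpha t] --> H t.
    by apply: (@continuous_cvg _ _ _ _ _ _ H) => //; exact: win_time.
  move=> /cvgrPdist_lt /(_ _ dl0) h.
  have : \forall x \near win alpha t, `|H (x.2%:R / x.1%:R) - H t| < dl.
    by apply: filterS h => x; rewrite addn0 distrC.
  by [].
apply: filter_app (nbr_iota alpha01 t01); apply: filter_app (qn_big alpha01 1).
apply: filter_app (nbhs_infty_gt 0).
apply: filter_app h6; apply: filter_app h5; apply: filter_app h4.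
apply: filter_app h3; apply: filter_app h2; apply: filter_app h1.
near=> n => h1 h2 h3 h4 h5 h6 n0 q1 [a [v [WE _ /andP[v1 _] va nr]]].
have np : 0 < n%:R :> R by rewrite ltr0n.
have n1 : 1 <= n%:R :> R by rewrite ler1n.
rewrite -/(q n) in v1.
have vp : 0 < v%:R :> R by lra.
have S0 : 0 < sqrtr (q n) by rewrite sqrtr_gt0 (lt_le_trans _ q1).
pose L k := Lam2 (H (k%:R / n%:R)).
pose x k : R := k%:R / n%:R - t.
pose g k := Ex P (psz n k) - Lam2 (H t) - dLam2 (H t) * D * x k.
have gk k : k \in W n t -> sqrtr (q n) * `|g k| <= e1 + e1.
  move=> kW; have xk : `|x k| <= n%:R `^ (- alpha) by apply: nr; rewrite -WE.
  have xr : `|x k| < rho.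
    have m1 : minr rho 1 <= rho by rewrite ge_min lexx.
    by rewrite (le_lt_trans xk)// (le_lt_trans h4)//; lra.
  have x1 : `|x k| <= 1.
    have m1 : minr rho 1 <= 1 by rewrite ge_min lexx orbT.
    by rewrite (le_trans xk)// (le_trans h4)//; lra.
  have bb : 0 < b <= 2 by rewrite b0.
  have := comp_taylor bb K0 K10 x1 (hD _ xr) (proj2 (hL _ (h6 _ kW))); rewrite -/C => ct.
  rewrite (_ : g k = (Ex P (psz n k) - L k) + (L k - Lam2 (H t) - dLam2 (H t) * D * x k)); last by rewrite /g; ring.
  apply: (le_trans (ler_wpM2l (ltW S0) (ler_normD _ _))); rewrite mulrDr lerD//.
    apply: le_trans (h1 _ (h5 _ kW)); rewrite ler_wpM2r// sqrt_qn ler_powR//.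
  apply: (@le_trans _ _ (sqrtr (q n) * (C * n%:R `^ (- (alpha * b))))).
    rewrite ler_wpM2l ?(ltW S0)// (le_trans ct)// ler_wpM2l//.
    rewrite -mulNr powRrM ge0_ler_powR ?nnegrE ?powR_ge0// ltW//.
  rewrite mulrCA sqrt_qn -powRD; last by rewrite (gt_eqF np) implybT.
  apply: (@le_trans _ _ (C * (e1 / (C + 1)))); first by rewrite ler_wpM2l.
  by rewrite mulrCA ler_piMr ?(ltW e10)// ler_pdivrMr ?mul1r ?lerDl ?ltr_wpDl.
(* The average of an arithmetic progression is the mean of its ends, so [nbr_iota] bounds it by 1 /
   (2 n). *)
have xs : v%:R^-1 * \sum_(k <- W n t) x k = ((2 * a%:R + v%:R - 1) - 2 * (t * n%:R)) / (2 * n%:R).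
  rewrite WE big_split/= -mulr_suml sum_iota sum_seq_cst size_iota.
  by field; rewrite !gt_eqF.
have sz : size (W n t) = v by rewrite WE size_iota.
have avg : v%:R^-1 * \sum_(k <- W n t) Ex P (psz n k) - Lam2 (H t) =
    v%:R^-1 * \sum_(k <- W n t) g k + dLam2 (H t) * D * (v%:R^-1 * \sum_(k <- W n t) x k).
  have -> : \sum_(k <- W n t) g k =
      \sum_(k <- W n t) Ex P (psz n k) - v%:R * Lam2 (H t) - dLam2 (H t) * D * \sum_(k <- W n t) x k.
    rewrite sumrB; congr (_ - _); last by rewrite mulr_sumr.
    by rewrite sumrB; congr (_ - _); rewrite sum_seq_cst sz.
  by move: (Lam2 (H t)) (\sum_(k <- _) _) (\sum_(k <- _) x k) => l s y; field; rewrite gt_eqF.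
rewrite sz avg.
have g_avg : sqrtr (q n) * `|v%:R^-1 * \sum_(k <- W n t) g k| <= e1 + e1.
  rewrite normrM normfV (gtr0_norm vp) mulrCA mulrC ler_pdivrMr//.
  apply: (@le_trans _ _ (\sum_(k <- W n t | (k \in W n t) && true) sqrtr (q n) * `|g k|)).
    rewrite -big_seq_cond -mulr_sumr ler_wpM2l ?(ltW S0)// ler_norm_sum//.
  apply: (@le_trans _ _ (\sum_(k <- W n t | (k \in W n t) && true) (e1 + e1))).
    by apply: ler_sum => k /andP[kW _]; exact: gk.
  by rewrite -big_seq_cond big_const_seq count_predT sz iter_addr_0 -[leLHS]mulr_natr.
have x_avg : sqrtr (q n) * `|dLam2 (H t) * D * (v%:R^-1 * \sum_(k <- W n t) x k)| <= e1.
  rewrite normrM -/C' xs normrM normfV (gtr0_norm (_ : 0 < 2 * n%:R)) ?mulr_gt0//.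
  apply: (@le_trans _ _ (sqrtr (q n) * (C' * (1 / n%:R)))).
    rewrite ler_wpM2l ?(ltW S0)// ler_wpM2l ?normr_ge0// ler_pM ?invr_ge0 ?mulr_ge0//.
    by rewrite lef_pV2 ?posrE ?mulr_gt0// ler_peMl ?ler1n ?ltW.
  rewrite mulrCA sqrt_qn div1r -(powR_inv1 (ler0n R n)) -powRD; last by rewrite (gt_eqF np) implybT.
  apply: (@le_trans _ _ (C' * (e1 / (C' + 1)))); first by rewrite ler_wpM2l ?normr_ge0.
  by rewrite mulrCA ler_piMr ?(ltW e10)// ler_pdivrMr ?mul1r ?lerDl ?ltr_wpDl.
rewrite sqrtrM// normrM (gtr0_norm (mulr_gt0 s2 S0)) -[leLHS]mulrA.
have -> : e = sqrtr 2 * (e1 + e1 + e1) by rewrite /e1; field; rewrite gt_eqF.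
rewrite ler_pM2l// (le_trans (ler_wpM2l (ltW S0) (ler_normD _ _)))// mulrDr lerD.
Unshelve. all: by end_near.
Qed.

End Bias.
(** * From characteristic functions to convergence in distribution *)

Section WeakConvergence.
Context {R : realType}.

(** Heine's theorem on the compact box, with y free to leave it: the covering is by balls around the
    points x only. *)
Lemma row_uniform_cont (u : nat) (f : 'rV[R]_u -> R) (L e : R) : continuous f -> 0 < e ->
  exists2 D : R, 0 < D & forall x y : 'I_u -> R, sup_le L x -> sup_le D (fun i => x i - y i) ->
    `|f (\row_i x i) - f (\row_i y i)| <= e.
Proof.
move=> cf e0; pose A (i : 'I_u) := `[- L, L]%classic : set R.
have cA : compact [set v : 'rV[R]_u | forall i, A i (v ord0 i)] by apply: rV_compact => i; exact: segment_compact.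
move/compact_near_coveringP : cA => /(_ R 0^'+ (fun D x => forall y : 'rV[R]_u, (forall i, `|x ord0 i - y ord0 i| <= D) -> `|f x - f y| <= e)).
have e2 : 0 < e / 2 by rewrite divr_gt0.
case.
  move=> x _; have /cvgrPdist_le /(_ _ e2) := cf x; rewrite near_simpl => /nbhs_ballP [r /= r0 hr].
  have r2 : 0 < r / 2 by rewrite divr_gt0.
  exists (ball x (r / 2), [set D | D < r / 2]).
    by split => /=; [exact: nbhsx_ballx | exact: nbhs_right_lt].
  move=> [x' D]/= [bx Dr] y xy.
  have h1 : `|f x - f x'| <= e / 2 by apply: hr; apply: le_ball bx; rewrite ler_pdivrMr// ler_pMr// ler1n.
  have h2 : `|f x - f y| <= e / 2.
    apply: hr; move: bx; rewrite /ball/= /mx_ball => bx; split => // i j; rewrite !ord1.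
    have [_ bx'] := bx; have := bx' ord0 j; have := xy j.
    rewrite /ball/= => h3 h4; rewrite (_ : x ord0 j - y ord0 j = (x ord0 j - x' ord0 j) + (x' ord0 j - y ord0 j)); last by ring.
    by rewrite (le_lt_trans (ler_normD _ _))// (splitr r) ltrD// (le_lt_trans h3).
  rewrite (_ : f x' - f y = (f x' - f x) + (f x - f y)); last by ring.
  by rewrite (le_trans (ler_normD _ _))// (splitr e) lerD// distrC.
move=> d /= d0 hd; exists (d / 2); first by rewrite divr_gt0.
move=> x y xL xy; have := hd (d / 2); rewrite /= sub0r normrN gtr0_norm ?divr_gt0//.
have dd : d / 2 < d by lra.
move=> /(_ dd isT) h.
apply: h; first by move=> i; rewrite /A/= in_itv/= mxE -ler_norml; exact: xL.
by move=> i; rewrite !mxE; exact: xy.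
Qed.

Lemma row_tpoly_approx (u : nat) (f : 'rV[R]_u -> R) (M L e : R) : continuous f -> (forall x, `|f x| <= M) ->
  0 < L -> 0 < e -> exists F : tpoly R 'I_u, (forall x, `|tev F x| <= M) /\
    forall x, sup_le L x -> `|f (\row_i x i) - tev F x| <= e.
Proof.
move=> cf fM L0 e0; have e2 : 0 < e / 2 by rewrite divr_gt0.
have [D D0 hD] := row_uniform_cont (2 * L) cf e2.
have [|F [F1 F2]] := @weierstrass_tpoly R 'I_u (fun x => f (\row_i x i)) M L (e / 2) D (fun x => fM _) L0 e2 D0.
  by move=> x y xL _ xy; exact: hD.
by exists F; split => // x xL; have := F2 x xL; rewrite mulrC divfK.
Qed.

(** Measurability comes from pointwise approximation by trigonometric polynomials on growing boxes,
    so no sigma-algebra on row vectors is involved. *)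
Lemma bddm_row `{T : measurableType d} (u : nat) (f : 'rV[R]_u -> R) (X : 'I_u -> T -> R) :
  continuous f -> (exists M, forall x, `|f x| <= M) -> (forall i, measurable_fun setT (X i)) ->
  bddm (fun w => f (\row_i X i w)).
Proof.
move=> cf [M fM] mX; split; last by exists M => w.
have ap (n : nat) : exists F : tpoly R 'I_u,
    forall x, sup_le n.+1%:R x -> `|f (\row_i x i) - tev F x| <= n.+1%:R^-1.
  by have [|F [_ hF]] := @row_tpoly_approx u f M n.+1%:R n.+1%:R^-1 cf fM (ltr0Sn _ _) _; [rewrite invr_gt0 | exists F].
have [F hF] := choice ap.
apply: (@measurable_fun_cvg _ T R setT (fun n w => tev (F n) (fun i => X i w))).
  by move=> n; have [] := bddm_tev (F n) mX.
move=> w _; apply/cvgrPdist_le => e e0; near=> n.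
have sn : sup_le n.+1%:R (fun i => X i w).
  move=> i; apply: (@le_trans _ _ (\sum_i `|X i w|)); first by rewrite (bigD1 i)//= lerDl sumr_ge0.
  by rewrite (@le_trans _ _ n%:R) ?ler_nat//; near: n; exact: nbhs_infty_ger.
rewrite (le_trans (hF n _ sn))// invf_ple ?posrE// (@le_trans _ _ n%:R) ?ler_nat//.
by near: n; exact: nbhs_infty_ger.
Unshelve. all: by end_near.
Qed.

(** Test functions are replaced by a trigonometric polynomial on a box and the second moments
    control what leaves the box. Y need be close to U only where U is bounded, which is the form in
    which linearization of the estimator provides it. *)
Lemma weak_convergence {d d' : measure_display} {T : measurableType d} {T' : measurableType d'}
  (P : probability T R) (Q : probability T' R) (u : nat) (U Y : nat -> 'I_u -> T -> R) (V : 'I_u -> T' -> R)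
  (S : 'I_u -> 'I_u -> R) (K : R) : gvec Q V S ->
  (forall n i, bddm (U n i)) -> (forall n i, measurable_fun setT (Y n i)) ->
  (\forall n \near \oo, forall i, Ex P (fun w => U n i w * U n i w) <= K) ->
  (forall (l : 'I_u -> R) (p e : R), 0 < e -> \forall n \near \oo,
     `|Ex P (fun w => cos (dot l ((U n)^~ w) + p)) - expR (- qform S l l / 2) * cos p| <= e) ->
  (forall L dl : R, 0 < L -> 0 < dl -> \forall n \near \oo, forall w, sup_le L ((U n)^~ w) ->
     sup_le dl (fun i => Y n i w - U n i w)) ->
  cvg_in_distribution P Q (fun n w => \row_i Y n i w) (fun w => \row_i V i w).
Proof.
move=> gV bU mY hK hcos hYU f cf [M fM].
have mV i : measurable_fun setT (V i) by have [m _ _] := gV; exact: m.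
have bV := bddm_row cf (ex_intro _ M fM) mV.
have bY n := bddm_row cf (ex_intro _ M fM) (mY n).
rewrite expectationEx; last exact: bddm_itg.
rewrite (_ : (fun n => _) = (fun n => (Ex P (fun w => f (\row_i Y n i w)))%:E)); last first.
  by apply/funext => n; rewrite expectationEx//; exact: bddm_itg.
apply: cvg_EFin; first by apply: nearW => n.
have M0 : 0 <= M by rewrite (le_trans _ (fM 0)).
apply/cvgrPdist_le => e e0; pose e1 := e / 8; have e10 : 0 < e1 by rewrite divr_gt0.
pose Kt := \sum_(i < u) (`|K| + `|S i i|).
have Kt0 : 0 <= Kt by apply: sumr_ge0 => i _; rewrite addr_ge0.
(* Chebyshev: the total second moment Kt over L^2, times the trivial error 2 M, is at most e1. *)
pose L := sqrtr (2 * M * Kt / e1) + 1.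
have L0 : 0 < L by rewrite ltr_wpDl.
have L2 : 2 * M * Kt / L ^+ 2 <= e1.
  rewrite ler_pdivrMr ?exprn_gt0// [leRHS]mulrC -ler_pdivrMr//.
  rewrite -[leLHS]sqr_sqrtr; last by rewrite divr_ge0 ?mulr_ge0// ltW.
  by rewrite lerXn2r ?nnegrE ?sqrtr_ge0 ?(ltW L0)// lerDl.
have L10 : 0 < L + 1 by rewrite addr_gt0.
have [D D0 hD] := row_uniform_cont (L + 1) cf e10.
have [F [FM hF]] := row_tpoly_approx cf fM L10 e10.
have far (X X' : 'I_u -> R) : (sup_le L X -> `|f (\row_i X' i) - tev F X| <= 2 * e1) ->
    `|f (\row_i X' i) - tev F X| <= 2 * e1 + 2 * M / L ^+ 2 * \sum_i X i * X i.
  move=> h; have [/h hl|nl] := pselect (sup_le L X).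
    by rewrite (le_trans hl)// lerDl mulr_ge0 ?divr_ge0 ?mulr_ge0 ?exprn_ge0 ?(ltW L0)// sumr_ge0// => i _; rewrite -expr2 sqr_ge0.
  have [i iL] : exists i, L < `|X i|.
    by apply: contrapT => h'; apply: nl => i; rewrite leNgt; apply/negP => iL; apply: h'; exists i.
  rewrite (@le_trans _ _ (2 * M))//.
    by rewrite (le_trans (ler_normB _ _))// (_ : 2 * M = M + M) ?lerD//; ring.
  have sX : L ^+ 2 <= \sum_i X i * X i.
    rewrite (bigD1 i)//= ler_wpDr//; first by apply: sumr_ge0 => j _; rewrite -expr2 sqr_ge0.
    by rewrite -expr2 -(real_normK (num_real (X i))) lerXn2r ?nnegrE ?(ltW L0)// ltW.
  apply: (@le_trans _ _ (2 * M / L ^+ 2 * \sum_i X i * X i)); last by rewrite lerDr mulr_ge0// ltW.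
  by rewrite mulrAC ler_pdivlMr ?exprn_gt0// ler_wpM2l ?mulr_ge0.
have near_est (d0 : measure_display) (T0 : measurableType d0) (P0 : probability T0 R) (X X' : 'I_u -> T0 -> R) :
    (forall i, measurable_fun setT (X i)) -> (forall i, measurable_fun setT (X' i)) ->
    (forall i, itg P0 (fun w => X i w * X i w)) ->
    \sum_i Ex P0 (fun w => X i w * X i w) <= Kt ->
    (forall w, sup_le L (X^~ w) -> `|f (\row_i X' i w) - tev F (X^~ w)| <= 2 * e1) ->
    `|Ex P0 (fun w => f (\row_i X' i w)) - Ex P0 (fun w => tev F (X^~ w))| <= 3 * e1.
  move=> mX mX' iX hX h.
  have i1 := bddm_itg P0 (bddm_row cf (ex_intro _ M fM) mX').
  have i2 := bddm_itg P0 (bddm_tev F mX).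
  have i3 : itg P0 (fun w => \sum_i X i w * X i w) by apply: itg_sum.
  rewrite -ExB// (le_trans (Ex_norm (itgB i1 i2)))//.
  apply: (@le_trans _ _ (Ex P0 (fun w => 2 * e1 + 2 * M / L ^+ 2 * \sum_i X i w * X i w))).
    apply: Ex_le => [||w]; [exact: itg_norm (itgB i1 i2) | | by apply: far; exact: h].
    by apply: itgD; [exact: itg_cst | exact: itgZ].
  rewrite ExD ?Ex_cst ?ExZ//; [|exact: itg_cst|exact: itgZ].
  rewrite Ex_sum// (_ : 3 * e1 = 2 * e1 + e1); last by ring.
  rewrite lerD2l (le_trans _ L2)// mulrAC.
  by rewrite ler_wpM2r ?invr_ge0 ?exprn_ge0 ?(ltW L0)// ler_wpM2l// mulr_ge0.
have mU n i : measurable_fun setT (U n i) by have [] := bU n i.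
have iV i : itg Q (fun w => V i w * V i w).
  by have [] := gvec_sqr i gV; rewrite (_ : (fun w => V i w ^+ 2) = (fun w => V i w * V i w)).
have EV : \sum_i Ex Q (fun w => V i w * V i w) <= Kt.
  apply: ler_sum => i _; have [_] := gvec_sqr i gV.
  rewrite (_ : (fun w => V i w ^+ 2) = (fun w => V i w * V i w))// => /le_trans; apply.
  by rewrite (le_trans (ler_norm _))// lerDr.
have A1 : `|Ex Q (fun w => f (\row_i V i w)) - Ex Q (fun w => tev F (V^~ w))| <= 3 * e1.
  apply: near_est => // w h; rewrite (@le_trans _ _ e1)//; last by lra.
  by apply: hF => i; rewrite (le_trans (h i))// lerDl.
have A2 : Ex P (fun w => tev F ((U n)^~ w)) @[n --> \oo] --> Ex Q (fun w => tev F (V^~ w)).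
  rewrite (Ex_tev F gV).
  have E n : Ex P (fun w => tev F ((U n)^~ w)) = \sum_(t <- F) t.1.1 * Ex P (fun w => cos (dot t.1.2 ((U n)^~ w) + t.2)).
    have bc (t : R * ('I_u -> R) * R) : bddm (fun w => cos (dot t.1.2 ((U n)^~ w) + t.2)).
      by apply: bddm_cos; apply: measurable_funD => //; exact: measurable_dot.
    rewrite Ex_sum; last by move=> t; exact/bddm_itg/bddmZ.
    by apply: eq_bigr => t _; rewrite ExZ//; exact: bddm_itg.
  under eq_fun do rewrite E.
  apply: cvgn_sum => t; apply: cvgM; first exact: cvg_cst.
  apply/cvgrPdist_le => e' e'0; apply: filterS (hcos t.1.2 t.2 e' e'0) => n.
  by rewrite distrC.
have D10 : 0 < minr D 1 by rewrite lt_min D0/=.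
move: A2 => /cvgrPdist_le /(_ _ e10) A2.
apply: filter_app A2; apply: filter_app hK; apply: filter_app (hYU L _ L0 D10).
near=> n => hYU' hK' A2 /=.
have A3 : `|Ex P (fun w => f (\row_i Y n i w)) - Ex P (fun w => tev F ((U n)^~ w))| <= 3 * e1.
  apply: near_est => //.
  - by move=> i; exact/bddm_itg/bddmM.
  - apply: ler_sum => i _; rewrite (le_trans (hK' i))// (le_trans (ler_norm _))// lerDl//.
  move=> w h; have h1 := hYU' w h.
  have m1 : minr D 1 <= D by rewrite ge_min lexx.
  have h2 : sup_le (L + 1) ((U n)^~ w) by move=> i; rewrite (le_trans (h i))// lerDl.
  have h3 : `|f (\row_i U n i w) - f (\row_i Y n i w)| <= e1.
    by apply: hD => // i; rewrite distrC (le_trans (h1 i)).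
  have h4 := hF _ h2.
  rewrite -(subrKA (f (\row_i U n i w))) (le_trans (ler_normD _ _))// distrC.
  by rewrite mulr2n mulrDl mul1r lerD.
rewrite distrC in A1; move: A1 A2 A3.
move: (Ex Q (fun w => f _)) (Ex Q _) (Ex P (fun w => f _)) (Ex P _) => a b x y A1 A2 A3.
have : `|a - x| <= `|b - a| + `|b - y| + `|x - y|.
  rewrite (_ : a - x = - (b - a) + (b - y) - (x - y)); last by ring.
  by rewrite (le_trans (ler_normB _ _))// lerD2r (le_trans (ler_normD _ _))// normrN.
by move: A1 A2 A3 e0; rewrite /e1; lra.
Unshelve. all: by end_near.
Qed.

End WeakConvergence.

(** * Construction of the limit vector *)

Section GaussianFamily.
Context {R : realType}.

Lemma gauss_probability (s : R) : 0 <= s -> exists nu : probability (measurableTypeR R) R,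
  forall A, measurable A -> nu A = gauss_law 0 s A.
Proof.
move=> s0; have [sz|sn] := eqVneq s 0.
  by exists (dirac (0 : measurableTypeR R)) => A mA; rewrite /gauss_law sz eqxx.
by exists (normal_prob 0 s) => A mA; rewrite /gauss_law (negbTE sn).
Qed.

Lemma gaussian_family (u : nat) (s : 'I_u -> R) : (forall i, 0 <= s i) ->
  exists (dW : measure_display) (TW : measurableType dW) (Q : probability TW R) (W : 'I_u -> {RV Q >-> R}),
    [/\ independent_rvs W, forall i A, measurable A -> Q (W i @^-1` A) = gauss_law 0 (s i) A &
      gvec Q W (fun i j => (i == j)%:R * s i ^+ 2)].
Proof.
elim: u s => [|u IH] s s0.
  exists _, (measurableTypeR R), (@gam R), (fun=> (cst (0 : R) : {RV (@gam R) >-> R})).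
  split; [|by case|split; [by case|by case|]].
    by move=> A mA; rewrite big_ord0 (_ : [set w | _] = setT) ?probability_setT//; apply/seteqP; split => // w _ [].
  move=> l; rewrite /dot /qform !big_ord0.
  under eq_fun do rewrite big_ord0 cos0.
  under [X in _ /\ Ex _ X = _]eq_fun do rewrite big_ord0 sin0.
  by rewrite !Ex_cst oppr0 mul0r expR0.
have [dW [TW [Q [W [iW lW gW]]]]] := IH (fun i => s (lift ord0 i)) (fun i => s0 _).
have [nu lnu] := gauss_probability (s0 ord0).
pose PQ := (nu \x Q)%E.
pose W' (i : 'I_u.+1) (z : measurableTypeR R * TW) : R :=
  match unlift ord0 i with None => z.1 | Some j => W j z.2 end.
have W'0 z : W' ord0 z = z.1 by rewrite /W' unlift_none.
have W'S j z : W' (lift ord0 j) z = W j z.2 by rewrite /W' liftK.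
have mW' i : measurable_fun setT (W' i).
  case: (unliftP ord0 i) => [j ->|->].
    by rewrite (_ : W' _ = W j \o snd); [exact: measurableT_comp | apply/funext => z; rewrite W'S].
  by rewrite (_ : W' _ = fst); [exact: measurable_fst | apply/funext => z; rewrite W'0].
pose Wr (i : 'I_u.+1) : {RV PQ >-> R} := HB.pack (W' i) (isMeasurableFun.Build _ _ _ _ (W' i) (mW' i)).
exists _, (measurableTypeR R * TW)%type, PQ, Wr.
have rect (A : set R) (C : set TW) : measurable A -> measurable C -> PQ (A `*` C) = (nu A * Q C)%E.
  by move=> mA mC; exact: product_measure1E.
have p0 (A : set R) : measurable A -> PQ (W' ord0 @^-1` A) = nu A.
  move=> mA; rewrite (_ : _ @^-1` A = A `*` setT); first by rewrite rect// probability_setT mule1.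
  by apply/seteqP; split => z; rewrite /= W'0 => // -[].
have pS j (A : set R) : measurable A -> PQ (W' (lift ord0 j) @^-1` A) = Q (W j @^-1` A).
  move=> mA; rewrite (_ : _ @^-1` A = setT `*` (W j @^-1` A)).
    by rewrite rect// ?probability_setT ?mul1e// -[X in measurable X]setTI; exact: measurable_funPT.
  by apply/seteqP; split => z; rewrite /= W'S => // -[].
split.
- move=> A mA; change (PQ [set w | forall i, A i (W' i w)] = (\prod_(i < u.+1) PQ (W' i @^-1` A i))%E).
  rewrite big_ord_recl p0//.
  under eq_bigr do rewrite pS//.
  rewrite -iW// -rect//; last first.
    rewrite (_ : [set w | _] = \bigcap_(i in setT) (W i @^-1` A (lift ord0 i))); last first.
      by apply/seteqP; split => w h i //=; exact: h.
    apply: fin_bigcap_measurable => // i _; rewrite -[X in measurable X]setTI; exact: measurable_funPT.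
  congr (PQ _); apply/seteqP; split => z /=.
    by move=> h; split; [have := h ord0; rewrite W'0 | move=> i; have := h (lift ord0 i); rewrite W'S].
  by move=> [h1 h2] i; case: (unliftP ord0 i) => [j ->|->]; rewrite ?W'S ?W'0.
- move=> i A mA; change (PQ (W' i @^-1` A) = gauss_law 0 (s i) A); case: (unliftP ord0 i) => [j ->|->]; first by rewrite pS//; exact: lW.
  by rewrite p0//; exact: lnu.
have gnu : gvec nu (fun (_ : unit) (x : measurableTypeR R) => x : R) (fun _ _ => s ord0 ^+ 2).
  have mid : measurable_fun setT (fun x : measurableTypeR R => x : R) by exact: measurable_gam_id.
  have [_ _ _ _ hc] := gauss_law_moments mid (s0 ord0) lnu.
  split => // l; rewrite /dot /qform !sum_unit.
  have := hc erefl (l tt) 0; have := hc erefl (l tt) (- (pi / 2)).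
  rewrite cos0 mulr1 cosN cos_pihalf mulr0 => h1 h2; split.
    under eq_fun do rewrite sum_unit -[X in cos X]addr0.
    by rewrite h2; congr expR; ring.
  rewrite -[RHS]h1; congr Ex; apply/funext => x; rewrite sum_unit.
  by rewrite cosB cos_pihalf sin_pihalf mulr0 add0r mulr1.
have := gvec_prod gnu gW.
move=> /(gvec_lin (fun (i : 'I_u.+1) (k : unit + 'I_u) =>
   (k == match unlift ord0 i with None => inl tt | Some j => inr j end)%:R)).
apply: eq_gvec => [i z|i j]; first by rewrite dot_delta /Wr/= /W'; case: unlift.
rewrite qform_delta; case: (unliftP ord0 i) => [i' ->|->]; case: (unliftP ord0 j) => [j' ->|->].
- by rewrite (inj_eq (@lift_inj _ _)).
- by rewrite eq_sym (negbTE (neq_lift _ _)) mul0r.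
- by rewrite (negbTE (neq_lift _ _)) mul0r.
- by rewrite eqxx mul1r.
Qed.

End GaussianFamily.

Lemma is_derive_linear_approx {R : realType} (g : R -> R) (x l e : R) : is_derive x (1 : R) g l -> 0 < e ->
  exists2 r : R, 0 < r & forall z, `|z| < r -> `|g (x + z) - g x - l * z| <= e * `|z|.
Proof.
move=> [dg <-] e0; move: dg => /cvg_ex[l' cl]; rewrite (_ : 'D_1 g x = l'); last exact: cvg_lim cl.
move: cl => /cvgrPdist_le /(_ _ e0) H; have /nbhs_ballP[r /= r0 hd] := H.
exists r => // z zr.
have [->|z0] := eqVneq z 0; first by rewrite addr0 subrr mulr0 subr0 normr0 mulr0.
have zb : ball (0 : R) r z by rewrite -ball_normE /= sub0r normrN.
have := hd _ zb z0; rewrite /GRing.scale/= mulr1 => h.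
have -> : g (x + z) - g x - l' * z = - (l' - z^-1 * (g (z + x) - g x)) * z.
  by rewrite (addrC z); field.
by rewrite normrM normrN ler_wpM2r.
Qed.

(** * Inversion of Lambda_2 and the central limit theorem for the estimator *)

Section Lambda2Inverse.
Context {R : realType} `{T : measurableType d}.
Variables (P : probability T R) (B : R -> R -> {RV P >-> R}) (h0 : R).
Hypothesis hB : forall h : R, 0 < h < 1 -> is_fbm h (B h).

(** The chosen preimage is the right one because [Lam2] is injective on (0, 1). *)
Lemma Lambda2_invK (h : R) : 0 < h < 1 -> Lambda2_inv B h0 (Lam2 h) = h.
Proof.
move=> hh; have [h'1 e] := xgetPex h0 (ex_intro [set h' | 0 < h' < 1 /\ Lambda2 B h' = Lam2 h] h (conj hh (Lambda2E hh (hB hh)))).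
by apply: Lam2_inj => //; rewrite -[LHS](Lambda2E h'1 (hB h'1)).
Qed.

Lemma Lambda2_inv_out (s : R) : (forall h, 0 < h < 1 -> Lam2 h != s) -> Lambda2_inv B h0 s = h0.
Proof.
move=> hs; rewrite /Lambda2_inv; case: xgetP => // h' _ [h'1 e].
by have := hs h' h'1; rewrite -(Lambda2E h'1 (hB h'1)) e eqxx.
Qed.

End Lambda2Inverse.

Section MainCLT.
Context {R : realType} `{T : measurableType d} `{T' : measurableType d'}.
Variables (P : probability T R) (PB : probability T' R) (B : R -> R -> {RV PB >-> R}).
Variables (Z : R -> {RV P >-> R}) (alpha kappa eta : R) (H c : R -> R).
Hypotheses (hB : forall h : R, 0 < h < 1 -> is_fbm h (B h)) (gZ : gaussian_process `]0, 1[ Z).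
Hypotheses (zZ : zero_mean `]0, 1[ Z) (alpha01 : 0 < alpha < 1) (kap : (1 - alpha) / 2 <= kappa).
Hypotheses (hA : assumption_A B 2 kappa eta H c Z) (alpha_eta : 1 / (1 + 2 * minr eta 2) < alpha).
Local Notation W n t := (nbr alpha n 2 t).
Local Notation q := (qn alpha).
Variable gam : R.
Hypotheses (gam0 : 2^-1 < gam) (hBa : corr_decay Z alpha gam).
Variables (u : nat) (t : 'I_u -> R).
Hypotheses (tinj : injective t) (t01 : forall i, 0 < t i < 1).

Let kap0 : 0 <= kappa.
Proof. by rewrite (le_trans _ kap)// divr_ge0// subr_ge0 ltW//; have /andP[] := alpha01. Qed.

Lemma finite_lower (f : 'I_u -> R) (M : R) : 0 < M -> (forall i, 0 < f i) ->
  exists2 m : R, 0 < m <= M & forall i, m <= f i.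
Proof.
move=> M0 f0; exists (\big[minr/M]_i f i).
  apply/andP; split; last exact: bigmin_le_id.
  by apply: (big_ind (fun x => 0 < x)) => // x y x0 y0; rewrite lt_min x0.
by move=> i; exact: bigmin_le.
Qed.

(** Finitely many times share one eps and one v0, the minima of those found for each; 1/4 caps eps
    below 1/2. *)
Lemma windows_ok : exists eps v0 : R, [/\ 0 < eps < 2^-1, 0 < v0 <= 1 & forall i, wok Z alpha eps v0 (t i)].
Proof.
have f0 i : 0 < minr (t i) (1 - t i) / 2.
  by have /andP[a b] := t01 i; rewrite divr_gt0// lt_min a subr_gt0.
have [eps /andP[e0 e1] he] := @finite_lower _ (4^-1) (ltac:(by rewrite invr_gt0)) f0.
have et i : eps < t i < 1 - eps.
  have h1 : minr (t i) (1 - t i) <= t i by rewrite ge_min lexx.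
  have h2 : minr (t i) (1 - t i) <= 1 - t i by rewrite ge_min lexx orbT.
  by have := he i; have /andP[a b] := t01 i; move=> h; apply/andP; split; lra.
have [v hv] := choice (fun i => (ltac:(have [v h1 h2] := win_nice hB gZ zZ alpha01 kap0 hA (t01 i); by exists v; exact: (conj h1 h2)) :
  exists v : R, 0 < v <= 1 /\ (forall v1, 0 < v1 <= v -> forall p,
  \forall x \near win alpha (t i), nice v1 (fun a b => Ex P (fun w => xz Z x.1 (x.2 + p) a w * xz Z x.1 (x.2 + p) b w))))).
have [v0 v01 hv0] := @finite_lower v 1 ltr01 (fun i => proj1 (andP (proj1 (hv i)))).
have /andP[v00 _] := v01.
exists eps, v0; split => //; first by rewrite e0; apply: (le_lt_trans e1); rewrite ltf_pV2 ?posrE// ltr_nat.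
move=> i; split => // p.
have v0v : 0 < v0 <= v i by rewrite v00 hv0.
apply: filterS3 (win_good alpha01 p e0 (et i)) (win_vpos hB gZ zZ alpha01 kap0 hA (t01 i) p) (proj2 (hv i) v0 v0v p).
by move=> x; split.
Qed.

Definition Sw (n : nat) (i : 'I_u) (w : T) : R :=
  (size (W n (t i)))%:R^-1 * \sum_(k <- W n (t i)) psz Z n k w.

Lemma bddm_Sw n i : bddm (Sw n i).
Proof. by apply: bddmZ; apply: bddm_sum => k; exact: bddm_psz. Qed.

Lemma Ex_Sw n i : Ex P (Sw n i) = (size (W n (t i)))%:R^-1 * \sum_(k <- W n (t i)) Ex P (psz Z n k).
Proof.
have b k : bddm (psz Z n k) by exact: bddm_psz.
rewrite ExZ; last by apply: bddm_itg; apply: bddm_sum => k.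
by rewrite Ex_sum// => k; exact: bddm_itg.
Qed.

Lemma Yw_Sw n (lam : 'I_u -> R) w : (forall i k, k \in W n (t i) -> (k < n)%N) ->
  Yw Z alpha n t lam w = \sum_i lam i * (sqrtr (2 * q n) * Sw n i w).
Proof.
move=> Wlt; rewrite /Yw /wgt; under eq_bigr do rewrite mulr_suml.
rewrite exchange_big/=; apply: eq_bigr => i _; rewrite /Sw (sum_win Wlt) !mulr_sumr.
by apply: eq_bigr => k _; ring.
Qed.

Lemma near_lt : \forall n \near \oo, forall i k, k \in W n (t i) -> (k < n)%N.
Proof.
have [eps [v0 [he v01 ok]]] := windows_ok.
apply: filter_forall => i; apply: filterS (near_window alpha01 ok i) => n [_ _]; exact.
Qed.

Lemma near_bias (e : R) : 0 < e -> \forall n \near \oo, forall i,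
  `|sqrtr (2 * q n) * (Ex P (Sw n i) - Lam2 (H (t i)))| <= e.
Proof.
move=> e0; have [eps [v0 [he v01 ok]]] := windows_ok.
apply: filter_forall => i; apply: filterS (window_bias hB gZ zZ alpha01 kap hA alpha_eta he v01 (ok i) e0) => n.
by rewrite Ex_Sw.
Qed.

(** Linearization of the estimator: the rescaled window mean times the derivative of the inverse of
    Lambda_2, centred at the limit value and not at its expectation. *)
Definition Uw (n : nat) (i : 'I_u) (w : T) : R :=
  (dLam2 (H (t i)))^-1 * (sqrtr (2 * q n) * (Sw n i w - Lam2 (H (t i)))).

Lemma bddm_Uw n i : bddm (Uw n i).
Proof. by apply: bddmZ; apply: bddmZ; apply: bddmB; [exact: bddm_Sw | exact: bddm_cst]. Qed.

Let Ht i : 0 < H (t i) < 1. Proof. exact: (proj2 (H_in hA (t01 i))). Qed.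

Definition Sv (i j : 'I_u) : R := (i == j)%:R * ((dLam2 (H (t i)))^-1 ^+ 2 * sigma2 B (H (t i))).

Lemma qform_diag (l f : 'I_u -> R) : qform (fun i j => (i == j)%:R * f i) l l = \sum_i l i ^+ 2 * f i.
Proof.
apply: eq_bigr => i _; rewrite (bigD1 i)//= eqxx big1 ?addr0; first by rewrite mul1r; ring.
by move=> j; rewrite eq_sym => /negbTE ->; rewrite mul0r mulr0 mul0r.
Qed.

Lemma sigma2_H_ge0 i : 0 <= sigma2 B (H (t i)).
Proof.
have [eps [v0 [he v01 ok]]] := windows_ok.
have := sigma2_ge0 hB gZ zZ alpha01 kap0 hA gam0 hBa he v01 tinj ok (fun j => (j == i)%:R).
rewrite (bigD1 i)//= eqxx big1 ?addr0; first by rewrite expr1n mul1r.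
by move=> j /negbTE ->; rewrite expr0n/= mul0r.
Qed.

(** Passing from the mean to the limit value changes the argument of the cosine by a deterministic
    bias that tends to 0. *)
Lemma Uw_cos (l : 'I_u -> R) (p e : R) : 0 < e -> \forall n \near \oo,
  `|Ex P (fun w => cos (dot l ((Uw n)^~ w) + p)) - expR (- qform Sv l l / 2) * cos p| <= e.
Proof.
move=> e0; have [eps [v0 [he v01 ok]]] := windows_ok.
pose lam i := l i * (dLam2 (H (t i)))^-1.
have e2 : 0 < e / 2 by rewrite divr_gt0.
pose A := \sum_i `|lam i| + 1.
have A0 : 0 < A by rewrite ltr_wpDl// sumr_ge0.
have eA : 0 < e / (2 * A) by rewrite divr_gt0// mulr_gt0.
have h1 := window_clt hB gZ zZ alpha01 kap0 hA gam0 hBa he v01 tinj ok lam p e2.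
apply: filterS3 h1 near_lt (near_bias eA) => n h1 hlt hb.
have -> : qform Sv l l = \sum_i lam i ^+ 2 * sigma2 B (H (t i)).
  by rewrite /Sv qform_diag; apply: eq_bigr => i _; rewrite /lam; ring.
have bY : bddm (Yw Z alpha n t lam) by exact: bddm_Yw.
pose bias := \sum_i lam i * (sqrtr (2 * q n) * (Ex P (Sw n i) - Lam2 (H (t i)))).
have EY : Ex P (Yw Z alpha n t lam) = \sum_i lam i * (sqrtr (2 * q n) * Ex P (Sw n i)).
  rewrite (_ : Yw Z alpha n t lam = (fun w => \sum_i lam i * (sqrtr (2 * q n) * Sw n i w))); last first.
    by apply/funext => w; exact: Yw_Sw.
  have iS i : itg P (Sw n i) by exact/bddm_itg/bddm_Sw.
  rewrite Ex_sum; last by move=> i; apply: itgZ; exact: itgZ.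
  by apply: eq_bigr => i _; rewrite (ExZ _ (itgZ _ (iS i))) (ExZ _ (iS i)).
have dU w : dot l ((Uw n)^~ w) = Yw Z alpha n t lam w - Ex P (Yw Z alpha n t lam) + bias.
  rewrite EY Yw_Sw// /dot /bias -sumrB -big_split/=; apply: eq_bigr => i _.
  by rewrite /Uw /lam; ring.
have bb : `|bias| <= e / 2.
  rewrite (le_trans (ler_norm_sum _ _ _))//.
  apply: (@le_trans _ _ (\sum_i `|lam i| * (e / (2 * A)))).
    by apply: ler_sum => i _; rewrite normrM ler_wpM2l.
  rewrite -mulr_suml (_ : e / 2 = A * (e / (2 * A))); last by field; rewrite gt_eqF.
  by rewrite ler_wpM2r ?(ltW eA)// lerDl.
have bc (x : R) : bddm (fun w => cos (Yw Z alpha n t lam w - Ex P (Yw Z alpha n t lam) + x)).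
  by apply: bddm_cos; case: (bddmD (bddm_centered P bY) (bddm_cst x)).
have : `|Ex P (fun w => cos (dot l ((Uw n)^~ w) + p)) -
    Ex P (fun w => cos (Yw Z alpha n t lam w - Ex P (Yw Z alpha n t lam) + p))| <= e / 2.
  under [X in `|Ex _ X - _|]eq_fun do rewrite dU -addrA.
  have i1 := bddm_itg P (bc (bias + p)); have i2 := bddm_itg P (bc p).
  rewrite -ExB// (le_trans (Ex_norm (itgB i1 i2)))// -[leRHS](Ex_cst P).
  apply: Ex_le => [||w]; [exact: itg_norm (itgB i1 i2) | exact: itg_cst |].
  rewrite (le_trans (norm_cosB_le _ _))// (le_trans _ bb)// le_eqVlt; apply/orP; left; apply/eqP.
  by congr `|_|; ring.
move: h1; move: (Ex P _) (Ex P _) (expR _ * _) => x y z h1 h2.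
by rewrite -(subrKA y) (le_trans (ler_normD _ _))// (splitr e) lerD.
Qed.

(** Taking lam as the indicator of i, the variances converge and so are eventually below sigma^2 +
    1; the squared bias is at most 1. *)
Lemma Uw_moment : exists K : R, \forall n \near \oo, forall i, Ex P (fun w => Uw n i w * Uw n i w) <= K.
Proof.
have [eps [v0 [he v01 ok]]] := windows_ok.
pose K i := (dLam2 (H (t i)))^-1 ^+ 2 * (2 * (sigma2 B (H (t i)) + 1) + 2).
have K0 i : 0 <= K i by rewrite mulr_ge0 ?sqr_ge0// addr_ge0// mulr_ge0// addr_ge0// sigma2_H_ge0.
exists (\sum_i K i).
pose lam i : 'I_u -> R := fun j => (j == i)%:R.
have hV : \forall n \near \oo, forall i, Vr P (Yw Z alpha n t (lam i)) <= sigma2 B (H (t i)) + 1.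
  apply: filter_forall => i.
  have := @Vr_limit _ _ _ _ _ P PB B Z alpha kappa eta H c hB gZ zZ alpha01 kap0 hA gam gam0 hBa eps v0 he v01 u t tinj ok (lam i).
  rewrite (bigD1 i)//= /lam eqxx expr1n mul1r big1 ?addr0; last by move=> j /negbTE ->; rewrite expr0n/= mul0r.
  move=> /cvgrPdist_le /(_ 1 ltr01); apply: filterS => n; rewrite ler_norml => /andP[h _]; move: h; rewrite /lam; lra.
apply: filterS3 hV near_lt (near_bias ltr01) => n hV hlt hb i.
rewrite (bigD1 i)//= (@le_trans _ _ (K i))//; last by rewrite lerDl sumr_ge0.
set b := sqrtr (2 * q n) * (Ex P (Sw n i) - Lam2 (H (t i))).
have bY : bddm (Yw Z alpha n t (lam i)) by exact: bddm_Yw.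
have YE w : Yw Z alpha n t (lam i) w = sqrtr (2 * q n) * Sw n i w.
  rewrite Yw_Sw// (bigD1 i)//= big1 ?addr0; first by rewrite /lam eqxx mul1r.
  by move=> j /negbTE ji; rewrite /lam ji mul0r.
have iS : itg P (Sw n i) by exact/bddm_itg/bddm_Sw.
have EY : Ex P (Yw Z alpha n t (lam i)) = sqrtr (2 * q n) * Ex P (Sw n i).
  by rewrite -ExZ//; congr Ex; apply/funext => w; exact: YE.
have cY := bddm_centered P bY.
have i1 := bddm_itg P (bddmM cY cY).
apply: (@le_trans _ _ (Ex P (fun w => (dLam2 (H (t i)))^-1 ^+ 2 * (2 * ((Yw Z alpha n t (lam i) w - Ex P (Yw Z alpha n t (lam i))) *
    (Yw Z alpha n t (lam i) w - Ex P (Yw Z alpha n t (lam i)))) + 2 * b ^+ 2)))).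
  have bU := bddm_Uw n i.
  apply: Ex_le => [||w]; first by exact/bddm_itg/bddmM.
    by apply: itgZ; apply: itgD; [exact: itgZ | exact: itg_cst].
  have -> : Uw n i w = (dLam2 (H (t i)))^-1 * ((Yw Z alpha n t (lam i) w - Ex P (Yw Z alpha n t (lam i))) + b).
    by rewrite EY YE /Uw /b; ring.
  rewrite -expr2 exprMn ler_wpM2l ?sqr_ge0//; move: (_ - _) => x.
  by have := sqr_ge0 (x - b); rewrite !expr2; lra.
rewrite ExZ; last by apply: itgD; [exact: itgZ | exact: itg_cst].
rewrite ExD; [|exact: itgZ|exact: itg_cst].
rewrite ExZ// Ex_cst /K ler_wpM2l ?sqr_ge0// lerD//.
  by rewrite ler_pM2l//; apply: le_trans (hV i); rewrite Vr_centered.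
rewrite -[leRHS]mulr1 ler_pM2l// -(real_normK (num_real b)) -[leRHS](expr1n _ 2) lerXn2r ?nnegrE//; exact: hb.
Qed.

Variable h0 : R.
Local Notation Linv := (Lambda2_inv B h0).

Lemma derive_Linv i : is_derive (Lam2 (H (t i))) (1 : R) Linv (dLam2 (H (t i)))^-1.
Proof. exact: (is_derive_Lam2_inv (Lambda2_invK h0 hB)). Qed.

Definition Yr (n : nat) (i : 'I_u) (w : T) : R :=
  sqrtr (2 * n%:R `^ (1 - alpha)) * (IR_estimator B h0 alpha n (t i) Z w - H (t i)).

Lemma measurable_Yr n i : measurable_fun setT (Yr n i).
Proof.
apply: measurable_funM => //; apply: measurable_funB => //.
apply: (@measurableT_comp _ _ _ _ _ _ (Linv : measurableTypeR R -> R) _ (Sw n i)); last by have [] := bddm_Sw n i.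
exact: (measurable_Lam2_inv (Lambda2_invK h0 hB) (Lambda2_inv_out h0 hB)).
Qed.

(** For |U| <= L the window mean is within L D / sqrt (2 q) of [Lam2 (H t)], D being the derivative
    of Lambda_2 there. A remainder of slope dl / (L D), multiplied by sqrt (2 q), is then at most
    dl, uniformly in w. *)
Lemma Yr_Uw (L dl : R) : 0 < L -> 0 < dl -> \forall n \near \oo, forall w, sup_le L ((Uw n)^~ w) ->
  sup_le dl (fun i => Yr n i w - Uw n i w).
Proof.
move=> L0 dl0.
suff h : \forall n \near \oo, forall i w, `|Uw n i w| <= L -> `|Yr n i w - Uw n i w| <= dl.
  by apply: filterS h => n h w hU i; apply: h; exact: hU.
apply: filter_forall => i.
have D0 := dLam2_gt0 (Ht i); set D := dLam2 (H (t i)) in D0.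
have e0 : 0 < dl / (L * D) by rewrite divr_gt0// mulr_gt0.
have [r r0 hr] := is_derive_linear_approx (derive_Linv i) e0.
have hq := qn_big alpha01 ((L * D / r) ^+ 2 + 1).
apply: filterS hq => n hq w hU.
have q0 : 0 < 2 * q n by rewrite mulr_gt0// (lt_le_trans _ hq)// ltr_wpDl// sqr_ge0.
have s0 : 0 < sqrtr (2 * q n) by rewrite sqrtr_gt0.
pose z := Sw n i w - Lam2 (H (t i)).
have UE : Uw n i w = D^-1 * (sqrtr (2 * q n) * z) by [].
have zE : z = Uw n i w * D / sqrtr (2 * q n) by rewrite UE; field; rewrite !gt_eqF.
have zL : `|z| <= L * D / sqrtr (2 * q n).
  by rewrite zE normrM normfV (gtr0_norm s0) ler_pM2r ?invr_gt0// normrM (gtr0_norm D0) ler_pM2r.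
have zr : `|z| < r.
  rewrite (le_lt_trans zL)// ltr_pdivrMr// [ltRHS]mulrC -ltr_pdivrMr//.
  have p0 : 0 <= L * D / r by apply: ltW; apply: divr_gt0 => //; exact: mulr_gt0.
  rewrite -[ltLHS](ger0_norm p0) -sqrtr_sqr ltr_sqrt// (lt_le_trans (_ : _ < q n))//.
    by rewrite (lt_le_trans _ hq)// ltrDl.
  by rewrite ler_peMl ?ler1n// (le_trans _ hq)// addr_ge0// sqr_ge0.
have := hr _ zr; rewrite (Lambda2_invK h0 hB (Ht i)) {2}/z addrCA subrr addr0.
have -> : Linv (Sw n i w) = IR_estimator B h0 alpha n (t i) Z w by [].
move=> h; rewrite (_ : _ - _ = sqrtr (2 * q n) * (IR_estimator B h0 alpha n (t i) Z w - H (t i) - D^-1 * z)); last first.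
  by rewrite UE /Yr -/(q n); ring.
rewrite normrM (gtr0_norm s0) (le_trans (ler_wpM2l (ltW s0) h))//.
apply: (@le_trans _ _ (sqrtr (2 * q n) * (dl / (L * D) * (L * D / sqrtr (2 * q n))))).
  by rewrite ler_wpM2l ?(ltW s0)// ler_wpM2l// ltW.
by rewrite le_eqVlt; apply/orP; left; apply/eqP; field; rewrite !gt_eqF.
Qed.

Theorem IR_estimator_clt :
  exists (dW : measure_display) (TW : measurableType dW)
    (Q : probability TW R) (V : 'I_u -> {RV Q >-> R}),
    [/\ independent_rvs V,
        forall i, [/\ is_gaussian Q (V i), ('E_Q[V i] = 0)%E &
          ('E_Q[fun w => (V i w ^+ 2)%R])%E =
            ((derive1 Linv (Lambda2 B (H (t i)))) ^+ 2 * sigma2 B (H (t i)))%:E] &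
        cvg_in_distribution P Q (fun n w => \row_(i < u) Yr n i w) (fun w => \row_(i < u) V i w)].
Proof.
pose s i := sqrtr ((dLam2 (H (t i)))^-1 ^+ 2 * sigma2 B (H (t i))).
have v0 i : 0 <= (dLam2 (H (t i)))^-1 ^+ 2 * sigma2 B (H (t i)).
  by rewrite mulr_ge0 ?sqr_ge0// sigma2_H_ge0.
have [dW [TW [Q [V [iV lV gV]]]]] := gaussian_family (fun i => sqrtr_ge0 _ : 0 <= s i).
exists dW, TW, Q, V; split => //.
- move=> i; have [i1 i2 e1 e2 _] := gauss_law_moments (measurable_funPT (V i)) (sqrtr_ge0 _) (lV i).
  split; first by exists 0, (s i); split; [exact: sqrtr_ge0 | exact: lV].
    by rewrite expectationEx// e1.
  rewrite expectationEx// e2 expr0n/= add0r sqr_sqrtr// Lambda2E//; last exact: hB.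
  by rewrite derive1E (@derive_val _ _ _ _ _ _ _ (derive_Linv i)).
have [K hK] := Uw_moment.
apply: (weak_convergence gV (fun n i => bddm_Uw n i) (fun n i => measurable_Yr n i) hK); last exact: Yr_Uw.
move=> l p e e0; have := Uw_cos l p e0; apply: filterS => n.
have -> // : qform (fun i j => (i == j)%:R * s i ^+ 2) l l = qform Sv l l.
by rewrite /Sv !qform_diag; apply: eq_bigr => i _; rewrite /s sqr_sqrtr.
Qed.

End MainCLT.

Theorem theorem2 (R : realType)
  (d : measure_display) (T : measurableType d) (P : probability T R)
  (dB : measure_display) (TB : measurableType dB) (PB : probability TB R)
  (B : R -> R -> {RV PB >-> R})
  (hB : forall h : R, 0 < h < 1 -> is_fbm h (B h))
  (Z : R -> {RV P >-> R})
  (hZgauss : gaussian_process `]0, 1[ Z) (hZmean : zero_mean `]0, 1[ Z)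
  (alpha kappa eta : R) (H c : R -> R)
  (halpha : 0 < alpha < 1)
  (hA : assumption_A B 2 kappa eta H c Z)
  (hBa : assumption_B 2 alpha 0 Z)
  (halpha_eta : 1 / (1 + 2 * Num.min eta 2) < alpha)
  (hkappa : (1 - alpha) / 2 <= kappa)
  (h0 : R) (hh0 : 0 < h0 < 1)
  (u : nat) (hu : (0 < u)%N) (t : 'I_u -> R)
  (ht : forall i, 0 < t i < 1) (ht_inj : injective t) :
  exists (dW : measure_display) (TW : measurableType dW)
    (Q : probability TW R) (W : 'I_u -> {RV Q >-> R}),
    [/\ independent_rvs W,
        forall i, [/\ is_gaussian Q (W i), ('E_Q[W i] = 0)%E &
          ('E_Q[fun w => (W i w ^+ 2)%R])%E =
            ((derive1 (Lambda2_inv B h0) (Lambda2 B (H (t i)))) ^+ 2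
               * sigma2 B (H (t i)))%:E] &
        cvg_in_distribution P Q
          (fun n w => \row_(i < u)
             (Num.sqrt (2 * n%:R `^ (1 - alpha)) *
              (IR_estimator B h0 alpha n (t i) Z w - H (t i))))
          (fun w => \row_(i < u) W i w)].
Proof.
have [gam [gam0 _ _ hBg]] := hBa.
(* With theta = 0 the factor n^((1-alpha) theta) is n^0 = 1. *)
have {}hBg : corr_decay Z alpha gam.
  move=> eps he; have [C C0 hC] := hBg eps 2 (astar : 3.-tuple R) he (@astar_order R).
  by exists C => // n k k' *; have := hC n k k'; rewrite mulr0 powRr0 mulr1; apply.
exact: (IR_estimator_clt hB hZgauss hZmean halpha hkappa hA halpha_eta gam0 hBg ht_inj ht h0).
Qed.
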